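(* Let $M$ be a smooth manifold, $\{\cdot,\cdot\}$ a nondegenerate generalized Poisson bracket on $M$ with bundle map $J=\omega^{-1}:T^*M\to TM$ ($\omega$ a nondegenerate, not necessarily closed, two-form), $\Delta\subset TM$ a smooth vector subbundle, $\mathcal D$ the Dirac structure with fibers $\mathcal D(x)=\{(v,v^* )\in T_xM\times T_x^*M\mid v-J(x)v^*\in\Delta(x),\ v^*\in\Delta^\circ(x)\}$, and $H\in C^\infty(M)$. Let $G$ be a Lie group with Lie algebra $\mathfrak g$ acting properly on $M$ such that $H$ is $G$-invariant and, for all $\xi\in\mathfrak g$, $L_{\xi_M}J=0$ and $L_{\xi_M}Z$ is a local section of $\Delta$ whenever $Z$ is. Suppose the action admits an $Ad^*$-equivariant map $P:M\to\mathfrak g^*$ with $dP_\xi=\omega(\xi_M,\cdot)$ and $dP_\xi\in\Gamma(\Delta^\circ)$ for all $\xi\in\mathfrak g$. With $V(x)=\mathrm{span}\{\xi_M(x)\mid\xi\in\mathfrak g\}$, assume that $\Delta\cap V=0$, that $V+\Delta$ is a smooth vector subbundle of $TM$, and that the regular reduction conditions listed in the context hold on each $P^{-1}(0)\cap M_{(K)}$. Then: (1) The reduced space $M_0=P^{-1}(0)/G$ is decomposed into a disjoint union $M_0=\coprod_{(K)}(M_0)_{(K)}$ of smooth manifolds $(M_0)_{(K)}=(P^{-1}(0)\cap M_{(K)})/G$ (called pieces), where $(K)$ runs over the conjugacy classes of compact subgroups of $G$. (2) On each piece, the system $(M,\mathcal D,H)$ reduces, by means of regular reduction, to the implicit Hamiltonian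 system $((M_0)_{(K)},\mathcal D_{(K)},H_{(K)})$, where $\mathcal D_{(K)}$ is the Dirac structure with local sections $$\{(\hat X,\hat\alpha)\in\mathfrak X_{loc}((M_0)_{(K)})\times\Omega^1_{loc}((M_0)_{(K)})\mid \hat X-J_{(K)}\hat\alpha\in\Gamma_{loc}((\hat\Delta)_{(K)}),\ \hat\alpha\in\Gamma_{loc}(((\hat\Delta)_{(K)})^\circ)\}$$ and $H_{(K)}\in C^\infty((M_0)_{(K)})$ is defined by $H_{(K)}\circ\pi_{(K)}=H|_{P^{-1}(0)\cap M_{(K)}}$.
   Context: All objects are smooth. A generalized Poisson bracket is a skew-symmetric bilinear bracket on $C^\infty(M)$ satisfying the Leibniz rule (Jacobi not required). Here $\{f,h\}=\omega(X_f,X_h)$ with $df=\omega(X_f,\cdot)$, and $J$ satisfies $\langle df,J\,dh\rangle=\{f,h\}$, i.e. $J\,dh=X_h$. A Dirac structure on a manifold $M$ is a vector subbundle $\mathcal D\subset TM\oplus T^*M$ equal to its own orthogonal complement under the pairing $\langle\langle(v,v^* ),(w,w^* )\rangle\rangle=\langle v^*,w\rangle+\langle w^*,v\rangle$. The implicit Hamiltonian system $(M,\mathcal D,H)$ is the set of smooth curves $x(t)$ (solutions) with $(\dot x(t),dH(x(t)))\in\mathcal D(x(t))$ for all $t$. $\Delta^\circ$ is the annihilator of $\Delta$; $\xi_M$ is the infinitesimal generator of $\xi$; $P_\xi(x)=\langle P(x),\xi\rangle$; $\mathfrak X_{loc},\Omega^1_{loc},\Gamma_{loc}$ denote local vector fields,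 one-forms, sections. Orbit types: for a compact subgroup $K\subset G$, $M_{(K)}=\{x\in M\mid G_x\text{ is conjugate to }K\}$, where $G_x$ is the stabilizer of $x$; $(K)$ is the conjugacy class of $K$. Write $N_{(K)}=P^{-1}(0)\cap M_{(K)}$ (a submanifold of $M$), $\iota_{(K)}:N_{(K)}\hookrightarrow M$ for the inclusion and $\pi_{(K)}:N_{(K)}\to(M_0)_{(K)}=N_{(K)}/G$ for the projection. Regular reduction conditions, for each $N=N_{(K)}$: (i) $\mathcal D(x)\cap(T_xN\times T_x^*M)$ has constant dimension for $x\in N$, so that the restricted Dirac structure $\mathcal D_N$ on $N$, with fibers $\{(v,v^*|_{T_xN})\mid (v,v^* )\in\mathcal D(x),\ v\in T_xN\}$, is defined; (ii) $\ker T\pi_{(K)}+\Delta_N$ is a smooth subbundle of $TN$, where $\Delta_N(x)=\{X(x)\mid (X,0)\text{ a local section of }\mathcal D_N\}$, and $\mathcal D_N\cap E_N$ is a smooth subbundle of $TN\oplus T^*N$, where $E_N$ is the subbundle whose local sections are the $(X,\alpha)$ with $\alpha=\pi_{(K)}^*\hat\alpha$ for some local one-form $\hat\alpha$ on $(M_0)_{(K)}$. Regular reduction to a piece: restrict $\mathcal D$ to $\mathcal D_N$ on $N=N_{(K)}$ and then project to $(M_0)_{(K)}$; the result is the Dirac structure whose local sections are the $(\hat X,\hat\alpha)$ for which there is a local section $(X,\alpha)$ of $\mathcal D$ with $X$ tangent to $N_{(K)}$, $X|_{N_{(K)}}$ $\pi_{(K)}$-related to $\hat X$, and $\iota_{(K)}^*\alpha=\pi_{(K)}^*\hat\alpha$.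 The Hamiltonian is reduced by restricting $H$ to $N_{(K)}$ and factoring through $\pi_{(K)}$. Bracket on a piece: $W^\infty((M_0)_{(K)})$ is the set of continuous functions $\bar f_0$ on $(M_0)_{(K)}$ such that $\bar f_0\circ\pi_{(K)}=f|_{N_{(K)}}$ for some $f\in C^\infty(M)^G$; it is dense in $C^\infty((M_0)_{(K)})$. The bracket $\{\cdot,\cdot\}_{(K)}$ is given by $\{\bar f_0,\bar h_0\}_{(K)}\circ\pi_{(K)}=\{f,h\}|_{N_{(K)}}$ for such $f,h$, and extends to a generalized Poisson bracket on $C^\infty((M_0)_{(K)})$; $J_{(K)}$ is the skew-symmetric bundle map with $\langle d\bar f_0,J_{(K)}d\bar h_0\rangle=\{\bar f_0,\bar h_0\}_{(K)}$. Distribution on a piece: since $\Delta\cap V=0$ and $V+\Delta$ is a subbundle, $\Delta$ has local bases of sections $X_1,\dots,X_m$ with $[\xi_M,X_j]=0$ for all $\xi\in\mathfrak g$; these are tangent to $N_{(K)}$, and their restrictions project along $\pi_{(K)}$ to local vector fields $\hat X_1,\dots,\hat X_m$ on $(M_0)_{(K)}$, which span the distribution $(\hat\Delta)_{(K)}$; $((\hat\Delta)_{(K)})^\circ$ is its annihilator.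
   Formalization: Added: every g in G, not only the generators, preserves J and Δ (automatic for connected G; it fails e.g. for Z_2 acting by (x,y)↦(-x,y) on (R^2,dx∧dy), Δ=0). The reduced distribution is spanned by projections of those invariant local sections of Δ that are tangent to the level piece. *)

(* Defs.v *)
From HB Require Import structures.
From mathcomp Require Import all_boot all_order all_algebra.
From mathcomp Require Import all_classical all_reals topology normedtype derive.

Set Implicit Arguments.
Unset Strict Implicit.
Unset Printing Implicit Defensive.
Import Order.TTheory GRing.Theory Num.Theory.
Import numFieldNormedType.Exports.
Local Open Scope classical_set_scope.
Local Open Scope ring_scope.

(* Differential geometry is set up through functional structures: a space is a
   topological space together with the relation "f is smooth near x", and a
   manifold is such a space that is Hausdorff, second countable and locally
   isomorphic to R^n with its C^oo functions.  Subspaces, products and orbit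
   spaces carry their usual induced structures whether or not they are
   manifolds. *)

Section euclidean.
Context {R : realType}.

Fixpoint Ck (k n : nat) (U : set 'rV[R]_n) (f : 'rV[R]_n -> R) : Prop :=
  if k is k'.+1 then
    (forall x, U x -> differentiable f x) /\
    (forall i : 'I_n, Ck k' U (fun x => 'D_(delta_mx 0 i) f x))
  else forall x, U x -> {for x, continuous f}.

Definition euclidean_smooth_at n (a : 'rV[R]_n) (f : 'rV[R]_n -> R) : Prop :=
  exists2 U, open_nbhs a U & forall k, Ck k U f.

End euclidean.

(* smooth_at x f: f is smooth on a neighbourhood of x. *)
HB.mixin Record hasSmoothGerms (R : realType) T of Topological T := {
  smooth_at : T -> (T -> R) -> Prop
}.

#[short(type="smoothSpaceType")]
HB.structure Definition SmoothSpace (R : realType) :=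
  {T of Topological T & hasSmoothGerms R T}.

#[short(type="smoothGroupType")]
HB.structure Definition SmoothGroup (R : realType) :=
  {G of Group G & SmoothSpace R G}.

(* On a subset: local restrictions of smooth functions of the ambient space. *)
HB.instance Definition _ (R : realType) (X : smoothSpaceType R) (A : set X) :=
  hasSmoothGerms.Build R (set_type A) (fun x f =>
    exists2 F : X -> R, smooth_at (set_val x) F &
      \forall y \near x, f y = F (set_val y)).

(* On a product: functions that are locally F(u_1, .., u_n) with F smooth on
   R^n and each u_i smooth and depending on a single factor. *)
HB.instance Definition _ (R : realType) (X Y : smoothSpaceType R) :=
  hasSmoothGerms.Build R (X * Y)%type (fun p f =>
    exists (n : nat) (F : 'rV[R]_n -> R) (u : 'I_n -> X * Y -> R),
      [/\ forall i,
            (exists2 a : X -> R, smooth_at p.1 a & u i = a \o fst) \/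
            (exists2 b : Y -> R, smooth_at p.2 b & u i = b \o snd),
          euclidean_smooth_at (\row_i u i p) F
        & \forall q \near p, f q = F (\row_i u i q)]).

Section orbits.
Context {R : realType} {G : Type} {X : smoothSpaceType R}.
Variable act : G -> X -> X.

Definition action_orbit (x : X) : set X := range (act^~ x).

(* A/G for an invariant subset A, with the quotient structure. *)
Definition orbit_space (A : set X) : Type := set_type (action_orbit @` A).

Definition orbit_proj (A : set X) (x : set_type A) : orbit_space A :=
  exist (fun o => o \in action_orbit @` A) (action_orbit (set_val x))
    (mem_set (imageP action_orbit (set_valP x))).

HB.instance Definition _ (A : set X) := gen_eqMixin (orbit_space A).
HB.instance Definition _ (A : set X) := gen_choiceMixin (orbit_space A).

Definition orbit_open (A : set X) (U : set (orbit_space A)) : Prop :=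
  open (@orbit_proj A @^-1` U).

Program Definition orbit_space_topology (A : set X) :=
  @isOpenTopological.Build (orbit_space A) (@orbit_open A) _ _ _.
Next Obligation. by move=> A; rewrite /orbit_open preimage_setT; exact: openT. Qed.
Next Obligation. by move=> A U V; exact: openI. Qed.
Next Obligation. by move=> A I f ofi; apply: bigcup_open => i _; exact: ofi. Qed.
HB.instance Definition _ (A : set X) := orbit_space_topology A.

HB.instance Definition _ (A : set X) :=
  hasSmoothGerms.Build R (orbit_space A) (fun q f =>
    \forall q' \near q, forall x : set_type A, orbit_proj x = q' ->
      smooth_at x (f \o @orbit_proj A)).

End orbits.

Definition extend0 {R : realType} {S : Type} (D : set S) (f : S -> R^o) :
  S -> R^o := patch (fun=> 0) D f.

Section smooth_spaces.
Context {R : realType}.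
Implicit Types X Y : smoothSpaceType R.

Definition smooth_fun X (f : X -> R) : Prop := forall x, smooth_at x f.

Definition smooth_map X Y (phi : X -> Y) : Prop :=
  continuous phi /\
  forall x (f : Y -> R), smooth_at (phi x) f -> smooth_at x (f \o phi).

Definition is_chart X n (U : set X) (V : set 'rV[R]_n)
    (phi : X -> 'rV[R]_n) (psi : 'rV[R]_n -> X) : Prop :=
  [/\ open U /\ open V,
      (forall x, U x -> V (phi x) /\ psi (phi x) = x),
      (forall a, V a -> U (psi a) /\ phi (psi a) = a),
      (forall x, U x -> {for x, continuous phi}) /\
      (forall a, V a -> {for a, continuous psi})
    & forall x, U x -> forall f : X -> R,
        smooth_at x f <-> euclidean_smooth_at (phi x) (f \o psi)].

(* The dimension may depend on the connected component, as it does in general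
   for orbit type manifolds. *)
Definition is_manifold X : Prop :=
  [/\ hausdorff_space X, @second_countable X
    & forall x : X, exists n U (V : set 'rV[R]_n) phi psi,
        is_chart U V phi psi /\ U x].

(* Tangent vectors at x are derivations of the germs at x.  They are all given
   the same carrier type by the convention that they vanish on functions that
   are not smooth near x; likewise covectors at x vanish off T_x. *)
Definition tvec X : Type := (X -> R) -> R^o.
Definition covec X : Type := tvec X -> R^o.

Definition tangent X (x : X) : set (tvec X) := [set v |
  [/\ forall (c : R) f g, smooth_at x f -> smooth_at x g ->
        v (fun y => c * f y + g y) = c * v f + v g,
      forall f g, smooth_at x f -> smooth_at x g ->
        v (fun y => f y * g y) = v f * g x + f x * v g
    & forall f, ~ smooth_at x f -> v f = 0]].

Definition cotangent X (x : X) : set (covec X) := [set a |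
  (forall (c : R) v w, tangent x v -> tangent x w ->
     a (c *: v + w) = c * a v + a w) /\
  (forall v, ~ tangent x v -> a v = 0)].

Definition differential X (f : X -> R) (x : X) : covec X :=
  extend0 (tangent x) (fun v => v f).

Definition tmap X Y (phi : X -> Y) (x : X) (v : tvec X) : tvec Y :=
  extend0 (smooth_at (phi x)) (fun f => v (f \o phi)).

Definition cotmap X Y (phi : X -> Y) (x : X) (a : covec Y) : covec X :=
  extend0 (tangent x) (fun v => a (tmap phi x v)).

Definition ker_tmap X Y (phi : X -> Y) (x : X) : set (tvec X) :=
  [set v | tangent x v /\ tmap phi x v = 0].

Definition is_submersion X Y (phi : X -> Y) : Prop :=
  smooth_map phi /\
  forall x, tangent (phi x) `<=` tmap phi x @` tangent x.

Definition smooth_vf X (U : set X) (Z : X -> tvec X) : Prop :=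
  forall x, U x -> tangent x (Z x) /\
    forall f, smooth_at x f -> smooth_at x (fun y => Z y f).

Definition smooth_form X (U : set X) (al : X -> covec X) : Prop :=
  forall x, U x -> cotangent x (al x) /\
    forall W Z, open_nbhs x W -> smooth_vf W Z ->
      smooth_at x (fun y => al y (Z y)).

(* Smooth local sections of TX (+) T*X. *)
Definition smooth_pair X (U : set X) (s : X -> tvec X * covec X) : Prop :=
  smooth_vf U (fun x => (s x).1) /\ smooth_form U (fun x => (s x).2).

Definition lspan (E : lmodType R) (S : set E) : set E :=
  [set v | exists n (c : 'I_n -> R) (e : 'I_n -> E),
     (forall i, S (e i)) /\ v = \sum_(i < n) c i *: e i].

Definition is_basis (E : lmodType R) k (e : 'I_k -> E) (S : set E) : Prop :=
  (forall c : 'I_k -> R, \sum_(i < k) c i *: e i = 0 -> forall i, c i = 0) /\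
  S = [set \sum_(i < k) c i *: e i | c in [set: 'I_k -> R]].

Definition set_add (E : zmodType) (A B : set E) : set E :=
  [set v | exists a b, [/\ A a, B b & v = a + b]].

(* B is a smooth subbundle of the bundle whose smooth local sections over U are
   given by sec U. *)
Definition is_subbundle X (E : lmodType R)
    (sec : set X -> (X -> E) -> Prop) (B : X -> set E) : Prop :=
  forall x, exists U k (e : 'I_k -> X -> E),
    [/\ open_nbhs x U, forall i, sec U (e i)
      & forall y, U y -> is_basis (fun i => e i y) (B y)].

Definition vf_section X (Delta : X -> set (tvec X)) (U : set X)
    (Z : X -> tvec X) : Prop :=
  smooth_vf U Z /\ forall x, U x -> Delta x (Z x).

Definition pair_section X (D : X -> set (tvec X * covec X)) (U : set X)
    (Z : X -> tvec X) (al : X -> covec X) : Prop :=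
  smooth_pair U (fun x => (Z x, al x)) /\ forall x, U x -> D x (Z x, al x).

Definition annihilator X (Delta : X -> set (tvec X)) (x : X) : set (covec X) :=
  [set a | cotangent x a /\ forall v, Delta x v -> a v = 0].

Definition is_dirac X (D : X -> set (tvec X * covec X)) : Prop :=
  is_subbundle (@smooth_pair X) D /\
  forall x p, D x p <->
    [/\ tangent x p.1, cotangent x p.2
      & forall q, D x q -> p.2 q.1 + q.2 p.1 = 0].

Definition generalized_poisson X (br : (X -> R) -> (X -> R) -> (X -> R)) :
    Prop :=
  forall f g h, smooth_fun f -> smooth_fun g -> smooth_fun h ->
  [/\ smooth_fun (br f h),
      br f h = (fun x => - br h f x),
      forall c : R, br (fun x => c * f x + g x) h =
        (fun x => c * br f h x + br g h x)
    & br f (fun x => g x * h x) =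
        (fun x => br f g x * h x + g x * br f h x)].

Definition skew_bundle_map X (J : X -> covec X -> tvec X) : Prop :=
  [/\ forall x a, cotangent x a -> tangent x (J x a),
      forall x (c : R) a b, cotangent x a -> cotangent x b ->
        J x (c *: a + b) = c *: J x a + J x b,
      forall x a b, cotangent x a -> cotangent x b -> a (J x b) = - b (J x a)
    & forall U al, open U -> smooth_form U al ->
        smooth_vf U (fun x => J x (al x))].

Definition bracket_map X (br : (X -> R) -> (X -> R) -> (X -> R))
    (J : X -> covec X -> tvec X) : Prop :=
  skew_bundle_map J /\
  forall f h, smooth_fun f -> smooth_fun h ->
    forall x, br f h x = differential f x (J x (differential h x)).

Definition nondegenerate_two_form X (om : X -> tvec X -> tvec X -> R) : Prop :=
  [/\ forall x (c : R) u v w, tangent x u -> tangent x v -> tangent x w ->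
        om x (c *: u + v) w = c * om x u w + om x v w,
      forall x u v, tangent x u -> tangent x v -> om x u v = - om x v u,
      forall U Z1 Z2, open U -> smooth_vf U Z1 -> smooth_vf U Z2 ->
        forall x, U x -> smooth_at x (fun y => om y (Z1 y) (Z2 y))
    & forall x u, tangent x u ->
        (forall v, tangent x v -> om x u v = 0) -> u = 0].

(* J = om^-1 for the identification v |-> om(v, .) of TX with T*X. *)
Definition inverse_of_form X (J : X -> covec X -> tvec X)
    (om : X -> tvec X -> tvec X -> R) : Prop :=
  forall x a v, cotangent x a -> tangent x v -> om x (J x a) v = a v.

Definition dirac_of X (J : X -> covec X -> tvec X) (Delta : X -> set (tvec X))
    (x : X) : set (tvec X * covec X) :=
  [set p | [/\ tangent x p.1, cotangent x p.2, Delta x (p.1 - J x p.2)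
             & annihilator Delta x p.2]].

(* Also L_Y Z. *)
Definition lie_bracket X (Y Z : X -> tvec X) (x : X) : tvec X :=
  extend0 (smooth_at x)
    (fun f => Y x (fun y => Z y f) - Z x (fun y => Y y f)).

(* be = L_Y al on U. *)
Definition is_lie_form X (Y : X -> tvec X) (U : set X) (al be : X -> covec X) :
    Prop :=
  smooth_form U be /\
  forall W Z, open W -> W `<=` U -> smooth_vf W Z -> forall x, W x ->
    be x (Z x) = Y x (fun y => al y (Z y)) - al x (lie_bracket Y Z x).

(* L_Y J = 0, where (L_Y J) al = L_Y (J al) - J (L_Y al). *)
Definition lie_map_zero X (Y : X -> tvec X) (J : X -> covec X -> tvec X) :
    Prop :=
  forall U al be, open U -> smooth_form U al -> is_lie_form Y U al be ->
    forall x, U x -> lie_bracket Y (fun y => J y (al y)) x - J x (be x) = 0.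

End smooth_spaces.

Section lie_groups.
Context {R : realType} {G : smoothGroupType R}.

Definition is_lie_group : Prop :=
  [/\ is_manifold G, smooth_map (fun p : G * G => (p.1 * p.2)%g)
    & smooth_map (fun g : G => (g^-1)%g)].

Definition lie_algebra : set (tvec G) := tangent (1%g : G).

Definition Ad (g : G) : tvec G -> tvec G :=
  tmap (fun h : G => (g * h * g^-1)%g) (1%g : G).

Definition conj_class (K : set G) : set (set G) :=
  [set L | exists g : G, L = [set (g * k * g^-1)%g | k in K]].

Definition compact_subgroup (K : set G) : Prop :=
  [/\ K 1%g, forall g h, K g -> K h -> K (g * h)%g,
      forall g, K g -> K (g^-1)%g & compact K].

Definition compact_classes : set (set (set G)) :=
  conj_class @` compact_subgroup.

Section actions.
Context {M : smoothSpaceType R}.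
Variable act : G -> M -> M.

Definition smooth_action : Prop :=
  [/\ forall x, act 1%g x = x,
      forall g h x, act (g * h)%g x = act g (act h x)
    & smooth_map (fun p : G * M => act p.1 p.2)].

Definition proper_action : Prop :=
  forall A : set (M * M), compact A ->
    compact [set p : G * M | A (act p.1 p.2, p.2)].

Definition stabilizer (x : M) : set G := [set g | act g x = x].

(* M_(K), as a function of the conjugacy class c = (K). *)
Definition orbit_type (c : set (set G)) : set M := [set x | c (stabilizer x)].

Definition generator (xi : tvec G) (x : M) : tvec M :=
  tmap (fun g : G => act g x) (1%g : G) xi.

Definition vertical (x : M) : set (tvec M) :=
  lspan [set generator xi x | xi in lie_algebra].

Definition action_preserves_map (J : M -> covec M -> tvec M) : Prop :=
  forall g x a, cotangent (act g x) a ->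
    J (act g x) a = tmap (act g) x (J x (cotmap (act g) x a)).

Definition action_preserves_distribution (Delta : M -> set (tvec M)) : Prop :=
  forall g x v, Delta x v -> Delta (act g x) (tmap (act g) x v).

Definition zero_level (P : M -> covec G) : set M := [set x | P x = 0].

(* N_(K) = P^-1(0) `&` M_(K), with c = (K). *)
Definition level_piece (P : M -> covec G) (c : set (set G)) : set M :=
  zero_level P `&` orbit_type c.

(* P takes values in T*_1 G, the dual of the Lie algebra. *)
Definition is_momentum_map (om : M -> tvec M -> tvec M -> R)
    (P : M -> covec G) : Prop :=
  [/\ forall x, cotangent (1%g : G) (P x),
      forall xi, lie_algebra xi -> smooth_fun (fun x => P x xi),
      forall g x xi, lie_algebra xi -> P (act g x) xi = P x (Ad (g^-1)%g xi)
    & forall xi, lie_algebra xi -> forall x v, tangent x v ->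
        differential (fun y => P y xi) x v = om x (generator xi x) v].

Section pieces.
Variable N : set M.
Notation iota := (@set_val M N).
Notation pi := (@orbit_proj R G M act N).

Definition restricted_dirac (D : M -> set (tvec M * covec M))
    (x : set_type N) : set (tvec (set_type N) * covec (set_type N)) :=
  [set p | tangent x p.1 /\
     exists2 a, D (iota x) (tmap iota x p.1, a) & p.2 = cotmap iota x a].

Definition restricted_kernel (D : M -> set (tvec M * covec M))
    (x : set_type N) : set (tvec (set_type N)) :=
  [set v | exists U Z, [/\ open_nbhs x U,
     pair_section (restricted_dirac D) U Z (fun=> 0) & v = Z x]].

Definition basic_pairs (x : set_type N) :
    set (tvec (set_type N) * covec (set_type N)) :=
  [set p | tangent x p.1 /\
     exists U al, [/\ open_nbhs (pi x) U, smooth_form U al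
       & p.2 = cotmap pi x (al (pi x))]].

Definition regular_conditions (D : M -> set (tvec M * covec M)) : Prop :=
  [/\ exists k, forall x : set_type N, exists e : 'I_k -> tvec M * covec M,
        is_basis e [set p | D (iota x) p /\ (tmap iota x @` tangent x) p.1],
      is_subbundle (@smooth_vf R (set_type N))
        (fun x => set_add (ker_tmap pi x) (restricted_kernel D x))
    & is_subbundle (@smooth_pair R (set_type N))
        (fun x => restricted_dirac D x `&` basic_pairs x)].

(* On U, Z is tangent to N and its restriction to N is pi-related to Zh. *)
Definition projects_to (U : set M) (Z : M -> tvec M)
    (Zh : orbit_space act N -> tvec (orbit_space act N)) : Prop :=
  forall x : set_type N, U (iota x) ->
    exists w, [/\ tangent x w, tmap iota x w = Z (iota x)
                & tmap pi x w = Zh (pi x)].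

Definition reduced_section (D : M -> set (tvec M * covec M))
    (Uh : set (orbit_space act N))
    (Zh : orbit_space act N -> tvec (orbit_space act N))
    (ah : orbit_space act N -> covec (orbit_space act N)) : Prop :=
  exists U Z al,
    [/\ open U /\ (forall x : set_type N, U (iota x) <-> Uh (pi x)),
        pair_section D U Z al, projects_to U Z Zh
      & forall x : set_type N, U (iota x) ->
          cotmap iota x (al (iota x)) = cotmap pi x (ah (pi x))].

Definition reduces_dirac (D : M -> set (tvec M * covec M))
    (Dh : orbit_space act N ->
          set (tvec (orbit_space act N) * covec (orbit_space act N))) : Prop :=
  is_dirac Dh /\
  forall Uh Zh ah, open Uh -> smooth_vf Uh Zh -> smooth_form Uh ah ->
    (pair_section Dh Uh Zh ah <-> reduced_section D Uh Zh ah).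

Definition reduces_hamiltonian (H : M -> R) (Hh : orbit_space act N -> R) :
    Prop :=
  smooth_fun Hh /\ Hh \o pi = H \o iota.

Definition invariant_fun (f : M -> R) : Prop :=
  smooth_fun f /\ forall g x, f (act g x) = f x.

Definition reduced_bracket (br : (M -> R) -> (M -> R) -> (M -> R))
    (brh : (orbit_space act N -> R) -> (orbit_space act N -> R) ->
           (orbit_space act N -> R)) : Prop :=
  generalized_poisson brh /\
  forall f h fh hh, invariant_fun f -> invariant_fun h ->
    fh \o pi = f \o iota -> hh \o pi = h \o iota ->
    brh fh hh \o pi = br f h \o iota.

(* Tangency to N is part of the condition on Z: for a disconnected stabilizer it
   does not follow from [xi_M, Z] = 0 on a small open set. *)
Definition reduced_distribution (Delta : M -> set (tvec M))
    (q : orbit_space act N) : set (tvec (orbit_space act N)) :=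
  lspan [set v | exists U Z Uh Zh,
    [/\ open U /\ vf_section Delta U Z,
        forall xi, lie_algebra xi -> forall x, U x ->
          lie_bracket (generator xi) Z x = 0,
        open Uh /\ Uh = pi @` [set x | U (iota x)],
        smooth_vf Uh Zh /\ projects_to U Z Zh
      & Uh q /\ v = Zh q]].

End pieces.
End actions.
End lie_groups.

Arguments is_manifold {R} X.
Arguments is_lie_group {R} G.
Arguments lie_algebra {R} G.
Arguments compact_classes {R} G.
Arguments orbit_proj {R G X} act A.

(* Main.v *)
Require Import Defs.
From HB Require Import structures.
From mathcomp Require Import all_boot all_order all_algebra.
From mathcomp Require Import all_classical all_reals topology normedtype derive.
From mathcomp Require Import landau sequences realfun exp ring lra.
From mathcomp Require Import interval_inference.
From mathcomp Require Import measure lebesgue_measure lebesgue_integral ftc.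

(** Since Delta meets V trivially and V + Delta is a subbundle, V has locally constant rank, so near
    each x there are coordinates (a, b) with a along the orbits and b locally invariant.  Let P x = 0
    and K = G_x.  A k in K close to 1 fixes b to first order, and it acts trivially on V = J dP at x
    because dP is a combination of db there; as the powers of k stay bounded, its differential at x
    is the identity, and then so is k near x.  Hence K acts near x through a finite group, and
    averaging over this group makes the coordinates linear for K.  Properness then gives slices,
    near which M_(K) is the set where b is K-invariant; there P^-1(0) is cut out by functions of b with
    independent differentials, so b can be chosen such that P^-1(0) and M_(K) meet in a linear
    subspace.  The remaining coordinates z are coordinates of the quotient, and they extend to global
    invariant functions.

    At a point x of N = N_(K), call a covector basic if it is K-invariant and vanishes on V.  For
    basic al, J al is tangent to N, and it projects to J_(K) ah when al and ah pull back to the same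
    form.  Averaging a vector of Delta over K makes it tangent to N without changing its
    pairing with basic covectors, so a basic covector annihilates Delta as soon as it annihilates the
    part of Delta tangent to N.  A pair of D tangent to N thus projects into D_(K) because it is
    orthogonal to lifts of all pairs of D_(K), which is maximal isotropic.  Conversely a section
    of D_(K) lifts locally: take a combination of the dz, correct it off N by the db so that it
    annihilates Delta, and add invariant sections of Delta.  The lifts at a point form an affine
    space, so they can be patched by bump functions. *)

Set Implicit Arguments.
Unset Strict Implicit.
Unset Printing Implicit Defensive.
Import Order.TTheory GRing.Theory Num.Theory.
Import numFieldNormedType.Exports.
Local Open Scope classical_set_scope.
Local Open Scope ring_scope.

(** * Smooth functions on R^n *)

(** Smoothness is a relation between functions and points and tangent vectors are derivations, so
    coordinates determine a tangent vector only through Hadamard's lemma. This is why the calculus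
    on R^n, up to the inverse function theorem and bump functions, precedes the geometry.

    The reduced bracket is tested on global invariant functions only. Its values on the local
    coordinates z are reached by cutting these off, and the cut-off has to be invariant under the
    stabilizer K; an averaged quadratic form in b provides it.

    The delicate point about orbit types is that M_(K) asks for stabilizers that are merely
    conjugate to K. A point of the transversal near x has its stabilizer inside K, and a conjugate
    of K inside K has to be shown equal to K. This is a pigeonhole argument: K has finitely many
    path components, and the elements acting trivially near x, which contain a neighbourhood of 1 in
    K, lie in all these stabilizers.

    When K is not connected, invariance under K says more than vanishing brackets with the
    generators. Hence tangency to N is obtained from averages over K and not from infinitesimal
    invariance. *)

Section Ck_algebra.
Context {R : realType}.
Implicit Types n m k : nat.

Notation "''d_' i f" := (fun x => 'D_(delta_mx 0 i) f x)
  (at level 10, i at level 2, f at next level).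

Lemma Ck_sub k n (U U' : set 'rV[R]_n) f : U' `<=` U -> Ck k U f -> Ck k U' f.
Proof.
move=> UU; elim: k f => [|k IH] f /=; first by move=> h x /UU; exact: h.
by case=> h1 h2; split=> [x /UU|i]; [exact: h1 | exact: IH].
Qed.

Lemma near_eq_continuous (T T' : topologicalType) (f g : T -> T') x :
  (\near x, f x = g x) -> {for x, continuous f} -> {for x, continuous g}.
Proof.
move=> fg; rewrite /prop_for /continuous_at -(nbhs_singleton fg).
by move/(cvg_trans _); apply; exact: near_eq_cvg.
Qed.

(** The first-order expansion of f at x is one of g as well, and [diff_unique] turns an expansion
    into the differential. *)
Lemma near_eq_differentiable n (f g : 'rV[R]_n -> R) x :
  (\near x, f x = g x) -> differentiable f x -> differentiable g x.
Proof.
move=> fg df.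
have gf : \forall h \near (0 : 'rV[R]_n), g (h + x) = f (h + x).
  have c : (fun h => h + x) @ (0 : 'rV[R]_n) --> x.
    have := @cvgD _ _ _ (nbhs (0 : 'rV[R]_n)) _ id (fun=> x) 0 x cvg_id (cvg_cst x).
    by rewrite add0r; apply.
  by apply: (c [set y | g y = f y]); apply: filterS fg => y /esym.
have E : g \o shift x = cst (g x) + 'd f x +o_ 0 id.
  have /eqaddoP H := diff_locally df.
  apply/eqaddoP => e e0; near=> h.
  rewrite !fctE /= /cst (near gf h)// -(nbhs_singleton fg).
  by near: h; exact: H.
have cdf : continuous ('d f x) by have /diff_locallyP[] := df.
by apply/diff_locallyP; rewrite (diff_unique cdf E).
Unshelve. all: by end_near. Qed.

Lemma Ck_eq k n (U : set 'rV[R]_n) f g : open U ->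
  (forall x, U x -> f x = g x) -> Ck k U f -> Ck k U g.
Proof.
move=> oU; elim: k f g => [|k IH] f g fg /=.
  move=> cf x Ux; apply: near_eq_continuous (cf x Ux).
  by apply: filterS (open_nbhs_nbhs (conj oU Ux)) => y Uy; rewrite fg.
case=> h1 h2; split=> [x Ux|i].
  apply: near_eq_differentiable (h1 x Ux).
  by apply: filterS (open_nbhs_nbhs (conj oU Ux)) => y Uy; rewrite fg.
apply: IH (h2 i) => x Ux; apply: near_eq_derive.
by apply: filterS (open_nbhs_nbhs (conj oU Ux)) => y Uy; rewrite fg.
Qed.

Lemma CkW k n (U : set 'rV[R]_n) f : Ck k.+1 U f -> Ck k U f.
Proof.
elim: k f => [|k IH] f /= [h1 h2]; first by move=> x /h1; exact: differentiable_continuous.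
by split=> // i; apply: IH.
Qed.

Lemma Ck_diff k n (U : set 'rV[R]_n) f x : Ck k.+1 U f -> U x -> differentiable f x.
Proof. by case=> h _ /h. Qed.

Lemma Ck_cst k n (U : set 'rV[R]_n) (c : R) : Ck k U (fun=> c).
Proof.
elim: k c => [|k IH] c /=; first by move=> x _; exact: cst_continuous.
split=> [x _|i]; first exact: differentiable_cst.
have -> : ('d_ i (fun _ : 'rV[R]_n => c)) = fun=> 0.
  by apply/funext => x; rewrite derive_cst.
exact: IH.
Qed.

Lemma CkD k n (U : set 'rV[R]_n) f g : open U -> Ck k U f -> Ck k U g ->
  Ck k U (fun x => f x + g x).
Proof.
move=> oU; elim: k f g => [|k IH] f g /=.
  by move=> hf hg x Ux; apply: continuousD; [exact: hf | exact: hg].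
case=> f1 f2 [g1 g2]; split=> [x Ux|i].
  by apply: differentiableD; [exact: f1 | exact: g1].
apply: Ck_eq (IH _ _ (f2 i) (g2 i)) => // x Ux.
by rewrite -deriveD//; apply: diff_derivable; [exact: f1 | exact: g1].
Qed.

Lemma CkM k n (U : set 'rV[R]_n) f g : open U -> Ck k U f -> Ck k U g ->
  Ck k U (fun x => f x * g x).
Proof.
move=> oU; elim: k f g => [|k IH] f g.
  by move=> hf hg x Ux; apply: continuousM; [exact: hf | exact: hg].
move=> Cf Cg; have [f1 f2] := Cf; have [g1 g2] := Cg; split=> [x Ux|i].
  by apply: differentiableM; [exact: f1 | exact: g1].
have := CkD oU (IH _ _ (CkW Cf) (g2 i)) (IH _ _ (CkW Cg) (f2 i)).
apply: Ck_eq => // x Ux.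
by rewrite deriveM//; apply: diff_derivable; [exact: f1 | exact: g1].
Qed.

Lemma CkV k n (U : set 'rV[R]_n) f : open U -> (forall x, U x -> f x != 0) ->
  Ck k U f -> Ck k U (fun x => (f x)^-1).
Proof.
move=> oU f0; elim: k => [|k IH].
  by move=> hf x Ux; apply: continuousV; [exact: f0 | exact: hf].
move=> Cf; have [f1 f2] := Cf; split=> [x Ux|i].
  by apply: differentiableV; [exact: f1 | exact: f0].
have CV := IH (CkW Cf).
have := CkM oU (CkM oU (Ck_cst k U (-1)) (CkM oU CV CV)) (f2 i).
apply: Ck_eq => // x Ux.
rewrite deriveV//; [|exact: f0|by apply: diff_derivable; exact: f1].
by rewrite mulN1r expr2 invfM.
Qed.

Lemma Ck_sum k n m (U : set 'rV[R]_n) (f : 'I_m -> 'rV[R]_n -> R) : open U ->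
  (forall j, Ck k U (f j)) -> Ck k U (fun x => \sum_j f j x).
Proof.
move=> oU; elim: m f => [|m IH] f Cf.
  by apply: Ck_eq (Ck_cst k U 0) => // x _; rewrite big_ord0.
have := CkD oU (IH (fun j => f (widen_ord (leqnSn m) j)) (fun j => Cf _)) (Cf ord_max).
by apply: Ck_eq => // x Ux; rewrite big_ord_recr.
Qed.

Lemma Ck_coord k n (U : set 'rV[R]_n) j : Ck k U (fun x => x 0 j).
Proof.
case: k => [|k] /=; first by move=> x _; exact: coord_continuous.
split=> [x _|i]; first exact: differentiable_coord.
suff -> : ('d_ i (fun x : 'rV[R]_n => x 0 j)) = fun=> (i == j)%:R by exact: Ck_cst.
apply/funext => x; rewrite deriveE; last exact: differentiable_coord.
(* The coordinate is packaged as a linear map, since a continuous linear map is its own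
   differential. *)
have @f : {linear 'rV[R]_n -> R}.
  by exists (fun N : 'rV[R]_n => N 0 j); do 2![eexists]; do ?[constructor];
     rewrite ?mxE// => ? *; rewrite ?mxE//; move=> ?; rewrite !mxE.
rewrite (@diff_lin _ _ _ f); last exact: coord_continuous.
by rewrite /f /= mxE eqxx eq_sym.
Qed.

Lemma differentiable_row n m (g : 'I_m -> 'rV[R]_n -> R) x :
  (forall j, differentiable (g j) x) ->
  differentiable (fun x => \row_j g j x) x /\
  forall v, 'd (fun x => \row_j g j x) x v = \row_j 'd (g j) x v.
Proof.
move=> dg.
have E : (fun x => \row_j g j x) =
    \sum_(j < m) (fun x => g j x *: (delta_mx 0 j : 'rV[R]_m)).
  apply/funext => y; rewrite fct_sumE; apply/rowP => j.
  rewrite mxE summxE (bigD1 j)//= big1 => [|l lj]; rewrite !mxE eqxx.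
    by rewrite eqxx mulr1 addr0.
  by rewrite eq_sym (negPf lj) mulr0.
have D : differentiable (fun x => \row_j g j x) x.
  by rewrite E; apply: differentiable_sum => j; apply: differentiableZl.
split=> // v; apply/rowP => j; rewrite mxE.
have <- : 'd (fun y : 'rV[R]_m => y 0 j) (\row_j g j x) ('d (fun x => \row_j g j x) x v)
   = ('d (fun x => \row_j g j x) x v) 0 j.
  have @f : {linear 'rV[R]_m -> R}.
    by exists (fun N : 'rV[R]_m => N 0 j); do 2![eexists]; do ?[constructor];
      rewrite ?mxE// => ? *; rewrite ?mxE//; move=> ?; rewrite !mxE.
  by rewrite (@diff_lin _ _ _ f) //; exact: coord_continuous.
have H := @diff_comp _ _ _ _ _ (fun y : 'rV[R]_m => y 0 j) x D (differentiable_coord _ 0 j).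
have -> : g j = (fun y : 'rV[R]_m => y 0 j) \o (fun x => \row_j g j x).
  by apply/funext => y /=; rewrite mxE.
by rewrite H.
Qed.

Lemma diff_partial n (f : 'rV[R]_n -> R) x v : differentiable f x ->
  'd f x v = \sum_i v 0 i * 'D_(delta_mx 0 i) f x.
Proof.
move=> df; rewrite {1}(row_sum_delta v) linear_sum; apply: eq_bigr => i _.
by rewrite linearZ deriveE.
Qed.

Lemma derive_comp_row n m (f : 'rV[R]_m -> R) (g : 'I_m -> 'rV[R]_n -> R) x v :
  (forall j, differentiable (g j) x) -> differentiable f (\row_j g j x) ->
  differentiable (fun x => f (\row_j g j x)) x /\
  'D_v (fun x => f (\row_j g j x)) x =
     \sum_j 'D_v (g j) x * 'D_(delta_mx 0 j) f (\row_j g j x).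
Proof.
move=> dg df; have [dG EG] := differentiable_row dg.
have D : differentiable (f \o (fun x => \row_j g j x)) x by exact: differentiable_comp.
split=> //; rewrite deriveE// (diff_comp dG df) /= diff_partial// EG.
by apply: eq_bigr => j _; rewrite mxE -deriveE.
Qed.

Lemma continuous_row (T : topologicalType) m (g : 'I_m -> T -> R) (x : T) :
  (forall j, {for x, continuous (g j)}) ->
  {for x, continuous (fun x => \row_j g j x)}.
Proof.
move=> cg; apply/cvgrPdist_lt => e e0.
have H : \forall y \near x, forall j, `|g j x - g j y| < e.
  by apply: filter_forall => j; have /cvgrPdist_lt/(_ _ e0) := cg j.
apply: filterS H => y H.
rewrite [ltLHS]/Num.Def.normr/= mx_normrE (bigmax_lt _ e0)//= => -[i j] _.
by rewrite !mxE /=; exact: H.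
Qed.

(** Induction on k for all f at once: by the chain rule the partials of the composite involve
    partials of f composed with the same map. *)
Lemma Ck_comp k n m (U : set 'rV[R]_n) (V : set 'rV[R]_m) f
    (g : 'I_m -> 'rV[R]_n -> R) : open U -> (forall x, U x -> V (\row_j g j x)) ->
  Ck k V f -> (forall j, Ck k U (g j)) -> Ck k U (fun x => f (\row_j g j x)).
Proof.
move=> oU UV; elim: k f => [|k IH] f.
  move=> cf cg x Ux.
  apply: (@continuous_comp _ _ _ (fun x => \row_j g j x) f); last exact/cf/UV.
  by apply: continuous_row => j; exact: cg.
move=> Cf Cg; have [f1 f2] := Cf.
have D x v Ux := derive_comp_row v (fun j => Ck_diff (Cg j) (Ux : U x)) (f1 _ (UV x Ux)).
split=> [x Ux|i]; first by have [] := D x 0 Ux.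
apply: Ck_eq (Ck_sum oU (f := fun j x => 'D_(delta_mx 0 i) (g j) x *
   'D_(delta_mx 0 j) f (\row_j g j x)) _) => // [x Ux|j].
  by have [_ ->] := D x (delta_mx 0 i) Ux.
apply: CkM => //; first by have [_] := Cg j; exact.
by apply: IH (f2 j) _ => l; exact: CkW.
Qed.

End Ck_algebra.

(** * Germs of smooth functions on R^n and bounds from their partials *)

Section euclidean_smooth.
Context {R : realType}.
Implicit Types n m k : nat.

Notation "''d_' i f" := (fun x => 'D_(delta_mx 0 i) f x)
  (at level 10, i at level 2, f at next level).

Lemma Ck_bigsum k n (I : Type) (r : seq I) (P : pred I) (U : set 'rV[R]_n)
    (f : I -> 'rV[R]_n -> R) : open U -> (forall j, Ck k U (f j)) ->
  Ck k U (fun x => \sum_(j <- r | P j) f j x).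
Proof.
move=> oU Cf; elim: r => [|i r IH].
  by apply: Ck_eq (Ck_cst k U 0) => // x _; rewrite big_nil.
have [Pi|Pi] := boolP (P i).
  by apply: Ck_eq (CkD oU (Cf i) IH) => // x _; rewrite big_cons Pi.
by apply: Ck_eq IH => // x _; rewrite big_cons (negPf Pi).
Qed.

Lemma Ck_bigprod k n (I : Type) (r : seq I) (P : pred I) (U : set 'rV[R]_n)
    (f : I -> 'rV[R]_n -> R) : open U -> (forall j, Ck k U (f j)) ->
  Ck k U (fun x => \prod_(j <- r | P j) f j x).
Proof.
move=> oU Cf; elim: r => [|i r IH].
  by apply: Ck_eq (Ck_cst k U 1) => // x _; rewrite big_nil.
have [Pi|Pi] := boolP (P i).
  by apply: Ck_eq (CkM oU (Cf i) IH) => // x _; rewrite big_cons Pi.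
by apply: Ck_eq IH => // x _; rewrite big_cons (negPf Pi).
Qed.

Lemma Ck_det k n p (U : set 'rV[R]_n) (A : 'rV[R]_n -> 'M[R]_p) : open U ->
  (forall i j, Ck k U (fun x => A x i j)) -> Ck k U (fun x => \det (A x)).
Proof.
move=> oU CA; apply: Ck_bigsum => // s; apply: CkM => //; first exact: Ck_cst.
by apply: Ck_bigprod => // i.
Qed.

(** Cramer's rule: the entries of the inverse are cofactors divided by the determinant, and both are
    polynomial in the entries of the matrix. *)
Lemma Ck_invmx k n p (U : set 'rV[R]_n) (A : 'rV[R]_n -> 'M[R]_p) : open U ->
  (forall x, U x -> A x \in unitmx) ->
  (forall i j, Ck k U (fun x => A x i j)) ->
  forall i j, Ck k U (fun x => invmx (A x) i j).
Proof.
move=> oU uA CA i j.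
have C1 : Ck k U (fun x => (\det (A x))^-1 * cofactor (A x) j i).
  apply: CkM => //.
    apply: CkV => //; last exact: Ck_det.
    by move=> x /uA; rewrite unitmxE unitfE.
  apply: CkM => //; first exact: Ck_cst.
  by apply: Ck_det => // u v; apply: Ck_eq (CA _ _) => // x _; rewrite !mxE.
by apply: Ck_eq C1 => // x /uA Ax; rewrite /invmx Ax !mxE.
Qed.

Notation es := (@euclidean_smooth_at R _).

Lemma near_forall (T : topologicalType) (I : finType) (x : T) (P : I -> T -> Prop) :
  (forall i, \forall y \near x, P i y) -> \forall y \near x, forall i, P i y.
Proof. by move=> H; apply: filter_forall. Qed.

Lemma es_common n (I : finType) (a : 'rV[R]_n) (f : I -> 'rV[R]_n -> R) :
  (forall i, es a (f i)) -> exists2 U, open_nbhs a U & forall i k, Ck k U (f i).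
Proof.
move=> ef; pose Us i := sval (cid2 (ef i)).
have HU i : open_nbhs a (Us i) by rewrite /Us; case: cid2.
have CU i k : Ck k (Us i) (f i) by rewrite /Us; case: cid2.
exists (interior [set x | forall i, Us i x]); last first.
  by move=> i k; apply: Ck_sub (CU i k) => x /interior_subset.
split; first exact: open_interior.
by apply: (near_forall (T := 'rV[R]_n)) => i; exact: open_nbhs_nbhs.
Qed.

Lemma es_near n (a : 'rV[R]_n) f g : (\near a, f a = g a) -> es a f -> es a g.
Proof.
move=> fg [U oU CU]; have [aU Ua] := oU.
exists (U `&` interior [set x | f x = g x]).
  split; last by split.
  by apply: openI => //; exact: open_interior.
move=> k; apply: (@Ck_eq _ _ _ _ f).
- by apply: openI => //; exact: open_interior.
- by move=> x [_ /interior_subset].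
- by apply: Ck_sub (CU k) => x [].
Qed.

Lemma es_nearby n (a : 'rV[R]_n) f : es a f -> \forall b \near a, es b f.
Proof.
move=> [U oU CU]; apply: filterS (open_nbhs_nbhs oU) => b Ub.
by exists U => //; split => //; case: oU.
Qed.

Lemma es_diff n (a : 'rV[R]_n) f : es a f -> differentiable f a.
Proof. by move=> [U [_ Ua] CU]; exact: (Ck_diff (CU 1%N)). Qed.

Lemma es_continuous n (a : 'rV[R]_n) f : es a f -> {for a, continuous f}.
Proof. by move/es_diff/differentiable_continuous. Qed.

Lemma es_cst n (a : 'rV[R]_n) c : es a (fun=> c).
Proof. by exists setT => [|k]; [split=> //; exact: openT | exact: Ck_cst]. Qed.

Lemma es_coord n (a : 'rV[R]_n) j : es a (fun x => x 0 j).
Proof. by exists setT => [|k]; [split=> //; exact: openT | exact: Ck_coord]. Qed.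

Lemma es_partial n (a : 'rV[R]_n) f i : es a f -> es a ('d_ i f).
Proof. by move=> [U oU CU]; exists U => // k; have [_] := CU k.+1; exact. Qed.

Lemma es_comp n m (a : 'rV[R]_n) f (g : 'I_m -> 'rV[R]_n -> R) :
  es (\row_j g j a) f -> (forall j, es a (g j)) ->
  es a (fun x => f (\row_j g j x)).
Proof.
move=> [V [oV Va] CV] /es_common[U [oU Ua] CU].
have cg : {for a, continuous (fun x => \row_j g j x)}.
  by apply: continuous_row => j; have := CU j 0%N; exact.
exists (U `&` interior [set x | V (\row_j g j x)]).
  split; first by apply: openI => //; exact: open_interior.
  by split=> //; apply: cg; exact: open_nbhs_nbhs.
move=> k; apply: (Ck_comp (V := V)) => //.
- by apply: openI => //; exact: open_interior.
- by move=> x [_ /interior_subset].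
- by move=> j; apply: Ck_sub (CU j k) => x [].
Qed.

Lemma es_sum n (I : finType) (P : pred I) (a : 'rV[R]_n) (f : I -> 'rV[R]_n -> R) :
  (forall j, es a (f j)) -> es a (fun x => \sum_(j | P j) f j x).
Proof.
move=> /es_common[U [oU Ua] CU]; exists U => // k.
by apply: Ck_bigsum => // j; exact: CU.
Qed.

Lemma esD n (a : 'rV[R]_n) f g : es a f -> es a g -> es a (fun x => f x + g x).
Proof.
move=> ef eg; have := @es_sum _ bool xpredT a (fun b => if b then f else g).
move=> H; apply: es_near (H _); last by case.
by near=> x; rewrite big_bool.
Unshelve. all: by end_near. Qed.

Lemma esM n (a : 'rV[R]_n) f g : es a f -> es a g -> es a (fun x => f x * g x).
Proof.
move=> ef eg; have [|U [oU Ua] CU] := @es_common _ bool a (fun b => if b then f else g).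
  by case.
by exists U => // k; apply: CkM => //; [exact: (CU true) | exact: (CU false)].
Qed.

Lemma es_prod n (I : finType) (P : pred I) (a : 'rV[R]_n) (f : I -> 'rV[R]_n -> R) :
  (forall j, es a (f j)) -> es a (fun x => \prod_(j | P j) f j x).
Proof.
move=> /es_common[U [oU Ua] CU]; exists U => // k.
by apply: Ck_bigprod => // j; exact: CU.
Qed.

Lemma es_invmx n p (a : 'rV[R]_n) (A : 'rV[R]_n -> 'M[R]_p) :
  (forall i j, es a (fun x => A x i j)) -> A a \in unitmx ->
  (\forall x \near a, A x \in unitmx) /\
  forall i j, es a (fun x => invmx (A x) i j).
Proof.
move=> eA uA.
have [|U [oU Ua] CU] := @es_common _ ('I_p * 'I_p)%type a (fun ij x => A x ij.1 ij.2).
  by case=> i j; exact: eA.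
have nu : \forall x \near a, A x \in unitmx.
  have cd : {for a, continuous (fun x => \det (A x))}.
    by have := @Ck_det 0 n p U A oU (fun i j => CU (i, j) 0%N); exact.
  have d0 : \det (A a) != 0 by rewrite -unitfE -unitmxE.
  near=> x; rewrite unitmxE unitfE; near: x.
  by apply: (cd [set y | y != 0]); apply: open_nbhs_nbhs; split=> //; exact: open_neq.
split=> // i j; exists (U `&` interior [set x | A x \in unitmx]).
  by split; [apply: openI => //; exact: open_interior | split].
move=> k; apply: Ck_invmx => //.
- by apply: openI => //; exact: open_interior.
- by move=> x [_ /interior_subset].
- by move=> u v; apply: Ck_sub (CU (u, v) k) => x [].
Unshelve. all: by end_near. Qed.

Lemma ball_segment n (a x y : 'rV[R]_n) d (t : R) : ball a d x -> ball a d y ->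
  0 <= t <= 1 -> ball a d (y + t *: (x - y)).
Proof.
rewrite -!ball_normE /= => ax ay /andP[t0 t1].
have -> : a - (y + t *: (x - y)) = t *: (a - x) + (1 - t) *: (a - y).
  by apply/rowP => i; rewrite !mxE; ring.
apply: le_lt_trans (ler_normD _ _) _; rewrite !normrZ (ger0_norm t0) ger0_norm ?subr_ge0//.
have [->|tn0] := eqVneq t 0; first by rewrite mul0r add0r subr0 mul1r.
have : t * `|a - x| < t * d by rewrite ltr_pM2l// lt_def tn0.
have : (1 - t) * `|a - y| <= (1 - t) * d by rewrite ler_wpM2l ?subr_ge0// ltW.
move=> h1 h2; apply: lt_le_trans (ltr_leD h2 h1) _.
by rewrite -mulrDl addrC subrK mul1r.
Qed.

Lemma segment_MVT n (f : 'rV[R]_n -> R) (x y : 'rV[R]_n) :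
  (forall t : R, 0 <= t <= 1 -> differentiable f (y + t *: (x - y))) ->
  exists2 t : R, 0 <= t <= 1 & f x - f y = 'd f (y + t *: (x - y)) (x - y).
Proof.
move=> df; pose g (t : R) := f (y + t *: (x - y)).
have dl (t : R) : is_diff t (fun t : R => y + t *: (x - y)) ( *:%R^~ (x - y)).
  by apply: is_diff_eq; rewrite add0r.
have dg (t : R) : 0 <= t <= 1 -> is_derive t 1 g ('d f (y + t *: (x - y)) (x - y)).
  move=> t01; have dt := df _ t01.
  have dgt : differentiable g t.
    by apply: (@differentiable_comp _ _ _ _ (fun t : R => y + t *: (x - y)) f).
  apply: DeriveDef; first exact: diff_derivable.
  rewrite deriveE// /g (@diff_comp _ _ _ _ (fun t : R => y + t *: (x - y)) f)//=.
  by rewrite diff_val scale1r.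
have [||c c01 E] := @MVT_segment R g (fun t => 'd f (y + t *: (x - y)) (x - y)) 0 1 ler01.
- by move=> t; rewrite in_itv /= => /andP[t0 t1]; apply: dg; rewrite !ltW.
- apply: derivable_within_continuous => t; rewrite in_itv /= => t01.
  by have [] := dg _ t01.
- exists c; first by move: c01; rewrite in_itv.
  move: E; rewrite /g scale0r addr0 scale1r subr0 mulr1 => <-.
  by congr (f _ - _); rewrite addrC subrK.
Qed.

Lemma normr_coord_le n (v : 'rV[R]_n) i : `|v 0 i| <= `|v|.
Proof. by rewrite [leRHS]/Num.Def.normr/= mx_normrE; exact: (le_bigmax _ _ (0, i)). Qed.

(** Mean value theorem on the segment, each of the n terms being at most c times the sup norm of x -
    y. With c = 0 it gives constancy on balls. *)
Lemma lipschitz_of_partials n (f : 'rV[R]_n -> R) a d c x y :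
  (forall z, ball a d z -> differentiable f z) ->
  (forall z i, ball a d z -> `|'D_(delta_mx 0 i) f z| <= c) ->
  ball a d x -> ball a d y -> `|f x - f y| <= n%:R * c * `|x - y|.
Proof.
move=> df pf ax ay.
have [|t t01 ->] := @segment_MVT n f x y.
  by move=> t t01; apply/df/ball_segment.
have bt := ball_segment ax ay t01.
rewrite diff_partial; last exact: df.
apply: le_trans (ler_norm_sum _ _ _) _.
apply: (@le_trans _ _ (\sum_(i < n) c * `|x - y|)).
  apply: ler_sum => i _; rewrite normrM mulrC; apply: ler_pM => //; first exact: pf.
  exact: normr_coord_le.
by rewrite sumr_const card_ord -mulrA mulr_natl.
Qed.

End euclidean_smooth.

(** * The inverse function theorem on R^n *)

Section inverse_function.
Context {R : realType}.
Implicit Types n m k : nat.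

Notation "''d_' i f" := (fun x => 'D_(delta_mx 0 i) f x)
  (at level 10, i at level 2, f at next level).
Notation es := (@euclidean_smooth_at R _).

Lemma mulmx_norm_bound n m (B : 'M[R]_(n, m)) :
  exists2 c, 0 < c & forall v : 'rV[R]_n, `|v *m B| <= c * `|v|.
Proof.
exists (1 + \sum_i \sum_j `|B i j|) => [|v].
  by rewrite ltr_pwDl// sumr_ge0// => i _; rewrite sumr_ge0.
rewrite [leLHS]/Num.Def.normr/= mx_normrE; apply: bigmax_le => [|[i j] _].
  by rewrite mulr_ge0// addr_ge0// sumr_ge0// => i _; rewrite sumr_ge0.
rewrite mxE; apply: le_trans (ler_norm_sum _ _ _) _.
rewrite mulrDl mul1r ler_wpDl// mulr_suml ler_sum// => l _.
rewrite normrM mulrC ler_pM//=; last by rewrite (ord1 i); exact: normr_coord_le.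
by rewrite (bigD1 j)//= ler_wpDr// sumr_ge0.
Qed.

(** For y near h a, the map x |-> y - (h x - x) contracts the closed ball of radius d/2 with factor
    1/2, and its fixed point solves h x = y. The radius d/4 for y keeps that ball stable, since d/4
    + d/4 = d/2. *)
Lemma lipschitz_inverse n (h : 'rV[R]_n -> 'rV[R]_n) a d : 0 < d ->
  (forall x y, ball a d x -> ball a d y ->
     `|(h x - x) - (h y - y)| <= 2^-1 * `|x - y|) ->
  (forall x y, ball a d x -> ball a d y -> `|x - y| <= 2 * `|h x - h y|) /\
  exists psi, forall y, ball (h a) (d / 4) y -> ball a (d / 2) (psi y) /\ h (psi y) = y.
Proof.
move=> d0 Lh; split.
  move=> x y /Lh L /L {}L.
  have E : x - y = (h x - h y) - ((h x - x) - (h y - y)).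
    by apply/rowP => i; rewrite !mxE; ring.
  have : `|x - y| <= `|h x - h y| + 2^-1 * `|x - y|.
    rewrite {1}E; apply: le_trans (ler_normB _ _) _; exact: lerD.
  by lra.
have ha : ball a d a by exact: ballxx.
have sub : forall x, `|a - x| <= d / 2 -> ball a d x.
  move=> x ax; rewrite -ball_normE /=; lra.
suff H : forall y, ball (h a) (d / 4) y -> exists x, ball a (d / 2) x /\ h x = y.
  exists (fun y => get [set x | ball a (d / 2) x /\ h x = y]) => y /H.
  by case=> x Hx; exact: (@getI _ [set x | ball a (d / 2) x /\ h x = y] x).
move=> y; rewrite -ball_normE /= => hy.
pose U : set 'rV[R]_n := closed_ball a (d / 2).
have UE x : U x <-> `|a - x| <= d / 2.
  by rewrite /U closed_ballE ?divr_gt0.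
have est x : U x -> `|a - (y - (h x - x))| <= `|h a - y| + 2^-1 * `|a - x|.
  move=> /UE /sub bx; have := Lh _ _ ha bx.
  have -> : a - (y - (h x - x)) = (h a - y) - ((h a - a) - (h x - x)).
    by apply/rowP => i; rewrite !mxE; ring.
  by move=> L; apply: le_trans (ler_normB _ _) _; exact: lerD.
have UU : {homo (fun x => y - (h x - x)) : x / U x >-> U x}.
  by move=> x Ux; apply/UE; apply: le_trans (est x Ux) _; move/UE : Ux; lra.
pose T := mkfun_fun UU.
pose X : completeNormedModType R := HB.pack 'rV[R]_n
  (Uniform_isComplete.Build 'rV[R]_n (@mx_complete R 1 n)).
have [|||x Ux xE] := @banach_fixed_point R X U T.
- exists 2^-1%:nng; split; first by rewrite /=; lra.
  move=> [u v] [/= Uu Uv].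
  have := Lh _ _ (sub _ ((UE _).1 Uu)) (sub _ ((UE _).1 Uv)).
  have -> : y - (h u - u) - (y - (h v - v)) = - ((h u - u) - (h v - v)).
    by apply/rowP => i; rewrite !mxE; ring.
  by rewrite normrN.
- exact: closed_ball_closed.
- by exists a; apply/UE; rewrite subrr normr0 divr_ge0// ltW.
exists x; split; last first.
  have : x = y - (h x - x) by exact: xE.
  by move=> E; apply/rowP => i; move/rowP/(_ i) : E; rewrite !mxE; lra.
have := est x Ux; rewrite -[y - (h x - x)]/(T x) -xE.
by lra.
Qed.

(** The partials of h - id vanish at a, so they are small on small balls and bound the Lipschitz
    constant there. *)
Lemma strict_derivative n (h : 'I_n -> 'rV[R]_n -> R) a : (forall j, es a (h j)) ->
  (forall i j, 'D_(delta_mx 0 i) (h j) a = (i == j)%:R) ->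
  \forall d \near (0 : R)^'+, forall x y, ball a d x -> ball a d y ->
    `|(\row_j h j x - x) - (\row_j h j y - y)| <= 2^-1 * `|x - y|.
Proof.
move=> eh Dh; pose r j x := h j x + -1 * x 0 j.
have er j : es a (r j) by apply: esD => //; apply: esM; [exact: es_cst | exact: es_coord].
have Dr i j : 'D_(delta_mx 0 i) (r j) a = 0.
  have dc := @differentiable_coord R _ _ a 0 j.
  rewrite /r deriveD; last 2 first.
  - by apply/diff_derivable/es_diff.
  - by apply/diff_derivable/differentiableM => //; exact: differentiable_cst.
  rewrite Dh deriveM; [|exact: derivable_cst|exact: diff_derivable].
  rewrite derive_cst scaler0 addr0.
  have -> : 'D_(delta_mx 0 i) (fun x : 'rV[R]_n => x 0 j) a = (i == j)%:R.
    rewrite deriveE//.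
    have @f : {linear 'rV[R]_n -> R}.
      by exists (fun N : 'rV[R]_n => N 0 j); do 2![eexists]; do ?[constructor];
        rewrite ?mxE// => ? *; rewrite ?mxE//; move=> ?; rewrite !mxE.
    rewrite (@diff_lin _ _ _ f); last exact: coord_continuous.
    by rewrite /f /= mxE eqxx eq_sym.
  by rewrite scaleN1r subrr.
(* The factor n of [lipschitz_of_partials] times c is at most 1/2; taking n + 1 keeps c positive
   when n = 0. *)
pose c : R := (2 * n.+1%:R)^-1.
have c0 : 0 < c by rewrite invr_gt0 mulr_gt0.
have : \forall z \near a, forall j, differentiable (r j) z /\
    forall i, `|'D_(delta_mx 0 i) (r j) z| <= c.
  apply: near_forall => j.
  have H : \forall z \near a, forall i, `|'D_(delta_mx 0 i) (r j) z| <= c.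
    apply: near_forall => i.
    have /es_continuous/cvgrPdist_le/(_ _ c0) := es_partial i (er j).
    by apply: filterS => z; rewrite Dr sub0r normrN.
  near=> z; split; last by near: z.
  by apply: es_diff; near: z; exact: es_nearby.
move=> /nbhs_ballP[e /= e0 He].
near=> d => x y bx by_.
have de : d <= e by near: d; exact: nbhs_right_le.
have sub := le_ball de.
rewrite [leLHS]/Num.Def.normr/= mx_normrE; apply: bigmax_le => [|[i j] _].
  by rewrite mulr_ge0// invr_ge0.
have := @lipschitz_of_partials R n (r j) a d c x y _ _ bx by_.
have -> : (\row_j h j x - x - (\row_j h j y - y)) (i, j).1 (i, j).2 = r j x - r j y.
  by rewrite (ord1 i) !mxE /r /=; ring.
move=> L; apply: le_trans (L _ _) _.
- by move=> z /sub/He/(_ j)[].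
- by move=> z l /sub/He/(_ j)[_]; exact.
apply: ler_wpM2r => //; rewrite /c invfM mulrCA -[leRHS]mulr1 ler_wpM2l ?invr_ge0//.
by rewrite ler_pdivrMr// mul1r ler_nat.
Unshelve. all: by end_near. Qed.

Lemma cvg0_of_bound (V W : normedModType R) (f : V -> W) c : 0 < c ->
  (\forall k \near 0, `|f k| <= c * `|k|) -> f @ 0 --> 0.
Proof.
move=> c0 H; apply/cvgr0Pnorm_le => r r0; near=> k.
apply: le_trans (near H k _) _ => //.
rewrite mulrC -ler_pdivlMr//; near: k; apply: nbhs0_le.
by rewrite divr_gt0.
Unshelve. all: by end_near. Qed.

Lemma diff_of_linear_bound (V W : normedModType R) (f : V -> W) x (L : {linear V -> W}) :
  continuous L ->
  (forall e, 0 < e -> \forall h \near 0, `|f (h + x) - f x - L h| <= e * `|h|) ->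
  differentiable f x /\ 'd f x = L :> (V -> W).
Proof.
move=> cL H.
have E : f \o shift x = cst (f x) + L +o_ 0 id.
  apply/eqaddoP => e e0; apply: filterS (H e e0) => h.
  by rewrite !fctE /= opprD addrA.
have D := diff_unique cL E.
by split=> //; apply/diff_locallyP; rewrite D.
Qed.

Lemma diff_bound (V W : normedModType R) (f : V -> W) x : differentiable f x ->
  forall e, 0 < e -> \forall h \near 0, `|f (h + x) - f x - 'd f x h| <= e * `|h|.
Proof.
move=> /diff_locally/eqaddoP H e e0; apply: filterS (H e e0) => h.
by rewrite !fctE /= opprD addrA.
Qed.

Lemma diff_of_bound n m (f : 'rV[R]_n -> 'rV[R]_m) (x : 'rV[R]_n) (B : 'M[R]_(n, m)) :
  (forall e, 0 < e -> \forall h \near (0 : 'rV[R]_n),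
     `|f (h + x) - f x - h *m B| <= e * `|h|) ->
  differentiable f x /\ forall v, 'd f x v = v *m B.
Proof.
move=> H; have [c c0 Hc] := mulmx_norm_bound B.
have cL : continuous (mulmxr B : 'rV[R]_n -> 'rV[R]_m).
  apply: bounded_linear_continuous; apply/linear_boundedP.
  by near=> r => v; apply: le_trans (Hc v) _; rewrite ler_wpM2r//; near: r; exact: nbhs_pinfty_ge.
by have [D E] := diff_of_linear_bound cL H; split=> // v; rewrite E.
Unshelve. all: by end_near. Qed.

(** Multiplying by the inverse Jacobian at a makes the derivative the identity there, and
    [lipschitz_inverse] applies. The inverse is Lipschitz, hence differentiable with the inverse
    Jacobian as derivative, and this formula raises its smoothness one order at a time. *)
Theorem euclidean_inverse_function n (g : 'I_n -> 'rV[R]_n -> R) a W : nbhs a W ->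
  (forall j, es a (g j)) ->
  \matrix_(i, j) 'D_(delta_mx 0 i) (g j) a \in unitmx ->
  exists U V psi, [/\ open_nbhs a U /\ open V, U `<=` W,
    forall x, U x -> [/\ V (\row_j g j x), psi (\row_j g j x) = x & forall j, es x (g j)],
    forall y, V y -> U (psi y) /\ \row_j g j (psi y) = y
  & forall y, V y -> forall j, es y (fun y => psi y 0 j)].
Proof.
move=> nW eg uJ; set J := \matrix_(i, j) _ in uJ.
pose A := invmx J; pose G x : 'rV[R]_n := \row_j g j x.
pose h j x := \sum_i g i x * A i j.
have hE x : \row_j h j x = G x *m A.
  by apply/rowP => j; rewrite !mxE; apply: eq_bigr => i _; rewrite mxE.
have eh j : es a (h j) by apply: es_sum => i; apply: esM => //; exact: es_cst.
have Dh i j : 'D_(delta_mx 0 i) (h j) a = (i == j)%:R.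
  have : (J *m A) i j = (i == j)%:R by rewrite mulmxV// mxE.
  rewrite mxE => <-.
  rewrite (_ : h j = \sum_i (fun x => g i x * A i j)); last first.
    by apply/funext => x; rewrite fct_sumE.
  have dg l : derivable (g l) a (delta_mx 0 i) by apply/diff_derivable/es_diff.
  rewrite derive_sum; last first.
    by move=> l; apply: derivableM => //; exact: derivable_cst.
  apply: eq_bigr => l _.
  have -> := @deriveM _ _ (g l) (fun=> A l j) a (delta_mx 0 i) (dg l) (derivable_cst _ _ _).
  by rewrite derive_cst scaler0 add0r mxE mulrC.
have [Ug [oUg Uga] CUg] := es_common eg.
pose JG x : 'M[R]_n := \matrix_(i, j) 'D_(delta_mx 0 i) (g j) x.
have nJ : \forall x \near a, [/\ W x, Ug x & JG x \in unitmx].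
  have [||nu _] := @es_invmx R n n a JG.
  - by move=> i j; apply: es_near (es_partial i (eg j)); near=> x; rewrite mxE.
  - exact: uJ.
  by near=> x; split; near: x => //; exact: open_nbhs_nbhs.
move: nJ => /nbhs_ballP[e /= e0 He].
near (0 : R)^'+ => d.
have de : ball a d `<=` ball a e by apply: le_ball; near: d; exact: nbhs_right_le.
have d0 : 0 < d by near: d; exact: nbhs_right_gt.
have L : forall x y, ball a d x -> ball a d y ->
    `|(\row_j h j x - x) - (\row_j h j y - y)| <= 2^-1 * `|x - y|.
  by near: d; exact: strict_derivative.
have [inj [psi Hpsi]] := lipschitz_inverse d0 L.
have d2 : ball a (d / 2) `<=` ball a d by apply: le_ball; lra.
pose V := [set y : 'rV[R]_n | ball (\row_j h j a) (d / 4) (y *m A)].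
(* The smaller ball leaves room: h is injective on the whole ball of radius d, which identifies
   [Psi (G x)] with x. *)
pose U := [set x | ball a (d / 2) x /\ V (G x)].
pose Psi y := psi (y *m A).
have bU x : U x -> [/\ W x, Ug x & JG x \in unitmx] by move=> [/d2/de/He].
have bP y : V y -> ball a (d / 2) (Psi y) by move=> /Hpsi[].
have GP y : V y -> G (Psi y) = y.
  move=> /Hpsi[_]; rewrite hE => /(congr1 (mulmx^~ J)).
  by rewrite -!mulmxA mulVmx// !mulmx1.
have PG x : U x -> Psi (G x) = x.
  move=> [bx Vx]; apply/eqP; rewrite -subr_eq0 -normr_le0.
  have [b1 E] := Hpsi _ Vx.
  apply: le_trans (inj _ _ (d2 _ b1) (d2 _ bx)) _.
  by rewrite E hE subrr normr0 mulr0.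
have UP y : V y -> U (Psi y) by move=> Vy; split; [exact: bP | rewrite GP].
have [c c0 Hc] := mulmx_norm_bound A.
have Plip y y' : V y -> V y' -> `|Psi y - Psi y'| <= 2 * c * `|y - y'|.
  move=> Vy Vy'; have [b1 E1] := Hpsi _ Vy; have [b2 E2] := Hpsi _ Vy'.
  apply: le_trans (inj _ _ (d2 _ b1) (d2 _ b2)) _.
  by rewrite E1 E2 -mulmxBl -mulrA ler_wpM2l.
have oV : open V.
  rewrite openE => y; rewrite /V /= => Vy.
  move: Vy; rewrite -ball_normE /= => Vy.
  apply/nbhs_ballP; exists ((d / 4 - `|\row_j h j a - y *m A|) / c) => /=.
    by rewrite divr_gt0// subr_gt0.
  move=> z; rewrite -!ball_normE /= => yz.
  have -> : \row_j h j a - z *m A = (\row_j h j a - y *m A) + (y - z) *m A.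
    by rewrite mulmxBl addrA subrK.
  apply: le_lt_trans (ler_normD _ _) _; rewrite -ltrBrDl.
  by apply: le_lt_trans (Hc _) _; rewrite mulrC -ltr_pdivlMr.
have cG x : Ug x -> {for x, continuous G}.
  by move=> Ux; apply: continuous_row => j; have := CUg j 0%N; exact.
have Pdiff y : V y -> differentiable Psi y /\ forall v, 'd Psi y v = v *m invmx (JG (Psi y)).
  move=> Vy; apply: diff_of_bound => eps eps0.
  set x0 := Psi y; set B := invmx _.
  have [_ Ux0 uB] := bU _ (UP _ Vy).
  have [cB cB0 HB] := mulmx_norm_bound B.
  have [dG EG] := differentiable_row (fun j => Ck_diff (CUg j 1%N) Ux0).
  have EG' v : 'd G x0 v = v *m JG x0.
    rewrite EG; apply/rowP => j; rewrite !mxE diff_partial; last first.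
      by apply: Ck_diff Ux0; exact: (CUg j 1%N).
    by apply: eq_bigr => i _; rewrite mxE.
  (* The error e' |w| of G is enlarged by cB on passing through B, and |w| is at most 2 c |k|; e'
     absorbs both factors. *)
  pose e' := eps / (cB * (2 * c)).
  have e'0 : 0 < e' by rewrite divr_gt0// !mulr_gt0.
  have nG := diff_bound dG e'0.
  have nV : \forall h \near (0 : 'rV[R]_n), V (h + y).
    have cs : (fun h => h + y) @ (0 : 'rV[R]_n) --> y.
      have := @cvgD _ _ _ (nbhs (0 : 'rV[R]_n)) _ id (fun=> y) 0 y cvg_id (cvg_cst y).
      by rewrite add0r; apply.
    by apply: (cs V); exact: open_nbhs_nbhs.
  have cw : (fun h => Psi (h + y) - x0) @ (0 : 'rV[R]_n) --> (0 : 'rV[R]_n).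
    apply: (@cvg0_of_bound _ _ _ (2 * c)); first by rewrite mulr_gt0.
    by apply: filterS nV => k Vk; apply: le_trans (Plip _ _ Vk Vy) _; rewrite addrK.
  have nG' : \forall k \near (0 : 'rV[R]_n),
      `|G (Psi (k + y) - x0 + x0) - G x0 - 'd G x0 (Psi (k + y) - x0)| <=
      e' * `|Psi (k + y) - x0| := cw _ nG.
  near=> k; have Vk : V (k + y) by near: k.
  set w := Psi (k + y) - x0.
  have : `|G (w + x0) - G x0 - w *m JG x0| <= e' * `|w|.
    by rewrite -EG'; apply: (near nG' k).
  rewrite {1}/w subrK (GP _ Vk) /x0 (GP _ Vy) -/x0 addrK => E.
  have -> : w - k *m B = (w *m JG x0 - k) *m B.
    by rewrite mulmxBl -mulmxA mulmxV// mulmx1.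
  apply: le_trans (HB _) _; rewrite distrC.
  have : `|w| <= 2 * c * `|k|.
    by apply: le_trans (Plip _ _ Vk Vy) _; rewrite addrK.
  move=> Hw; apply: le_trans (_ : cB * (e' * `|w|) <= _).
    by rewrite ler_wpM2l// ltW.
  apply: le_trans (_ : cB * (e' * (2 * c * `|k|)) <= _).
    by rewrite !ler_wpM2l// ltW.
  rewrite /e' le_eqVlt; apply/orP; left; apply/eqP.
  by field; rewrite !gt_eqF.
have CP k j : Ck k V (fun y => Psi y 0 j).
  elim: k j => [|k IH] j.
    move=> y Vy; have [dP _] := Pdiff y Vy.
    apply: (@continuous_comp _ _ _ Psi (fun z : 'rV[R]_n => z 0 j)).
      exact: differentiable_continuous.
    exact: coord_continuous.
  have DP y : V y -> differentiable (fun y => Psi y 0 j) y /\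
      forall i, 'D_(delta_mx 0 i) (fun y => Psi y 0 j) y = invmx (JG (Psi y)) i j.
    move=> Vy; have [dP EP] := Pdiff y Vy.
    have dc := @differentiable_coord R _ _ (Psi y) 0 j.
    have D : differentiable ((fun z : 'rV[R]_n => z 0 j) \o Psi) y by exact: differentiable_comp.
    split=> // i; rewrite deriveE//.
    have -> : 'd ((fun z : 'rV[R]_n => z 0 j) \o Psi) y =
       'd (fun z : 'rV[R]_n => z 0 j) (Psi y) \o 'd Psi y :> (_ -> _).
      exact: diff_comp.
    have @f : {linear 'rV[R]_n -> R}.
      by exists (fun N : 'rV[R]_n => N 0 j); do 2![eexists]; do ?[constructor];
        rewrite ?mxE// => ? *; rewrite ?mxE//; move=> ?; rewrite !mxE.
    rewrite /= (@diff_lin _ _ _ f); last exact: coord_continuous.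
    by rewrite /f /= EP -rowE mxE.
  split=> [y /DP[]//|i].
  apply: (@Ck_eq _ _ _ _ (fun y => invmx (JG (Psi y)) i j)) => //.
    by move=> y Vy; have [_ ->] := DP y Vy.
  apply: Ck_invmx => // [y Vy|u v]; first by have [] := bU _ (UP _ Vy).
  have CD : Ck k Ug ('d_ u (g v)) by have [_] := CUg v k.+1; exact.
  have VU y : V y -> Ug (\row_j Psi y 0 j).
    move=> Vy; have [_ + _] := bU _ (UP _ Vy).
    by have -> : \row_j Psi y 0 j = Psi y by apply/rowP => l; rewrite mxE.
  apply: Ck_eq (Ck_comp oV VU CD IH) => // y Vy; rewrite mxE.
  by have -> : \row_j Psi y 0 j = Psi y by apply/rowP => l; rewrite mxE.
exists U, V, Psi; split.
- split=> //; split; last first.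
    by split; [apply: ballxx; rewrite divr_gt0 | rewrite /V /= hE; apply: ballxx; rewrite divr_gt0].
  rewrite openE => x Ux; have [_ Ugx _] := bU _ Ux; have [bx Vx] := Ux.
  rewrite /interior; near=> z; split; near: z.
    by apply: open_nbhs_nbhs; split=> //; exact: ball_open.
  by apply: (cG x Ugx V); exact: open_nbhs_nbhs.
- by move=> x /bU[].
- move=> x Ux; split; [by case: Ux | exact: PG | move=> j].
  by have [_ Ugx _] := bU _ Ux; exists Ug.
- by move=> y Vy; split; [exact: UP | exact: GP].
- by move=> y Vy j; exists V.
Unshelve. all: by end_near. Qed.

End inverse_function.

(** * Integration over [0, 1] *)

Section segment_integral.
Context {R : realType}.
Implicit Types phi Phi : R -> R.

(* Any antiderivative gives the integral over [0, 1]; linearity and the sup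
   bound then follow from the mean value theorem. *)
Definition primitive01 phi Phi : Prop :=
  {within `[0, 1], continuous Phi} /\
  forall t : R, 0 < t < 1 -> is_derive t (1 : R) Phi (phi t).

Definition int01 phi : R :=
  xget 0 [set r | exists2 Phi, primitive01 phi Phi & r = Phi 1 - Phi 0].

Lemma primitive01_ex phi : (forall t : R, 0 <= t <= 1 -> {for t, continuous phi}) ->
  exists Phi, primitive01 phi Phi.
Proof.
move=> cphi.
have cw : {within `[0, 1], continuous phi}.
  apply: continuous_in_subspaceT => t; rewrite inE /= in_itv /= => t01; exact: cphi.
have iphi : (@lebesgue_measure R).-integrable `[0%R, 1%R] (EFin \o phi).
  by apply: continuous_compact_integrable => //; exact: segment_compact.
exists (fun x => parameterized_integral lebesgue_measure 0 x phi); split.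
  exact: parameterized_integral_continuous.
move=> t /andP[t0 t1].
have [|D E] := continuous_FTC1_closed t1 iphi t0; first by apply: cphi; rewrite !ltW.
rewrite /parameterized_integral; apply: DeriveDef; first exact: D.
by rewrite -derive1E; exact: E.
Qed.

Lemma primitive01_bound phi Phi M : primitive01 phi Phi ->
  (forall t : R, 0 < t < 1 -> `|phi t| <= M) -> `|Phi 1 - Phi 0| <= M.
Proof.
move=> [cP dP] bM.
have dP' (t : R) : t \in `]0, 1[ -> is_derive t (1 : R) Phi (phi t).
  by rewrite in_itv; exact: dP.
have [c + ->] := @MVT R Phi phi 0 1 ltr01 dP' cP.
by rewrite in_itv /= => /bM; rewrite subr0 mulr1.
Qed.

Lemma primitive01D phi Phi psi Psi c : primitive01 phi Phi -> primitive01 psi Psi ->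
  primitive01 (fun t => phi t + c * psi t) (fun t => Phi t + c * Psi t).
Proof.
move=> [cP dP] [cQ dQ]; split.
  by move=> t; apply: cvgD; [exact: cP | apply: cvgM; [exact: cvg_cst | exact: cQ]].
move=> t t01; have h1 := dP t t01; have h2 := dQ t t01.
have h3 : is_derive t (1 : R) (c *: Psi) (c *: psi t) by exact: is_deriveZ.
exact: (is_deriveD h1 h3).
Qed.

Lemma primitive01_sum n (phi Phi : 'I_n -> R -> R) :
  (forall i, primitive01 (phi i) (Phi i)) ->
  primitive01 (fun t => \sum_i phi i t) (fun t => \sum_i Phi i t).
Proof.
elim: n phi Phi => [|n IH] phi Phi H.
  have -> : (fun t => \sum_i Phi i t) = fun=> 0 by apply/funext => t; rewrite big_ord0.
  have -> : (fun t => \sum_i phi i t) = fun=> 0 by apply/funext => t; rewrite big_ord0.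
  by split=> [t|t _]; [exact: cvg_cst | exact: is_derive_cst].
have := primitive01D 1 (IH _ _ (fun i => H (widen_ord (leqnSn n) i))) (H ord_max).
congr primitive01; apply/funext => t; by rewrite big_ord_recr mul1r.
Qed.

(** The difference of two antiderivatives has derivative 0, so the bound with M = 0 shows that they
    have the same increment and that the choice inside [int01] does not matter. *)
Lemma int01E phi Phi : primitive01 phi Phi -> int01 phi = Phi 1 - Phi 0.
Proof.
move=> P; rewrite /int01; case: xgetP => [r _ [Psi Q ->]|/(_ (Phi 1 - Phi 0))]; last first.
  by case; exists Phi.
have := primitive01_bound (M := 0) (primitive01D (-1) P Q).
have h (t : R) : 0 < t < 1 -> `|phi t + -1 * phi t| <= 0 by rewrite mulN1r subrr normr0.
by move=> /(_ h); rewrite normr_le0 => /eqP; lra.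
Qed.

End segment_integral.

Lemma is_derive_segment (R : realType) n (f : 'rV[R]_n -> R) (y w : 'rV[R]_n) (t : R) :
  differentiable f (y + t *: w) ->
  is_derive t (1 : R) (fun t => f (y + t *: w)) ('d f (y + t *: w) w).
Proof.
move=> dt.
have dl : is_diff t (fun t : R => y + t *: w) ( *:%R^~ w).
  by apply: is_diff_eq; rewrite add0r.
have dgt : differentiable (f \o (fun t : R => y + t *: w)) t.
  exact: differentiable_comp.
apply: DeriveDef; first exact: diff_derivable.
rewrite deriveE// (@diff_comp _ _ _ _ (fun t : R => y + t *: w) f)//=.
by rewrite diff_val scale1r.
Qed.

(** * Hadamard's lemma *)

Section hadamard.
Context {R : realType} {n : nat}.
Implicit Types (a x v : 'rV[R]_n) (f h : 'rV[R]_n -> R).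

Notation "''d_' i f" := (fun x => 'D_(delta_mx 0 i) f x)
  (at level 10, i at level 2, f at next level).
Notation es := (@euclidean_smooth_at R _).

Let seg a x (t : R) := a + t *: (x - a).

(** Differentiating in x under the integral produces a factor t, so the weights t ^ p make the
    family closed under partial derivatives. *)
Definition segint a p h x : R := int01 (fun t => t ^+ p * h (seg a x t)).

Let seg_ball a d x (t : R) : ball a d x -> 0 <= t <= 1 -> ball a d (seg a x t).
Proof.
move=> bx t01; have d0 : 0 < d by move: bx; rewrite -ball_normE /=; exact: le_lt_trans.
exact: (ball_segment bx (ballxx a d0)).
Qed.

Let seg_primitive a d p h x : (forall y, ball a d y -> {for y, continuous h}) ->
  ball a d x -> exists Phi, primitive01 (fun t => t ^+ p * h (seg a x t)) Phi.
Proof.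
move=> ch bx; apply: primitive01_ex => t t01.
apply: continuousM; first exact: exprn_continuous.
apply: (@continuous_comp _ _ _ (seg a x) h); last exact/ch/seg_ball.
apply: (@differentiable_continuous _ R^o); rewrite /seg.
by have : is_diff t (fun t : R => a + t *: (x - a)) ( *:%R^~ (x - a))
  by apply: is_diff_eq; rewrite add0r.
Qed.

(** Differentiation under the integral sign: by the mean value theorem the error of the integrand is
    bounded by the oscillation of the partials of h, uniformly in t. *)
Lemma segint_diff a d p h x : Ck 1 (ball a d) h -> ball a d x ->
  differentiable (segint a p h) x /\
  forall i, 'D_(delta_mx 0 i) (segint a p h) x = segint a p.+1 ('d_ i h) x.
Proof.
move=> Ch bx; have [dh Cdh] := Ch.
have ch y : ball a d y -> {for y, continuous h} by move/dh; exact: differentiable_continuous.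
pose c i := segint a p.+1 ('d_ i h) x.
pose L v := \sum_i v 0 i * c i.
have linL : linear L.
  move=> r u v; rewrite /L scaler_sumr -big_split /=; apply: eq_bigr => i _.
  by rewrite !mxE mulrDl -mulrA.
pose LM := GRing.isLinear.Build _ _ _ _ _ linL.
pose LL : {linear 'rV[R]_n -> R} := HB.pack L LM.
have cL : continuous LL.
  move=> v; apply: (@Ck_sum R 0 n n setT (fun i v => v 0 i * c i)) => //; first exact: openT.
  by move=> i; apply: CkM; [exact: openT | exact: Ck_coord | exact: Ck_cst].
have key e : 0 < e -> \forall v \near (0 : 'rV[R]_n),
    `|segint a p h (v + x) - segint a p h x - LL v| <= e * `|v|.
  move=> e0; pose eps := e / n.+1%:R.
  have eps0 : 0 < eps by rewrite divr_gt0.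
  (* Compactness of [0, 1] turns continuity of the partials at each point of the segment into one
     estimate for all t. *)
  have unif : \forall v \near (0 : 'rV[R]_n), forall t, t \in `[0, 1] ->
     forall i, `|'D_(delta_mx 0 i) h (v + seg a x t) - 'D_(delta_mx 0 i) h (seg a x t)| <= eps.
    have := @segment_compact R 0 1; rewrite compact_near_coveringP => NC.
    have := NC _ (nbhs (0 : 'rV[R]_n)) (fun v t => forall i,
      `|'D_(delta_mx 0 i) h (v + seg a x t) - 'D_(delta_mx 0 i) h (seg a x t)| <= eps) (nbhs_filter _).
    move=> H; apply: filterS (H _) => [v Hv t|t t01]; first exact: Hv.
    have t01' : 0 <= t <= 1 by move: t01; rewrite /= in_itv.
    have bt := seg_ball bx t01'.
    suff : \forall q \near (t, (0 : 'rV[R]_n)), forall i,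
      `|'D_(delta_mx 0 i) h (q.2 + seg a x q.1) - 'D_(delta_mx 0 i) h (seg a x q.1)| <= eps by [].
    apply: (near_forall (T := (R * 'rV[R]_n)%type)) => i.
    have cD : {for seg a x t, continuous ('d_ i h)} by exact: (Cdh i).
    have cs : continuous (seg a x : R^o -> _).
      move=> s; apply: differentiable_continuous; rewrite /seg.
      by have : is_diff s (fun t : R => a + t *: (x - a)) ( *:%R^~ (x - a))
        by apply: is_diff_eq; rewrite add0r.
    pose T : topologicalType := (R * 'rV[R]_n)%type.
    have ca : {for (t, 0) : T, continuous (fun q : T => q.2 + seg a x q.1)}.
      apply: continuousD; first exact: cvg_snd.
      by apply: (@continuous_comp _ _ _ fst (seg a x)); [exact: cvg_fst | exact: cs].
    have cb : {for (t, 0) : T, continuous (fun q : T => seg a x q.1)}.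
      by apply: (@continuous_comp _ _ _ fst (seg a x)); [exact: cvg_fst | exact: cs].
    have c1 : {for (t, 0) : T, continuous (fun q : T => 'D_(delta_mx 0 i) h (q.2 + seg a x q.1))}.
      apply: (@continuous_comp _ _ _ (fun q : T => q.2 + seg a x q.1) ('d_ i h)) => //=.
      by rewrite add0r.
    have c2 : {for (t, 0) : T, continuous (fun q : T => 'D_(delta_mx 0 i) h (seg a x q.1))}.
      exact: (@continuous_comp _ _ _ (fun q : T => seg a x q.1) ('d_ i h)).
    have := continuousB c1 c2; rewrite /prop_for /continuous_at !fctE /= add0r subrr.
    move=> /cvgr0Pnorm_le/(_ _ eps0).
    exact.
  move: unif => /nbhs_ballP[r /= r0 Hr].
  have nb : \forall v \near (0 : 'rV[R]_n), ball a d (v + x).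
    have cs : (fun z => z + x) @ (0 : 'rV[R]_n) --> x.
      have := @cvgD _ _ _ (nbhs (0 : 'rV[R]_n)) _ id (fun=> x) 0 x cvg_id (cvg_cst x).
      by rewrite add0r; apply.
    by apply: (cs (ball a d)); apply: open_nbhs_nbhs; split=> //; exact: ball_open.
  near=> v.
  have bv : ball a d (v + x) by near: v.
  have rv : ball 0 r v by near: v; exact: nbhsx_ballx.
  have [Pv PvE] := seg_primitive p ch bv.
  have [P0 P0E] := seg_primitive p ch bx.
  have Qex i := seg_primitive p.+1 (Cdh i) bx.
  pose Q i := sval (cid (Qex i)).
  have QE i : primitive01 (fun t => t ^+ p.+1 * 'D_(delta_mx 0 i) h (seg a x t)) (Q i).
    by rewrite /Q; case: cid.
  have Z0 : primitive01 (fun=> 0 : R) (fun=> 0).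
    by split=> [t|t _]; [exact: cvg_cst | exact: is_derive_cst].
  (* All integrals are combined into the increment of a single antiderivative, so that a bound of
     its integrand bounds the whole expression. *)
  have := primitive01D (-1) (primitive01D (-1) PvE P0E)
    (primitive01_sum (fun i => primitive01D (v 0 i) Z0 (QE i))).
  move=> /(primitive01_bound (M := e * `|v|)) B.
  rewrite /segint (int01E PvE) (int01E P0E) /LL /= /L.
  rewrite (_ : \sum_i v 0 i * c i = \sum_i (0 + v 0 i * Q i 1) - \sum_i (0 + v 0 i * Q i 0)); last first.
    rewrite -sumrB; apply: eq_bigr => i _.
    by rewrite /c /segint (int01E (QE i)); ring.
  rewrite (_ : Pv 1 - Pv 0 - (P0 1 - P0 0) - _ = (Pv 1 + -1 * P0 1 + -1 * (\sum_i (0 + v 0 i * Q i 1))) -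
     (Pv 0 + -1 * P0 0 + -1 * (\sum_i (0 + v 0 i * Q i 0)))); last by ring.
  apply: B => t /andP[t0 t1].
  have t01 : 0 <= t <= 1 by rewrite !ltW.
  have tI : t \in `[0, 1] by rewrite in_itv.
  have svx : seg a (v + x) t = seg a x t + t *: v.
    by apply/rowP => i; rewrite /seg !mxE; ring.
  have Dseg : v + x - x = v by rewrite addrK.
  have [|s s01 E] := @segment_MVT R n h (seg a (v + x) t) (seg a x t).
    move=> s s01; apply/dh/ball_segment => //; exact: seg_ball.
  have sv2 : seg a x t + t *: v - seg a x t = t *: v by rewrite addrC addKr.
  move: E; rewrite svx sv2 => E.
  have st v' : `|v'| <= `|v| -> ball 0 r v'.
    by move: rv; rewrite -!ball_normE /= !sub0r !normrN => rv vv; apply: le_lt_trans rv.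
  have bd : differentiable h (seg a x t + s *: (t *: v)).
    apply: dh; have := ball_segment (seg_ball bv t01) (seg_ball bx t01) s01.
    by rewrite svx sv2.
  rewrite (_ : t ^+ p * h _ + _ + _ = t ^+ p * (h (seg a x t + t *: v) - h (seg a x t) -
      \sum_i (t * v 0 i) * 'D_(delta_mx 0 i) h (seg a x t))); last first.
    have -> : \sum_i (0 + v 0 i * (t ^+ p.+1 * 'D_(delta_mx 0 i) h (seg a x t))) =
        t ^+ p * \sum_i (t * v 0 i) * 'D_(delta_mx 0 i) h (seg a x t).
      by rewrite mulr_sumr; apply: eq_bigr => i _; rewrite exprSr; ring.
    by ring.
  rewrite E diff_partial// -sumrB normrM ger0_norm; last by rewrite exprn_ge0// ltW.
  apply: le_trans (_ : 1 * (\sum_(i < n) eps * `|v|) <= _); last first.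
    rewrite mul1r sumr_const card_ord -mulr_natl /eps mulrA ler_wpM2r//.
    rewrite mulrCA -[leRHS]mulr1; apply: ler_wpM2l; first exact: ltW.
    by rewrite ler_pdivrMr// mul1r ler_nat.
  apply: ler_pM => //; first by rewrite exprn_ge0// ltW.
    by rewrite exprn_ile1 ?ltW.
  apply: le_trans (ler_norm_sum _ _ _) _; apply: ler_sum => i _.
  rewrite !mxE -mulrBr normrM mulrC; apply: ler_pM => //.
    rewrite [seg a x t + _]addrC; apply: Hr => //; apply: st.
    move: s01 => /andP[s0 s1].
    rewrite !normrZ (ger0_norm s0) (ger0_norm (ltW t0)) mulrA ler_piMl//.
    by apply: mulr_ile1 => //; exact: ltW.
  rewrite normrM (ger0_norm (ltW t0)); apply: le_trans (normr_coord_le v i).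
  by rewrite ler_piMl// ltW.
have [D E] := diff_of_linear_bound cL key; split=> // i.
rewrite deriveE// E /LL /= /L (bigD1 i)//= big1 => [|j ji].
  by rewrite addr0 mxE !eqxx mul1r.
by rewrite mxE eqxx (negPf ji) mul0r.
Unshelve. all: by end_near. Qed.

Lemma Ck_segint a d k p h : (forall k, Ck k (ball a d) h) ->
  Ck k (ball a d) (segint a p h).
Proof.
elim: k p h => [|k IH] p h Ch.
  by move=> x bx; apply: differentiable_continuous; have [] := segint_diff p (Ch 1%N) bx.
split=> [x bx|i]; first by have [] := segint_diff p (Ch 1%N) bx.
apply: (@Ck_eq _ _ _ _ (segint a p.+1 ('d_ i h))); first exact: ball_open.
  by move=> x bx; have [_ ->] := segint_diff p (Ch 1%N) bx.
by apply: IH => l; have [_] := Ch l.+1; exact.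
Qed.

(** g i is the integral of the i-th partial of f along the segment from a to x, and the formula is
    the fundamental theorem of calculus on this segment. *)
Theorem hadamard f a : es a f -> exists g : 'I_n -> 'rV[R]_n -> R,
  [/\ forall i, es a (g i), forall i, g i a = 'D_(delta_mx 0 i) f a
    & \forall x \near a, f x = f a + \sum_i (x 0 i - a 0 i) * g i x].
Proof.
move=> [U oU CU]; have /nbhs_ballP[d /= d0 dU] := open_nbhs_nbhs oU.
have Cf k : Ck k (ball a d) f by apply: Ck_sub (CU k).
exists (fun i => segint a 0 ('d_ i f)); split.
- move=> i; exists (ball a d); first by split; [exact: ball_open | exact: ballxx].
  by move=> k; apply: Ck_segint => l; have [_] := Cf l.+1; exact.
- move=> i; rewrite /segint.
  have P : primitive01 (fun t => t ^+ 0 * 'D_(delta_mx 0 i) f (seg a a t))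
     (fun t => 'D_(delta_mx 0 i) f a * t).
    split=> [|t _]; first by apply: continuous_subspaceT; exact: mulrl_continuous.
    rewrite /seg subrr scaler0 addr0 expr0 mul1r.
    have := is_deriveZ ('D_(delta_mx 0 i) f a) (is_derive_id t (1 : R)).
    by rewrite /GRing.scale /= mulr1.
  by rewrite (int01E P); ring.
apply: filterS (nbhsx_ballx a d d0) => x bx.
pose Q i := sval (cid (seg_primitive 0 ((Cf 1%N).2 i) bx)).
have QE i : primitive01 (fun t => t ^+ 0 * 'D_(delta_mx 0 i) f (seg a x t)) (Q i).
  by rewrite /Q; case: cid.
have Z0 : primitive01 (fun=> 0 : R) (fun=> 0).
  by split=> [t|t _]; [exact: cvg_cst | exact: is_derive_cst].
have P1 := primitive01_sum (fun i => primitive01D (x 0 i - a 0 i) Z0 (QE i)).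
have df y : ball a d y -> differentiable f y := (Cf 1%N).1 y.
have P2 : primitive01
    (fun t => \sum_i (0 + (x 0 i - a 0 i) * (t ^+ 0 * 'D_(delta_mx 0 i) f (seg a x t))))
    (fun t => f (seg a x t)).
  have D (t : R) : 0 <= t <= 1 -> is_derive t (1 : R) (fun t => f (seg a x t)) ('d f (seg a x t) (x - a)).
    by move=> t01; apply: is_derive_segment; apply: df; exact: seg_ball.
  split=> [|t /andP[t0 t1]].
    by apply: derivable_within_continuous => t; rewrite in_itv /= => /D[].
  apply: is_derive_eq; first by apply: D; rewrite !ltW.
  rewrite diff_partial; last by apply: df; apply: seg_ball => //; rewrite !ltW.
  by apply: eq_bigr => i _; rewrite add0r expr0 mul1r !mxE.
have s1 : seg a x 1 = x by rewrite /seg scale1r addrC subrK.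
have s0 : seg a x 0 = a by rewrite /seg scale0r addr0.
have := int01E P2; rewrite (int01E P1) s1 s0 => E.
have -> : f x = f a + (f x - f a) by rewrite addrC subrK.
rewrite -E -sumrB; congr (_ + _).
by apply: eq_bigr => i _; rewrite /segint (int01E (QE i)); ring.
Qed.

End hadamard.

(** * Flat functions and bump functions *)

Section bump.
Context {R : realType}.
Notation es := (@euclidean_smooth_at R _).

(* t^-p exp(-1/t), extended by 0: a family closed under differentiation. *)
Definition flat (p : nat) (t : R) : R :=
  if 0 < t then t ^- p * expR (- t^-1) else 0.

Lemma flat_ge0 p t : 0 <= flat p t.
Proof.
rewrite /flat; case: ifP => // t0.
by rewrite mulr_ge0 ?expR_ge0// invr_ge0 exprn_ge0// ltW.
Qed.

(** From exp s >= s ^ (p + 1) / (p + 1)! at s = 1 / t. The spare power of t makes every member of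
    the family tend to 0 at 0. *)
Lemma flat_bound p : exists2 c, 0 < c & forall t, flat p t <= c * `|t|.
Proof.
exists (p.+1`!%:R) => [|t]; first by rewrite ltr0n fact_gt0.
rewrite /flat; case: ifP => [t0|_]; last by rewrite mulr_ge0.
rewrite gtr0_norm// expRN.
have ti : 0 <= t^-1 by rewrite invr_ge0 ltW.
have H := expR_ge1Dxn p ti.
have E0 := expR_gt0 t^-1.
have tn0 : t != 0 by rewrite gt_eqF.
rewrite ler_pdivrMr//.
have f0 : (0 : R) < (p.+1)`!%:R by rewrite ltr0n fact_gt0.
apply: le_trans (_ : (p.+1)`!%:R * t * (t^-1 ^+ p.+1 / (p.+1)`!%:R) <= _).
  rewrite le_eqVlt; apply/orP; left; apply/eqP.
  rewrite exprVn exprS; have fn0 : (p.+1)`!%:R != 0 :> R by rewrite gt_eqF.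
  field; by rewrite fn0 expf_neq0 ?tn0.
apply: ler_wpM2l; first by rewrite mulr_ge0// ltW.
by apply: le_trans H; rewrite lerDr.
Qed.

Lemma flat_derive p (t : R) :
  is_derive t (1 : R) (flat p) (flat p.+2 t - p%:R * flat p.+1 t).
Proof.
have [t0|t0|<-] := ltgtP 0 t.
- have H : is_derive t (1 : R) (fun t => t ^- p * expR (- t^-1))
      (flat p.+2 t - p%:R * flat p.+1 t).
    have tn0 : t != 0 by rewrite gt_eqF.
    have d1 : is_derive t (1 : R) (fun t : R => t^-1) (- t ^- 2).
      have := is_deriveV tn0 (is_derive_id t (1:R)).
      by rewrite /GRing.scale /= mulr1.
    have d2 : is_derive t (1 : R) (fun t : R => expR (- t^-1)) (t ^- 2 * expR (- t^-1)).
      have := is_derive1_comp (is_derive_expR _) (is_deriveN d1).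
      by rewrite opprK mulrC.
    have d3 : is_derive t (1 : R) (fun t : R => t ^- p) (- (p%:R * t ^- p.+1)).
      have := is_deriveX p d1.
      rewrite (_ : (fun t : R => t^-1) ^+ p = fun t => t ^- p); last first.
        by apply/funext => s; rewrite exprfctE exprVn.
      move=> H; apply: is_derive_eq.
      case: p H => [|p] H; first by rewrite !mul0r scale0r oppr0.
      rewrite /GRing.scale /= exprVn !exprS; field; by rewrite ?expf_neq0.
    refine (is_derive_eq (is_deriveM d3 d2) _).
    rewrite /flat t0 /GRing.scale /= !exprS; field; by rewrite ?expf_neq0.
  apply: near_eq_is_derive H; near=> s; rewrite /flat.
  have -> // : 0 < s by near: s; exact: lt_nbhsr.
- rewrite {2 3}/flat ltNge (ltW t0) /= mulr0 subr0.
  apply: near_eq_is_derive (is_derive_cst (0 : R) t (1 : R)); near=> s; rewrite /flat.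
  have -> // : 0 < s = false.
  by apply/negbTE; rewrite -leNgt ltW//; near: s; exact: lt_nbhsl.
- rewrite {2 3}/flat ltxx mulr0 subr0.
  have [c c0 B] := flat_bound p.+1.
  have C : (fun h : R => h^-1 *: (flat p (h *: (1 : R) + 0) - flat p 0)) @ 0^' --> (0 : R).
    apply/cvgr0Pnorm_le => e e0; near=> h.
    have hn0 : h != 0 by near: h; exact: nbhs_dnbhs_neq.
    rewrite addr0 {2}/flat ltxx subr0 /GRing.scale /= mulr1.
    (* The difference quotient at 0 is dominated by the next member of the family, which tends to
       0. *)
    have : `|h^-1 * flat p h| <= flat p.+1 h.
      rewrite /flat; case: ifP => [h0|]; last by rewrite mulr0 normr0.
      rewrite ger0_norm; last first.
        by rewrite !mulr_ge0 ?expR_ge0// invr_ge0 ?exprn_ge0 ?ltW.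
      by rewrite mulrA exprS invfM.
    move=> H; apply: le_trans H (le_trans (B _) _).
    rewrite mulrC -ler_pdivlMr//; near: h.
    by apply: dnbhs0_le; rewrite divr_gt0.
  by apply: DeriveDef; [apply/cvg_ex; exists 0 | apply/cvg_lim].
Unshelve. all: by end_near. Qed.

Lemma Ck_flat k p (U : set 'rV[R]_1) : open U ->
  Ck k U (fun x => flat p (x 0 0)).
Proof.
move=> oU; have D q (x : 'rV[R]_1) : differentiable (fun x : 'rV[R]_1 => flat q (x 0 0)) x.
  apply: (@differentiable_comp _ _ _ _ (fun x : 'rV[R]_1 => x 0 0) (flat q)).
    exact: differentiable_coord.
  by apply/derivable1_diffP; have [] := flat_derive q (x 0 0).
elim: k p => [|k IH] p; first by move=> x _; exact: differentiable_continuous.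
split=> [x _ //|i]; rewrite (ord1 i).
have := CkD oU (IH p.+2) (CkM oU (Ck_cst k U (- p%:R)) (IH p.+1)).
apply: Ck_eq => // x Ux; rewrite deriveE//.
have -> : 'd (fun x : 'rV[R]_1 => flat p (x 0 0)) x =
   'd (flat p) (x 0 0) \o 'd (fun x : 'rV[R]_1 => x 0 0) x :> (_ -> _).
  apply: (@diff_comp _ _ _ _ (fun x : 'rV[R]_1 => x 0 0) (flat p)).
    exact: differentiable_coord.
  by apply/derivable1_diffP; have [] := flat_derive p (x 0 0).
have @f : {linear 'rV[R]_1 -> R}.
  by exists (fun N : 'rV[R]_1 => N 0 0); do 2![eexists]; do ?[constructor];
     rewrite ?mxE// => ? *; rewrite ?mxE//; move=> ?; rewrite !mxE.
rewrite /= (@diff_lin _ _ _ f); last exact: coord_continuous.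
have [df Df] := flat_derive p (x 0 0).
by rewrite /f /= mxE eqxx -deriveE -?Df ?mulNr//; apply/derivable1_diffP.
Qed.

Lemma es_flat n (a : 'rV[R]_n) (g : 'rV[R]_n -> R) p : es a g -> es a (fun x => flat p (g x)).
Proof.
move=> eg; have := @es_comp R n 1 a (fun x => flat p (x 0 0)) (fun=> g).
move=> H; apply: es_near (H _ (fun=> eg)); first by near=> x; rewrite mxE.
by exists setT => [|k]; [split=> //; exact: openT | exact/Ck_flat/openT].
Unshelve. all: by end_near. Qed.

Lemma esV n (a : 'rV[R]_n) f : es a f -> f a != 0 -> es a (fun x => (f x)^-1).
Proof.
move=> ef f0.
have [||_ H] := @es_invmx R n 1 a (fun x => (f x)%:M).
- by move=> i j; apply: es_near ef; near=> x; rewrite !ord1 mxE eqxx mulr1n.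
- by rewrite unitmxE det_scalar expr1 unitfE.
apply: es_near (H 0 0); near=> x; rewrite invmx_scalar mxE eqxx mulr1n//.
Unshelve. all: by end_near. Qed.

Theorem euclidean_bump n (a : 'rV[R]_n) d : 0 < d ->
  exists chi : 'rV[R]_n -> R, [/\ forall x, es x chi,
    \forall x \near a, chi x = 1 & forall x, d <= `|x - a| -> chi x = 0].
Proof.
(* The scaling gives q >= 2 as soon as one coordinate of x - a reaches d in absolute value, while q
   < 1 near a. *)
move=> d0; pose q (x : 'rV[R]_n) := 2 / d ^+ 2 * \sum_i (x 0 i - a 0 i) ^+ 2.
have eq x : es x q.
  apply: esM; first exact: es_cst.
  apply: es_sum => i; have e1 : es x (fun x => x 0 i - a 0 i).
    by apply: esD; [exact: es_coord | exact: es_cst].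
  exact: esM.
have eB x c : es x (fun x => c - q x).
  apply: es_near (esD (es_cst x c) (esM (es_cst x (-1)) (eq x))).
  by near=> y; rewrite mulN1r.
(* The two terms vanish for q >= 2 and for q <= 1 respectively, so the denominator has no zero. *)
have pos x : 0 < flat 0 (2 - q x) + flat 0 (q x - 1).
  have [q2|q2] := ltP (q x) 2.
    by rewrite ltr_pwDl ?flat_ge0// /flat subr_gt0 q2 mulr_gt0 ?expR_gt0// expr0 invr1.
  rewrite ltr_wpDl ?flat_ge0// /flat subr_gt0 (lt_le_trans _ q2)//; last by rewrite ltr1n.
  by rewrite mulr_gt0 ?expR_gt0// expr0 invr1.
exists (fun x => flat 0 (2 - q x) / (flat 0 (2 - q x) + flat 0 (q x - 1))); split.
- move=> x; apply: esM; first exact: es_flat.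
  apply: esV; last by rewrite gt_eqF.
  apply: esD; first exact: es_flat.
  by apply: es_flat; apply: esD; [exact: eq | exact: es_cst].
- have q0 : q a = 0.
    by rewrite /q big1 ?mulr0// => i _; rewrite subrr expr0n.
  have /es_continuous/cvgrPdist_lt/(_ _ ltr01) := eq a.
  apply: filterS => x; rewrite q0 sub0r normrN => /ltr_normlW q1.
  have q2 : q x < 2 by apply: lt_trans q1 _; rewrite ltr1n.
  have -> : flat 0 (q x - 1) = 0 by rewrite /flat subr_gt0 ltNge ltW.
  by rewrite addr0 divff// gt_eqF// /flat subr_gt0 q2 mulr_gt0 ?expR_gt0// expr0 invr1.
- move=> x dx; have -> : flat 0 (2 - q x) = 0; last by rewrite mul0r.
  rewrite /flat subr_gt0 ltNge; suff -> : 2 <= q x by [].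
  rewrite /q mulrAC ler_pdivlMr ?exprn_gt0// ler_pM2l//.
  have xa0 : `|x - a| != 0 by rewrite gt_eqF// (lt_le_trans d0).
  have [[i j] E] := mx_norm_neq0 xa0.
  apply: le_trans (_ : `|x - a| ^+ 2 <= _); first by rewrite ler_pXn2r ?nnegrE ?(ltW d0).
  rewrite [`|x - a|]E /= (ord1 i) !mxE real_normK ?num_real//.
  by rewrite (bigD1 j)//= lerDl sumr_ge0// => k _; rewrite sqr_ge0.
Unshelve. all: by end_near. Qed.

End bump.

(** * Smooth spaces, tangent vectors and charts *)

HB.instance Definition _ (R : realType) (n : nat) :=
  hasSmoothGerms.Build R 'rV[R]_n (@euclidean_smooth_at R n).

(* The properties of the functional structure that hold on subspaces and orbit
   spaces of manifolds, whether or not these are manifolds themselves. *)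
Definition cinf_space {R : realType} (X : smoothSpaceType R) : Prop :=
  [/\ forall (x : X) f g, (\near x, f x = g x) -> smooth_at x f -> smooth_at x g,
      forall n (x : X) (F : 'rV[R]_n -> R) (u : 'I_n -> X -> R),
        (forall i, smooth_at x (u i)) -> euclidean_smooth_at (\row_i u i x) F ->
        smooth_at x (fun y => F (\row_i u i y)),
      forall (x : X) f, smooth_at x f -> {for x, continuous f}
    & forall (x : X) f, smooth_at x f -> \forall y \near x, smooth_at y f].

(** The pointwise form of [smooth_map]: chart maps and local inverses are total functions that are
    smooth only on an open set. *)
Definition smooth_map_at {R : realType} (X Y : smoothSpaceType R)
    (phi : X -> Y) (x : X) : Prop :=
  {for x, continuous phi} /\
  forall f : Y -> R, smooth_at (phi x) f -> smooth_at x (f \o phi).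

(** * Calculus with germs and derivations *)

Section cinf_spaces.
Context {R : realType}.
Implicit Types X Y Z : smoothSpaceType R.

Lemma cinf_rV n : cinf_space 'rV[R]_n.
Proof.
split.
- by move=> x f g; exact: es_near.
- by move=> m x F u eu eF; exact: es_comp.
- by move=> x f; exact: es_continuous.
- by move=> x f; exact: es_nearby.
Qed.

Section functions.
Variables (X : smoothSpaceType R) (hX : cinf_space X).
Implicit Types (x y : X) (f g : X -> R) (v w : tvec X).

Lemma sm_near x f g : (\near x, f x = g x) -> smooth_at x f -> smooth_at x g.
Proof. by have [H _ _ _] := hX; exact: H. Qed.

Lemma sm_comp n x (F : 'rV[R]_n -> R) (u : 'I_n -> X -> R) :
  (forall i, smooth_at x (u i)) -> euclidean_smooth_at (\row_i u i x) F ->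
  smooth_at x (fun y => F (\row_i u i y)).
Proof. by have [_ H _ _] := hX; exact: H. Qed.

Lemma sm_continuous x f : smooth_at x f -> {for x, continuous f}.
Proof. by have [_ _ H _] := hX; exact: H. Qed.

Lemma sm_nearby x f : smooth_at x f -> \forall y \near x, smooth_at y f.
Proof. by have [_ _ _ H] := hX; exact: H. Qed.

Lemma sm_cst x (c : R) : smooth_at x (fun=> c).
Proof.
by have := @sm_comp 0 x (fun=> c) (fun i _ => 0); apply; [case | exact: es_cst].
Qed.

Lemma sm_sum n x (u : 'I_n -> X -> R) : (forall i, smooth_at x (u i)) ->
  smooth_at x (fun y => \sum_i u i y).
Proof.
move=> su; have := @sm_comp n x (fun z => \sum_i z 0 i) u su.
move=> H; apply: sm_near (H _); last by apply: es_sum => i; exact: es_coord.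
by apply: nearW => y; apply: eq_bigr => i _; rewrite mxE.
Qed.

Lemma sm_prod n x (u : 'I_n -> X -> R) : (forall i, smooth_at x (u i)) ->
  smooth_at x (fun y => \prod_i u i y).
Proof.
move=> su; have := @sm_comp n x (fun z => \prod_i z 0 i) u su.
move=> H; apply: sm_near (H _); last by apply: es_prod => i; exact: es_coord.
by apply: nearW => y; apply: eq_bigr => i _; rewrite mxE.
Qed.

Lemma smD x f g : smooth_at x f -> smooth_at x g -> smooth_at x (fun y => f y + g y).
Proof.
move=> sf sg; have := @sm_sum 2 x (fun i => if i == 0 then f else g).
move=> H; apply: sm_near (H _); last by case => -[|[]].
by apply: nearW => y; rewrite big_ord_recl big_ord1.
Qed.

Lemma smM x f g : smooth_at x f -> smooth_at x g -> smooth_at x (fun y => f y * g y).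
Proof.
move=> sf sg; have := @sm_prod 2 x (fun i => if i == 0 then f else g).
move=> H; apply: sm_near (H _); last by case => -[|[]].
by apply: nearW => y; rewrite big_ord_recl big_ord1.
Qed.

Lemma smN x f : smooth_at x f -> smooth_at x (fun y => - f y).
Proof.
move=> sf; apply: sm_near (smM (sm_cst x (-1)) sf).
by apply: nearW => y; rewrite mulN1r.
Qed.

Lemma smB x f g : smooth_at x f -> smooth_at x g -> smooth_at x (fun y => f y - g y).
Proof. by move=> sf sg; apply: smD => //; exact: smN. Qed.

Lemma smZD x (c : R) f g : smooth_at x f -> smooth_at x g ->
  smooth_at x (fun y => c * f y + g y).
Proof. by move=> sf sg; apply: smD => //; apply: smM => //; exact: sm_cst. Qed.

Lemma sm_row_map n x (u : 'I_n -> X -> R) : (forall i, smooth_at x (u i)) ->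
  smooth_map_at (fun y => \row_i u i y : 'rV[R]_n) x.
Proof.
move=> su; split; last by move=> F sF; exact: sm_comp.
by apply: continuous_row => i; apply: sm_continuous.
Qed.

Lemma sm_invmx n x (A : X -> 'M[R]_n) : (forall i j, smooth_at x (fun y => A y i j)) ->
  A x \in unitmx -> (\forall y \near x, A y \in unitmx) /\
  forall i j, smooth_at x (fun y => invmx (A y) i j).
Proof.
move=> sA uA.
(* The entries are listed in one row, because composition is available for functions of a row. *)
have cm y : vec_mx (\row_i A y (enum_val (cast_ord (esym (mxvec_cast n n)) i)).1
  (enum_val (cast_ord (esym (mxvec_cast n n)) i)).2) = A y.
  apply/matrixP => i j; rewrite mxE mxE.
  by rewrite /mxvec_index cast_ordK enum_rankK.
set u := fun (i : 'I_(n * n)) y => A y (enum_val (cast_ord (esym (mxvec_cast n n)) i)).1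
  (enum_val (cast_ord (esym (mxvec_cast n n)) i)).2 in cm.
have su i : smooth_at x (u i) by exact: sA.
have [||nu eI] := @es_invmx R (n * n) n (\row_i u i x) (fun z => vec_mx z).
- move=> i j; rewrite (_ : (fun z : 'rV[R]_(n * n) => vec_mx z i j) = fun z => z 0 (mxvec_index i j)).
    exact: es_coord.
  by apply/funext => z; rewrite mxE.
- by rewrite cm.
have [cu _] := sm_row_map su; split.
  have H0 : \forall y \near x, vec_mx (\row_i u i y) \in unitmx := cu _ nu.
  by apply: filterS H0 => y; rewrite cm.
move=> i j; apply: sm_near (sm_comp su (eI i j)).
by apply: nearW => y; rewrite cm.
Qed.

(** Locality without bump functions: h = g - f vanishes near x, so the indicator b of h <> 0 is
    smooth at x as a function that is locally 0. From h = b h and b x = h x = 0 the Leibniz rule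
    gives v h = 0. *)
Lemma tan_near x f g v : tangent x v -> (\near x, f x = g x) -> v f = v g.
Proof.
move=> [lv mv zv] fg.
have [sf|nf] := pselect (smooth_at x f); last first.
  rewrite !zv// => sg; apply: nf; apply: sm_near sg.
  by apply: filterS fg => y.
have sg := sm_near fg sf.
pose h y := -1 * f y + g y.
have hx : h x = 0 by rewrite /h (nbhs_singleton fg) mulN1r addrC subrr.
have sh : smooth_at x h by exact: smZD.
pose b y : R := (h y != 0)%:R.
have sb : smooth_at x b.
  apply: sm_near (sm_cst x 0); apply: filterS fg => y E.
  by rewrite /b /h E mulN1r addrC subrr eqxx.
have : v h = 0.
  have E : h = fun y => b y * h y.
    by apply/funext => y; rewrite /b; case: eqP => [->|_]; rewrite ?mulr0 ?mul1r.
  by rewrite {1}E mv// hx /b hx eqxx mulr0 mul0r addr0.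
by rewrite /h lv// mulN1r => /eqP; rewrite addrC subr_eq0 => /eqP.
Qed.

Lemma tan_lin x v (c : R) f g : tangent x v -> smooth_at x f -> smooth_at x g ->
  v (fun y => c * f y + g y) = c * v f + v g.
Proof. by move=> [lv _ _]; exact: lv. Qed.

Lemma tanM x v f g : tangent x v -> smooth_at x f -> smooth_at x g ->
  v (fun y => f y * g y) = v f * g x + f x * v g.
Proof. by move=> [_ mv _]; exact: mv. Qed.

Lemma tan_cst x v (c : R) : tangent x v -> v (fun=> c) = 0.
Proof.
move=> tv; have s1 := sm_cst x 1.
have v1 : v (fun=> 1) = 0.
  have := tanM tv s1 s1; rewrite !mulr1 mul1r => E.
  by apply: (addrI (v (fun=> 1))); rewrite addr0 -E.
have := tan_lin (c - 1) tv s1 s1; rewrite v1 mulr0 addr0 => <-.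
by congr (v _); apply/funext => y; rewrite mulr1 subrK.
Qed.

Lemma tanD x v f g : tangent x v -> smooth_at x f -> smooth_at x g ->
  v (fun y => f y + g y) = v f + v g.
Proof.
move=> tv sf sg; rewrite -[v f]mul1r -(tan_lin 1 tv sf sg).
by congr (v _); apply/funext => y; rewrite mul1r.
Qed.

Lemma tanZ x v (c : R) f : tangent x v -> smooth_at x f ->
  v (fun y => c * f y) = c * v f.
Proof.
move=> tv sf; have := tan_lin c tv sf (sm_cst x 0); rewrite (tan_cst 0 tv) addr0 => <-.
by congr (v _); apply/funext => y; rewrite addr0.
Qed.

Lemma tanN x v f : tangent x v -> smooth_at x f -> v (fun y => - f y) = - v f.
Proof.
move=> tv sf; rewrite -mulN1r -(tanZ _ tv sf).
by congr (v _); apply/funext => y; rewrite mulN1r.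
Qed.

Lemma tan_sum n x v (u : 'I_n -> X -> R) : tangent x v ->
  (forall i, smooth_at x (u i)) -> v (fun y => \sum_i u i y) = \sum_i v (u i).
Proof.
move=> tv; elim: n u => [|n IH] u su.
  rewrite big_ord0 -[RHS](tan_cst 0 tv); congr (v _).
  by apply/funext => y; rewrite big_ord0.
rewrite big_ord_recl -IH// -(tanD (x := x))//; last exact: sm_sum.
by congr (v _); apply/funext => y; rewrite big_ord_recl.
Qed.

(** Hadamard's lemma writes F as a constant plus products with a factor vanishing at the point; in
    each product the Leibniz rule keeps only the value of the other factor there, which is a partial
    of F. *)
Lemma tan_chain n x v (F : 'rV[R]_n -> R) (u : 'I_n -> X -> R) : tangent x v ->
  (forall i, smooth_at x (u i)) -> euclidean_smooth_at (\row_i u i x) F ->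
  v (fun y => F (\row_i u i y)) =
    \sum_i 'D_(delta_mx 0 i) F (\row_i u i x) * v (u i).
Proof.
move=> tv su eF; have [g [eg ga gE]] := hadamard eF.
have [cu _] := sm_row_map su.
pose a := \row_i u i x.
have H : \near x, F (\row_i u i x) =
    F a + \sum_i (u i x - a 0 i) * g i (\row_i u i x).
  have H0 : \forall y \near x, F (\row_i u i y) = F a +
    \sum_i ((\row_i u i y) 0 i - a 0 i) * g i (\row_i u i y) := cu _ gE.
  apply: filterS H0 => y ->.
  by congr (_ + _); apply: eq_bigr => i _; rewrite !mxE.
have sd i : smooth_at x (fun y => u i y - a 0 i) by apply: smB => //; exact: sm_cst.
have sg i : smooth_at x (fun y => g i (\row_i u i y)) by exact: sm_comp.
rewrite (tan_near tv H) (tanD tv); [|exact: sm_cst|by apply: sm_sum => i; exact: smM].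
rewrite (tan_cst _ tv) add0r (tan_sum tv); last by move=> i; exact: smM.
apply: eq_bigr => i _; rewrite (tanM tv)// ga mxE subrr mul0r addr0 mulrC.
by rewrite (tanD tv)//; [rewrite (tan_cst _ tv) addr0 | exact: sm_cst].
Qed.

Lemma tangent0 x : tangent x (0 : tvec X).
Proof.
by split=> [c f g _ _|f g _ _|f _]; rewrite /= ?fctE ?mulr0 ?mul0r ?addr0.
Qed.

Lemma tangent_lin x (c : R) v w : tangent x v -> tangent x w -> tangent x (c *: v + w).
Proof.
move=> [lv mv zv] [lw mw zw]; split=> [k f g sf sg|f g sf sg|f nf].
- by rewrite !fctE lv// lw// /GRing.scale /=; ring.
- by rewrite !fctE mv// mw// /GRing.scale /=; ring.
- by rewrite !fctE zv// zw// scaler0 addr0.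
Qed.

Lemma tangentD x v w : tangent x v -> tangent x w -> tangent x (v + w).
Proof. by move=> tv tw; rewrite -[v]scale1r; exact: tangent_lin. Qed.

Lemma tangentZ x (c : R) v : tangent x v -> tangent x (c *: v).
Proof. by move=> tv; rewrite -[c *: v]addr0; apply: tangent_lin => //; exact: tangent0. Qed.

Lemma tangentB x v w : tangent x v -> tangent x w -> tangent x (v - w).
Proof. by move=> tv tw; rewrite -scaleN1r addrC; exact: tangent_lin. Qed.

Lemma tangent_sum x n (c : 'I_n -> R) (e : 'I_n -> tvec X) :
  (forall i, tangent x (e i)) -> tangent x (\sum_i c i *: e i).
Proof.
move=> te; elim/big_ind : _ => [|? ?|i _]; [exact: tangent0 | exact: tangentD | exact: tangentZ].
Qed.

Lemma differentialE x f v : tangent x v -> differential f x v = v f.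
Proof. by move=> tv; rewrite /differential /extend0 patchT// inE. Qed.

Lemma cotangent_differential x f : cotangent x (differential f x).
Proof.
split=> [c v w tv tw|v ntv]; last by rewrite /differential /extend0 patchC// inE.
by rewrite !differentialE//; exact: tangent_lin.
Qed.

End functions.

Lemma smooth_map_at_comp X Y Z (phi : X -> Y) (psi : Y -> Z) x :
  smooth_map_at phi x -> smooth_map_at psi (phi x) -> smooth_map_at (psi \o phi) x.
Proof.
move=> [c1 s1] [c2 s2]; split; first exact: continuous_comp.
by move=> f sf; exact: (s1 _ (s2 _ sf)).
Qed.

Lemma smooth_map_at_near X Y (phi psi : X -> Y) x : cinf_space X ->
  (\near x, phi x = psi x) -> smooth_map_at phi x -> smooth_map_at psi x.
Proof.
move=> hX E [c s]; split; first exact: near_eq_continuous c.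
move=> f; rewrite -(nbhs_singleton E) => /s; apply: sm_near => //.
by apply: filterS E => y /= ->.
Qed.

Lemma tmapE X Y (phi : X -> Y) x v f : smooth_at (phi x) f ->
  tmap phi x v f = v (f \o phi).
Proof. by move=> sf; rewrite /tmap /extend0 patchT// inE. Qed.

Lemma tmap_out X Y (phi : X -> Y) x v f : ~ smooth_at (phi x) f -> tmap phi x v f = 0.
Proof. by move=> sf; rewrite /tmap /extend0 patchC// inE. Qed.

Lemma tangent_tmap X Y (phi : X -> Y) x v : cinf_space Y -> smooth_map_at phi x ->
  tangent x v -> tangent (phi x) (tmap phi x v).
Proof.
move=> hY [c s] [lv mv zv]; split=> [k f g sf sg|f g sf sg|f nf]; last exact: tmap_out.
- by rewrite !tmapE ?lv//; [exact: s | exact: s | exact: smZD].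
- by rewrite !tmapE ?mv//; [exact: s | exact: s | exact: smM].
Qed.

Lemma tmap_lin X Y (phi : X -> Y) x (c : R) v w :
  tmap phi x (c *: v + w) = c *: tmap phi x v + tmap phi x w.
Proof.
apply/funext => f; rewrite !fctE.
have [sf|nf] := pselect (smooth_at (phi x) f); first by rewrite !tmapE// !fctE.
by rewrite !tmap_out// scaler0 addr0.
Qed.

Lemma tmap0 X Y (phi : X -> Y) x : tmap phi x 0 = 0.
Proof.
by have := tmap_lin phi x (-1) 0 0; rewrite !scaleN1r oppr0 addr0 addNr.
Qed.

Lemma tmapD X Y (phi : X -> Y) x v w : tmap phi x (v + w) = tmap phi x v + tmap phi x w.
Proof. by rewrite -{1}[v]scale1r tmap_lin scale1r. Qed.

Lemma tmapZ X Y (phi : X -> Y) x (c : R) v : tmap phi x (c *: v) = c *: tmap phi x v.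
Proof. by rewrite -[c *: v]addr0 tmap_lin tmap0 addr0. Qed.

Lemma tmap_sum X Y (phi : X -> Y) x n (c : 'I_n -> R) (e : 'I_n -> tvec X) :
  tmap phi x (\sum_i c i *: e i) = \sum_i c i *: tmap phi x (e i).
Proof.
elim/big_rec2 : _ => [|i u v _ <-]; first exact: tmap0.
by rewrite tmapD tmapZ.
Qed.

Lemma tmap_comp X Y Z (phi : X -> Y) (psi : Y -> Z) x v : smooth_map_at psi (phi x) ->
  tmap (psi \o phi) x v = tmap psi (phi x) (tmap phi x v).
Proof.
move=> [_ s]; apply/funext => f.
have [sf|nf] := pselect (smooth_at (psi (phi x)) f); last by rewrite !tmap_out.
by rewrite !tmapE//; exact: s.
Qed.

Lemma tmap_near X Y (phi psi : X -> Y) x v : cinf_space X -> tangent x v ->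
  (\near x, phi x = psi x) -> tmap phi x v = tmap psi x v.
Proof.
move=> hX tv E; apply/funext => f.
have [sf|nf] := pselect (smooth_at (phi x) f).
  rewrite !tmapE -?(nbhs_singleton E)//; apply: (tan_near hX tv).
  by apply: filterS E => y /= ->.
by rewrite !tmap_out -?(nbhs_singleton E).
Qed.

Lemma tmap_id X x (v : tvec X) : tangent x v -> tmap id x v = v.
Proof.
move=> [_ _ zv]; apply/funext => f.
by have [sf|nf] := pselect (smooth_at x f); [rewrite tmapE | rewrite tmap_out// zv].
Qed.

Lemma cotmapE X Y (phi : X -> Y) x (a : covec Y) v : tangent x v ->
  cotmap phi x a v = a (tmap phi x v).
Proof. by move=> tv; rewrite /cotmap /extend0 patchT// inE. Qed.

Lemma cotangent_cotmap X Y (phi : X -> Y) x a : cinf_space X -> cinf_space Y ->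
  smooth_map_at phi x -> cotangent (phi x) a -> cotangent x (cotmap phi x a).
Proof.
move=> hX hY sp [la za]; split=> [c v w tv tw|v nv]; last first.
  by rewrite /cotmap /extend0 patchC// inE.
rewrite !cotmapE//; last exact: tangent_lin.
by rewrite tmap_lin la//; exact: tangent_tmap.
Qed.

End cinf_spaces.

(** * Tangent vectors and the inverse function theorem in charts *)

Section charts.
Context {R : realType}.
Implicit Types X Y Z : smoothSpaceType R.

Lemma rV_smooth_map n X (phi : X -> 'rV[R]_n) x : cinf_space X ->
  (smooth_map_at phi x <-> forall i, smooth_at x (fun y => phi y 0 i)).
Proof.
move=> hX; split=> [[_ s] i|su]; first by have := s _ (es_coord (phi x) i).
have := sm_row_map hX su; apply: smooth_map_at_near => //.
by apply: nearW => y; apply/rowP => i; rewrite mxE.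
Qed.

Lemma derive_tangent n (a : 'rV[R]_n) (c : 'rV[R]_n) :
  tangent a (extend0 (euclidean_smooth_at a) (fun f => \sum_i c 0 i * 'D_(delta_mx 0 i) f a)).
Proof.
have E f : euclidean_smooth_at a f -> extend0 (euclidean_smooth_at a)
   (fun f => \sum_i c 0 i * 'D_(delta_mx 0 i) f a) f = 'd f a c.
  move=> sf; rewrite /extend0 patchT ?inE// diff_partial//; exact: es_diff.
have hX := @cinf_rV R n.
split=> [k f g sf sg|f g sf sg|f nf]; last by rewrite /extend0 patchC// inE.
- have df := es_diff sf; have dg := es_diff sg.
  rewrite !E//; last exact: (smZD hX).
  rewrite (_ : (fun y => k * f y + g y) = (k *: f) + g)//.
  rewrite diffD//; last exact: differentiableZ.
  by rewrite /= diffZ.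
- have df := es_diff sf; have dg := es_diff sg.
  rewrite !E//; last exact: (smM hX).
  have -> : 'd (fun y => f y * g y) a c = f a *: 'd g a c + g a *: 'd f a c.
    exact: (congr1 (fun h : 'rV[R]_n -> R => h c) (diffM df dg)).
  by rewrite addrC [_ *: 'd f a c]mulrC.
Qed.

Definition partial_vec n (a c : 'rV[R]_n) : tvec 'rV[R]_n :=
  extend0 (euclidean_smooth_at a) (fun f => \sum_i c 0 i * 'D_(delta_mx 0 i) f a).

Lemma partial_vecE n (a c : 'rV[R]_n) f : euclidean_smooth_at a f ->
  partial_vec a c f = \sum_i c 0 i * 'D_(delta_mx 0 i) f a.
Proof. by move=> sf; rewrite /partial_vec /extend0 patchT// inE. Qed.

Lemma partial_coord n (a : 'rV[R]_n) i j :
  'D_(delta_mx 0 i) (fun x : 'rV[R]_n => x 0 j) a = (i == j)%:R.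
Proof.
rewrite deriveE; last exact: differentiable_coord.
have @f : {linear 'rV[R]_n -> R}.
  by exists (fun N : 'rV[R]_n => N 0 j); do 2![eexists]; do ?[constructor];
     rewrite ?mxE// => ? *; rewrite ?mxE//; move=> ?; rewrite !mxE.
rewrite (@diff_lin _ _ _ f); last exact: coord_continuous.
by rewrite /f /= mxE eqxx eq_sym.
Qed.

Lemma partial_vec_coord n (a c : 'rV[R]_n) j : partial_vec a c (fun x => x 0 j) = c 0 j.
Proof.
rewrite partial_vecE; last exact: es_coord.
rewrite (bigD1 j)//= partial_coord eqxx mulr1 big1 ?addr0// => i ij.
by rewrite partial_coord (negPf ij) mulr0.
Qed.

Lemma smooth_map_at_id X (x : X) : smooth_map_at id x.
Proof. by split=> //; exact: cvg_id. Qed.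

Lemma is_chartP X n (U : set X) (V : set 'rV[R]_n) phi psi : cinf_space X ->
  open U -> open V ->
  (forall x, U x -> [/\ V (phi x), psi (phi x) = x & smooth_map_at phi x]) ->
  (forall a, V a -> [/\ U (psi a), phi (psi a) = a & smooth_map_at psi a]) ->
  is_chart U V phi psi.
Proof.
move=> hX oU oV hphi hpsi; split=> //.
- by move=> x /hphi[].
- by move=> a /hpsi[].
- by split=> [x /hphi[_ _ []]|a /hpsi[_ _ []]].
move=> x Ux f; have [Vx px sx] := hphi x Ux; have [_ _ [_ sa]] := hpsi _ Vx; split.
  by move=> sf; apply: sa; rewrite px.
move=> ef; have [_ /(_ _ ef)] := sx; apply: sm_near => //.
apply: filterS (open_nbhs_nbhs (conj oU Ux)) => y Uy /=.
by have [_ -> _] := hphi y Uy.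
Qed.

Section one_chart.
Variables (X : smoothSpaceType R) (n : nat) (U : set X) (V : set 'rV[R]_n).
Variables (phi : X -> 'rV[R]_n) (psi : 'rV[R]_n -> X).
Hypothesis ch : is_chart U V phi psi.

Lemma chart_open : open U /\ open V. Proof. by case: ch. Qed.
Lemma chartV x : U x -> V (phi x). Proof. by case: ch => _ h _ _ _ /h[]. Qed.
Lemma chartK x : U x -> psi (phi x) = x. Proof. by case: ch => _ h _ _ _ /h[]. Qed.
Lemma chartU a : V a -> U (psi a). Proof. by case: ch => _ _ h _ _ /h[]. Qed.
Lemma chartVK a : V a -> phi (psi a) = a. Proof. by case: ch => _ _ h _ _ /h[]. Qed.
Lemma chart_sm x f : U x -> smooth_at x f <-> euclidean_smooth_at (phi x) (f \o psi).
Proof. by case: ch => _ _ _ _ h Ux; exact: h. Qed.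

Lemma chart_nearU x : U x -> \forall y \near x, U y.
Proof. by move=> Ux; apply: open_nbhs_nbhs; split=> //; case: chart_open. Qed.

Lemma chart_nearV a : V a -> \forall b \near a, V b.
Proof. by move=> Va; apply: open_nbhs_nbhs; split=> //; case: chart_open. Qed.

Lemma chart_psi a : V a -> smooth_map_at psi a.
Proof.
move=> Va; split; first by case: ch => _ _ _ [_ h] _; exact: h.
by move=> f; rewrite chart_sm; [rewrite chartVK | exact: chartU].
Qed.

Lemma chart_phi x : U x -> smooth_map_at phi x.
Proof.
move=> Ux; split; first by case: ch => _ _ _ [h _] _; exact: h.
move=> f sf; rewrite chart_sm//; apply: es_near sf.
by apply: filterS (chart_nearV (chartV Ux)) => a Va /=; rewrite chartVK.
Qed.

Lemma chart_coord x i : U x -> smooth_at x (fun y => phi y 0 i).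
Proof. by move=> /chart_phi[_ s]; exact: (s _ (es_coord (phi x) i)). Qed.

Lemma chart_sub U' : open U' -> U' `<=` U ->
  is_chart U' (V `&` psi @^-1` U') phi psi.
Proof.
move=> oU' sU; have [oU oV] := chart_open; split.
- split=> //; rewrite openE => a [Va Ua].
  have [c _] := chart_psi Va; apply: filterI; first exact: chart_nearV.
  by apply: c; exact: open_nbhs_nbhs.
- move=> x U'x; have Ux := sU _ U'x.
  by split; [split; [exact: chartV | rewrite /= chartK] | exact: chartK].
- by move=> a [Va Ua]; split=> //; exact: chartVK.
- by split=> [x /sU /chart_phi[]|a [/chart_psi[]]].
- by move=> x /sU Ux f; exact: chart_sm.
Qed.

(** Stated for all small r, so that positivity of r and other smallness conditions are added by
    intersecting filters. *)
Lemma chart_ball x W : U x -> nbhs x W -> \forall r \near (0 : R)^'+,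
  is_chart (U `&` phi @^-1` ball (phi x) r) (ball (phi x) r) phi psi /\
  U `&` phi @^-1` ball (phi x) r `<=` W.
Proof.
move=> Ux nW; have Vx := chartV Ux.
have nV : nbhs (phi x) (V `&` psi @^-1` W).
  apply: filterI; first exact: chart_nearV.
  by have [c _] := chart_psi Vx; apply: c; rewrite chartK.
have /nbhs_ballP[e /= e0 He] := nV.
near=> r; have re : ball (phi x) r `<=` ball (phi x) e.
  by apply: le_ball; near: r; exact: nbhs_right_le.
have bV a : ball (phi x) r a -> V a by move=> /re/He[].
set U' := U `&` _.
have oU' : open U'.
  rewrite openE => y [Uy by_]; have [c _] := chart_phi Uy.
  apply: filterI; first exact: chart_nearU.
  by apply: c; apply: open_nbhs_nbhs; split=> //; exact: ball_open.
split; last first.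
  by move=> y [Uy] /re/He[_] /=; rewrite chartK.
have := chart_sub oU' (fun y => @proj1 _ _).
suff -> : V `&` psi @^-1` U' = ball (phi x) r by [].
apply/seteqP; split=> a; first by move=> [Va [_ /=]]; rewrite chartVK.
by move=> ba; have Va := bV a ba; split=> //; split; [exact: chartU | rewrite /= chartVK].
Unshelve. all: by end_near. Qed.

Hypothesis hX : cinf_space X.

Lemma chart_deriv x v f : U x -> tangent x v -> smooth_at x f ->
  v f = \sum_i v (fun y => phi y 0 i) * 'D_(delta_mx 0 i) (f \o psi) (phi x).
Proof.
move=> Ux tv sf.
have rE y : \row_i phi y 0 i = phi y by apply/rowP => i; rewrite mxE.
have ef : euclidean_smooth_at (\row_i phi x 0 i) (f \o psi) by rewrite rE -chart_sm.
have := tan_chain hX tv (fun i => chart_coord i Ux) ef.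
rewrite rE => E; rewrite -[LHS](_ : v (fun y => (f \o psi) (\row_i phi y 0 i)) = _).
  by rewrite E; apply: eq_bigr => i _; rewrite mulrC.
apply: (tan_near hX tv); apply: filterS (chart_nearU Ux) => y Uy.
by rewrite rE /= chartK.
Qed.

Lemma chart_tan_inj x v w : U x -> tangent x v -> tangent x w ->
  (forall i, v (fun y => phi y 0 i) = w (fun y => phi y 0 i)) -> v = w.
Proof.
move=> Ux tv tw E; apply/funext => f.
have [sf|nf] := pselect (smooth_at x f).
  by rewrite !(chart_deriv Ux)//; apply: eq_bigr => i _; rewrite E.
by case: tv tw => _ _ zv [_ _ zw]; rewrite zv ?zw.
Qed.

Definition chart_vec (x : X) (c : 'rV[R]_n) : tvec X := tmap psi (phi x) (partial_vec (phi x) c).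

Lemma chart_vec_tangent x c : U x -> tangent x (chart_vec x c).
Proof.
move=> Ux; rewrite -{1}(chartK Ux); apply: tangent_tmap => //.
  by apply: chart_psi; exact: chartV.
exact: derive_tangent.
Qed.

Lemma chart_vecE x c f : U x -> smooth_at x f ->
  chart_vec x c f = \sum_i c 0 i * 'D_(delta_mx 0 i) (f \o psi) (phi x).
Proof.
move=> Ux sf; rewrite /chart_vec tmapE ?chartK// partial_vecE//.
by rewrite -chart_sm.
Qed.

Lemma chart_vec_coord x c i : U x -> chart_vec x c (fun y => phi y 0 i) = c 0 i.
Proof.
move=> Ux; rewrite /chart_vec tmapE ?chartK//; last exact: chart_coord.
rewrite -[RHS](partial_vec_coord (phi x)).
apply: (tan_near (@cinf_rV R n) (derive_tangent (phi x) c)).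
by apply: filterS (chart_nearV (chartV Ux)) => a Va /=; rewrite chartVK.
Qed.

Lemma chart_vec_id x v : U x -> tangent x v -> chart_vec x (\row_i v (fun y => phi y 0 i)) = v.
Proof.
move=> Ux tv; apply: (chart_tan_inj Ux) => //; first exact: chart_vec_tangent.
by move=> i; rewrite chart_vec_coord// mxE.
Qed.

Lemma chart_covec x a v : U x -> cotangent x a -> tangent x v ->
  a v = \sum_i v (fun y => phi y 0 i) * a (chart_vec x (delta_mx 0 i)).
Proof.
move=> Ux [la _] tv.
have aS m (c : 'I_m -> R) e : (forall i, tangent x (e i)) ->
    a (\sum_i c i *: e i) = \sum_i c i * a (e i).
  move=> te; elim: m c e te => [|m IH] c e te.
    rewrite !big_ord0; have := la (-1) 0 0 (tangent0 x) (tangent0 x).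
    by rewrite scaler0 addr0 mulN1r addNr.
  by rewrite !big_ord_recl la// ?IH//; exact: tangent_sum.
rewrite -(aS _ (fun i => v (fun y => phi y 0 i))); last first.
  by move=> i; exact: chart_vec_tangent.
congr (a _); apply: (chart_tan_inj Ux) => //.
  by apply: tangent_sum => i; exact: chart_vec_tangent.
move=> i; rewrite fct_sumE (bigD1 i)//= big1 => [|j ji].
  by rewrite fctE chart_vec_coord// mxE !eqxx addr0 /GRing.scale /= mulr1.
by rewrite fctE chart_vec_coord// mxE eqxx eq_sym (negPf ji) /GRing.scale /= mulr0.
Qed.

Lemma chart_covec_eq x a b : U x -> cotangent x a -> cotangent x b ->
  (forall i, a (chart_vec x (delta_mx 0 i)) = b (chart_vec x (delta_mx 0 i))) -> a = b.
Proof.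
move=> Ux ca cb E; apply/funext => v.
have [tv|ntv] := pselect (tangent x v).
  by rewrite !(chart_covec Ux)//; apply: eq_bigr => i _; rewrite E.
by case: ca cb => _ za [_ zb]; rewrite za ?zb.
Qed.

End one_chart.

Lemma manifold_cinf X : is_manifold X -> cinf_space X.
Proof.
move=> [_ _ ch]; split.
- move=> x f g fg; have [n [U [V [phi [psi [c Ux]]]]]] := ch x.
  rewrite !(chart_sm c)//; apply: es_near.
  have [cp _] := chart_psi c (chartV c Ux).
  have nP : nbhs (psi (phi x)) [set y | f y = g y] by rewrite (chartK c Ux).
  exact: (cp _ nP).
- move=> m x F u su eF; have [n [U [V [phi [psi [c Ux]]]]]] := ch x.
  rewrite (chart_sm c)//.
  have := @es_comp R n m (phi x) F (fun i => u i \o psi).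
  apply; first by under eq_mx do rewrite /= (chartK c Ux).
  by move=> j; rewrite -(chart_sm c).
- move=> x f; have [n [U [V [phi [psi [c Ux]]]]]] := ch x.
  move/(chart_sm c _ Ux)/es_continuous => cf.
  have [cp _] := chart_phi c Ux.
  apply: (@near_eq_continuous _ _ ((f \o psi) \o phi)); last exact: continuous_comp.
  by apply: filterS (chart_nearU c Ux) => y Uy /=; rewrite (chartK c).
- move=> x f; have [n [U [V [phi [psi [c Ux]]]]]] := ch x.
  move/(chart_sm c _ Ux)/es_nearby => nf.
  have [cp _] := chart_phi c Ux.
  have H : \forall y \near x, euclidean_smooth_at (phi y) (f \o psi) := cp _ nf.
  by apply: filterS2 H (chart_nearU c Ux) => y ey Uy; rewrite (chart_sm c).
Qed.

Lemma chart_comp X n (U : set X) (V : set 'rV[R]_n) phi psi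
    (U1 : set 'rV[R]_n) V1 (g h : 'rV[R]_n -> 'rV[R]_n) : cinf_space X ->
  is_chart U V phi psi -> is_chart (U1 : set ('rV[R]_n : smoothSpaceType R)) V1 g h ->
  U1 `<=` V -> is_chart (U `&` phi @^-1` U1) V1 (g \o phi) (psi \o h).
Proof.
move=> hX c c1 sV; have [oU oV] := chart_open c; have [oU1 oV1] := chart_open c1.
apply: is_chartP => //.
- rewrite openE => x [Ux U1x]; apply: filterI; first exact: (chart_nearU c Ux).
  by have [cp _] := chart_phi c Ux; apply: cp; exact: open_nbhs_nbhs.
- move=> x [Ux U1x]; split; first exact: (chartV c1).
    by rewrite /= (chartK c1)// (chartK c).
  by apply: smooth_map_at_comp; [exact: (chart_phi c Ux) | exact: (chart_phi c1 U1x)].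
- move=> a Va; have U1a := chartU c1 Va; split.
  + by split; [exact/(chartU c)/sV | rewrite /= (chartVK c)//; exact: sV].
  + by rewrite /= (chartVK c) ?(chartVK c1)//; exact: sV.
  + by apply: smooth_map_at_comp; [exact: (chart_psi c1 Va) | apply: (chart_psi c _); exact: sV].
Qed.

(** The condition on tangent vectors is the invertibility of the Jacobian of f in the given chart:
    functions whose differentials separate the tangent vectors at x are coordinates near x. *)
Theorem inverse_function_chart X n (U : set X) (V : set 'rV[R]_n) phi psi
    (f : 'I_n -> X -> R) x W : cinf_space X -> is_chart U V phi psi -> U x -> nbhs x W ->
  (forall i, smooth_at x (f i)) ->
  (forall v, tangent x v -> (forall i, v (f i) = 0) -> v = 0) ->
  exists U' V' psi', [/\ is_chart U' V' (fun y => \row_i f i y) psi', U' x & U' `<=` W].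
Proof.
move=> hX c Ux nW sf inj; have Vx := chartV c Ux.
pose g i := f i \o psi.
have eg i : euclidean_smooth_at (phi x) (g i) by rewrite -(chart_sm c).
have uJ : \matrix_(i, j) 'D_(delta_mx 0 i) (g j) (phi x) \in unitmx.
  rewrite -row_free_unit; apply: inj_row_free => r rJ.
  have tv := chart_vec_tangent c hX r Ux.
  have : chart_vec phi psi x r = 0.
    apply: inj => // i; rewrite (chart_vecE c)//.
    by move/rowP/(_ i): rJ; rewrite !mxE => E; rewrite -[RHS]E; apply: eq_bigr => j _; rewrite !mxE.
  move=> v0; apply/rowP => i; rewrite -(chart_vec_coord c r i Ux) v0 mxE.
  by [].
have nW' : nbhs (phi x) (V `&` psi @^-1` W).
  apply: filterI; first exact: (chart_nearV c Vx).
  by have [cp _] := chart_psi c Vx; apply: cp; rewrite (chartK c).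
have [U1 [V1 [h [[[oU1 U1x] oV1] sW hU hV eh]]]] := euclidean_inverse_function nW' eg uJ.
have hr := @cinf_rV R n.
have c1 : is_chart (U1 : set ('rV[R]_n : smoothSpaceType R)) V1 (fun a => \row_i g i a) h.
  apply: is_chartP => //.
    by move=> a /hU[? ? ?]; split=> //; apply: sm_row_map.
  by move=> a /[dup] /hV[? ?] /eh ?; split=> //; apply/rV_smooth_map.
exists (U `&` phi @^-1` U1), V1, (psi \o h); split.
- have c2 := chart_comp hX c c1 (fun a U1a => (sW a U1a).1).
  have [[oU' _] hU' hV' [cU cV] hs] := c2.
  apply: is_chartP => //.
    move=> y [Uy U1y]; have E : (fun y => \row_i f i y) y = ((fun a => \row_i g i a) \o phi) y.
      by apply/rowP => i; rewrite !mxE /g /= (chartK c).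
    split; [by rewrite E; exact: (chartV c2) | by rewrite E; exact: (chartK c2) |].
    apply: smooth_map_at_near hX _ (chart_phi c2 (conj Uy U1y)).
    apply: filterS (chart_nearU c Uy) => z Uz.
    by apply/rowP => i; rewrite !mxE /g /= (chartK c).
  move=> a V1a; have U'a := chartU c2 V1a; split=> //; last exact: (chart_psi c2).
  rewrite -[RHS](chartVK c2 V1a); apply/rowP => i; rewrite !mxE /g /= (chartK c) //.
  by case: U'a.
- by [].
- by move=> y [Uy] /sW[_] /=; rewrite (chartK c).
Qed.

(** The same theorem read from the side of a parametrization: the coordinates of F form a chart of
    R^n near a, and its inverse after phi is the coordinate map inverting F. *)
Theorem inverse_function_param X n (U : set X) (V : set 'rV[R]_n) phi psi
    (F : 'rV[R]_n -> X) a W : cinf_space X -> is_chart U V phi psi -> U (F a) -> nbhs a W ->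
  (\forall b \near a, smooth_map_at F b) ->
  (forall c, tmap F a (partial_vec a c) = 0 -> c = 0) ->
  exists U' V' G, [/\ is_chart U' V' G F, V' a & V' `<=` W].
Proof.
move=> hX c UFa nW sF inj.
have hr := @cinf_rV R n.
have sFa := nbhs_singleton sF.
have idc : is_chart (setT : set ('rV[R]_n : smoothSpaceType R)) setT id id.
  by apply: is_chartP => //; try exact: openT; move=> b _; split=> //; exact: smooth_map_at_id.
pose f i b := phi (F b) 0 i.
have fE b : \row_i f i b = phi (F b) by apply/rowP => i; rewrite mxE.
have nW' : \forall b \near a, [/\ W b, smooth_map_at F b & U (F b)].
  have H : \forall b \near a, U (F b) := sFa.1 _ (chart_nearU c UFa).
  by near=> b; split; near: b.
have [||U1 [V1 [h [c1 U1a sW]]]] := inverse_function_chart hr idc (I : setT a) nW' (f := f).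
- by move=> i; exact: (sFa.2 _ (chart_coord c i UFa)).
- move=> v tv vf; pose r := \row_i v (fun y : 'rV[R]_n => y 0 i).
  have rv : partial_vec a r = v.
    by rewrite -[RHS](chart_vec_id idc hr I tv) /chart_vec (tmap_id (derive_tangent a r)).
  have r0 : r = 0.
    apply: inj; rewrite rv; apply: (chart_tan_inj c hX UFa).
    - exact: tangent_tmap.
    - exact: tangent0.
    - by move=> i; rewrite tmapE; [exact: vf | exact: (chart_coord c i UFa)].
  rewrite -rv r0; apply/funext => g; rewrite /partial_vec /extend0 /patch.
  by case: ifP => // _; rewrite big1// => i _; rewrite mxE mul0r.
have [oU oV] := chart_open c; have [oU1 oV1] := chart_open c1.
exists (U `&` phi @^-1` V1), U1, (h \o phi); split=> //; last by move=> b /sW[].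
apply: is_chartP => //.
- rewrite openE => y [Uy V1y]; apply: filterI; first exact: (chart_nearU c Uy).
  by have [cp _] := chart_phi c Uy; apply: cp; exact: open_nbhs_nbhs.
- move=> y [Uy V1y]; have U1h := chartU c1 V1y; have [_ _ UF] := sW _ U1h; split=> //=.
    have E : phi (F (h (phi y))) = phi y by rewrite -fE (chartVK c1 V1y).
    by rewrite -(chartK c UF) E (chartK c Uy).
  by apply: smooth_map_at_comp; [exact: (chart_phi c Uy) | exact: (chart_psi c1 V1y)].
- move=> b U1b; have [_ sb UF] := sW _ U1b; split=> //.
    by split=> //; rewrite /= -fE; exact: (chartV c1).
  by rewrite /= -fE (chartK c1).
Unshelve. all: by end_near. Qed.

End charts.

Lemma nearS (T : topologicalType) (x : T) (P Q : T -> Prop) :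
  (forall y, P y -> Q y) -> (\forall y \near x, P y) -> \forall y \near x, Q y.
Proof. by move=> PQ; exact: filterS. Qed.

Lemma nearT (T : topologicalType) (x : T) (P : T -> Prop) :
  (forall y, P y) -> \forall y \near x, P y.
Proof. by move=> HP; exact: nearW. Qed.

Lemma near_comp (T T' : topologicalType) (f : T -> T') (x : T) (P : T' -> Prop) :
  {for x, continuous f} -> (\forall y \near f x, P y) -> \forall y \near x, P (f y).
Proof. by move=> cf; exact: (cf P). Qed.

Lemma near_near (T : topologicalType) (x : T) (P : T -> Prop) :
  (\forall y \near x, P y) -> \forall y \near x, \forall z \near y, P z.
Proof. exact: nbhs_interior. Qed.

(** * Smooth structures on subsets, products and orbit spaces *)

Section induced_spaces.
Context {R : realType}.
Implicit Types X Y Z : smoothSpaceType R.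

Section subspace.
Variables (X : smoothSpaceType R) (A : set X).
Notation iota := (@set_val X A).

Lemma nbhs_subspace (x : A) (P : set A) :
  nbhs x P <-> exists2 W, nbhs (iota x) W & forall y : A, W (iota y) -> P y.
Proof.
split=> [[_ [[W oW <-] Wx] WP]|[W nW WP]].
  by exists W => [|y /WP//]; exact: open_nbhs_nbhs.
exact: nearS WP (near_comp (@initial_continuous A X set_val x) nW).
Qed.

Lemma open_subspace (P : set A) : open P <-> exists2 W, open W & P = iota @^-1` W.
Proof.
split=> [[W oW <-]|[W oW ->]]; first by exists W.
by exists W.
Qed.

Lemma cinf_subspace : cinf_space X -> cinf_space A.
Proof.
move=> hX; have ci (x : A) : {for x, continuous iota} := @initial_continuous A X set_val x.
split.
- move=> x f g fg [F sF fF]; exists F => //.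
  by apply: filterS2 fg fF => y <-.
- move=> n x F u su eF.
  pose U i := sval (cid2 (su i)).
  have sU i : smooth_at (iota x) (U i) by rewrite /U; case: cid2.
  have uU i : \forall y \near x, u i y = U i (iota y) by rewrite /U; case: cid2.
  have rE y : (forall i, u i y = U i (iota y)) -> \row_i u i y = \row_i U i (iota y).
    by move=> E; apply/rowP => i; rewrite !mxE.
  have uUx i : u i x = U i (iota x) by exact: (nbhs_singleton (uU i)).
  exists (fun y => F (\row_i U i y)).
    by apply: sm_comp => //; rewrite -rE.
  by apply: filterS (near_forall uU) => y E; rewrite rE.
- move=> x f [F sF fF].
  apply: (@near_eq_continuous _ _ (F \o iota)); first by apply: filterS fF => y.
  by apply: continuous_comp; [exact: ci | exact: (sm_continuous hX)].
- move=> x f [F sF fF].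
  have h1 : \forall y \near x, smooth_at (iota y) F := ci x _ (sm_nearby hX sF).
  have h2 : \forall y \near x, \forall z \near y, f z = F (iota z).
    exact: near_near.
  by apply: filterS2 h1 h2 => y sy ny; exists F.
Qed.

Lemma smooth_map_at_val x : smooth_map_at iota x.
Proof.
split; first exact: (@initial_continuous A X set_val).
by move=> f sf; exists f => //; exact: nearT.
Qed.

Lemma smooth_map_at_lift Z (phi : Z -> A) z : cinf_space Z ->
  smooth_map_at (iota \o phi) z -> smooth_map_at phi z.
Proof.
move=> hZ [c s]; split.
  by move=> P /= /nbhs_subspace[W nW WP]; exact: nearS (fun y => WP (phi y)) (near_comp c nW).
move=> f [F sF fF]; apply: sm_near (s _ sF) => //.
move: fF => /nbhs_subspace[W nW WP].
by apply: nearS (near_comp c nW) => y /= /WP ->.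
Qed.

Lemma hausdorff_subspace : hausdorff_space X -> hausdorff_space A.
Proof.
rewrite !open_hausdorff => hX x y xy.
have [|[U V] [/= Ux Vy] [oU oV UV]] := hX (iota x) (iota y).
  by apply: contra xy => /eqP/val_inj ->.
exists (iota @^-1` U, iota @^-1` V); split => /=.
- by move: Ux; rewrite !inE.
- by move: Vy; rewrite !inE.
- by exists U.
- by exists V.
- by rewrite -preimage_setI (eqP UV) preimage_set0.
Qed.

Lemma second_countable_subspace : @second_countable X -> @second_countable A.
Proof.
move=> [B cB [oB bB]]; exists [set iota @^-1` W | W in B].
  exact: card_le_trans (card_image_le _ _) cB.
split=> [_ [W BW <-]|x P]; first by exists W => //; exact: oB.
move=> /nbhs_subspace[W nW WP].
have [V [BV Vx] VW] := bB _ _ nW.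
by exists (iota @^-1` V) => [|y /VW /WP//]; split=> //; exists V.
Qed.

End subspace.

Section products.
Variables (X Y : smoothSpaceType R).

Lemma smooth_map_at_pair Z (phi : Z -> X) (psi : Z -> Y) z : cinf_space Z ->
  smooth_map_at phi z -> smooth_map_at psi z ->
  smooth_map_at (fun z => (phi z, psi z) : X * Y) z.
Proof.
move=> hZ [c1 s1] [c2 s2].
have c : {for z, continuous (fun z => (phi z, psi z) : X * Y)} by exact: cvg_pair.
split=> // f [n [F [u [us eF fE]]]].
apply: (sm_near hZ (f := fun y => F (\row_i u i (phi y, psi y)))).
  by apply: nearS (near_comp c fE) => y /= ->.
apply: (sm_comp hZ (u := fun i y => u i (phi y, psi y))) => // i.
by case: (us i) => -[a sa ->]; [exact: s1 | exact: s2].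
Qed.

End products.

Section orbit_spaces.
Variables (G : Type) (X : smoothSpaceType R) (act : G -> X -> X) (A : set X).
Hypothesis hX : cinf_space X.
Notation pi := (orbit_proj act A).

Lemma orbit_proj_surj q : exists x, pi x = q.
Proof.
case: q => o oA; have /= := set_mem oA; case=> x Ax xo.
exists (exist _ x (mem_set Ax)); apply: eq_exist; exact: xo.
Qed.

Lemma orbit_proj_continuous : continuous pi.
Proof.
move=> x P; rewrite nbhsE => -[Q [oQ Qx] QP].
by apply: (@filterS _ _ _ (pi @^-1` Q)) => [y /QP//|]; apply: open_nbhs_nbhs.
Qed.

Lemma near_orbitP q (P : set (orbit_space act A)) :
  (\forall y \near q, P y) <->
  exists2 Q : set (orbit_space act A), open (pi @^-1` Q) /\ Q q & Q `<=` P.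
Proof.
split=> [H|[Q [oQ Qq] QP]].
  by have : nbhs q P := H; rewrite nbhsE => -[Q [oQ Qq] QP]; exists Q.
by apply: filterS QP _; apply: open_nbhs_nbhs; split.
Qed.

Lemma orbit_sm_continuous (q : orbit_space act A) f : smooth_at q f -> {for q, continuous f}.
Proof.
have hA : cinf_space A := cinf_subspace A hX.
move=> /near_orbitP[Q [oQ Qq] Qsm] W nW; apply/near_orbitP.
exists (Q `&` [set q' | interior W (f q')]); last by move=> q' [_ /interior_subset].
split; last by split.
rewrite openE => x [Qx Wx].
have cf := sm_continuous hA (Qsm _ Qx x erefl).
have h1 : \forall y \near x, Q (pi y) by apply: open_nbhs_nbhs; split.
have h2 : \forall y \near x, interior W (f (pi y)).
  by apply: (near_comp cf); exact: nbhs_interior.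
by apply: filterS2 h1 h2.
Qed.

Lemma cinf_orbit_space : cinf_space (orbit_space act A).
Proof.
have hA : cinf_space A := cinf_subspace A hX; split.
- move=> q f g /near_near fg sf; apply: filterS2 fg sf => q' fg sf x xq.
  apply: sm_near (sf x xq) => //; rewrite -xq in fg.
  exact: near_comp (@orbit_proj_continuous x) fg.
- move=> n q F u su eF.
  have su' : \forall q' \near q, forall i x, pi x = q' -> smooth_at x (u i \o pi).
    exact: near_forall su.
  have cq : {for q, continuous (fun q' => \row_i u i q')}.
    by apply: continuous_row => i; exact: orbit_sm_continuous.
  apply: filterS2 su' (near_comp cq (es_nearby eF)) => q' sq' eq' x xq.
  by apply: (sm_comp hA (u := fun i y => u i (pi y))) => [i|]; [exact: sq' | rewrite xq].
- exact: orbit_sm_continuous.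
- by move=> q f; exact: near_near.
Qed.

Lemma smooth_map_at_proj x : smooth_map_at pi x.
Proof.
split; first exact: orbit_proj_continuous.
by move=> f sf; exact: (nbhs_singleton sf x erefl).
Qed.

(** The hypothesis ranges over all points above all q' near q because smoothness on the orbit space
    is defined that way. *)
Lemma smooth_map_at_descend Z (phi : orbit_space act A -> Z) q :
  (\forall q' \near q, forall x, pi x = q' -> smooth_map_at (phi \o pi) x) ->
  cinf_space Z -> smooth_map_at phi q.
Proof.
move=> H hZ.
have c : \forall q' \near q, {for q', continuous phi}.
  have := near_near H; apply: filterS => q0.
  move=> /near_orbitP[Q [oQ Qq] Qsm] W nW.
  apply/near_orbitP.
  exists (Q `&` [set q' | interior W (phi q')]); last by move=> q' [_ /interior_subset].
  split; last by split.
  rewrite openE => x [Qx Wx].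
  have [cf _] := Qsm _ Qx x erefl.
  have h1 : \forall y \near x, Q (pi y) by apply: open_nbhs_nbhs; split.
  have h2 : \forall y \near x, interior W (phi (pi y)).
    by apply: (near_comp cf); exact: nbhs_interior.
  by apply: filterS2 h1 h2.
have cq := nbhs_singleton c.
split=> // f sf.
apply: filterS2 H (near_comp cq (sm_nearby hZ sf)) => q' Hq sfq x xq.
by have [_ s] := Hq x xq; apply: s; rewrite /= xq.
Qed.

End orbit_spaces.
End induced_spaces.

(** * Charts adapted to a group action *)

Section linear_span.
Context {R : realType} {E : lmodType R}.

(** If p > q, the p by q matrix of coefficients has a nonzero left kernel, and any vector of it is a
    linear relation between the u i. *)
Lemma independent_le p q (u : 'I_p -> E) (w : 'I_q -> E) :
  (forall c : 'I_p -> R, \sum_i c i *: u i = 0 -> forall i, c i = 0) ->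
  (forall i, exists c : 'I_q -> R, u i = \sum_j c j *: w j) -> (p <= q)%N.
Proof.
move=> iu uw; have [c cE] := choice uw.
rewrite leqNgt; apply/negP => qp.
pose A : 'M[R]_(p, q) := \matrix_(i, j) c i j.
have : kermx A != 0.
  by rewrite kermx_eq0 /row_free neq_ltn (leq_ltn_trans (rank_leq_col A) qp).
move=> /rowV0Pn[r /sub_kermxP rA rn0].
move/eqP: rn0; apply; apply/rowP => i; rewrite mxE; apply: (iu (fun i => r 0 i)).
rewrite (eq_bigr (fun i => \sum_j (r 0 i * c i j) *: w j)); last first.
  by move=> k _; rewrite cE scaler_sumr; apply: eq_bigr => j _; rewrite scalerA.
rewrite exchange_big big1 //= => j _; rewrite -scaler_suml.
move/rowP/(_ j): rA; rewrite !mxE => E0.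
by rewrite [X in X *: _](_ : _ = 0) ?scale0r// -[RHS]E0; apply: eq_bigr => k _; rewrite mxE.
Qed.

Lemma independent_rcons p (u : 'I_p -> E) v :
  (forall c : 'I_p -> R, \sum_i c i *: u i = 0 -> forall i, c i = 0) ->
  ~ (exists c : 'I_p -> R, v = \sum_i c i *: u i) ->
  forall (c : 'I_p -> R) (k : R), \sum_i c i *: u i + k *: v = 0 ->
    k = 0 /\ forall i, c i = 0.
Proof.
move=> iu nv c k E0; have [k0|k0] := eqVneq k 0.
  by move: E0; rewrite k0 scale0r addr0 => /iu.
case: nv; exists (fun i => - (k^-1 * c i)).
have : k *: v = - \sum_i c i *: u i by apply/eqP; rewrite -addr_eq0 addrC E0.
move=> /(congr1 ( *:%R k^-1)); rewrite scalerA mulVf// scale1r => ->.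
rewrite scalerN scaler_sumr -sumrN; apply: eq_bigr => i _.
by rewrite scalerA scaleNr.
Qed.

End linear_span.

Section tangent_products.
Context {R : realType} {X Y Z : smoothSpaceType R}.
Hypothesis hZ : cinf_space Z.

(** A smooth function on the product is locally a function of finitely many functions of one factor
    each. The chain rule gives a sum in which each term sees only one of the two maps. *)
Lemma tan_pair (phi : Z -> X) (psi : Z -> Y) z v (f : X * Y -> R) : tangent z v ->
  smooth_map_at phi z -> smooth_map_at psi z -> smooth_at (phi z, psi z) f ->
  v (fun t => f (phi t, psi t)) =
  v (fun t => f (phi t, psi z)) + v (fun t => f (phi z, psi t)).
Proof.
move=> tv [c1 s1] [c2 s2] [n [F [u [us eF fE]]]].
have cc (y : Y) : {for z, continuous (fun=> y)} by exact: cst_continuous.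
have cx (y : X) : {for z, continuous (fun=> y)} by exact: cst_continuous.
have nE (a : Z -> X) (b : Z -> Y) : {for z, continuous a} -> {for z, continuous b} ->
    a z = phi z -> b z = psi z ->
    \forall t \near z, f (a t, b t) = F (\row_i u i (a t, b t)).
  move=> ca cb az bz.
  have c : {for z, continuous (fun z => (a z, b z))} by exact: cvg_pair.
  have fE' : \forall q \near (a z, b z), f q = F (\row_i u i q) by rewrite az bz.
  exact: (near_comp c fE').
have sm (a : Z -> X) (b : Z -> Y) i : (forall g, smooth_at (phi z) g -> smooth_at z (g \o a)) ->
    (forall g, smooth_at (psi z) g -> smooth_at z (g \o b)) -> smooth_at z (fun t => u i (a t, b t)).
  by move=> sa sb; case: (us i) => -[g sg ->]; [exact: sa | exact: sb].
have sc (y : Y) g : smooth_at (psi z) g -> smooth_at z (g \o (fun=> y)) by move=> _; exact: (sm_cst hZ).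
have scx (y : X) g : smooth_at (phi z) g -> smooth_at z (g \o (fun=> y)) by move=> _; exact: (sm_cst hZ).
rewrite (tan_near hZ tv (nE phi psi c1 c2 erefl erefl)).
rewrite (tan_near hZ tv (nE phi (fun=> psi z) c1 (cc _) erefl erefl)).
rewrite (tan_near hZ tv (nE (fun=> phi z) psi (cx _) c2 erefl erefl)).
rewrite (tan_chain hZ (u := fun i t => u i (phi t, psi t)) tv (fun i => sm phi psi i s1 s2) eF).
rewrite (tan_chain hZ (u := fun i t => u i (phi t, psi z)) tv (fun i => sm phi (fun=> psi z) i s1 (sc _)) eF).
rewrite (tan_chain hZ (u := fun i t => u i (phi z, psi t)) tv (fun i => sm (fun=> phi z) psi i (scx _) s2) eF).
rewrite -big_split /=; apply: eq_bigr => i _; rewrite -mulrDr; congr (_ * _).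
case: (us i) => -[g sg ->] /=.
  by rewrite (tan_cst hZ _ tv) addr0.
by rewrite (tan_cst hZ _ tv) add0r.
Qed.

End tangent_products.

Section affine_parametrization.
Context {R : realType} {X : smoothSpaceType R} {n : nat}.
Variables (U : set X) (V : set 'rV[R]_n) (phi : X -> 'rV[R]_n) (psi : 'rV[R]_n -> X).
Hypotheses (hX : cinf_space X) (ch : is_chart U V phi psi).

Lemma affine_smooth p (D : 'M[R]_(p, n)) b (a : 'rV[R]_p) :
  smooth_map_at (fun a : 'rV[R]_p => b + a *m D) a.
Proof.
apply/rV_smooth_map; first exact: cinf_rV.
move=> i; have := @esD R p a (fun=> b 0 i) (fun a => \sum_j a 0 j * D j i).
move=> H; apply: es_near (H _ _); last 2 first.
- exact: es_cst.
- by apply: es_sum => j; apply: esM; [exact: es_coord | exact: es_cst].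
by apply: nearT => c; rewrite !mxE.
Qed.

Lemma affine_tmap p (D : 'M[R]_(p, n)) b (a c : 'rV[R]_p) :
  tmap (fun a : 'rV[R]_p => b + a *m D) a (partial_vec a c) = partial_vec (b + a *m D) (c *m D).
Proof.
have idc : is_chart (setT : set ('rV[R]_n : smoothSpaceType R)) setT id id.
  by apply: is_chartP; [exact: cinf_rV | exact: openT | exact: openT |
    move=> z _; split=> //; exact: smooth_map_at_id | move=> z _; split=> //; exact: smooth_map_at_id].
have hr p' := @cinf_rV R p'.
apply: (chart_tan_inj idc (hr n) I).
- apply: tangent_tmap => //; [exact: affine_smooth | exact: derive_tangent].
- exact: derive_tangent.
move=> i; rewrite tmapE; last exact: es_coord.
rewrite partial_vec_coord mxE.
have tv : tangent (a : 'rV[R]_p) (partial_vec a c) := derive_tangent a c.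
have E : ((fun y : 'rV[R]_n => y 0 i) \o (fun a : 'rV[R]_p => b + a *m D)) =
    fun a => b 0 i + \sum_j D j i * a 0 j.
  by apply/funext => z; rewrite /= !mxE; congr (_ + _); apply: eq_bigr => j _; rewrite mulrC.
have sS j : smooth_at (a : 'rV[R]_p) (fun a : 'rV[R]_p => D j i * a 0 j : R).
  by apply: esM; [exact: es_cst | exact: es_coord].
have s0 : smooth_at (a : 'rV[R]_p) (fun=> b 0 i) by exact: es_cst.
rewrite E (tanD tv s0 (sm_sum (hr p) sS)).
rewrite (tan_cst (hr p) _ tv) add0r (tan_sum (hr p) tv sS).
apply: eq_bigr => j _; rewrite (tanZ (hr p) _ tv); last exact: es_coord.
by rewrite partial_vec_coord mulrC.
Qed.

Definition affine_param p (D : 'M[R]_(p, n)) x (a : 'rV[R]_p) : X := psi (phi x + a *m D).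

Lemma affine_param0 p (D : 'M[R]_(p, n)) x : U x -> affine_param D x 0 = x.
Proof. by move=> Ux; rewrite /affine_param mul0mx addr0 (chartK ch). Qed.

Lemma affine_param_smooth p (D : 'M[R]_(p, n)) x a : V (phi x + a *m D) ->
  smooth_map_at (affine_param D x) a.
Proof.
move=> Va; apply: (smooth_map_at_comp (affine_smooth D (phi x) a)).
exact: (chart_psi ch Va).
Qed.

Lemma affine_param_near p (D : 'M[R]_(p, n)) x : U x ->
  \forall a \near (0 : 'rV[R]_p), V (phi x + a *m D).
Proof.
move=> Ux; have [c _] := affine_smooth D (phi x) 0.
by apply: (near_comp c); rewrite mul0mx addr0; apply: (chart_nearV ch); exact: (chartV ch).
Qed.

Lemma affine_param_tmap p (D : 'M[R]_(p, n)) x c : U x ->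
  tmap (affine_param D x) 0 (partial_vec 0 c) = chart_vec phi psi x (c *m D).
Proof.
move=> Ux; have E : phi x + 0 *m D = phi x by rewrite mul0mx addr0.
rewrite (@tmap_comp _ _ _ _ (fun a : 'rV[R]_p => phi x + a *m D) psi); last first.
  by rewrite E; apply: (chart_psi ch); exact: (chartV ch).
by rewrite affine_tmap /chart_vec E.
Qed.

End affine_parametrization.

(** * Generators and vertical spaces *)

Section action.
Context {R : realType} {M : smoothSpaceType R} {G : smoothGroupType R}.
Variable act : G -> M -> M.
Hypotheses (hM : is_manifold M) (hG : is_lie_group G) (hact : smooth_action act).

Let hMc : cinf_space M := manifold_cinf hM.
Let hGc : cinf_space G.
Proof. by case: hG => hGm _ _; exact: manifold_cinf. Qed.

Lemma act1 x : act 1%g x = x. Proof. by case: hact. Qed.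
Lemma actM g h x : act (g * h)%g x = act g (act h x). Proof. by case: hact. Qed.
Lemma actK g x : act g^-1%g (act g x) = x. Proof. by rewrite -actM mulVg act1. Qed.
Lemma actVK g x : act g (act g^-1%g x) = x. Proof. by rewrite -actM mulgV act1. Qed.

Lemma smooth_act (p : G * M) : smooth_map_at (fun p : G * M => act p.1 p.2) p.
Proof. by case: hact => _ _ [c s]; split; [exact: c | exact: s]. Qed.

Lemma smooth_act_comp (Z : smoothSpaceType R) (al : Z -> G) (be : Z -> M) z :
  cinf_space Z -> smooth_map_at al z -> smooth_map_at be z ->
  smooth_map_at (fun z => act (al z) (be z)) z.
Proof.
move=> hZ sa sb; have sp := smooth_map_at_pair hZ sa sb.
exact: (smooth_map_at_comp sp (smooth_act (al z, be z))).
Qed.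

Lemma smooth_map_at_cst (Z Y : smoothSpaceType R) (y : Y) z : cinf_space Z ->
  smooth_map_at (fun _ : Z => y) z.
Proof.
move=> hZ; split; first exact: cst_continuous.
by move=> f _; exact: (sm_cst hZ z (f y)).
Qed.

Lemma smooth_act_r g x : smooth_map_at (act g) x.
Proof.
apply: (smooth_act_comp (be := id)) => //; first exact: smooth_map_at_cst.
exact: smooth_map_at_id.
Qed.

Lemma smooth_act_l x g : smooth_map_at (act^~ x) g.
Proof.
apply: (smooth_act_comp (al := id)) => //; first exact: smooth_map_at_id.
exact: smooth_map_at_cst.
Qed.

Lemma smooth_mul_comp (Z : smoothSpaceType R) (al be : Z -> G) z :
  cinf_space Z -> smooth_map_at al z -> smooth_map_at be z ->
  smooth_map_at (fun z => (al z * be z)%g) z.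
Proof.
move=> hZ sa sb; have sp := smooth_map_at_pair hZ sa sb.
have [_ [c s] _] := hG.
by apply: (smooth_map_at_comp sp (psi := fun p : G * G => (p.1 * p.2)%g)); split; [exact: c | exact: s].
Qed.

Lemma generator_lin c xi eta x :
  generator act (c *: xi + eta) x = c *: generator act xi x + generator act eta x.
Proof. exact: tmap_lin. Qed.

Lemma tangent_generator xi x : lie_algebra G xi -> tangent x (generator act xi x).
Proof.
move=> tx; rewrite -{1}(act1 x); apply: (tangent_tmap (phi := act^~ x)) => //.
exact: smooth_act_l.
Qed.

Lemma generatorE xi x f : smooth_at x f -> generator act xi x f = xi (fun g => f (act g x)).
Proof. by move=> sf; rewrite /generator tmapE// act1. Qed.

(** Generators depend linearly on the Lie algebra element, so they already form the linear span. *)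
Lemma verticalP x v : vertical act x v <-> exists2 xi, lie_algebra G xi & v = generator act xi x.
Proof.
split=> [[n [c [e [eV ->]]]]|[xi tx ->]]; last first.
  exists 1%N, (fun=> 1), (fun=> generator act xi x); split; first by move=> _; exists xi.
  by rewrite big_ord1 scale1r.
have eV' i : exists xi, lie_algebra G xi /\ generator act xi x = e i.
  by have [xi ? ?] := eV i; exists xi.
have [xi xiE] := choice eV'.
exists (\sum_i c i *: xi i); first by apply: tangent_sum => i; have [] := xiE i.
rewrite /generator tmap_sum; apply: eq_bigr => i _.
by have [_ <-] := xiE i.
Qed.

Lemma vertical_tangent x v : vertical act x v -> tangent x v.
Proof. by move/verticalP => [xi tx ->]; exact: tangent_generator. Qed.

Lemma vertical_lin x (c : R) v w : vertical act x v -> vertical act x w ->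
  vertical act x (c *: v + w).
Proof.
move=> /verticalP[xi tx ->] /verticalP[eta te ->]; apply/verticalP.
exists (c *: xi + eta); first exact: tangent_lin.
by rewrite generator_lin.
Qed.

Lemma vertical0 x : vertical act x 0.
Proof.
apply/verticalP; exists 0; first exact: tangent0.
by rewrite /generator tmap0.
Qed.

Lemma vertical_sum x n (c : 'I_n -> R) e : (forall i, vertical act x (e i)) ->
  vertical act x (\sum_i c i *: e i).
Proof.
move=> ve; elim: n c e ve => [|n IH] c e ve; first by rewrite big_ord0; exact: vertical0.
by rewrite big_ord_recl; apply: vertical_lin => //; exact: IH.
Qed.

(* Right translation carries an arbitrary tangent vector of G to the Lie algebra. *)
Lemma vertical_orbit_map x g v : tangent g v ->
  vertical act (act g x) (tmap (act^~ x) g v).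
Proof.
move=> tv; pose r (h : G) := (h * g^-1)%g.
have sr : smooth_map_at r g.
  apply: smooth_mul_comp => //; [exact: smooth_map_at_id | exact: smooth_map_at_cst].
have rg : r g = 1%g by rewrite /r mulgV.
apply/verticalP; exists (tmap r g v); first by rewrite /lie_algebra -rg; exact: tangent_tmap.
rewrite /generator -rg -tmap_comp; last exact: smooth_act_l.
by congr tmap; apply/funext => h; rewrite /= /r -actM -mulgA mulVg mulg1.
Qed.

End action.

Definition split_fun (A : Type) a b (g : 'I_a -> A) (h : 'I_b -> A) (i : 'I_(a + b)) : A :=
  match fintype.split i with inl j => g j | inr j => h j end.

Lemma split_funl A a b (g : 'I_a -> A) (h : 'I_b -> A) i : split_fun g h (lshift b i) = g i.
Proof. by rewrite /split_fun -[lshift b i]/(unsplit (inl _ i)) unsplitK. Qed.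

Lemma split_funr A a b (g : 'I_a -> A) (h : 'I_b -> A) i : split_fun g h (rshift a i) = h i.
Proof. by rewrite /split_fun -[rshift a i]/(unsplit (inr _ i)) unsplitK. Qed.

(** * Local constancy of the rank of the vertical spaces *)

Section vertical_rank.
Context {R : realType} {M : smoothSpaceType R} {G : smoothGroupType R}.
Variables (act : G -> M -> M) (Delta : M -> set (tvec M)).
Hypotheses (hDelta : is_subbundle (@smooth_vf R M) Delta)
  (hDeltaV : forall x, Delta x `&` vertical act x = [set 0])
  (hVDelta : is_subbundle (@smooth_vf R M)
     (fun x => set_add (vertical act x) (Delta x))).

Lemma basis_mem (E : lmodType R) k (e : 'I_k -> E) S i : is_basis e S -> S (e i).
Proof.
move=> [_ ->]; exists (fun j => (j == i)%:R) => //.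
rewrite (bigD1 i)//= eqxx scale1r big1 ?addr0// => j /negPf ->.
by rewrite scale0r.
Qed.

Lemma basis_comb (E : lmodType R) k (e : 'I_k -> E) S (c : 'I_k -> R) :
  is_basis e S -> S (\sum_i c i *: e i).
Proof. by move=> [_ ->]; exists c. Qed.

(* The rank of the vertical distribution is that of (vertical + Delta) minus that of Delta. *)
Lemma vertical_rank x d (u : 'I_d -> M -> tvec M) :
  (forall v, vertical act x v -> exists c : 'I_d -> R, v = \sum_i c i *: u i x) ->
  (\forall y \near x, (forall i, vertical act y (u i y)) /\
     forall c : 'I_d -> R, \sum_i c i *: u i y = 0 -> forall i, c i = 0) ->
  \forall y \near x, forall v, vertical act y v ->
    exists c : 'I_d -> R, v = \sum_i c i *: u i y.
Proof.
move=> sp nu.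
have [U [q [e [oU _ eb]]]] := hDelta x.
have [U' [k [f [oU' _ fb]]]] := hVDelta x.
have Ux := oU.2; have U'x := oU'.2.
have kdq : (k <= d + q)%N.
  apply: (@independent_le _ _ _ _ (fun i => f i x) (split_fun (u^~ x) (e^~ x))).
    by have [] := fb x U'x.
  move=> i; have := basis_mem i (fb x U'x).
  move=> [v [w [Vv Dw ->]]]; have [c cE] := sp _ Vv.
  have [_ De] := eb x Ux; move: Dw; rewrite De => -[c' _ c'E].
  exists (split_fun c c').
  by rewrite big_split_ord /= cE -c'E; congr (_ + _); apply: eq_bigr => j _;
    rewrite ?split_funl ?split_funr.
apply: filterS3 nu (open_nbhs_nbhs oU) (open_nbhs_nbhs oU') => y [Vu iu] Uy U'y v Vv.
apply: contrapT => nv.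
(* A vertical vector outside the span would give d + 1 + q independent vectors in a space of
   dimension k <= d + q. *)
have : (d + (1 + q) <= k)%N; last first.
  by move=> /leq_trans/(_ kdq); rewrite leq_add2l add1n ltnn.
pose w : 'I_(1 + q) -> tvec M := split_fun (fun=> v) (e^~ y).
apply: (@independent_le _ _ _ _ (split_fun (u^~ y) w) (fun i => f i y)); last first.
  move=> i; suff : set_add (vertical act y) (Delta y)
      (split_fun (u^~ y) w i).
    by have [_ ->] := fb y U'y => -[c _ <-]; exists c.
  have D0 : Delta y 0 by have := hDeltaV y => /seteqP[_ /(_ 0 erefl)][].
  case: (split_ordP i) => j ->; rewrite ?split_funl ?split_funr; first by exists (u j y), 0; rewrite addr0.
  case: (split_ordP j) => l ->; rewrite /w ?split_funl ?split_funr; first by exists v, 0; rewrite addr0.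
  exists 0, (e l y); rewrite add0r; split=> //; first exact: vertical0.
  exact: (basis_mem l (eb y Uy)).
move=> c; rewrite big_split_ord /=.
rewrite (eq_bigr (fun i => c (lshift _ i) *: u i y)); last by move=> i _; rewrite split_funl.
rewrite [X in _ + X](eq_bigr (fun i => c (rshift _ i) *: w i)); last by move=> i _; rewrite split_funr.
rewrite big_split_ord /= big_ord1.
rewrite {1}/w split_funl.
rewrite (eq_bigr (fun i => c (rshift d (rshift 1 i)) *: e i y)); last by move=> i _; rewrite /w split_funr.
set X1 := \sum_i _; set X2 := \sum_i _; set k0 := c _ => E0.
have X1E : X1 + k0 *: v = - X2 by apply/eqP; rewrite -addr_eq0 -addrA E0.
have V1 : vertical act y (X1 + k0 *: v).
  by rewrite addrC; apply: vertical_lin => //; exact: vertical_sum.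
have D1 : Delta y (X1 + k0 *: v).
  rewrite X1E /X2 -sumrN (eq_bigr (fun i => (- c (rshift d (rshift 1 i))) *: e i y)); last by move=> i _; rewrite scaleNr.
  exact: (basis_comb _ (eb y Uy)).
(* Delta meets the vertical space only in 0, so the relation splits into a vertical one and one
   inside Delta. *)
have Z1 : X1 + k0 *: v = 0 by have : (Delta y `&` vertical act y) (X1 + k0 *: v) by []; rewrite hDeltaV.
have Z2 : X2 = 0 by apply: oppr_inj; rewrite -X1E Z1 oppr0.
have [c0 ci] := independent_rcons iu nv Z1.
have ce := (eb y Uy).1 _ Z2.
move=> i; case: (split_ordP i) => [j ->|j ->]; first exact: ci.
case: (split_ordP j) => [l ->|l ->]; last exact: ce.
by rewrite (ord1 l).
Qed.

End vertical_rank.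

Section tangent_vector_operations.
Context {R : realType} {X : smoothSpaceType R}.
Implicit Types (v w : tvec X) (f : X -> R).

Lemma tvecD v w f : (v + w) f = v f + w f. Proof. by []. Qed.
Lemma tvecN v f : (- v) f = - v f. Proof. by []. Qed.
Lemma tvecZ (c : R) v f : (c *: v) f = c * v f. Proof. by []. Qed.
Lemma tvec0 f : (0 : tvec X) f = 0. Proof. by []. Qed.
Lemma tvec_sum n (c : 'I_n -> R) (e : 'I_n -> tvec X) f :
  (\sum_i c i *: e i) f = \sum_i c i * e i f.
Proof. by rewrite fct_sumE. Qed.

Lemma inverse_function_param_dim n p (U : set X) (V : set 'rV[R]_n) phi psi
    (F : 'rV[R]_p -> X) a W : n = p -> cinf_space X -> is_chart U V phi psi -> U (F a) ->
  nbhs a W -> (\forall b \near a, smooth_map_at F b) ->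
  (forall c, tmap F a (partial_vec a c) = 0 -> c = 0) ->
  exists U' V' G, [/\ is_chart U' V' G F, V' a & V' `<=` W].
Proof. by move=> E; subst p; exact: inverse_function_param. Qed.

End tangent_vector_operations.

Section block_rows.
Context {R : realType} {d m : nat}.

Lemma ball_row_mx (r : R) (a : 'rV[R]_d) (s : 'rV[R]_m) : 0 < r ->
  ball 0 r a -> ball 0 r s -> ball 0 r (row_mx a s).
Proof.
move=> r0 [_ ar] [_ sr]; split=> // i j.
case: (split_ordP j) => k ->; rewrite ?row_mxEl ?row_mxEr ?mxE.
  by have := ar i k; rewrite mxE.
by have := sr i k; rewrite mxE.
Qed.

Lemma ball_lsubmx (r : R) (u : 'rV[R]_(d + m)) : ball 0 r u -> ball 0 r (lsubmx u).
Proof.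
by move=> [r0 ur]; split=> // i j; have := ur i (lshift m j); rewrite !mxE.
Qed.

Lemma ball_rsubmx (r : R) (u : 'rV[R]_(d + m)) : ball 0 r u -> ball 0 r (rsubmx u).
Proof.
by move=> [r0 ur]; split=> // i j; have := ur i (rshift d j); rewrite !mxE.
Qed.

Lemma cont_row_mx (T : topologicalType) (f : T -> 'rV[R]_d) (g : T -> 'rV[R]_m) t :
  {for t, continuous f} -> {for t, continuous g} ->
  {for t, continuous (fun t => row_mx (f t) (g t))}.
Proof.
move=> cf cg; have -> : (fun t => row_mx (f t) (g t)) =
    fun t => \row_q split_fun (fun i => f t 0 i) (fun i => g t 0 i) q.
  apply/funext => z; apply/rowP => q; rewrite [RHS]mxE.
  by case: (split_ordP q) => q' ->; rewrite ?split_funl ?split_funr ?row_mxEl ?row_mxEr.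
apply: continuous_row => q; case: (split_ordP q) => q' ->.
  rewrite (_ : (fun _ => _) = (fun t => f t 0 q')); last by apply/funext => z; rewrite split_funl.
  exact: (continuous_comp cf (@coord_continuous _ _ _ _ _ _)).
rewrite (_ : (fun _ => _) = (fun t => g t 0 q')); last by apply/funext => z; rewrite split_funr.
exact: (continuous_comp cg (@coord_continuous _ _ _ _ _ _)).
Qed.

Lemma cont_lsubmx (T : topologicalType) (f : T -> 'rV[R]_(d + m)) t :
  {for t, continuous f} -> {for t, continuous (fun t => lsubmx (f t))}.
Proof.
move=> cf; have -> : (fun t => lsubmx (f t)) = fun t => \row_i f t 0 (lshift m i).
  by apply/funext => z; apply/rowP => i; rewrite !mxE.
by apply: continuous_row => i; exact: (continuous_comp cf (@coord_continuous _ _ _ _ _ _)).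
Qed.

Lemma cont_rsubmx (T : topologicalType) (f : T -> 'rV[R]_(d + m)) t :
  {for t, continuous f} -> {for t, continuous (fun t => rsubmx (f t))}.
Proof.
move=> cf; have -> : (fun t => rsubmx (f t)) = fun t => \row_i f t 0 (rshift d i).
  by apply/funext => z; apply/rowP => i; rewrite !mxE.
by apply: continuous_row => i; exact: (continuous_comp cf (@coord_continuous _ _ _ _ _ _)).
Qed.

End block_rows.

(** * Construction of leaf charts *)

Section leaf_chart_construction.
Context {R : realType} {M : smoothSpaceType R} {G : smoothGroupType R}.
Variables (act : G -> M -> M) (Delta : M -> set (tvec M)).
Hypotheses (hM : is_manifold M) (hG : is_lie_group G) (hact : smooth_action act)
  (hDelta : is_subbundle (@smooth_vf R M) Delta)
  (hDeltaV : forall x, Delta x `&` vertical act x = [set 0])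
  (hVDelta : is_subbundle (@smooth_vf R M)
     (fun x => set_add (vertical act x) (Delta x))).

Let hMc : cinf_space M := manifold_cinf hM.

Lemma lie_group_cinf : cinf_space G.
Proof. by case: hG => hGm _ _; exact: manifold_cinf. Qed.
Let hGc := lie_group_cinf.

Lemma chart_vec_sum (X : smoothSpaceType R) n (U : set X) (V : set 'rV[R]_n) phi psi x p
    (c : 'I_p -> R) (e : 'I_p -> 'rV[R]_n) : cinf_space X -> is_chart U V phi psi -> U x ->
  chart_vec phi psi x (\sum_i c i *: e i) = \sum_i c i *: chart_vec phi psi x (e i).
Proof.
move=> hX ch Ux; apply: (chart_tan_inj ch hX Ux).
- exact: (chart_vec_tangent ch hX).
- by apply: tangent_sum => i; exact: (chart_vec_tangent ch hX).
move=> j; rewrite (chart_vec_coord ch) // summxE tvec_sum.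
by apply: eq_bigr => i _; rewrite mxE (chart_vec_coord ch).
Qed.

(* Coordinates (a, b): a runs along the group orbits, and b is locally constant on them. *)
Record leaf_chart (x : M) := LeafChart {
  ldim : nat; lcodim : nat; lrad : R; ldom : set M;
  lphi : M -> 'rV[R]_(ldim + lcodim); lpsi : 'rV[R]_(ldim + lcodim) -> M;
  lmove : 'rV[R]_ldim -> G;
  leaf_rad : 0 < lrad;
  leaf_is_chart : is_chart ldom (ball 0 lrad) lphi lpsi;
  leaf_dom : ldom x;
  leaf_center : lphi x = 0;
  leaf_move_smooth : forall a, ball 0 lrad a -> smooth_map_at lmove a;
  leaf_move0 : lmove 0 = 1%g;
  leaf_act : forall u, ball 0 lrad u ->
    lpsi u = act (lmove (lsubmx u)) (lpsi (row_mx 0 (rsubmx u)));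
  leaf_vertical : forall y v, ldom y -> (vertical act y v <->
    tangent y v /\ forall j, v (fun y => lphi y 0 (rshift ldim j)) = 0) }.

Section construction.
Variables (x : M) (n : nat) (U0 : set M) (V0 : set 'rV[R]_n) (phi0 : M -> 'rV[R]_n)
  (psi0 : 'rV[R]_n -> M) (n' : nat) (UG : set G) (VG : set 'rV[R]_n') (phiG : G -> 'rV[R]_n')
  (psiG : 'rV[R]_n' -> G).
Hypotheses (ch0 : is_chart U0 V0 phi0 psi0) (U0x : U0 x) (chG : is_chart UG VG phiG psiG)
  (UG1 : UG 1%g).

(** The derivative at 1 of the orbit map of x in the two charts; its row space is the vertical space
    at x. *)
Let E : 'M[R]_(n', n) := \matrix_(i, j)
  'D_(delta_mx 0 i) (fun u => phi0 (act (psiG u) x) 0 j) (phiG 1%g).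

Let generator_coord e j :
  generator act (chart_vec phiG psiG 1%g e) x (fun y => phi0 y 0 j) = (e *m E) 0 j.
Proof.
rewrite (generatorE hact); last exact: (chart_coord ch0).
have s1 : smooth_at (1%g : G) (fun g => phi0 (act g x) 0 j).
  have [_ /(_ (fun y => phi0 y 0 j))] := smooth_act_l hG hact x 1%g.
  by apply; rewrite (act1 hact); exact: (chart_coord ch0).
rewrite (chart_vecE chG)// mxE; apply: eq_bigr => i _.
by rewrite mxE.
Qed.

Let d := \rank E.
Let m := \rank (E^C)%MS.
(** Directions in the Lie algebra that E maps to a basis of its row space; they span a complement of
    the kernel of E. *)
Let D : 'M[R]_(d, n') := row_base E *m pinvmx E.
Let C : 'M[R]_(m, n) := row_base (E^C)%MS.

Let DE : D *m E = row_base E.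
Proof. by rewrite mulmxKpV// eq_row_base. Qed.

Let l (a : 'rV[R]_d) : G := affine_param phiG psiG D 1%g a.
Let sg (s : 'rV[R]_m) : M := affine_param phi0 psi0 C x s.
(** The parametrization (a, s) |-> l(a) sg(s): l moves along the orbits, and sg along a complement C
    of the vertical space at x. *)
Let F (u : 'rV[R]_(d + m)) : M := act (l (lsubmx u)) (sg (rsubmx u)).

Let lE u : l (lsubmx u) = affine_param phiG psiG (col_mx D (0 : 'M_(m, n'))) 1%g u.
Proof. by rewrite /l /affine_param -{2}(hsubmxK u) mul_row_col mulmx0 addr0. Qed.

Let sgE u : sg (rsubmx u) = affine_param phi0 psi0 (col_mx (0 : 'M_(d, n)) C) x u.
Proof. by rewrite /sg /affine_param -{2}(hsubmxK u) mul_row_col mulmx0 add0r. Qed.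

Let good u := VG (phiG 1%g + u *m col_mx D (0 : 'M_(m, n'))) /\
              V0 (phi0 x + u *m col_mx (0 : 'M_(d, n)) C).

Let F_smooth u : good u -> smooth_map_at F u.
Proof.
move=> [vG v0].
have -> : F = fun u => act (affine_param phiG psiG (col_mx D (0 : 'M_(m, n'))) 1%g u)
    (affine_param phi0 psi0 (col_mx (0 : 'M_(d, n)) C) x u).
  by apply/funext => z; rewrite /F lE sgE.
apply: (smooth_act_comp hact (cinf_rV _)).
  exact: (affine_param_smooth chG vG).
exact: (affine_param_smooth ch0 v0).
Qed.

Let good0 : \forall u \near (0 : 'rV[R]_(d + m)), good u.
Proof.
have H1 := affine_param_near chG (col_mx D (0 : 'M_(m, n'))) UG1.
have H2 := affine_param_near ch0 (col_mx (0 : 'M_(d, n)) C) U0x.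
exact: filterI H1 H2.
Qed.

Let F0 : F 0 = x.
Proof.
by rewrite /F lE sgE (affine_param0 chG)// (affine_param0 ch0)// (act1 hact).
Qed.

Let F_tmap c : tmap F 0 (partial_vec 0 c) =
  generator act (chart_vec phiG psiG 1%g (lsubmx c *m D)) x +
  chart_vec phi0 psi0 x (rsubmx c *m C).
Proof.
have [vG v0] := nbhs_singleton good0.
set v := partial_vec 0 c.
have tv : tangent (0 : 'rV[R]_(d + m)) v := derive_tangent 0 c.
pose lu := affine_param phiG psiG (col_mx D (0 : 'M_(m, n'))) 1%g.
pose su := affine_param phi0 psi0 (col_mx (0 : 'M_(d, n)) C) x.
have lu0 : lu 0 = 1%g by exact: (affine_param0 chG).
have su0 : su 0 = x by exact: (affine_param0 ch0).
have slu : smooth_map_at lu 0 by exact: (affine_param_smooth chG vG).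
have ssu : smooth_map_at su 0 by exact: (affine_param_smooth ch0 v0).
have FE : F = fun u => act (lu u) (su u) by apply/funext => z; rewrite /F lE sgE.
have -> : lsubmx c *m D = c *m col_mx D (0 : 'M_(m, n')).
  by rewrite -{2}(hsubmxK c) mul_row_col mulmx0 addr0.
have -> : rsubmx c *m C = c *m col_mx (0 : 'M_(d, n)) C.
  by rewrite -{2}(hsubmxK c) mul_row_col mulmx0 add0r.
have tg : tangent (1%g : G) (tmap lu 0 v) by rewrite -lu0; exact: tangent_tmap.
rewrite -(affine_param_tmap chG)// -(affine_param_tmap ch0)//.
rewrite -/lu -/su -/v; apply/funext => f.
have [sf|nf] := pselect (smooth_at x f); last first.
  rewrite tmap_out ?F0//; rewrite tvecD.
  rewrite (tmap_out (phi := su)) ?su0// /generator tmap_out ?(act1 hact)//.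
  by rewrite addr0.
rewrite tmapE ?F0// tvecD (generatorE hact)// tmapE ?lu0; last first.
  by have [_] := smooth_act_l hG hact x 1%g; apply; rewrite (act1 hact).
rewrite tmapE ?su0// FE.
have := @tan_pair _ _ _ _ (cinf_rV _) lu su 0 v (fun p => f (act p.1 p.2)) tv slu ssu.
rewrite lu0 su0 => ->; last first.
  have [_] := smooth_act hact (1%g, x); apply => /=; by rewrite (act1 hact).
by congr (_ + _); congr v; apply/funext => z /=; rewrite ?lu0 ?(act1 hact).
Qed.

Let F_inj c : tmap F 0 (partial_vec 0 c) = 0 -> c = 0.
Proof.
rewrite F_tmap => E0.
have {}E0 : lsubmx c *m row_base E + rsubmx c *m C = 0.
  apply/rowP => j; have := congr1 (fun v : tvec M => v (fun y => phi0 y 0 j)) E0.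
  rewrite tvecD generator_coord (chart_vec_coord ch0)// -mulmxA DE tvec0 => H.
  by rewrite [RHS]mxE -[RHS]H mxE.
have L0 : lsubmx c *m row_base E = 0.
  apply/eqP; rewrite -submx0 -(capmx_compl E) sub_capmx.
  rewrite (submx_trans (submxMl _ _)) ?eq_row_base//=.
  have -> : lsubmx c *m row_base E = - (rsubmx c *m C) by apply/eqP; rewrite -addr_eq0 E0.
  by rewrite -mulNmx (submx_trans (submxMl _ _)) ?eq_row_base.
have R0 : rsubmx c *m C = 0 by rewrite -E0 L0 add0r.
rewrite -(hsubmxK c).
have -> : lsubmx c = 0 by apply: (row_free_inj (row_base_free E)); rewrite L0 mul0mx.
have -> : rsubmx c = 0 by apply: (row_free_inj (row_base_free (E^C)%MS)); rewrite R0 mul0mx.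
by rewrite row_mx0.
Qed.

(** For fixed s the map F is the orbit map of one point y0 composed with l, so its derivatives in a
    are vertical by [vertical_orbit_map]. *)
Let vertical_direction U V phi y (e : 'rV[R]_d) : is_chart U V phi F -> V `<=` good ->
  U y -> vertical act y (chart_vec phi F y (row_mx e 0)).
Proof.
move=> ch Vg Uy; have Vy := chartV ch Uy.
set a := lsubmx (phi y); set s := rsubmx (phi y).
have phiE : phi y = row_mx 0 s + a *m row_mx 1%:M 0.
  by rewrite mul_mx_row mulmx1 mulmx0 add_row_mx add0r addr0 hsubmxK.
have sl : smooth_map_at l a.
  apply: (affine_param_smooth chG).
  have [+ _] := Vg _ Vy; rewrite -{1}(hsubmxK (phi y)) mul_row_col mulmx0 addr0.
  exact.
have l0 : l 0 = 1%g by exact: (affine_param0 chG).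
pose y0 := F (row_mx 0 s).
have E1 : F \o (fun a : 'rV[R]_d => row_mx 0 s + a *m row_mx 1%:M 0) = act^~ y0 \o l.
  apply/funext => b /=; rewrite mul_mx_row mulmx1 mulmx0 add_row_mx add0r addr0.
  by rewrite /y0 /F !row_mxKl !row_mxKr l0 (act1 hact).
have yE : act (l a) y0 = y.
  have /= <- := congr1 (fun h => h a) E1.
  by rewrite -phiE (chartK ch).
have := vertical_orbit_map hG hact y0 (tangent_tmap hGc sl (derive_tangent a e)).
rewrite yE -tmap_comp; last exact: smooth_act_l.
rewrite -E1 tmap_comp; last first.
  by rewrite -phiE; exact: (chart_psi ch).
rewrite affine_tmap /chart_vec -phiE mul_mx_row mulmx1 mulmx0.
exact.
Qed.

(** The coordinate vectors of a are vertical at every point of the chart and span the vertical space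
    at x. That they still span it near x is what the local constancy of the rank provides. *)
Lemma leaf_chart_here : inhabited (leaf_chart x).
Proof.
have gs : \forall b \near (0 : 'rV[R]_(d + m)), smooth_map_at F b.
  apply: nearS good0 => b; exact: F_smooth.
have dmn : n = (d + m)%N by rewrite /d /m mxrank_compl subnKC// rank_leq_col.
have U0F : U0 (F 0) by rewrite F0.
have [U [V [phi [ch V0' Vg]]]] := inverse_function_param_dim dmn hMc ch0 U0F good0 gs F_inj.
have Ux : U x by rewrite -F0; exact: (chartU ch).
have phix : phi x = 0 by rewrite -F0 (chartVK ch).
pose u i y := chart_vec phi F y (row_mx (delta_mx 0 i) 0 : 'rV[R]_(d + m)).
have comb y (c : 'rV[R]_d) : U y ->
    \sum_i c 0 i *: u i y = chart_vec phi F y (row_mx c 0).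
  move=> Uy; rewrite -(chart_vec_sum _ _ hMc ch Uy); congr chart_vec.
  apply/rowP => j; rewrite summxE; case: (split_ordP j) => k ->; rewrite ?row_mxEl ?row_mxEr.
    rewrite [in RHS](row_sum_delta c) summxE; apply: eq_bigr => i _.
    by rewrite mxE row_mxEl [RHS]mxE.
  by rewrite big1 ?mxE// => i _; rewrite mxE row_mxEr mxE mulr0.
have near_vertical : \forall y \near x, forall v, vertical act y v ->
    exists c : 'I_d -> R, v = \sum_i c i *: u i y.
  apply: (vertical_rank hDelta hDeltaV hVDelta).
    move=> v /verticalP[xi txi ->].
    have [c cE] : exists c : 'rV[R]_d,
        (\row_i xi (fun y => phiG y 0 i)) *m E = c *m row_base E.
      by apply/submxP; rewrite eq_row_base submxMl.
    exists (fun i => c 0 i); rewrite comb// /chart_vec phix F_tmap.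
    rewrite row_mxKl row_mxKr mul0mx -(chart_vec_id chG hGc UG1 txi).
    apply: (chart_tan_inj ch0 hMc U0x).
    - by apply: (tangent_generator hM hG hact); exact: (chart_vec_tangent chG hGc).
    - apply: tangentD; last exact: (chart_vec_tangent ch0 hMc).
      by apply: (tangent_generator hM hG hact); exact: (chart_vec_tangent chG hGc).
    move=> j; rewrite tvecD !generator_coord (chart_vec_coord ch0)// [X in _ + X]mxE addr0.
    by rewrite -mulmxA DE -cE.
  apply: filterS (chart_nearU ch Ux) => y Uy; split.
    by move=> i; exact: (vertical_direction _ ch Vg Uy).
  move=> c; have := comb y (\row_i c i) Uy.
  under eq_bigr do rewrite mxE.
  move=> -> E0 i.
  have := congr1 (fun v : tvec M => v (fun y => phi y 0 (lshift m i))) E0.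
  by rewrite (chart_vec_coord ch)// row_mxEl mxE.
have [r [[chr subr] r0]] := filter_ex (filterI (chart_ball ch Ux near_vertical) (nbhs_right_gt 0)).
rewrite phix in chr subr.
have {}r0 : 0 < r by exact: r0.
have Vr (w : 'rV[R]_(d + m)) : ball 0 r w -> V w.
  move=> wr; have [UFw _] := chartU chr wr.
  by have := chartV ch UFw; rewrite (chartVK chr wr).
have l0 : l 0 = 1%g by exact: (affine_param0 chG).
apply: inhabits; refine (@LeafChart x d m r (U `&` phi @^-1` ball 0 r) phi F l r0 chr _ phix _ l0 _ _).
- by split=> //=; rewrite phix; exact: ballxx.
- move=> a ar; apply: (affine_param_smooth chG).
  have : ball 0 r (row_mx a (0 : 'rV[R]_m)).
    by apply: ball_row_mx => //; exact: ballxx.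
  by move=> /Vr/Vg[]; rewrite mul_row_col mulmx0 addr0.
- by move=> w _; rewrite /F row_mxKl row_mxKr l0 (act1 hact).
move=> y v Uy; split=> [vv|[tv v0]].
  split; first exact: (vertical_tangent hM hG hact).
  have [c ->] := subr _ Uy _ vv.
  move=> j; have := comb y (\row_i c i) Uy.1.
  under eq_bigr do rewrite mxE.
  by move=> ->; rewrite (chart_vec_coord ch) ?row_mxEr ?mxE//; exact: Uy.1.
rewrite -(chart_vec_id ch hMc Uy.1 tv).
have -> : \row_i v (fun y => phi y 0 i) = row_mx (\row_i v (fun y => phi y 0 (lshift m i))) 0.
  apply/rowP => j; case: (split_ordP j) => k ->; rewrite ?row_mxEl ?row_mxEr !mxE//.
exact: (vertical_direction _ ch Vg Uy.1).
Qed.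

End construction.

Lemma leaf_chart_exists x : inhabited (leaf_chart x).
Proof.
have [_ _ /(_ x)[n [U0 [V0 [phi0 [psi0 [ch0 U0x]]]]]]] := hM.
have [[_ _ /(_ 1%g)[n' [UG [VG [phiG [psiG [chG UG1]]]]]]] _ _] := hG.
exact: (leaf_chart_here ch0 U0x chG UG1).
Qed.

End leaf_chart_construction.

Arguments lpsi {R M G act x} l _.
Arguments lmove {R M G act x} l _.
Arguments leaf_vertical {R M G act x} l [y v] _.
Arguments leaf_move_smooth {R M G act x} l [a] _.
Arguments leaf_act {R M G act x} l [u] _.

(** * Invariance of the transversal coordinates under small group elements *)

Section leaf_invariance.
Context {R : realType} {M : smoothSpaceType R} {G : smoothGroupType R}.
Variables (act : G -> M -> M).
Hypotheses (hM : is_manifold M) (hG : is_lie_group G) (hact : smooth_action act).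

Let hMc : cinf_space M := manifold_cinf hM.
Let hGc : cinf_space G := lie_group_cinf hG.

Lemma act_continuous (p : G * M) : {for p, continuous (fun p : G * M => act p.1 p.2)}.
Proof. by have [c _] := smooth_act hact p. Qed.

Lemma near_fst (T T' : topologicalType) (t : T) (t' : T') (P : T -> Prop) :
  (\forall s \near t, P s) -> \forall p \near ((t, t') : T * T'), P p.1.
Proof. by apply: near_comp; exact: cvg_fst. Qed.

Lemma near_snd (T T' : topologicalType) (t : T) (t' : T') (P : T' -> Prop) :
  (\forall s \near t', P s) -> \forall p \near ((t, t') : T * T'), P p.2.
Proof. by apply: near_comp; exact: cvg_snd. Qed.

Lemma near_pairP (T T' : topologicalType) (t : T) (t' : T') (P : T * T' -> Prop) :
  (\forall p \near ((t, t') : T * T'), P p) <->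
  exists W V, [/\ nbhs t W, nbhs t' V & forall s s', W s -> V s' -> P (s, s')].
Proof.
split=> [[[W V] [/= nW nV] sub]|[W [V [nW nV sub]]]].
  by exists W, V; split=> // s s' Ws Vs'; exact: sub.
by exists (W, V) => // -[s s'] [/= Ws Vs']; exact: sub.
Qed.

Section leaf.
Variables (x : M) (L : leaf_chart act x).
Notation U := (ldom L).
Notation phi := (lphi L).
Notation psi := (lpsi L).
Notation a y := (lsubmx (phi y)).
Notation b y := (rsubmx (phi y)).
Let ch := leaf_is_chart L.

Lemma leaf_domE : \forall y \near x, U y.
Proof. exact: (chart_nearU ch (leaf_dom L)). Qed.

Lemma vertical_leaf_coord y v j : U y -> vertical act y v ->
  v (fun y => b y 0 j) = 0.
Proof.
move=> Uy /(leaf_vertical L Uy)[_ /(_ j) <-]; congr v.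
by apply/funext => z; rewrite mxE.
Qed.

Lemma smooth_leaf_coord y j : U y -> smooth_at y (fun y => b y 0 j).
Proof.
move=> Uy; have -> : (fun y => b y 0 j) = (fun y => phi y 0 (rshift _ j)).
  by apply/funext => z; rewrite mxE.
exact: (chart_coord ch).
Qed.

(** For fixed y, the derivative of g |-> b(g y) is the differential of b on a vertical vector, hence
    0. On a ball in a chart of G around 1 this function is therefore constant. *)
Lemma leaf_invariant : \forall p \near ((1%g, x) : G * M),
  [/\ U (act p.1 p.2), U p.2 & b (act p.1 p.2) = b p.2].
Proof.
have : \forall p \near ((1%g, x) : G * M), U (act p.1 p.2).
  apply: (near_comp (act_continuous (p := (1%g, x)))); rewrite /= (act1 hact).
  exact: leaf_domE.
move=> /near_pairP[W [V [nW nV WV]]].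
have [[_ _ /(_ 1%g)[n' [UG [VG [phiG [psiG [chG UG1]]]]]]] _ _] := hG.
have [r [[chr subr] r0]] := filter_ex (filterI (chart_ball chG UG1 nW) (nbhs_right_gt 0)).
apply/near_pairP; exists (UG `&` phiG @^-1` ball (phiG 1%g) r), V; split=> //.
  by apply: (chart_nearU chr); split=> //; exact: ballxx.
move=> g y [Ug gr] Vy; have W1 := nbhs_singleton nW.
split; first by apply: WV => //; exact: subr.
  by have := WV _ _ W1 Vy; rewrite /= (act1 hact).
apply/rowP => j.
pose f u := b (act (psiG u) y) 0 j.
have sf u : ball (phiG 1%g) r u -> U (act (psiG u) y) /\ smooth_at (psiG u) (fun g => b (act g y) 0 j).
  move=> ur; have UA : U (act (psiG u) y).
    by apply: WV => //; apply: subr; exact: (chartU chr).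
  split=> //; have [_] := smooth_act_l hG hact y (psiG u).
  by move=> /(_ (fun y => b y 0 j)); apply; exact: smooth_leaf_coord.
have ef u : ball (phiG 1%g) r u -> euclidean_smooth_at u f.
  move=> ur; have [_ s] := sf u ur.
  by have [_ sp] := chart_psi chr ur; exact: (sp _ s).
have df u i : ball (phiG 1%g) r u -> 'D_(delta_mx 0 i) f u = 0.
  move=> ur; have [UA s] := sf u ur.
  have tu : tangent (psiG u) (tmap psiG u (partial_vec u (delta_mx 0 i))).
    by apply: tangent_tmap => //; [exact: (chart_psi chr) | exact: derive_tangent].
  have := vertical_leaf_coord j UA (vertical_orbit_map hG hact y tu).
  rewrite tmapE; last exact: smooth_leaf_coord.
  rewrite tmapE; last exact: s.
  rewrite partial_vecE; last exact: ef.
  by rewrite (bigD1 i)//= mxE !eqxx mul1r big1 ?addr0// => k /negPf ki; rewrite mxE ki andbF mul0r.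
have /= := @lipschitz_of_partials R n' f (phiG 1%g) r 0 (phiG g) (phiG 1%g) _ _ gr (ballxx _ r0).
rewrite mulr0 mul0r normr_le0 subr_eq0 /f (chartK chG Ug) (chartK chG UG1) (act1 hact) => H.
apply/eqP; apply: H; first by move=> u /ef; exact: es_diff.
by move=> u i ur; rewrite df// normr0.
Qed.

(** The partial is taken in y alone, but in a chart of G times the leaf chart it is a partial of one
    smooth function of both variables. Joint continuity in (g, y) makes estimates uniform over the
    compact stabilizer possible. *)
Lemma partial_act_continuous k i j : U (act k x) ->
  {for (k, x), continuous (fun p : G * M =>
     'D_(delta_mx 0 i) (fun u => phi (act p.1 (psi u)) 0 j) (phi p.2))}.
Proof.
move=> Uk; have [[_ _ /(_ k)[n' [UG [VG [phiG [psiG [chG UGk]]]]]]] _ _] := hG.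
pose f (w : 'rV[R]_(n' + (ldim L + lcodim L))) := phi (act (psiG (lsubmx w)) (psi (rsubmx w))) 0 j.
pose w0 := row_mx (phiG k) (phi x).
have cl : smooth_map_at (lsubmx : 'rV[R]_(n' + (ldim L + lcodim L)) -> _) w0.
  apply/rV_smooth_map; first exact: cinf_rV.
  move=> q; have := es_coord w0 (lshift _ q).
  by apply: es_near; apply: nearT => w; rewrite mxE.
have cr : smooth_map_at (rsubmx : 'rV[R]_(n' + (ldim L + lcodim L)) -> _) w0.
  apply/rV_smooth_map; first exact: cinf_rV.
  move=> q; have := es_coord w0 (rshift _ q).
  by apply: es_near; apply: nearT => w; rewrite mxE.
have ef : euclidean_smooth_at w0 f.
  have sa : smooth_map_at (psiG \o lsubmx) w0.
    apply: (smooth_map_at_comp cl); rewrite row_mxKl.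
    by apply: (chart_psi chG); exact: (chartV chG).
  have sb : smooth_map_at (psi \o rsubmx) w0.
    apply: (smooth_map_at_comp cr); rewrite row_mxKr.
    by apply: (chart_psi ch); apply: (chartV ch); exact: leaf_dom.
  have [_ s] := smooth_act_comp hact (cinf_rV _) sa sb.
  apply: (s (fun y => phi y 0 j)).
  rewrite /= row_mxKl row_mxKr (chartK chG UGk) (chartK ch (leaf_dom L)).
  exact: (chart_coord ch).
have cD := es_continuous (es_partial (rshift n' i) ef).
have cw : {for (k, x), continuous (fun p : G * M => row_mx (phiG p.1) (phi p.2))}.
  have -> : (fun p : G * M => row_mx (phiG p.1) (phi p.2)) =
      fun p => \row_q split_fun (fun i => phiG p.1 0 i) (fun i => phi p.2 0 i) q.
    apply/funext => p; apply/rowP => q; rewrite [RHS]mxE.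
    by case: (split_ordP q) => q' ->; rewrite ?split_funl ?split_funr ?row_mxEl ?row_mxEr.
  apply: continuous_row => q; case: (split_ordP q) => q' ->.
    rewrite (_ : (fun _ => _) = (fun g => phiG g 0 q') \o fst); last first.
      by apply/funext => p; rewrite split_funl.
    apply: continuous_comp; first exact: cvg_fst.
    apply: (sm_continuous hGc); exact: (chart_coord chG).
  rewrite (_ : (fun _ => _) = (fun g => phi g 0 q') \o snd); last first.
    by apply/funext => p; rewrite split_funr.
  apply: continuous_comp; first exact: cvg_snd.
  by apply: (sm_continuous hMc); apply: (chart_coord ch); exact: leaf_dom.
apply: (near_eq_continuous (f := fun p : G * M => 'D_(delta_mx 0 (rshift n' i)) f (row_mx (phiG p.1) (phi p.2)))); last first.
  exact: (continuous_comp cw cD).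
have nk : \forall p \near ((k, x) : G * M), UG p.1.
  by apply: near_fst; exact: (chart_nearU chG).
apply: filterS nk => p Up; rewrite /derive.
have shift (h : R) : f (h *: delta_mx 0 (rshift n' i) + row_mx (phiG p.1) (phi p.2)) =
    phi (act p.1 (psi (h *: delta_mx 0 i + phi p.2))) 0 j.
  rewrite /f; have -> : lsubmx (h *: delta_mx 0 (rshift n' i) + row_mx (phiG p.1) (phi p.2)) = phiG p.1.
    apply/rowP => q; rewrite !mxE /=; case: splitP => // q' qq'.
      rewrite (_ : _ == _ = false) ?andbF ?mulr0 ?add0r; last first.
        by apply/negbTE/eqP => /(congr1 val) /= E; have := ltn_ord q; rewrite E ltnNge leq_addr.
      by congr (phiG p.1 _ _); apply: val_inj.
    by have := ltn_ord q; rewrite -[nat_of_ord q]/(nat_of_ord (lshift (ldim L + lcodim L) q)) qq' ltnNge leq_addr.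
  have -> : rsubmx (h *: delta_mx 0 (rshift n' i) + row_mx (phiG p.1) (phi p.2)) = h *: delta_mx 0 i + phi p.2.
    apply/rowP => q; rewrite mxE mxE row_mxEr !mxE.
    by rewrite (inj_eq (@rshift_inj _ _)).
  by rewrite (chartK chG Up).
have f0 : f (row_mx (phiG p.1) (phi p.2)) = phi (act p.1 (psi (phi p.2))) 0 j.
  by have := shift 0; rewrite !scale0r !add0r.
apply: (f_equal (fun F : R -> R => lim (F @ 0^'))); apply/funext => h /=.
by rewrite f0 shift.
Qed.

End leaf.
End leaf_invariance.

(** * Stabilizers and slices *)

Section stabilizers.
Context {R : realType} {M : smoothSpaceType R} {G : smoothGroupType R}.
Variables (act : G -> M -> M).
Hypotheses (hM : is_manifold M) (hG : is_lie_group G) (hact : smooth_action act)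
  (hproper : proper_action act).

Let hMc : cinf_space M := manifold_cinf hM.
Let hGc : cinf_space G := lie_group_cinf hG.

Lemma cont_act (T : topologicalType) (f : T -> G) (h : T -> M) t :
  {for t, continuous f} -> {for t, continuous h} ->
  {for t, continuous (fun t => act (f t) (h t))}.
Proof.
move=> cf ch; have c : {for t, continuous (fun t => (f t, h t))} by exact: cvg_pair.
exact: (continuous_comp c (act_continuous hact (p := (f t, h t)))).
Qed.

Lemma cont_mul (T : topologicalType) (f h : T -> G) t :
  {for t, continuous f} -> {for t, continuous h} ->
  {for t, continuous (fun t => (f t * h t)%g)}.
Proof.
move=> cf ch; have c : {for t, continuous (fun t => (f t, h t))} by exact: cvg_pair.
have [_ [cm _] _] := hG.
exact: (continuous_comp c (cm (f t, h t))).
Qed.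

Lemma cont_inv (T : topologicalType) (f : T -> G) t :
  {for t, continuous f} -> {for t, continuous (fun t => (f t)^-1%g)}.
Proof. by move=> cf; have [_ _ [ci _]] := hG; exact: (continuous_comp cf (ci (f t))). Qed.

Section stabilizer.
Variable x : M.
Notation K := (stabilizer act x).

Lemma stab1 : K 1%g. Proof. exact: (act1 hact). Qed.

Lemma stabM g h : K g -> K h -> K (g * h)%g.
Proof. by rewrite /stabilizer /= (actM hact) => Kg ->. Qed.

Lemma stabV g : K g -> K g^-1%g.
Proof. by rewrite /stabilizer /= => Kg; rewrite -{1}Kg (actK hact). Qed.

Lemma stab_compact : compact K.
Proof.
have := hproper (@compact_set1 _ (x, x)).
set A := [set p | _]; move=> cA.
have -> : K = fst @` A.
  apply/seteqP; split=> [g Kg|g [[h y] /= [hy yx] <-]].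
    by exists (g, x) => //=; rewrite /A /= Kg.
  by rewrite /stabilizer /= -{1}yx.
by apply: continuous_compact cA; apply: continuous_subspaceT => p; exact: cvg_fst.
Qed.

Lemma tmap_act k v f : K k -> smooth_at x f -> tmap (act k) x v f = v (f \o act k).
Proof. by move=> Kk sf; rewrite tmapE// Kk. Qed.

Lemma tangent_stab k v : K k -> tangent x v -> tangent x (tmap (act k) x v).
Proof.
move=> Kk tv; rewrite -{1}Kk; apply: tangent_tmap => //.
exact: smooth_act_r.
Qed.

Lemma tmap_actM g h y v :
  tmap (act (g * h)%g) y v = tmap (act g) (act h y) (tmap (act h) y v).
Proof.
rewrite -tmap_comp; last exact: smooth_act_r.
by congr tmap; apply/funext => z /=; rewrite (actM hact).
Qed.

Lemma tmap_act1 y v : tangent y v -> tmap (act 1%g) y v = v.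
Proof.
by move=> tv; rewrite (_ : act 1%g = id) ?tmap_id//; apply/funext => z; exact: (act1 hact).
Qed.

(** The tube lemma for the compact stabilizer. *)
Lemma stab_near_covering (P : M -> G -> Prop) :
  (forall k, K k -> \forall p \near ((k, x) : G * M), P p.2 p.1) ->
  \forall y \near x, forall k, K k -> P y k.
Proof.
move=> H; have /compact_near_coveringP/(_ _ (nbhs x) P) := stab_compact.
by move=> HC; apply: (HC _) => k Kk; exact: H.
Qed.

Lemma stab_bounded (f : G -> R) : (forall k, K k -> {for k, continuous f}) ->
  exists B, forall k, K k -> `|f k| <= B.
Proof.
move=> cf; have /compact_near_coveringP/(_ _ (+oo%R) (fun B k => `|f k| <= B)) := stab_compact.
move=> HC; have [] := HC _.
  move=> k Kk; have /cvgrPdist_le/(_ _ ltr01) H := cf k Kk.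
  exists ([set h | `|f k - f h| <= 1], [set B | `|f k| + 1 <= B]).
    by split; [exact: H | apply: nbhs_pinfty_ge; exact: num_real].
  move=> [h B] /= [h1 hB]; apply: le_trans hB.
  rewrite -lerBlDl; apply: le_trans h1.
  by rewrite distrC lerB_dist.
move=> A [Ar H]; exists (A + 1) => k Kk; apply: (H (A + 1)) => //.
by rewrite ltrDl.
Qed.

Variable L : leaf_chart act x.
Notation U := (ldom L).
Notation phi := (lphi L).
Notation psi := (lpsi L).
Notation l := (lmove L).
Notation a y := (lsubmx (phi y)).
Notation b y := (rsubmx (phi y)).
Notation n := (ldim L + lcodim L)%N.
Let ch := leaf_is_chart L.
Let Ux := leaf_dom L.
Let phix := leaf_center L.

Definition stab_mx (k : G) (y : M) (i j : 'I_n) : R :=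
  'D_(delta_mx 0 i) (fun u => phi (act k (psi u)) 0 j) (phi y).

Lemma stab_mxE k v j : K k -> tangent x v ->
  tmap (act k) x v (fun y => phi y 0 j) = \sum_i v (fun y => phi y 0 i) * stab_mx k x i j.
Proof.
move=> Kk tv; have sj := chart_coord ch j Ux.
rewrite tmap_act// (chart_deriv ch hMc Ux)//.
by have [_] := smooth_act_r hM hact k x; apply; rewrite Kk.
Qed.

Lemma stab_mx_continuous k i j : K k ->
  {for (k, x), continuous (fun p : G * M => stab_mx p.1 p.2 i j)}.
Proof. by move=> Kk; apply: (partial_act_continuous hM hG hact); rewrite Kk. Qed.

Lemma stab_mx_uniform (e : R) : 0 < e ->
  \forall y \near x, forall k, K k ->
    U (act k y) /\ forall i j, `|stab_mx k y i j - stab_mx k x i j| <= e.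
Proof.
move=> e0; apply: stab_near_covering => k Kk.
have H1 : \forall p \near ((k, x) : G * M), U (act p.1 p.2).
  by apply: (near_comp (act_continuous hact (p := (k, x)))); rewrite /= Kk; exact: leaf_domE.
have H2 : \forall p \near ((k, x) : G * M), forall i j,
    `|stab_mx p.1 p.2 i j - stab_mx p.1 x i j| <= e.
  apply: near_forall => i; apply: near_forall => j.
  have e2 : 0 < e / 2 by rewrite divr_gt0.
  have /cvgrPdist_le/(_ _ e2)/near_pairP[W [V [nW nV H]]] := stab_mx_continuous (i := i) (j := j) Kk.
  apply/near_pairP; exists W, V; split=> // h y Wh Vy.
  have A1 := H _ _ Wh Vy; have A2 := H _ _ Wh (nbhs_singleton nV).
  rewrite /= in A1 A2 *; rewrite (splitr e) -(subrKA (stab_mx k x i j)) (le_trans (ler_normD _ _))//.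
  by rewrite lerD// distrC.
by apply: filterS2 H1 H2 => p; split.
Qed.

End stabilizer.
Arguments stab_mx {x} L k y i j.

Section momentum.
Variables (br : (M -> R) -> (M -> R) -> (M -> R)) (J : M -> covec M -> tvec M)
  (om : M -> tvec M -> tvec M -> R) (P : M -> covec G).
Hypotheses (hJ : bracket_map br J) (hom : nondegenerate_two_form om)
  (hJom : inverse_of_form J om) (hGJ : action_preserves_map act J)
  (hP : is_momentum_map act om P).

(** Equivariance keeps the orbit of a point of the zero level inside that level, so P is constant
    along it. *)
Lemma momentum_vertical x xi v : lie_algebra G xi -> P x = 0 -> vertical act x v ->
  v (fun y => P y xi) = 0.
Proof.
move=> txi Px /verticalP[eta te ->]; have [_ sP eP _] := hP.
rewrite (generatorE hact); last exact: sP.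
rewrite (_ : (fun _ => _) = fun=> 0); last by apply/funext => g; rewrite eP// Px.
exact: (tan_cst hGc _ te).
Qed.

Lemma generator_J x xi : lie_algebra G xi ->
  generator act xi x = J x (differential (fun y => P y xi) x).
Proof.
move=> txi; have [lin _ _ nondeg] := hom; have [_ _ _ dP] := hP.
set al := differential _ _; have ca : cotangent x al by exact: cotangent_differential.
have tJ : tangent x (J x al) by have [[+ _ _ _] _] := hJ; apply.
have tg := tangent_generator hM hG hact x txi.
apply/eqP; rewrite -subr_eq0; apply/eqP; apply: (nondeg x).
  exact: tangentB.
move=> v tv; have -> : generator act xi x - J x al = (-1) *: J x al + generator act xi x.
  by rewrite scaleN1r addrC.
by rewrite lin// hJom// mulN1r -dP// addNr.
Qed.

Lemma stab_J x k al : stabilizer act x k -> cotangent x al ->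
  (forall v, tangent x v -> al (tmap (act k) x v) = al v) ->
  tmap (act k) x (J x al) = J x al.
Proof.
move=> Kk ca inv; have := hGJ (g := k) (x := x) (a := al); rewrite Kk => /(_ ca) E.
rewrite [RHS]E; suff -> : cotmap (act k) x al = al by [].
apply/funext => v.
have [tv|nv] := pselect (tangent x v); first by rewrite cotmapE ?inv.
by rewrite /cotmap /extend0 patchN ?ca.2//; apply: contra_notN nv => /set_mem.
Qed.

Section fixed_point.
Variables (x : M) (L : leaf_chart act x).
Hypothesis Px : P x = 0.
Notation K := (stabilizer act x).
Notation U := (ldom L).
Notation phi := (lphi L).
Notation psi := (lpsi L).
Notation l := (lmove L).
Notation a y := (lsubmx (phi y)).
Notation b y := (rsubmx (phi y)).
Notation n := (ldim L + lcodim L)%N.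
Let ch := leaf_is_chart L.
Let Ux := leaf_dom L.
Let phix := leaf_center L.

(* dk is unipotent, being the identity on the vertical space and modulo it, and its powers stay bounded by
   compactness of K. *)
Lemma stab_tmap_id k : K k ->
  (forall v j, tangent x v -> tmap (act k) x v (fun y => b y 0 j) = v (fun y => b y 0 j)) ->
  forall v, tangent x v -> tmap (act k) x v = v.
Proof.
move=> Kk kb.
have vert v : tangent x v -> vertical act x (tmap (act k) x v - v).
  move=> tv; apply/(leaf_vertical L Ux); split; first by apply: tangentB => //; exact: tangent_stab.
  move=> j; have -> : (fun y => phi y 0 (rshift (ldim L) j)) = (fun y => b y 0 j).
    by apply/funext => y; rewrite mxE.
  by rewrite tvecD tvecN kb// subrr.
(* The differential of each P_xi is unchanged by dk, because dk v - v is vertical and the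
   differential vanishes on vertical vectors. Its image under the invariant J, which is the
   generator of xi, is therefore fixed. *)
have fixv v : vertical act x v -> tmap (act k) x v = v.
  move=> /verticalP[xi txi ->]; rewrite generator_J//.
  apply: stab_J => //; first exact: cotangent_differential.
  move=> v' tv'; have tk := tangent_stab Kk tv'.
  rewrite !differentialE//; apply/eqP; rewrite -subr_eq0; apply/eqP.
  exact: (momentum_vertical txi Px (vert _ tv')).
move=> v tv; set w := tmap (act k) x v - v.
have dk : tmap (act k) x v = v + w by rewrite /w addrC subrK.
have Kn N : K (k ^+ N)%g.
  by elim: N => [|N IH]; [rewrite expg0; exact: stab1 | rewrite expgS; exact: stabM].
have iterE N : tmap (act (k ^+ N)%g) x v = v + N%:R *: w.
  elim: N => [|N IH]; first by rewrite expg0 scale0r addr0 tmap_act1.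
  rewrite expgS tmap_actM Kn IH tmapD tmapZ dk (fixv w (vert _ tv)).
  by rewrite -addrA -natr1 scalerDl scale1r [w + _]addrC.
apply/eqP; rewrite -subr_eq0 -/w; apply/eqP.
have tw : tangent x w by apply: tangentB => //; exact: tangent_stab.
apply: (chart_tan_inj ch hMc Ux tw (tangent0 _)) => j; rewrite tvec0.
have Bi i : exists B, forall h, K h -> `|stab_mx L h x i j| <= B.
  apply: stab_bounded => h Kh.
  have c := stab_mx_continuous (L := L) (i := i) (j := j) Kh.
  have cx : {for h, continuous (fun h : G => (h, x))} by apply: cvg_pair; [exact: cvg_id | exact: cvg_cst].
  exact: (continuous_comp cx c).
have [B0 HB0] := choice Bi.
pose B := \sum_i `|v (fun y => phi y 0 i)| * B0 i.
have HB h : K h -> `|\sum_i v (fun y => phi y 0 i) * stab_mx L h x i j| <= B.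
  move=> Kh; apply: le_trans (ler_norm_sum _ _ _) _; apply: ler_sum => i _.
  by rewrite normrM ler_wpM2l// HB0.
apply/eqP/negPn/negP => w0.
have wgt : 0 < `|w (fun y => phi y 0 j)| by rewrite normr_gt0.
(* N |w_j| exceeds B + |v_j|, which contradicts the bound B on the j-th coordinate of v + N w. *)
pose N := (Num.truncn ((B + `|v (fun y => phi y 0 j)|) / `|w (fun y => phi y 0 j)|)).+1.
have := HB _ (Kn N); rewrite -stab_mxE// iterE tvecD tvecZ leNgt => /negP; apply.
have : (B + `|v (fun y => phi y 0 j)|) / `|w (fun y => phi y 0 j)| < N%:R by exact: truncnS_gt.
rewrite ltr_pdivrMr// => H.
rewrite -ltrBrDr in H; apply: lt_le_trans H _.
rewrite -[X in X * _]ger0_norm// -normrM.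
have := lerB_normD (N%:R * w (fun y => phi y 0 j)) (v (fun y => phi y 0 j)).
by rewrite [X in _ <= `|X| -> _]addrC.
Qed.

(** The kernel of the isotropy representation. It contains a neighbourhood of 1 in K, so by
    compactness K modulo this subgroup is finite. *)
Definition ineffective : set G :=
  [set k | K k /\ forall v, tangent x v -> tmap (act k) x v = v].

Lemma ineffectiveM g h : ineffective g -> ineffective h -> ineffective (g * h)%g.
Proof.
move=> [Kg ig] [Kh ih]; split; first exact: stabM.
by move=> v tv; rewrite tmap_actM Kh ih// ig.
Qed.

Lemma near_ineffective : \forall k \near (1%g : G), K k -> ineffective k.
Proof.
have /near_pairP[W [V [nW nV H]]] := leaf_invariant hG hact L.
apply: filterS nW => k Wk Kk; split=> //; apply: stab_tmap_id => // v j tv.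
rewrite tmap_act//; last exact: smooth_leaf_coord.
apply: (tan_near hMc tv); apply: filterS nV => y Vy.
by have [_ _ /= ->] := H _ _ Wk Vy.
Qed.

Let stab_mx_ineffective k i j : ineffective k -> stab_mx L k x i j = (i == j)%:R.
Proof.
move=> [Kk ik]; have tv := chart_vec_tangent ch hMc (delta_mx 0 i) Ux.
have := ik _ tv => /(congr1 (fun v : tvec M => v (fun y => phi y 0 j))).
rewrite stab_mxE// (chart_vec_coord ch)// mxE eqxx /= (eq_sym i j) => <-.
rewrite (bigD1 i)//= (chart_vec_coord ch)// mxE !eqxx mul1r big1 ?addr0// => q /negPf qi.
by rewrite (chart_vec_coord ch)// mxE qi andbF mul0r.
Qed.

(** Every ineffective k has the identity as Jacobian at x, and by compactness of K the Jacobians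
    stay close to their values at x on one ball for all k. *)
Let displacement_lipschitz : exists2 d : R, 0 < d & forall k, ineffective k ->
  forall u u', ball 0 d u -> ball 0 d u' ->
  `|(phi (act k (psi u)) - u) - (phi (act k (psi u')) - u')| <= 2^-1 * `|u - u'|.
Proof.
pose c : R := (2 * n.+1%:R)^-1.
have c0 : 0 < c by rewrite invr_gt0 mulr_gt0.
have H := stab_mx_uniform L c0.
have [d [[chd subd] d0]] := filter_ex (filterI (chart_ball ch Ux H) (nbhs_right_gt 0)).
have {}d0 : 0 < d by exact: d0.
rewrite phix in chd subd; exists d => // k ik u u' ud u'd.
have Kk := ik.1.
have good (z : 'rV[R]_n) : ball 0 d z -> U (act k (psi z)) /\
    forall i j, `|stab_mx L k (psi z) i j - stab_mx L k x i j| <= c.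
  by move=> zd; apply: (subd (psi z)) => //; exact: (chartU chd).
have phiz z : ball 0 d z -> phi (psi z) = z by move=> zd; exact: (chartVK chd).
have er z j : ball 0 d z -> euclidean_smooth_at z (fun w => phi (act k (psi w)) 0 j).
  move=> zd; have [Uz _] := good z zd.
  have sa := smooth_map_at_comp (chart_psi chd zd) (smooth_act_r hM hact k (psi z)).
  by have [_ s] := sa; exact: (s _ (chart_coord ch j Uz)).
have em z j : ball 0 d z -> euclidean_smooth_at z (fun w : 'rV[R]_n => -1 * w 0 j).
  by move=> zd; apply: esM; [exact: es_cst | exact: es_coord].
rewrite [leLHS]/Num.Def.normr/= mx_normrE; apply: bigmax_le => [|[i j] _].
  by rewrite mulr_ge0// invr_ge0.
pose f (w : 'rV[R]_n) := phi (act k (psi w)) 0 j + -1 * w 0 j.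
have := @lipschitz_of_partials R n f 0 d c u u' _ _ ud u'd.
have -> : (phi (act k (psi u)) - u - (phi (act k (psi u')) - u')) (i, j).1 (i, j).2 = f u - f u'.
  by rewrite (ord1 i) !mxE /f /=; ring.
move=> Lip; apply: le_trans (Lip _ _) _.
- by move=> z zd; apply: es_diff; apply: esD; [exact: er | exact: em].
- move=> z q zd; have [_ /(_ q j)] := good z zd.
  rewrite stab_mx_ineffective// /stab_mx phiz// /f.
  rewrite deriveD; last 2 first.
  - by apply/diff_derivable/es_diff; exact: er.
  - by apply/diff_derivable/es_diff; exact: em.
  rewrite deriveM; [|exact: derivable_cst|by apply/diff_derivable/es_diff; exact: es_coord].
  by rewrite derive_cst scaler0 addr0 partial_coord scaleN1r.
apply: ler_wpM2r => //; rewrite /c invfM mulrCA -[leRHS]mulr1 ler_wpM2l ?invr_ge0//.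
by rewrite ler_pdivrMr// mul1r ler_nat.
Qed.

(* With u_i = phi (k^i y), the identity 2 (u_1 - u_0) = (u_2 - u_0) - ((u_2 - u_1) - (u_1 - u_0)) improves
   any common bound D of the displacements to 3/4 D. *)
Lemma ineffective_trivial : \forall y \near x, forall k, ineffective k -> act k y = y.
Proof.
have [d d0 Lip] := displacement_lipschitz.
have : \forall y \near x, U y /\ forall k, K k -> U (act k y) /\ ball 0 d (phi (act k y)).
  have H : \forall y \near x, forall k, K k -> U (act k y) /\ ball 0 d (phi (act k y)).
    apply: (@stab_near_covering x (fun y k => U (act k y) /\ ball 0 d (phi (act k y)))) => k Kk.
    apply: (near_comp (act_continuous hact (p := (k, x))) (P := fun z => U z /\ ball 0 d (phi z))).
    rewrite /= Kk; apply: filterI; first exact: leaf_domE.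
    have [c _] := chart_phi ch Ux; apply: (near_comp c); rewrite phix.
    exact: nbhsx_ballx.
  by apply: filterS2 (leaf_domE L) H => y; split.
apply: filterS => y [Uy good] k ik.
have bound : forall N k, ineffective k -> `|phi (act k y) - phi y| <= (3 / 4) ^+ N * (2 * d).
  have yb : ball 0 d (phi y) by have [_] := good _ (stab1 _); rewrite (act1 hact).
  elim=> [|N IH] h ih; have Kh := ih.1; have [Uh bh] := good _ Kh.
    rewrite expr0 mul1r mulr_natl mulr2n.
    move: bh yb; rewrite -!ball_normE /ball_ /= !sub0r !normrN => bh yb.
    by rewrite (le_trans (ler_normB _ _))// lerD// ltW.
  have := Lip h ih _ _ bh yb; rewrite (chartK ch Uh) (chartK ch Uy) -(actM hact) => L1.
  have L2 := IH _ (ineffectiveM ih ih); have L3 := IH _ ih.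
  set u0 := phi y in L1 L2 L3 *; set u1 := phi (act h y) in L1 L3 *.
  set u2 := phi _ in L1 L2; set B := _ * (2 * d) in L2 L3.
  have E : 2 * `|u1 - u0| = `|(u2 - u0) - ((u2 - u1) - (u1 - u0))|.
    rewrite -[X in X * _](ger0_norm (x := 2%:R))// -normrZ scaler_nat mulr2n.
    congr `|_|; apply/rowP => j; rewrite !mxE; ring.
  have := ler_normB (u2 - u0) ((u2 - u1) - (u1 - u0)); rewrite -E exprS -mulrA -/B => L4.
  have : 2 * `|u1 - u0| <= B + 2^-1 * B.
    apply: le_trans L4 _; apply: lerD => //; apply: le_trans L1 _.
    by rewrite ler_wpM2l// invr_ge0.
  lra.
have [Uk _] := good _ ik.1.
rewrite -[LHS](chartK ch Uk) -[RHS](chartK ch Uy); congr (psi _).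
apply/eqP; rewrite -subr_eq0 -normr_le0.
rewrite leNgt; apply/negP => e0.
have q1 : `|3 / 4 : R| < 1 by rewrite ger0_norm; lra.
have d2 : 0 < `|phi (act k y) - phi y| / (2 * d) by rewrite divr_gt0// mulr_gt0.
have [N] := filter_ex (cvgr0_norm_lt _ (cvg_expr q1) _ d2).
rewrite ger0_norm; last by apply: exprn_ge0; lra.
rewrite ltr_pdivlMr; last by rewrite mulr_gt0.
by rewrite ltNge bound.
Qed.

Lemma lmove_continuous (T : topologicalType) (f : T -> 'rV[R]_(ldim L)) t :
  {for t, continuous f} -> f t = 0 -> {for t, continuous (fun t => l (f t))}.
Proof.
move=> cf f0; apply: (continuous_comp cf).
have [c _] := leaf_move_smooth L (ballxx 0 (leaf_rad L)).
by rewrite f0.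
Qed.

Lemma lsub_phi_continuous y : U y -> {for y, continuous (fun y => a y)}.
Proof. by move=> Uy; apply: cont_lsubmx; have [] := chart_phi ch Uy. Qed.

Lemma rsub_phi_continuous y : U y -> {for y, continuous (fun y => b y)}.
Proof. by move=> Uy; apply: cont_rsubmx; have [] := chart_phi ch Uy. Qed.

Lemma lsub_center : a x = 0. Proof. by rewrite phix; apply/rowP => i; rewrite !mxE. Qed.
Lemma rsub_center : b x = 0. Proof. by rewrite phix; apply/rowP => i; rewrite !mxE. Qed.

Lemma leaf_psi0 : psi 0 = x. Proof. by rewrite -phix (chartK ch Ux). Qed.

Lemma leaf_section_continuous : {for x, continuous (fun y => psi (row_mx 0 (b y)))}.
Proof.
have c : {for x, continuous (fun y => row_mx (0 : 'rV[R]_(ldim L)) (b y))}.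
  by apply: cont_row_mx; [exact: cvg_cst | exact: rsub_phi_continuous].
apply: (continuous_comp c); rewrite rsub_center row_mx0.
by have [] := chart_psi ch (ballxx 0 (leaf_rad L)).
Qed.

(* The element l(a(g x))^-1 g fixes x and is close to 1, so it acts trivially near x. *)
Lemma leaf_translate : \forall p \near ((1%g, x) : G * M),
  act p.1 p.2 = act (l (a (act p.1 x))) p.2.
Proof.
have [W [V [nW nV inv]]] := (near_pairP _ _ _).1 (leaf_invariant hG hact L).
pose w g : G := ((l (a (act g x)))^-1 * g)%g.
have c1 : {for (1%g : G), continuous (fun g => act g x)}.
  by apply: cont_act; [exact: cvg_id | exact: cvg_cst].
have c2 : {for (1%g : G), continuous (fun g => a (act g x))}.
  have U1 : U (act 1%g x) by rewrite (act1 hact).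
  exact: (continuous_comp c1 (lsub_phi_continuous U1)).
have w1 : w 1%g = 1%g by rewrite /w (act1 hact) lsub_center leaf_move0 invg1 mulg1.
have cw : {for (1%g : G), continuous w}.
  apply: cont_mul; last exact: cvg_id.
  by apply: cont_inv; apply: lmove_continuous => //; rewrite (act1 hact) lsub_center.
have nw : \forall g \near (1%g : G), K (w g) -> ineffective (w g).
  by apply: (near_comp cw (P := fun h => K h -> ineffective h)); rewrite w1; exact: near_ineffective.
have /near_pairP[W' [V' [nW' nV' triv]]] := near_snd (1%g : G) ineffective_trivial.
apply/near_pairP; exists (W `&` [set g | K (w g) -> ineffective (w g)]), (V' `&` V).
split; [exact: filterI|exact: filterI|].
move=> g y [Wg iw] [V'y Vy] /=.
have [Ugx _ bgx] := inv _ _ Wg (nbhs_singleton nV); rewrite /= rsub_center in Ugx bgx.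
have Kw : K (w g).
  rewrite /stabilizer /= /w (actM hact); apply: (canLR (actVK hact _)).
  rewrite invgK -[LHS](chartK ch Ugx) (leaf_act L); last exact: (chartV ch).
  by rewrite bgx row_mx0 leaf_psi0.
have := triv _ _ (nbhs_singleton nW') V'y _ (iw Kw).
by rewrite /= /w (actM hact) => {2}<-; rewrite (actVK hact).
Qed.

(** Let w be the conjugate of g by l(a y) that fixes the point sg y of the transversal. By
    [leaf_translate] w acts there as l(a(w x)), and distinct values of a give distinct points, so
    a(w x) = 0. As also b(w x) = 0, w fixes x; then w acts trivially near x, in particular at l(a
    y)^-1 x, and this says that g fixes x. *)
Lemma local_stabilizer : \forall p \near ((1%g, x) : G * M),
  act p.1 p.2 = p.2 -> act p.1 x = x.
Proof.
pose sg y := psi (row_mx 0 (b y)).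
pose w (p : G * M) : G := ((l (a p.2))^-1 * p.1 * l (a p.2))%g.
have ca : {for (1%g, x), continuous (fun p : G * M => a p.2)}.
  have c0 : {for (1%g, x), continuous (@snd G M)} by exact: cvg_snd.
  exact: (continuous_comp c0 (lsub_phi_continuous (y := (1%g, x).2) Ux)).
have cl : {for (1%g, x), continuous (fun p : G * M => l (a p.2))}.
  by apply: lmove_continuous => //; exact: lsub_center.
have cw : {for (1%g, x), continuous w}.
  by apply: cont_mul => //; apply: cont_mul; [exact: cont_inv | exact: cvg_fst].
have w1 : w (1%g, x) = 1%g by rewrite /w /= lsub_center leaf_move0 invg1 !mulg1.
have csg : {for x, continuous sg} by exact: leaf_section_continuous.
have sgx : sg x = x by rewrite /sg rsub_center row_mx0 leaf_psi0.
have cp : {for (1%g, x), continuous (fun p : G * M => (w p, sg p.2))}.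
  by apply: cvg_pair => //; apply: (@continuous_comp _ _ _ snd sg) => //; exact: cvg_snd.
have N1 : \forall p \near ((1%g, x) : G * M),
    act (w p) (sg p.2) = act (l (a (act (w p) x))) (sg p.2).
  by apply: (near_comp cp (P := fun p => act p.1 p.2 = act (l (a (act p.1 x))) p.2));
     rewrite w1 /= sgx; exact: leaf_translate.
have N2 : \forall p \near ((1%g, x) : G * M), [/\ U (act (w p) x) & b (act (w p) x) = 0].
  have cp' : {for (1%g, x), continuous (fun p : G * M => (w p, x))}.
    by apply: cvg_pair => //; exact: cvg_cst.
  have : \forall p \near ((1%g, x) : G * M),
      [/\ U (act (w p) x), U x & b (act (w p) x) = b x].
    apply: (near_comp cp' (P := fun q => [/\ U (act q.1 q.2), U q.2 & b (act q.1 q.2) = b q.2])).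
    by rewrite w1; exact: leaf_invariant.
  by apply: filterS => p [] ? _ ->; rewrite rsub_center.
have N3 : \forall p \near ((1%g, x) : G * M), K (w p) -> ineffective (w p).
  by apply: (near_comp cw (P := fun h => K h -> ineffective h)); rewrite w1; exact: near_ineffective.
have N4 : \forall p \near ((1%g, x) : G * M), forall k, ineffective k ->
    act k (act (l (a p.2))^-1%g x) = act (l (a p.2))^-1%g x.
  have c4 : {for (1%g, x), continuous (fun p : G * M => act (l (a p.2))^-1%g x)}.
    by apply: cont_act; [exact: cont_inv | exact: cvg_cst].
  apply: (near_comp c4 (P := fun z => forall k, ineffective k -> act k z = z)).
  by rewrite /= lsub_center leaf_move0 invg1 (act1 hact); exact: ineffective_trivial.
have N5 : \forall p \near ((1%g, x) : G * M), ball 0 (lrad L) (a (act (w p) x)).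
  have c5 : {for (1%g, x), continuous (fun p : G * M => a (act (w p) x))}.
    have c0 : {for (1%g, x), continuous (fun p : G * M => act (w p) x)}.
      by apply: cont_act => //; exact: cvg_cst.
    have U1 : U (act (w (1%g, x)) x) by rewrite w1 (act1 hact).
    exact: (continuous_comp c0 (lsub_phi_continuous U1)).
  apply: (near_comp c5); rewrite w1 (act1 hact) lsub_center; apply: nbhsx_ballx; exact: leaf_rad.
have N0 : \forall p \near ((1%g, x) : G * M), U p.2 by apply: near_snd; exact: leaf_domE.
near=> p => fixp.
have Up : U p.2 by near: p.
have yE : p.2 = act (l (a p.2)) (sg p.2).
  by rewrite -{1}(chartK ch Up) (leaf_act L) //; exact: (chartV ch).
have wsg : act (w p) (sg p.2) = sg p.2.
  rewrite /w (actM hact) -yE (actM hact) fixp {2}yE; exact: (actK hact).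
have bU : ball 0 (lrad L) (b p.2) by apply: ball_rsubmx; exact: (chartV ch).
have a0 : a (act (w p) x) = 0.
  have aU : ball 0 (lrad L) (a (act (w p) x)) by near: p.
  have rU := ball_row_mx (leaf_rad L) aU bU.
  have rU0 := ball_row_mx (leaf_rad L) (ballxx (0 : 'rV[R]_(ldim L)) (leaf_rad L)) bU.
  have : psi (row_mx (a (act (w p) x)) (b p.2)) = psi (row_mx (0 : 'rV[R]_(ldim L)) (b p.2)).
    rewrite (leaf_act L rU) row_mxKl row_mxKr -/(sg p.2) -[RHS]wsg; symmetry.
    by near: p.
  move=> /(congr1 phi); rewrite (chartVK ch rU) (chartVK ch rU0).
  by move=> /eq_row_mx[].
have [Uw b0] : [/\ U (act (w p) x) & b (act (w p) x) = 0] by near: p.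
have Kw : K (w p).
  by rewrite /stabilizer /= -[LHS](chartK ch Uw) -(hsubmxK (phi _)) a0 b0 row_mx0 leaf_psi0.
have iw : ineffective (w p) by move: Kw; near: p.
have : act (w p) (act (l (a p.2))^-1%g x) = act (l (a p.2))^-1%g x by move: iw; move: (w p); near: p.
rewrite /w !(actM hact) (actVK hact) => /(congr1 (act (l (a p.2)))).
by rewrite !(actVK hact).
Unshelve. all: by end_near. Qed.

End fixed_point.
End momentum.
End stabilizers.

Arguments stab_mx {R M G act x} L k y i j.

(** * Sums over coset representatives *)

Section coset_sums.
Context {G : groupType}.
Variables (K N : set G).
Hypotheses (K1 : K 1%g) (N1 : N 1%g)
  (NM : forall g h, N g -> N h -> N (g * h)%g) (NV : forall g, N g -> N g^-1%g).

Let cls (k : G) : set G := [set h | K h /\ N (k^-1 * h)%g].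
Let rep (k : G) : G := xget 1%g (cls k).

Let repP k : K k -> K (rep k) /\ N (k^-1 * rep k)%g.
Proof.
move=> Kk; have : cls k k by split=> //; rewrite mulVg.
by move=> ckk; have := xgetI 1%g ckk.
Qed.

Let rep_eq k h : K k -> K h -> (rep k = rep h <-> N (k^-1 * h)%g).
Proof.
move=> Kk Kh; split=> [E|nkh].
  have [_ nk] := repP Kk; have [_ nh] := repP Kh.
  have -> : (k^-1 * h = (k^-1 * rep k) * (h^-1 * rep h)^-1)%g.
    by rewrite E invgM invgK mulgA mulgK.
  exact: NM nk (NV nh).
congr (xget _ _); apply/seteqP; split=> z [Kz nz]; split=> //.
  have -> : (h^-1 * z = (k^-1 * h)^-1 * (k^-1 * z))%g by rewrite invgM invgK mulgA mulgK.
  exact: NM (NV nkh) nz.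
have -> : (k^-1 * z = (k^-1 * h) * (h^-1 * z))%g by rewrite mulgA mulgK.
exact: NM.
Qed.

(** The list s has one representative of each class of K under k^-1 h in N. A map t that is
    injective on the classes permutes them because they are finitely many, and F only sees the
    class. *)
Lemma coset_representatives (D : seq G) : (forall k, k \in D -> K k) ->
  (forall k, K k -> exists2 g, g \in D & N (g^-1 * k)%g) ->
  exists s : seq G, [/\ (0 < size s)%N, forall k, k \in s -> K k &
    forall (V : nmodType) (F : G -> V),
      (forall k g, K k -> N g -> F (k * g)%g = F k) ->
      forall t : G -> G, (forall k, K k -> K (t k)) ->
      (forall k h, K k -> K h -> N ((t k)^-1 * t h)%g -> N (k^-1 * h)%g) ->
      \sum_(k <- s) F (t k) = \sum_(k <- s) F k].
Proof.
move=> DK cov; pose s := undup (map rep D).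
have sK k : k \in s -> K k.
  by rewrite mem_undup => /mapP[g gD ->]; have [] := repP (DK _ gD).
have reps k : K k -> rep k \in s.
  move=> Kk; have [g gD ng] := cov _ Kk; rewrite mem_undup; apply/mapP; exists g => //.
  by apply/esym/rep_eq => //; exact: DK.
have rep_s k : k \in s -> rep k = k.
  rewrite mem_undup => /mapP[g gD ->]; have Kg := DK _ gD.
  by apply/esym; apply/rep_eq => //; have [] := repP Kg.
exists s; split=> //.
  by rewrite -has_predT; apply/hasP; exists (rep 1%g) => //; exact: reps.
move=> V F Fc t tK tN.
have Frep k : K k -> F (rep k) = F k.
  by move=> Kk; have [_ nk] := repP Kk; have := Fc _ _ Kk nk; rewrite mulgA mulgV mul1g.
have uq : uniq (map (rep \o t) s).
  rewrite map_inj_in_uniq ?undup_uniq// => k h ks hs /= /rep_eq.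
  move=> /(_ (tK _ (sK _ ks)) (tK _ (sK _ hs)))/(tN _ _ (sK _ ks) (sK _ hs)).
  by move=> /(rep_eq (sK _ ks) (sK _ hs)); rewrite !rep_s.
have sub : {subset map (rep \o t) s <= s}.
  by move=> _ /mapP[k ks ->]; apply: reps; apply: tK; exact: sK.
have pe : perm_eq (map (rep \o t) s) s.
  apply: uniq_perm => //; first exact: undup_uniq.
  by have [] := uniq_min_size uq sub; rewrite ?size_map.
rewrite -[RHS](perm_big _ pe) big_map big_seq [RHS]big_seq.
by apply: eq_bigr => k ks; rewrite /= Frep//; apply: tK; exact: sK.
Qed.

End coset_sums.

(** * Averages over the stabilizer *)

Section stabilizer_averages.
Context {R : realType} {M : smoothSpaceType R} {G : smoothGroupType R}.
Variables (act : G -> M -> M).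
Hypotheses (hM : is_manifold M) (hG : is_lie_group G) (hact : smooth_action act)
  (hproper : proper_action act).
Variables (br : (M -> R) -> (M -> R) -> (M -> R)) (J : M -> covec M -> tvec M)
  (om : M -> tvec M -> tvec M -> R) (P : M -> covec G).
Hypotheses (hJ : bracket_map br J) (hom : nondegenerate_two_form om)
  (hJom : inverse_of_form J om) (hGJ : action_preserves_map act J)
  (hP : is_momentum_map act om P).
Variables (x : M) (L : leaf_chart act x).
Hypothesis Px : P x = 0.
Notation K := (stabilizer act x).

Lemma stab_finite_cover (W : set G) : nbhs (1%g : G) W ->
  exists s : seq G, (forall k, k \in s -> K k) /\
    forall k, K k -> exists2 g, g \in s & W (g^-1 * k)%g.
Proof.
move=> nW.
(* The filter of all finite lists containing a given one; near-covering compactness along it is the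
   existence of a finite subcover. *)
pose F : set_system (seq G) := [set A : set (seq G) | exists l : seq G, forall D : seq G, {subset l <= D} -> A D].
have FF : Filter F.
  apply: Build_Filter; first by exists [::].
    move=> A B [l lA] [l' lB]; exists (l ++ l') => D sD; split.
      by apply: lA => g gl; apply: sD; rewrite mem_cat gl.
    by apply: lB => g gl; apply: sD; rewrite mem_cat gl orbT.
  by move=> A B AB [l lA]; exists l => D /lA/AB.
have cK : compact K by exact: stab_compact.
have /(_ _ F (fun D k => exists2 g, g \in D & K g /\ W (g^-1 * k)%g) FF) := (compact_near_coveringP K).1 cK.
move=> [].
  move=> k Kk; exists ([set h | W (k^-1 * h)%g], [set D : seq G | k \in D]).
    split=> /=; last by exists [:: k] => D; apply; rewrite mem_seq1.
    have c : {for k, continuous (fun h => k^-1 * h)%g}.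
      by apply: (cont_mul hG); [exact: cvg_cst | exact: cvg_id].
    by apply: (near_comp c); rewrite mulVg.
  by move=> [h D] [/= Wh kD]; exists k.
move=> l /(_ l (fun g gl => gl)) cov.
exists [seq g <- l | `[< K g >]]; split=> [g|k Kk].
  by rewrite mem_filter => /andP[/asboolP].
by have [g gl [Kg Wg]] := cov _ Kk; exists g => //; rewrite mem_filter gl andbT; apply/asboolP.
Qed.

Lemma ineffective1 : ineffective act x 1%g.
Proof. by split; [exact: stab1 | move=> v tv; rewrite tmap_act1]. Qed.

(** Normality in K: it makes right translations well behaved on the left cosets of the ineffective
    elements. *)
Lemma ineffectiveJ k g : K k -> ineffective act x g -> ineffective act x (k * g * k^-1)%g.
Proof.
move=> Kk [Kg ig]; have KV := stabV hact Kk.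
split; first by apply: (stabM hact) => //; exact: (stabM hact).
move=> v tv; rewrite !(tmap_actM hM hact) KV Kg.
rewrite ig; last exact: (tangent_stab hM hact).
by have := tmap_actM hM hact k k^-1%g x v; rewrite KV mulgV tmap_act1// => <-.
Qed.

Lemma ineffectiveV g : ineffective act x g -> ineffective act x g^-1%g.
Proof.
move=> [Kg ig]; have KV := stabV hact Kg; split=> // v tv.
by rewrite -{1}(ig _ tv) -{1}Kg -(tmap_actM hM hact) mulVg tmap_act1.
Qed.

(** A sum over the finite quotient of K by its ineffective part takes the place of a Haar integral;
    right and left translations by elements of K both permute the cosets. *)
Lemma stab_average : exists s : seq G, [/\ (0 < size s)%N, forall k, k \in s -> K k &
    forall (V : nmodType) (F : G -> V),
      (forall k g, K k -> ineffective act x g -> F (k * g)%g = F k) ->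
      forall h, K h -> \sum_(k <- s) F (k * h)%g = \sum_(k <- s) F k /\
                       \sum_(k <- s) F (h * k)%g = \sum_(k <- s) F k].
Proof.
have nW : nbhs (1%g : G) (fun k => K k -> ineffective act x k) :=
  near_ineffective hM hG hact hproper hJ hom hJom hGJ hP L Px.
have [l [lK cov]] := stab_finite_cover nW.
have [//|k Kk|s [s0 sK Hs]] := @coset_representatives G K (ineffective act x)
    (stab1 hact x) ineffective1
    (fun g h => ineffectiveM hM hact (x := x) (g := g) (h := h)) ineffectiveV l.
  have [g gl Wg] := cov _ Kk; exists g => //.
  by apply: Wg; apply: (stabM hact) => //; apply: (stabV hact); exact: lK.
exists s; split=> // V f Fc h Kh; split; apply: Hs => //.
- by move=> k Kk; exact: (stabM hact).
- move=> k g Kk Kg; rewrite invgM => /(ineffectiveJ Kh).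
  by rewrite !mulgA mulgV mul1g mulgK.
- by move=> k Kk; exact: (stabM hact).
- by move=> k g Kk Kg; rewrite invgM -mulgA mulKg.
Qed.

End stabilizer_averages.

(** * Slices *)

Section slices.
Context {R : realType} {M : smoothSpaceType R} {G : smoothGroupType R}.
Variables (act : G -> M -> M).

(* A leaf chart (a, b) on which the stabilizer of x acts linearly; each y near x is moved by sturn y
   from the transversal a = 0. *)
Record slice (x : M) := Slice {
  sdim : nat; scodim : nat; srad : R; sdom : set M;
  sphi : M -> 'rV[R]_(sdim + scodim); spsi : 'rV[R]_(sdim + scodim) -> M;
  sal : G -> 'M[R]_sdim; srho : G -> 'M[R]_scodim; sturn : M -> G;
  slice_rad : 0 < srad;
  slice_chart : is_chart sdom (ball 0 srad) sphi spsi;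
  slice_dom : sdom x;
  slice_center : sphi x = 0;
  slice_equiv : \forall y \near x, forall k, stabilizer act x k ->
    lsubmx (sphi (act k y)) = lsubmx (sphi y) *m sal k /\
    rsubmx (sphi (act k y)) = rsubmx (sphi y) *m srho k;
  slice_inv : \forall p \near ((1%g, x) : G * M),
    rsubmx (sphi (act p.1 p.2)) = rsubmx (sphi p.2);
  slice_vert : forall y v, sdom y -> (vertical act y v <->
    tangent y v /\ forall j, v (fun y => sphi y 0 (rshift sdim j)) = 0);
  sturn_continuous : {for x, continuous sturn};
  sturn1 : sturn x = 1%g;
  slice_turn : \forall y \near x,
    y = act (sturn y) (spsi (row_mx 0 (rsubmx (sphi y))));
  srho_mul : forall g h, stabilizer act x g -> stabilizer act x h ->
    srho (g * h)%g = srho h *m srho g;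
  srho_class : forall g h, stabilizer act x g -> ineffective act x h ->
    srho (g * h)%g = srho g;
  srho1 : srho 1%g = 1%:M }.

End slices.

Arguments spsi {R M G act x} s _.
Arguments sal {R M G act x} s _.
Arguments srho {R M G act x} s _.
Arguments slice_vert {R M G act x} s [y v] _.
Arguments srho_mul {R M G act x} s [g h] _ _.
Arguments srho_class {R M G act x} s [g h] _ _.

(** * Linearization of a leaf chart by averaging *)

Section slice_construction.
Context {R : realType} {M : smoothSpaceType R} {G : smoothGroupType R}.
Variables (act : G -> M -> M).
Hypotheses (hM : is_manifold M) (hG : is_lie_group G) (hact : smooth_action act)
  (hproper : proper_action act).
Variables (x : M) (L : leaf_chart act x).
Notation K := (stabilizer act x).
Notation U := (ldom L).
Notation phi := (lphi L).
Notation psi := (lpsi L).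
Notation l := (lmove L).
Notation d := (ldim L).
Notation m := (lcodim L).
Notation n := (d + m)%N.
Let ch := leaf_is_chart L.
Let Ux := leaf_dom L.
Let phix := leaf_center L.
Let hMc : cinf_space M := manifold_cinf hM.
Let hGc : cinf_space G := lie_group_cinf hG.

(** The isotropy representation in row convention, hence order reversing: rho (g h) = rho h rho
    g. *)
Definition stab_rho (k : G) : 'M[R]_n := \matrix_(i, j) stab_mx L k x i j.
Notation rho := stab_rho.

Let coords (v : tvec M) : 'rV[R]_n := \row_j v (fun y => phi y 0 j).

Let rhoE k v : K k -> tangent x v -> coords (tmap (act k) x v) = coords v *m rho k.
Proof.
move=> Kk tv; apply/rowP => j; rewrite !mxE (stab_mxE hM hact)//.
by apply: eq_bigr => i _; rewrite !mxE.
Qed.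

Let coords_vec c : coords (chart_vec phi psi x c) = c.
Proof. by apply/rowP => j; rewrite mxE (chart_vec_coord ch). Qed.

Let mx_ext (A B : 'M[R]_n) : (forall c : 'rV[R]_n, c *m A = c *m B) -> A = B.
Proof. by move=> H; apply/row_matrixP => i; rewrite !rowE. Qed.

Let rhoM g h : K g -> K h -> rho (g * h)%g = rho h *m rho g.
Proof.
move=> Kg Kh; apply: mx_ext => c; have tv := chart_vec_tangent ch hMc c Ux.
rewrite -{1}(coords_vec c) -rhoE//; last exact: (stabM hact).
rewrite (tmap_actM hM hact) Kh rhoE//; last exact: (tangent_stab hM hact).
by rewrite rhoE// coords_vec mulmxA.
Qed.

Let rho_ineffective k : ineffective act x k -> rho k = 1%:M.
Proof.
move=> [Kk ik]; apply: mx_ext => c; have tv := chart_vec_tangent ch hMc c Ux.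
by rewrite -{1}(coords_vec c) -rhoE// ik// coords_vec mulmx1.
Qed.

Let rhoVr k : K k -> rho k *m rho k^-1%g = 1%:M.
Proof.
move=> Kk; rewrite -rhoM ?mulVg ?rho_ineffective//; last exact: (stabV hact).
exact: ineffective1.
Qed.

Let rhoVl k : K k -> rho k^-1%g *m rho k = 1%:M.
Proof.
move=> Kk; rewrite -rhoM ?mulgV ?rho_ineffective//; last exact: (stabV hact).
exact: ineffective1.
Qed.

Let rho_class k g : K k -> ineffective act x g -> rho (k * g)%g = rho k.
Proof. move=> Kk ig; rewrite rhoM//; last by case: ig.
by rewrite rho_ineffective// mul1mx. Qed.

Lemma vertical_tmap_act g y v : vertical act y v -> vertical act (act g y) (tmap (act g) y v).
Proof.
move=> /verticalP[xi txi ->].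
have sm : smooth_map_at (fun h => g * h)%g (1%g : G).
  by apply: (smooth_mul_comp hG) => //; [exact: smooth_map_at_cst | exact: smooth_map_at_id].
have := vertical_orbit_map hG hact y (tangent_tmap hGc sm txi).
rewrite mulg1 -{2}(mulg1 g) -tmap_comp; last exact: smooth_act_l.
have -> : (act^~ y) \o (fun h => g * h)%g = act g \o act^~ y.
  by apply/funext => h /=; rewrite (actM hact).
by rewrite tmap_comp (act1 hact) //; exact: (smooth_act_r hM hact).
Qed.

(** The vertical space is stable under K, which makes rho k block lower triangular: the upper left
    block is the action on vertical vectors and the lower right block the action modulo them. *)
Let ur_rho k : K k -> ursubmx (rho k) = 0.
Proof.
move=> Kk; suff E (e : 'rV[R]_d) : e *m ursubmx (rho k) = 0.
  by apply/row_matrixP => i; rewrite rowE E row0.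
have tv := chart_vec_tangent ch hMc (row_mx e 0) Ux.
have : vertical act x (chart_vec phi psi x (row_mx e 0)).
  apply/(leaf_vertical L Ux); split=> // j.
  by rewrite (chart_vec_coord ch)// row_mxEr mxE.
move=> /(vertical_tmap_act k); rewrite Kk => /(leaf_vertical L Ux)[_ H].
apply/rowP => j; rewrite [RHS]mxE -[RHS](H j).
have -> : tmap (act k) x (chart_vec phi psi x (row_mx e 0)) (fun y => phi y 0 (rshift d j)) =
    coords (tmap (act k) x (chart_vec phi psi x (row_mx e 0))) 0 (rshift d j) by rewrite mxE.
rewrite rhoE// coords_vec -[rho k]submxK mul_row_block row_mxEr mul0mx addr0.
by rewrite block_mxKur.
Qed.

Notation al k := (ulsubmx (rho k)).
Notation dl k := (drsubmx (rho k)).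

Let rho_block k : K k -> rho k = block_mx (al k) 0 (dlsubmx (rho k)) (dl k).
Proof. by move=> Kk; rewrite -{1}(submxK (rho k)) ur_rho. Qed.

Variable s : seq G.
Hypotheses (s0 : (0 < size s)%N) (sK : forall k, k \in s -> K k)
  (sav : forall (V : nmodType) (F : G -> V),
      (forall k g, K k -> ineffective act x g -> F (k * g)%g = F k) ->
      forall h, K h -> \sum_(k <- s) F (k * h)%g = \sum_(k <- s) F k /\
                       \sum_(k <- s) F (h * k)%g = \sum_(k <- s) F k).

Let c0 : R := (size s)%:R^-1.
Let c0s : c0 * (size s)%:R = 1.
Proof. by rewrite mulVf// pnatr_eq0 -lt0n. Qed.

Let avg_cst (V : lmodType R) (a : V) : c0 *: \sum_(k <- s) a = a.
Proof. by rewrite big_const_seq count_predT iter_addr_0 -scaler_nat scalerA c0s scale1r. Qed.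

Let good y := (forall k, K k -> U (act k y)) /\ forall g, ineffective act x g -> act g y = y.

Let near_good : \forall y \near x, good y.
Proof.
have H1 : \forall y \near x, forall k, K k -> U (act k y).
  apply: (stab_near_covering hproper (P := fun y k => U (act k y))) => k Kk.
  apply: (near_comp (act_continuous hact (p := (k, x)))); rewrite /= Kk.
  exact: leaf_domE.
by apply: filterS2 H1 (ineffective_trivial hM hG hact hproper L) => y; split.
Qed.

Let good_act k y : K k -> good y -> good (act k y).
Proof.
move=> Kk [gU gi]; split=> [h Kh|g ig]; first by rewrite -(actM hact); apply: gU; exact: (stabM hact).
have -> : act g (act k y) = act k (act (k^-1 * g * k)%g y).
  by rewrite -!(actM hact) !mulgA mulgV mul1g.
rewrite gi// -{2}(invgK k); apply: (ineffectiveJ hM hact) => //; exact: (stabV hact).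
Qed.

(** Bochner's linearization. The average has the same differential at x as phi, and it intertwines
    the action of K with rho. *)
Let phit y : 'rV[R]_n := c0 *: \sum_(k <- s) phi (act k y) *m rho k^-1%g.

Let phit_equiv y h : good y -> K h -> phit (act h y) = phit y *m rho h.
Proof.
move=> [_ gi] Kh; rewrite /phit -scalemxAl; congr (_ *: _).
pose F k := phi (act k y) *m rho k^-1%g.
have Fc k g : K k -> ineffective act x g -> F (k * g)%g = F k.
  move=> Kk ig; rewrite /F (actM hact) gi// invgM rhoM; try exact: (stabV hact).
    rewrite [rho g^-1%g]rho_ineffective ?mulmx1//; exact: (ineffectiveV hM hact).
  by apply: (stabV hact); case: ig.
rewrite -[in RHS](sav Fc Kh).1 mulmx_suml big_seq [RHS]big_seq; apply: eq_bigr => k /sK Kk.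
rewrite /F (actM hact) invgM rhoM; try exact: (stabV hact).
by rewrite -!mulmxA rhoVl// mulmx1.
Qed.

Let phit_sum y j : phit y 0 j = c0 * \sum_(q < size s)
   \sum_i phi (act (tnth (in_tuple s) q) y) 0 i * rho (tnth (in_tuple s) q)^-1%g i j.
Proof.
rewrite /phit mxE (big_tnth _ _ s) summxE; congr (_ * _); apply: eq_bigr => q _.
by rewrite mxE.
Qed.

Let smooth_phi_act k i : K k -> smooth_at x (fun y => phi (act k y) 0 i).
Proof.
move=> Kk; have [_ sm] := smooth_act_r hM hact k x.
apply: (sm (fun y => phi y 0 i)); rewrite Kk; exact: (chart_coord ch).
Qed.

Let tK q : K (tnth (in_tuple s) q). Proof. by apply: sK; exact: mem_tnth. Qed.

Let smM_cst f (r : R) : smooth_at x f -> smooth_at x (fun y => f y * r).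
Proof. by move=> sf; apply: (smM hMc) => //; exact: (sm_cst hMc). Qed.

Let phit_smooth j : smooth_at x (fun y => phit y 0 j).
Proof.
apply: (sm_near hMc (f := fun y => c0 * \sum_(q < size s)
   \sum_i phi (act (tnth (in_tuple s) q) y) 0 i * rho (tnth (in_tuple s) q)^-1%g i j)).
  by apply: nearT => y; rewrite phit_sum.
apply: (smM hMc); first exact: (sm_cst hMc).
apply: (sm_sum hMc) => q; apply: (sm_sum hMc) => i; apply: smM_cst.
exact: smooth_phi_act.
Qed.

Let phit_deriv v j : tangent x v -> v (fun y => phit y 0 j) = v (fun y => phi y 0 j).
Proof.
move=> tv; rewrite (_ : (fun _ => _) = fun y => c0 * \sum_(q < size s)
   \sum_i rho (tnth (in_tuple s) q)^-1%g i j * phi (act (tnth (in_tuple s) q) y) 0 i); last first.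
  apply/funext => y; rewrite phit_sum; congr (_ * _); apply: eq_bigr => q _.
  by apply: eq_bigr => i _; rewrite mulrC.
have sq q i : smooth_at x (fun y => rho (tnth (in_tuple s) q)^-1%g i j * phi (act (tnth (in_tuple s) q) y) 0 i).
  by apply: (smM hMc); [exact: (sm_cst hMc) | exact: smooth_phi_act].
have sQ q : smooth_at x (fun y => \sum_i rho (tnth (in_tuple s) q)^-1%g i j * phi (act (tnth (in_tuple s) q) y) 0 i).
  exact: (sm_sum hMc).
rewrite (tanZ hMc _ tv); last exact: (sm_sum hMc).
rewrite (tan_sum hMc tv sQ).
rewrite (eq_bigr (fun=> v (fun y => phi y 0 j))); last first.
  move=> q _; rewrite (tan_sum hMc tv (sq q)).
  have -> : v (fun y => phi y 0 j) = (coords v *m rho (tnth (in_tuple s) q) *m rho (tnth (in_tuple s) q)^-1%g) 0 j.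
    by rewrite -mulmxA rhoVr// mulmx1 mxE.
  rewrite -rhoE// [RHS]mxE; apply: eq_bigr => i _.
  rewrite (tanZ hMc _ tv); last exact: smooth_phi_act.
  rewrite [X in _ = X * _]mxE tmap_act//; first by rewrite mulrC.
  exact: (chart_coord ch).
by rewrite sumr_const card_ord -mulr_natl mulrA c0s mul1r.
Qed.

(** Maschke's trick: the projection onto the vertical space is averaged to one that commutes with K.
    Its kernel is a K-stable complement, encoded by the block T. *)
Let Ebar : 'M[R]_n := c0 *: \sum_(k <- s) rho k *m (block_mx 1%:M 0 0 0 : 'M_(d + m)) *m rho k^-1%g.

Let T : 'M[R]_(m, d) := dlsubmx Ebar.

Let EbarE : Ebar = block_mx 1%:M 0 T 0.
Proof.
have E k : K k -> rho k *m (block_mx 1%:M 0 0 0 : 'M_(d + m)) *m rho k^-1%g =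
    block_mx 1%:M 0 (dlsubmx (rho k) *m al k^-1%g) 0.
  move=> Kk; have := rhoVr Kk; rewrite (rho_block Kk) (rho_block (stabV hact Kk)).
  rewrite !mulmx_block !(mulmx0, mul0mx, addr0, add0r, mulmx1).
  rewrite (scalar_mx_block _ _ 1) => /eq_block_mx[-> _ _ _].
  by rewrite block_mxKdl block_mxKul.
have : Ebar = c0 *: \sum_(k <- s) block_mx 1%:M 0 (dlsubmx (rho k) *m al k^-1%g) 0.
  by rewrite /Ebar; congr (_ *: _); rewrite big_seq [RHS]big_seq; apply: eq_bigr => k /sK; exact: E.
have sumE (t : G -> 'M[R]_(m, d)) (s' : seq G) : \sum_(k <- s') (block_mx 1%:M 0 (t k) 0 : 'M[R]_(d + m)) =
    block_mx (\sum_(k <- s') 1%:M) 0 (\sum_(k <- s') t k) 0.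
  elim: s' => [|k s' IH]; first by rewrite !big_nil block_mx0.
  by rewrite !big_cons IH add_block_mx !addr0.
rewrite sumE scale_block_mx avg_cst !scaler0 => EE.
by rewrite /T EE block_mxKdl.
Qed.

Let Ebar_rho h : K h -> rho h *m Ebar = Ebar *m rho h.
Proof.
move=> Kh; pose F k := rho k *m (block_mx 1%:M 0 0 0 : 'M_(d + m)) *m rho k^-1%g.
have Fc k g : K k -> ineffective act x g -> F (k * g)%g = F k.
  move=> Kk ig; rewrite /F rho_class// invgM rhoM; try exact: (stabV hact).
    rewrite [rho g^-1%g]rho_ineffective ?mulmx1//; exact: (ineffectiveV hM hact).
  by apply: (stabV hact); case: ig.
have E : Ebar = rho h *m Ebar *m rho h^-1%g.
  rewrite {1}/Ebar -/(F _) -(sav Fc Kh).1 /Ebar -scalemxAr -scalemxAl; congr (_ *: _).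
  rewrite mulmx_sumr mulmx_suml big_seq [RHS]big_seq; apply: eq_bigr => k /sK Kk.
  by rewrite /F rhoM// invgM rhoM ?mulmxA//; exact: (stabV hact).
by rewrite {2}E -!mulmxA rhoVl// mulmx1.
Qed.

Let T_rho h : K h -> dlsubmx (rho h) + dl h *m T = T *m al h.
Proof.
move=> Kh; have := Ebar_rho Kh; rewrite EbarE {1 2}(rho_block Kh) !mulmx_block.
rewrite !(mulmx0, mul0mx, addr0, add0r, mulmx1, mul1mx).
by move=> /eq_block_mx[_ _ -> _].
Qed.

(** The linear change of coordinates that straightens the stable complement and makes rho block
    diagonal. *)
Let hat (w : 'rV[R]_n) : 'rV[R]_n := row_mx (lsubmx w + rsubmx w *m T) (rsubmx w).

Let rsub_rho h (w : 'rV[R]_n) : K h -> rsubmx (w *m rho h) = rsubmx w *m dl h.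
Proof.
move=> Kh; rewrite -{1}(hsubmxK w) {1}(rho_block Kh) mul_row_block row_mxKr.
by rewrite mulmx0 add0r.
Qed.

Let hat_rho h w : K h -> lsubmx (hat (w *m rho h)) = lsubmx (hat w) *m al h /\
  rsubmx (hat (w *m rho h)) = rsubmx (hat w) *m dl h.
Proof.
move=> Kh; rewrite !row_mxKl !row_mxKr; split; last exact: rsub_rho.
rewrite rsub_rho// -{1}(hsubmxK w) {1}(rho_block Kh) mul_row_block row_mxKl.
by rewrite mulmxDl -[_ *m T *m _]mulmxA -T_rho// mulmxDr mulmxA addrA.
Qed.

Let phih y := hat (phit y).

Let phih_r y j : phih y 0 (rshift d j) = phit y 0 (rshift d j).
Proof. by rewrite row_mxEr mxE. Qed.

Let phih_l y i : phih y 0 (lshift m i) =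
  phit y 0 (lshift m i) + \sum_j T j i * phit y 0 (rshift d j).
Proof.
rewrite row_mxEl !mxE; congr (_ + _); apply: eq_bigr => j _.
by rewrite mxE mulrC.
Qed.

Let phih_smooth i : smooth_at x (fun y => phih y 0 i).
Proof.
case: (split_ordP i) => j ->.
  apply: (sm_near hMc (f := fun y => phit y 0 (lshift m j) + \sum_q T q j * phit y 0 (rshift d q))).
    by apply: nearT => y; rewrite phih_l.
  apply: (smD hMc); first exact: phit_smooth.
  apply: (sm_sum hMc) => q; apply: (smM hMc); first exact: (sm_cst hMc).
  exact: phit_smooth.
apply: (sm_near hMc (f := fun y => phit y 0 (rshift d j))).
  by apply: nearT => y; rewrite phih_r.
exact: phit_smooth.
Qed.

Let phih_r_deriv v j : tangent x v ->
  v (fun y => phih y 0 (rshift d j)) = v (fun y => phi y 0 (rshift d j)).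
Proof.
move=> tv; rewrite -(phit_deriv _ tv); congr v.
by apply/funext => y; rewrite phih_r.
Qed.

Let phih_inj v : tangent x v -> (forall i, v (fun y => phih y 0 i) = 0) -> v = 0.
Proof.
move=> tv v0; have vr j : v (fun y => phi y 0 (rshift d j)) = 0.
  by rewrite -phih_r_deriv.
apply: (chart_tan_inj ch hMc Ux tv (tangent0 _)) => i; rewrite tvec0.
case: (split_ordP i) => j -> //.
have := v0 (lshift m j); rewrite (_ : (fun _ => _) = fun y => phit y 0 (lshift m j) +
    \sum_q T q j * phit y 0 (rshift d q)); last by apply/funext => y; rewrite phih_l.
have sq q : smooth_at x (fun y => T q j * phit y 0 (rshift d q)).
  by apply: (smM hMc); [exact: (sm_cst hMc) | exact: phit_smooth].
rewrite (tanD tv); [|exact: phit_smooth|exact: (sm_sum hMc)].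
rewrite (tan_sum hMc tv sq) phit_deriv// big1 ?addr0// => q _.
by rewrite (tanZ hMc _ tv) ?phit_deriv ?vr ?mulr0//; exact: phit_smooth.
Qed.

Let phih_act y h : good y -> K h ->
  lsubmx (phih (act h y)) = lsubmx (phih y) *m al h /\
  rsubmx (phih (act h y)) = rsubmx (phih y) *m dl h.
Proof. by move=> gy Kh; rewrite /phih phit_equiv//; exact: hat_rho. Qed.

Let rsub_phit y : rsubmx (phit y) = c0 *: \sum_(k <- s) rsubmx (phi (act k y)) *m dl k^-1%g.
Proof.
apply/rowP => j; rewrite mxE /phit mxE [RHS]mxE !summxE; congr (_ * _).
rewrite big_seq [RHS]big_seq; apply: eq_bigr => k /sK Kk.
rewrite -rsub_rho; last exact: (stabV hact).
by rewrite [RHS]mxE.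
Qed.

Let near_seq (S : topologicalType) (t : S) (Q : G -> S -> Prop) (s' : seq G) :
  (forall k, k \in s' -> \forall z \near t, Q k z) -> \forall z \near t, forall k, k \in s' -> Q k z.
Proof.
elim: s' => [|k s' IH] H; first exact: nearT.
have H1 := H k (mem_head _ _).
have H2 : \forall z \near t, forall k, k \in s' -> Q k z.
  by apply: IH => h hs; apply: H; rewrite in_cons hs orbT.
apply: filterS2 H1 H2 => z Hk Hs h; rewrite in_cons => /orP[/eqP -> //|]; exact: Hs.
Qed.

(** Writing k g = (k g k^-1) k, an element g near 1 stays near 1 after conjugation by each of the
    finitely many k, so every summand of the average is locally invariant. *)
Let phih_inv : \forall p \near ((1%g, x) : G * M),
  rsubmx (phih (act p.1 p.2)) = rsubmx (phih p.2).
Proof.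
have H : \forall p \near ((1%g, x) : G * M), forall k, k \in s ->
    rsubmx (phi (act k (act p.1 p.2))) = rsubmx (phi (act k p.2)).
  apply: near_seq => k /sK Kk.
  have c : {for (1%g, x), continuous (fun p : G * M => (k * p.1 * k^-1, act k p.2)%g)}.
    have c1 : {for (1%g, x), continuous (fun p : G * M => (k * p.1 * k^-1)%g)}.
      apply: (cont_mul hG); last exact: cvg_cst.
      by apply: (cont_mul hG); [exact: cvg_cst | exact: cvg_fst].
    have c2 : {for (1%g, x), continuous (fun p : G * M => act k p.2)}.
      by apply: (cont_act hact); [exact: cvg_cst | exact: cvg_snd].
    exact: (cvg_pair c1 c2).
  have := near_comp c (P := fun p => [/\ U (act p.1 p.2), U p.2 &
     rsubmx (phi (act p.1 p.2)) = rsubmx (phi p.2)]).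
  rewrite /= mulg1 mulgV Kk => /(_ (leaf_invariant hG hact L)).
  apply: filterS => p [_ _ <-].
  by rewrite -!(actM hact) mulgVK.
apply: filterS H => p H; rewrite !row_mxKr !rsub_phit; congr (_ *: _).
by rewrite big_seq [RHS]big_seq; apply: eq_bigr => k ks; rewrite H.
Qed.

Let phihx : phih x = 0.
Proof.
have -> : phih x = hat 0.
  congr hat; rewrite /phit big_seq big1 ?scaler0// => k /sK Kk.
  by rewrite [act k x]Kk phix mul0mx.
have l0 : lsubmx (0 : 'rV[R]_n) = 0 by apply/rowP => i; rewrite !mxE.
have r0 : rsubmx (0 : 'rV[R]_n) = 0 by apply/rowP => i; rewrite !mxE.
by rewrite /hat l0 r0 mul0mx addr0 row_mx0.
Qed.

Let phih_cont : {for x, continuous phih}.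
Proof.
have -> : phih = fun y => \row_i phih y 0 i by apply/funext => y; apply/rowP => i; rewrite mxE.
by apply: continuous_row => i; apply: (sm_continuous hMc).
Qed.

Let section0 y := psi (row_mx 0 (rsubmx (phi y))).

Let near_section0 (Q : M -> Prop) : (\forall y \near x, Q y) -> \forall y \near x, Q (section0 y).
Proof.
move=> nQ; apply: (near_comp (leaf_section_continuous (L := L))).
by rewrite /= rsub_center row_mx0 leaf_psi0.
Qed.

(** The averaged chart has a transversal different from that of the leaf chart, while group elements
    moving points to a transversal are known for the leaf chart only. The two transversals are
    compared by means of a mixed chart. *)
Lemma slice_from_average : inhabited (slice act x).
Proof.
(* The mixed coordinates: a of the leaf chart and b of the averaged one. In them a point of the old
   transversal is determined by its new b. *)
pose f3 i y := split_fun (fun i => phi y 0 (lshift m i)) (fun j => phih y 0 (rshift d j)) i.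
have sf3 i : smooth_at x (f3 i).
  rewrite /f3; case: (split_ordP i) => j ->.
    apply: (sm_near hMc (f := fun y => phi y 0 (lshift m j))); last exact: (chart_coord ch).
    by apply: nearT => y; rewrite split_funl.
  apply: (sm_near hMc (f := fun y => phih y 0 (rshift d j))); last exact: phih_smooth.
  by apply: nearT => y; rewrite split_funr.
have f3l j : f3 (lshift m j) = (fun y => phi y 0 (lshift m j)).
  by apply/funext => y; rewrite /f3 split_funl.
have f3r j : f3 (rshift d j) = (fun y => phih y 0 (rshift d j)).
  by apply/funext => y; rewrite /f3 split_funr.
have inj3 v : tangent x v -> (forall i, v (f3 i) = 0) -> v = 0.
  move=> tv v0; apply: (chart_tan_inj ch hMc Ux tv (tangent0 _)) => i; rewrite tvec0.
  case: (split_ordP i) => j ->; first by have := v0 (lshift m j); rewrite f3l.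
  by have := v0 (rshift d j); rewrite f3r phih_r_deriv.
have nU : nbhs x U by exact: leaf_domE.
have [U3 [V3 [psi3 [ch3 U3x U3U]]]] := inverse_function_chart hMc ch Ux nU sf3 inj3.
have f3_inj y z : U3 y -> U3 z -> lsubmx (phi y) = lsubmx (phi z) ->
    rsubmx (phih y) = rsubmx (phih z) -> y = z.
  move=> Uy Uz E1 E2; rewrite -(chartK ch3 Uy) -(chartK ch3 Uz); congr psi3.
  apply/rowP => i; rewrite !mxE; case: (split_ordP i) => j ->; rewrite ?f3l ?f3r.
    by move/rowP/(_ j): E1; rewrite !mxE.
  by move/rowP/(_ j): E2; rewrite !row_mxKr !row_mxEr.
have cl : {for x, continuous (fun y => l (lsubmx (phi y)))}.
  by apply: lmove_continuous; [exact: lsub_phi_continuous | exact: lsub_center].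
have lx : l (lsubmx (phi x)) = 1%g by rewrite lsub_center leaf_move0.
have sx : section0 x = x by rewrite /section0 rsub_center row_mx0 leaf_psi0.
pose Q y := [/\ U3 (section0 y), lsubmx (phi (section0 y)) = 0,
    y = act (l (lsubmx (phi y))) (section0 y) & rsubmx (phih y) = rsubmx (phih (section0 y))].
have nQ : \forall y \near x, Q y.
  have H1 := near_section0 (chart_nearU ch3 U3x).
  have cp : {for x, continuous (fun y => (l (lsubmx (phi y)), section0 y))}.
    by apply: cvg_pair => //; exact: (leaf_section_continuous (L := L)).
  have := near_comp cp (P := fun p => rsubmx (phih (act p.1 p.2)) = rsubmx (phih p.2)).
  rewrite lx sx => /(_ phih_inv) H2.
  apply: filterS3 nU H1 H2 => y Uy H1 H2.
  have yE : y = act (l (lsubmx (phi y))) (section0 y).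
    by rewrite -{1}(chartK ch Uy) (leaf_act L)//; exact: (chartV ch).
  split=> //; last by rewrite {1}yE.
  rewrite /section0 (chartVK ch) ?row_mxKl//.
  apply: ball_row_mx; [exact: leaf_rad | exact: ballxx (leaf_rad _) | ].
  by apply: ball_rsubmx; exact: (chartV ch).
have [U1 [V1 [psi1 [ch1 U1x U1sub]]]] := inverse_function_chart hMc ch Ux nU phih_smooth phih_inj.
have phiE : (fun y => \row_i phih y 0 i) = phih by apply/funext => y; apply/rowP => i; rewrite mxE.
rewrite phiE in ch1.
have vert1 : \forall y \near x, forall v, vertical act y v -> forall j, v (fun y => phih y 0 (rshift d j)) = 0.
  have [W [V [nW nV H]]] := (near_pairP _ _ _).1 phih_inv.
  apply: filterS2 (chart_nearU ch1 U1x) nV => y U1y Vy v /verticalP[xi txi ->] j.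
  rewrite (generatorE hact); last exact: (chart_coord ch1).
  rewrite (tan_near hGc txi (g := fun=> phih y 0 (rshift d j))); first exact: (tan_cst hGc _ txi).
  apply: filterS nW => g Wg; have := H g y Wg Vy; rewrite /= !row_mxKr => /rowP/(_ j).
  by rewrite /phih /hat !row_mxEr.
have vertW : \forall y \near x, forall v, (vertical act y v <->
    tangent y v /\ forall j, v (fun y => phih y 0 (rshift d j)) = 0).
  apply: filterS3 nU (chart_nearU ch3 U3x) vert1 => y Uy U3y v1 v; split.
    by move=> vv; split; [exact: (vertical_tangent hM hG hact) | exact: v1].
  move=> [tv v0]; pose u := chart_vec phi psi y (row_mx (\row_i v (fun y => phi y 0 (lshift m i))) 0).
  have tu : tangent y u by exact: (chart_vec_tangent ch hMc).
  have vu : vertical act y u.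
    by apply/(leaf_vertical L Uy); split=> // j; rewrite /u (chart_vec_coord ch)// row_mxEr mxE.
  suff -> : v = u by [].
  apply: (chart_tan_inj ch3 hMc U3y tv tu) => i.
  have -> : (fun y => (\row_q f3 q y) 0 i) = f3 i by apply/funext => z; rewrite mxE.
  case: (split_ordP i) => j ->; first by rewrite f3l /u (chart_vec_coord ch)// row_mxEl mxE.
  by rewrite f3r v0 v1.
have [r [[chr subr] r0]] := filter_ex (filterI (chart_ball ch1 U1x vertW) (nbhs_right_gt 0)).
have {}r0 : 0 < r by exact: r0.
rewrite phihx in chr subr.
pose z y := psi1 (row_mx 0 (rsubmx (phih y))).
have rx : rsubmx (phih x) = 0 by rewrite phihx; apply/rowP => i; rewrite !mxE.
have psi10 : psi1 0 = x by rewrite -phihx (chartK ch1).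
have zx : z x = x by rewrite /z rx row_mx0.
have cz : {for x, continuous z}.
  have c : {for x, continuous (fun y => row_mx (0 : 'rV[R]_d) (rsubmx (phih y)))}.
    by apply: cont_row_mx; [exact: cvg_cst | exact: cont_rsubmx].
  apply: (continuous_comp c); rewrite rx row_mx0.
  by have [] := chart_psi chr (ballxx 0 r0).
(* With z y the point of the new transversal over the new b of y, the points l(a y)^-1 y and l(a (z
   y))^-1 (z y) of the old transversal coincide. *)
pose tu y := (l (lsubmx (phi y)) * (l (lsubmx (phi (z y))))^-1)%g.
apply: inhabits; refine (@Slice _ _ _ act x d m r (U1 `&` phih @^-1` ball 0 r) phih psi1
  (fun k => al k) (fun k => dl k) tu r0 chr _ phihx _ phih_inv _ _ _ _ _ _ _).
- by split=> //=; rewrite phihx; exact: ballxx.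
- by apply: filterS near_good => y gy k Kk; exact: phih_act.
- by move=> y v Uy; exact: (subr _ Uy).
- apply: (cont_mul hG) => //; apply: (cont_inv hG).
  have := @continuous_comp _ _ _ z (fun y => l (lsubmx (phi y))) x cz.
  by rewrite zx; exact.
- by rewrite /tu zx lx invg1 mulg1.
- have nz : \forall y \near x, Q (z y) by apply: (near_comp cz); rewrite zx.
  have nr : \forall y \near x, rsubmx (phih (z y)) = rsubmx (phih y).
    apply: filterS (chart_nearU chr _); last by split=> //=; rewrite phihx; exact: ballxx.
    move=> y Uy; have yr := chartV chr Uy.
    rewrite /z (chartVK chr) ?row_mxKr//; apply: ball_row_mx => //; first exact: ballxx.
    by have := ball_rsubmx yr; rewrite row_mxKr.
  apply: filterS3 nQ nz nr => y [A1 A2 A3 A4] [B1 B2 B3 B4] C.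
  rewrite /tu (actM hact) -/(z y) {2}B3 (actK hact).
  rewrite (f3_inj _ _ B1 A1) ?A2 ?B2//.
  by rewrite -B4 C A4.
- move=> g h Kg Kh; rewrite rhoM// {1}(rho_block Kg) {1}(rho_block Kh) mulmx_block block_mxKdr.
  by rewrite mulmx0 add0r.
- by move=> g h Kg ih; rewrite rho_class.
- rewrite rho_ineffective; last exact: ineffective1.
  by rewrite (scalar_mx_block _ _ 1) block_mxKdr.
Qed.

End slice_construction.

(** * Consequences of properness *)

Section proper_actions.
Context {R : realType} {M : smoothSpaceType R} {G : smoothGroupType R}.
Variables (act : G -> M -> M).
Hypotheses (hM : is_manifold M) (hG : is_lie_group G) (hact : smooth_action act)
  (hproper : proper_action act).
Let hMc : cinf_space M := manifold_cinf hM.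
Let hGc : cinf_space G := lie_group_cinf hG.

Let hausdorffM : hausdorff_space M. Proof. by case: hM. Qed.

Lemma hausdorff_separated (z x : M) : z <> x ->
  exists A B, [/\ nbhs z A, nbhs x B & forall w, A w -> B w -> False].
Proof.
move=> zx; apply: contrapT => H; apply: zx; apply: hausdorffM => A B nA nB.
apply: contrapT => ne; apply: H; exists A, B; split=> // w Aw Bw.
by apply: ne; exists w.
Qed.

Lemma chart_compact_ball n (U : set M) (V : set 'rV[R]_n) phi psi a (r : R) :
  is_chart U V phi psi -> (forall u, `|u - a| <= r -> V u) ->
  compact (psi @` [set u | `|u - a| <= r]).
Proof.
move=> ch sub; apply: continuous_compact.
  apply: continuous_in_subspaceT => u; rewrite inE => /= /sub Vu.
  by have [] := chart_psi ch Vu.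
apply: bounded_closed_compact.
  exists (r + `|a|); split; [exact: num_real | move=> z /ltW zr u /= ur].
  by apply: le_trans zr; rewrite -(subrK a u) (le_trans (ler_normD _ _))// lerD2r.
have -> : [set u : 'rV[R]_n | `|u - a| <= r] = closed_ball_ Num.norm a r.
  by apply/seteqP; split=> u /=; rewrite /closed_ball_ /= distrC.
exact: closed_closed_ball_.
Qed.

Lemma compact_nbhd (x : M) W : nbhs x W -> exists C, [/\ compact C, nbhs x C & C `<=` W].
Proof.
move=> nW; have [_ _ /(_ x)[n [U [V [phi [psi [ch Ux]]]]]]] := hM.
have [r [[chr subr] r0]] := filter_ex (filterI (chart_ball ch Ux nW) (nbhs_right_gt 0)).
have {}r0 : 0 < r by exact: r0.
have r2 : 0 < r / 2 by rewrite divr_gt0.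
have sub (u : 'rV[R]_n) : `|u - phi x| <= r / 2 -> ball (phi x) r u.
  move=> ur; rewrite -ball_normE /ball_ /= distrC (le_lt_trans ur)//.
  by rewrite ltr_pdivrMr// ltr_pMr// ltr1n.
exists (psi @` [set u | `|u - phi x| <= r / 2]); split.
- exact: (chart_compact_ball chr).
- have [c _] := chart_phi ch Ux.
  have H : \forall y \near x, ball (phi x) (r / 2) (phi y) by apply: (near_comp c); exact: nbhsx_ballx.
  apply: filterS2 (chart_nearU ch Ux) H => y Uy yr; exists (phi y); last exact: (chartK ch Uy).
  by move: yr; rewrite -ball_normE /ball_ /= distrC => /ltW.
- by move=> _ [u /sub ur <-]; apply: subr; exact: (chartU chr).
Qed.

(** The pairs (g, y) with y and g y in a compact neighbourhood of x form a compact set. Near a pair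
    (g0, y0) of it, y and g y cannot both approach x unless y0 = x and g0 fixes x; in that case g
    g0^-1 lies in W for g near g0. *)
Lemma proper_near x (W : set G) : nbhs (1%g : G) W ->
  exists2 V, nbhs x V & forall y g, V y -> V (act g y) ->
    exists w k, [/\ W w, stabilizer act x k & g = (w * k)%g].
Proof.
move=> nW; have [C [cC nC _]] := compact_nbhd (filterT : nbhs x setT).
have cB := hproper (compact_setX cC cC).
set B := [set p | _] in cB.
pose Q (uv : M * M) (p : G * M) := act p.1 p.2 = uv.1 -> p.2 = uv.2 ->
  exists w k, [/\ W w, stabilizer act x k & p.1 = (w * k)%g].
have /(_ _ (nbhs ((x, x) : M * M)) Q) := (compact_near_coveringP B).1 cB.
move=> HC; have : \forall uv \near ((x, x) : M * M), B `<=` Q uv.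
  apply: HC => -[g0 y0] Bp.
  have vac (f : G * M -> M) (h : M * M -> M) : {for (g0, y0), continuous f} ->
      {for (x, x), continuous h} -> h (x, x) = x -> f (g0, y0) <> x ->
      (forall uv p, Q uv p \/ f p = h uv) ->
      \forall p \near (g0, y0) & uv \near nbhs ((x, x) : M * M), Q uv p.
    move=> cf ch hx fx alt; have [A [B' [nA nB dis]]] := hausdorff_separated fx.
    exists (f @^-1` A, h @^-1` B'); first by split; [exact: cf | apply: ch; rewrite hx].
    move=> [p uv] [/= Ap Buv]; have [//|E] := alt uv p.
    by have := dis _ Ap; rewrite E => /(_ Buv).
  have [E1|E1] := pselect (act g0 y0 = x); last first.
    apply: (vac (fun p => act p.1 p.2) fst) => //.
    - exact: (act_continuous hact (p := (g0, y0))).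
    - exact: cvg_fst.
    - by move=> uv p; have [->|n] := pselect (act p.1 p.2 = uv.1); [right | left => /n].
  have [E2|E2] := pselect (y0 = x); last first.
    apply: (vac snd snd) => //; [exact: cvg_snd | exact: cvg_snd |].
    by move=> uv p; have [->|n] := pselect (p.2 = uv.2); [right | left => _ /n].
  subst y0; have c : {for g0, continuous (fun g => g * g0^-1)%g}.
    by apply: (cont_mul hG); [exact: cvg_id | exact: cvg_cst].
  have nWg : \forall g \near g0, W (g * g0^-1)%g by apply: (near_comp c); rewrite mulgV.
  exists ([set p | W (p.1 * g0^-1)%g], setT); first by split; [exact: (@near_fst _ _ g0 x (fun g => W (g * g0^-1)%g) nWg) | exact: filterT].
  move=> [p uv] [/= Wp _] _ _; exists (p.1 * g0^-1)%g, g0; split=> //.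
  by rewrite mulgVK.
move=> /near_pairP[V1 [V2 [nV1 nV2 H]]].
exists (V1 `&` V2 `&` C); first by apply: filterI => //; exact: filterI.
move=> y g [[_ V2y] Cy] [[V1g _] Cg].
by apply: (H _ _ V1g V2y (g, y)).
Qed.

(** Inside a compact neighbourhood D of a limit point, the saturation of C is the projection of the
    set of all (g, y) with g y in C and y in D, which is compact by properness. *)
Lemma orbit_compact_closed (C : set M) : compact C -> closed [set y | exists g, C (act g y)].
Proof.
move=> cC z clz; have [D [cD nD _]] := compact_nbhd (filterT : nbhs z setT).
have cB := hproper (compact_setX cC cD).
set B := [set p | _] in cB.
have cE : compact (snd @` B).
  by apply: continuous_compact cB; apply: continuous_subspaceT => p; exact: cvg_snd.
have : closure (snd @` B) z.
  move=> A nA; have [y [[g Cy] [Ay Dy]]] := clz _ (filterI nA nD).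
  by exists y; split=> //; exists (g, y).
move=> /(compact_closed hausdorffM cE)[[g y] [/= Cy Dy] <-].
by exists g.
Qed.

(** The value at y is read off at any translate of y in O, and is 0 if there is none. The closed
    invariant set C carries the support and lies in the saturation of O, so a point without
    translates in O has a neighbourhood where the extension is 0. *)
Lemma glue_invariant (O C : set M) (u : M -> R) : open O -> closed C ->
  (forall g y, C y -> C (act g y)) -> (forall y, C y -> exists g, O (act g y)) ->
  (forall y, O y -> smooth_at y u) -> (forall y g, O y -> O (act g y) -> u (act g y) = u y) ->
  (forall y, O y -> ~ C y -> u y = 0) ->
  exists2 f, invariant_fun act f &
    (forall y, O y -> f y = u y) /\ forall y, ~ C y -> f y = 0.
Proof.
move=> oO cC iC CO su iu u0.
pose f y := match pselect (exists g, O (act g y)) with left h => u (act (projT1 (cid h)) y) | right _ => 0 end.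
have fE y g : O (act g y) -> f y = u (act g y).
  move=> Og; rewrite /f; case: pselect => [h|]; last by case; exists g.
  case: (cid h) => g' /= Og'.
  have -> : act g' y = act (g' * g^-1)%g (act g y) by rewrite -(actM hact) mulgVK.
  by apply: iu => //; rewrite -(actM hact) mulgVK.
have f0 y : ~ (exists g, O (act g y)) -> f y = 0.
  by rewrite /f; case: pselect.
have fC y : ~ C y -> f y = 0.
  move=> nC; have [[g Og]|/f0//] := pselect (exists g, O (act g y)).
  rewrite (fE _ _ Og) u0// => /(iC g^-1%g); rewrite (actK hact); exact: nC.
exists f; last by split=> // y Oy; rewrite (fE y 1%g) (act1 hact).
split; last first.
  move=> g y; have [[h Oh]|n] := pselect (exists g, O (act g y)).
    rewrite (fE _ _ Oh) (fE (act g y) (h * g^-1)%g) -(actM hact) mulgVK//.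
  rewrite !f0// => -[h Oh]; apply: n; exists (h * g)%g; by rewrite (actM hact).
move=> y; have [[g Og]|n] := pselect (exists g, O (act g y)).
  have [cg sg] := smooth_act_r hM hact g y.
  apply: (sm_near hMc (f := u \o act g)); last by apply: sg; exact: su.
  have : \forall y' \near y, O (act g y') by apply: (near_comp cg); exact: open_nbhs_nbhs.
  by apply: filterS => y' Og'; rewrite (fE _ _ Og').
apply: (sm_near hMc (f := fun=> 0)); last exact: (sm_cst hMc).
have nC : ~ C y by move=> /CO.
have : nbhs y (~` C) by apply: open_nbhs_nbhs; split=> //; exact: closed_openC.
by apply: filterS => y' /fC ->.
Qed.

End proper_actions.

(** * Conjugates of a stabilizer inside itself *)

Section stabilizer_conjugates.
Context {R : realType} {M : smoothSpaceType R} {G : smoothGroupType R}.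
Variables (act : G -> M -> M).
Hypotheses (hM : is_manifold M) (hG : is_lie_group G) (hact : smooth_action act)
  (hproper : proper_action act).
Variables (br : (M -> R) -> (M -> R) -> (M -> R)) (J : M -> covec M -> tvec M)
  (om : M -> tvec M -> tvec M -> R) (P : M -> covec G).
Hypotheses (hJ : bracket_map br J) (hom : nondegenerate_two_form om)
  (hJom : inverse_of_form J om) (hGJ : action_preserves_map act J)
  (hP : is_momentum_map act om P).
Variables (x : M) (L : leaf_chart act x).
Hypothesis Px : P x = 0.
Notation K := (stabilizer act x).
Let hMc : cinf_space M := manifold_cinf hM.
Let hGc : cinf_space G := lie_group_cinf hG.
Notation l := (lmove L).
Notation phi := (lphi L).

(** Membership in the path component of 1 in K. The paths are maps on R of which only the part over
    [0, 1] matters. *)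
Definition stab_joined (k : G) := exists gam : R -> G,
  [/\ forall t, 0 <= t <= 1 -> {for t, continuous gam}, gam 0 = 1%g, gam 1 = k
    & forall t, 0 <= t <= 1 -> K (gam t)].

(* A path g_t in G is corrected to the path l(a(g_t x))^-1 g_t in the stabilizer of x. *)
Lemma near_stab_joined : \forall k \near (1%g : G), K k -> stab_joined k.
Proof.
have [W [V [nW nV inv]]] := (near_pairP _ _ _).1 (leaf_invariant hG hact L).
have [[_ _ /(_ 1%g)[n [UG [VG [phiG [psiG [chG UG1]]]]]]] _ _] := hG.
have ch := leaf_is_chart L.
have [r [[chr subr] r0]] := filter_ex (filterI (chart_ball chG UG1 nW) (nbhs_right_gt 0)).
have Ur : (UG `&` phiG @^-1` ball (phiG 1%g) r) 1%g by split=> //; exact: ballxx.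
apply: filterS (chart_nearU chr Ur) => k Uk Kk.
have ur := chartV chr Uk; have ur1 := chartV chr Ur.
pose line (t : R) := phiG 1%g + t *: (phiG k - phiG 1%g).
have lr t : 0 <= t <= 1 -> ball (phiG 1%g) r (line t) by exact: ball_segment.
pose g t := psiG (line t).
have cline t : {for t, continuous line}.
  apply: cvgD; first exact: cvg_cst.
  by apply: cvgZr_tmp; exact: cvg_id.
have cg t : 0 <= t <= 1 -> {for t, continuous g}.
  move=> t01; apply: (continuous_comp (cline t)).
  by have [] := chart_psi chr (lr _ t01).
have Wg t : 0 <= t <= 1 -> W (g t).
  by move=> t01; apply: subr; exact: (chartU chr (lr _ t01)).
have fix_ w : W w -> K ((l (lsubmx (phi (act w x))))^-1 * w)%g.
  move=> Ww; have [Ugx _ bgx] := inv _ _ Ww (nbhs_singleton nV); rewrite /= rsub_center in Ugx bgx.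
  rewrite /stabilizer /= (actM hact); apply: (canLR (actVK hact _)).
  rewrite invgK -[LHS](chartK ch Ugx) (leaf_act L); last exact: (chartV ch).
  by rewrite bgx row_mx0 leaf_psi0.
exists (fun t => (l (lsubmx (phi (act (g t) x))))^-1 * g t)%g.
have g0 : g 0 = 1%g by rewrite /g /line scale0r addr0 (chartK chG).
have g1 : g 1 = k by rewrite /g /line scale1r addrC subrK (chartK chr).
split.
- move=> t t01; apply: (cont_mul hG); last exact: cg.
  apply: (cont_inv hG).
  have c1 : {for t, continuous (fun t => act (g t) x)}.
    by apply: (cont_act hact); [exact: cg | exact: cvg_cst].
  have [Ut _ _] := inv _ _ (Wg _ t01) (nbhs_singleton nV).
  have c2 := continuous_comp c1 (lsub_phi_continuous (L := L) Ut).
  apply: (continuous_comp c2).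
  have [] // := leaf_move_smooth L (a := lsubmx (phi (act (g t) x))).
  by apply: ball_lsubmx; exact: (chartV ch).
- by rewrite g0 (act1 hact) lsub_center leaf_move0 invg1 mulg1.
- by rewrite g1 [act k x]Kk lsub_center leaf_move0 invg1 mul1g.
- by move=> t t01; exact: fix_ (Wg _ t01).
Qed.

(** The ineffective elements contain a neighbourhood of 1 in K, so along a path in K membership in S
    is locally constant; connectedness of [0, 1] carries it from 1 to k. *)
Lemma stab_joined_mem (S : set G) k : S 1%g -> (forall g h, S g -> S h -> S (g * h)%g) ->
  ineffective act x `<=` S -> stab_joined k -> S k.
Proof.
move=> S1 SM iS [gam [cgam gam0 gam1 Kgam]].
have nI := near_ineffective hM hG hact hproper hJ hom hJom hGJ hP L Px.
have loc (t : R) : 0 <= t <= 1 ->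
    \forall u \near t, 0 <= u <= 1 -> ineffective act x ((gam t)^-1 * gam u)%g.
  move=> t01; have c : {for t, continuous (fun u => (gam t)^-1 * gam u)%g}.
    by apply: (cont_mul hG); [exact: cvg_cst | exact: cgam].
  have := near_comp c (P := fun h => K h -> ineffective act x h).
  rewrite mulVg => /(_ nI); apply: filterS => u H u01; apply: H.
  by apply: (stabM hact); [apply: (stabV hact)|]; exact: Kgam.
have Smul g h : S g -> ineffective act x (g^-1 * h)%g -> S h.
  by move=> Sg /iS Sgh; have := SM _ _ Sg Sgh; rewrite mulgA mulgV mul1g.
pose B := [set t : R | 0 <= t <= 1 /\ S (gam t)].
have itvE : [set t : R | 0 <= t <= 1] = `[0, 1]%classic.
  by apply/seteqP; split=> t /=; rewrite in_itv.
have BE : B = `[0, 1]%classic.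
  apply: (@segment_connected R 0 1 B).
  - by exists 0; split; [rewrite lexx ler01 | rewrite gam0].
  - exists (interior [set t : R | 0 <= t <= 1 -> S (gam t)]); first exact: open_interior.
    rewrite -itvE; apply/seteqP; split=> [t [t01 St]|t [t01 /interior_subset H]].
      by split=> //; apply: filterS (loc t t01) => u H /H; exact: Smul.
    by split=> //; exact: H.
  exists (~` interior [set t : R | 0 <= t <= 1 -> ~ S (gam t)]).
    by apply: open_closedC; exact: open_interior.
  rewrite -itvE; apply/seteqP; split=> [t [t01 St]|t [t01 nint]].
    by split=> // /interior_subset /(_ t01).
  split=> //; apply: contrapT => nS; apply: nint.
  apply: filterS (loc t t01) => u H /H iu Su; apply: nS.
  apply: (Smul _ _ Su); have := ineffectiveV hM hact iu.
  by rewrite invgM invgK.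
have : B 1 by rewrite BE -itvE /= lexx ler01.
by rewrite /B /= gam1 => -[].
Qed.

(* Among the conjugates h^i k h^-i two are in the same coset of the path component of 1 in K, which h normalizes. *)
Lemma conjugate_stab h : (forall k, K k -> K (h * k * h^-1)%g) ->
  (forall g, ineffective act x g -> K (h^-1 * g * h)%g) ->
  forall k, K k -> K (h^-1 * k * h)%g.
Proof.
move=> hK hI k Kk.
pose c g := (h * g * h^-1)%g; pose d g := (h^-1 * g * h)%g.
have cK g : d (c g) = g by rewrite /c /d !mulgA mulVg mul1g mulgVK.
have cM g g' : c (g * g')%g = (c g * c g')%g by rewrite /c !mulgA mulgVK.
have dM g g' : d (g * g')%g = (d g * d g')%g by rewrite /d !mulgA mulgK.
have d1 : d 1%g = 1%g by rewrite /d mulg1 mulVg.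
have cV g : c g^-1%g = (c g)^-1%g by rewrite /c !invgM invgK mulgA.
have KdS g : stab_joined g -> K (d g).
  move=> jg; apply: (stab_joined_mem (S := [set g | K (d g)])) => //.
    by rewrite /= d1; exact: stab1.
  by move=> a b /=; rewrite dM; exact: (stabM hact).
(* Every initial piece of the path shows that its end point is joined to 1, so [KdS] keeps the whole
   path d gam inside K. *)
have dS g : stab_joined g -> stab_joined (d g).
  move=> [gam [cgam gam0 gam1 Kgam]]; exists (d \o gam); split.
  - move=> t t01; apply: (cont_mul hG); last exact: cvg_cst.
    by apply: (cont_mul hG); [exact: cvg_cst | exact: cgam].
  - by rewrite /= gam0 d1.
  - by rewrite /= gam1.
  move=> t t01; apply: KdS; exists (fun u => gam (u * t)); split.
  - move=> u u01; have ut : 0 <= u * t <= 1.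
      by move: u01 t01 => /andP[u0 u1] /andP[t0 t1]; rewrite mulr_ge0// mulr_ile1.
    have cu : {for u, continuous (fun u : R => u * t)} by apply: cvgMl; exact: cvg_id.
    exact: (continuous_comp cu (cgam _ ut)).
  - by rewrite mul0r.
  - by rewrite mul1r.
  - move=> u u01; apply: Kgam; move: u01 t01 => /andP[u0 u1] /andP[t0 t1].
    by rewrite mulr_ge0// mulr_ile1.
have nW : nbhs (1%g : G) (fun k => K k -> stab_joined k) := near_stab_joined.
have [D [DK cov]] := stab_finite_cover hG hproper x nW.
pose u i := iter i c k.
have Ku i : K (u i) by elim: i => [//|i IH]; exact: hK.
have fex i : exists g, g \in D /\ stab_joined (g^-1 * u i)%g.
  have [g gD H] := cov _ (Ku i); exists g; split=> //; apply: H.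
  by apply: (stabM hact) => //; apply: (stabV hact); exact: DK.
have [f fP] := choice fex.
(* Pigeonhole: the u i fall into the finitely many classes represented by D. *)
have [i [j [ij fij]]] : exists i j, (i < j)%N /\ f i = f j.
  apply: contrapT => H.
  have uq : uniq (map f (iota 0 (size D).+1)).
    rewrite map_inj_in_uniq ?iota_uniq// => i j _ _ E; apply: contrapT => /eqP.
    by rewrite neq_ltn => /orP[] lt; apply: H; [exists i, j | exists j, i].
  have sub : {subset map f (iota 0 (size D).+1) <= D} by move=> _ /mapP[i _ ->]; case: (fP i).
  by have := uniq_leq_size uq sub; rewrite size_map size_iota ltnn.
have jm g g' : stab_joined g -> stab_joined g' -> stab_joined (g^-1 * g')%g.
  move=> [p [cp p0 p1 Kp]] [q [cq q0 q1 Kq]]; exists (fun t => (p t)^-1 * q t)%g; split.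
  - by move=> t t01; apply: (cont_mul hG); [apply: (cont_inv hG); exact: cp | exact: cq].
  - by rewrite p0 q0 invg1 mulg1.
  - by rewrite p1 q1.
  - by move=> t t01; apply: (stabM hact); [apply: (stabV hact); exact: Kp | exact: Kq].
have : stab_joined ((u i)^-1 * u j)%g.
  have [_ H1] := fP i; have [_ H2] := fP j; rewrite -fij in H2.
  by have := jm _ _ H1 H2; rewrite invgM invgK mulgA mulgK.
have -> : ((u i)^-1 * u j = iter i c (k^-1 * u (j - i)%N))%g.
  have iterM m a b : iter m c (a * b)%g = (iter m c a * iter m c b)%g.
    by elim: m => //= m ->; rewrite cM.
  have iterV m a : iter m c a^-1%g = (iter m c a)^-1%g by elim: m => //= m ->; rewrite cV.
  by rewrite iterM iterV -/(u i) /u -iterD subnKC// ltnW.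
have down m g : stab_joined (iter m c g) -> stab_joined g.
  by elim: m => // m IH /= /dS; rewrite cK; exact: IH.
(* As d undoes one application of c, d maps u (j - i) to the preceding term, which lies in K; this
   isolates d k^-1. *)
move=> /down/KdS; rewrite dM.
have : (0 < j - i)%N by rewrite subn_gt0.
case: (j - i)%N => // p _ /=; rewrite cK => H.
have -> : (h^-1 * k * h = (d k^-1)^-1)%g by rewrite /d !invgM !invgK mulgA.
apply: (stabV hact); have := stabM hact H (stabV hact (Ku p)).
by rewrite mulgK.
Qed.

End stabilizer_conjugates.

Record reduction_setting {R : realType} {M : smoothSpaceType R} {G : smoothGroupType R}
    (br : (M -> R) -> (M -> R) -> (M -> R)) (J : M -> covec M -> tvec M)
    (om : M -> tvec M -> tvec M -> R) (Delta : M -> set (tvec M))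
    (act : G -> M -> M) (P : M -> covec G) : Prop := ReductionSetting {
  rs_M : is_manifold M;
  rs_J : bracket_map br J;
  rs_om : nondegenerate_two_form om;
  rs_Jom : inverse_of_form J om;
  rs_Delta : is_subbundle (@smooth_vf R M) Delta;
  rs_G : is_lie_group G;
  rs_act : smooth_action act;
  rs_proper : proper_action act;
  rs_LDelta : forall xi, lie_algebra G xi -> forall U Z, open U ->
     vf_section Delta U Z ->
     vf_section Delta U (lie_bracket (generator act xi) Z);
  rs_GJ : action_preserves_map act J;
  rs_GDelta : action_preserves_distribution act Delta;
  rs_P : is_momentum_map act om P;
  rs_PDelta : forall xi, lie_algebra G xi -> forall x,
     annihilator Delta x (differential (fun y => P y xi) x);
  rs_DeltaV : forall x, Delta x `&` vertical act x = [set 0];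
  rs_VDelta : is_subbundle (@smooth_vf R M)
     (fun x => set_add (vertical act x) (Delta x)) }.

(** * Orbit types and invariant functions near a point of the zero level *)

Section slice_theory.
Context {R : realType} {M : smoothSpaceType R} {G : smoothGroupType R}.
Context {br : (M -> R) -> (M -> R) -> (M -> R)} {J : M -> covec M -> tvec M}
  {om : M -> tvec M -> tvec M -> R} {Delta : M -> set (tvec M)}
  {act : G -> M -> M} {P : M -> covec G}.
Hypothesis hs : reduction_setting br J om Delta act P.
Let hM := rs_M hs.
Let hG := rs_G hs.
Let hact := rs_act hs.
Let hproper := rs_proper hs.
Let hMc : cinf_space M := manifold_cinf hM.
Let hGc : cinf_space G := lie_group_cinf hG.

Section fixed_point.
Variable x : M.
Hypothesis Px : P x = 0.
Notation K := (stabilizer act x).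

Lemma rs_leaf : inhabited (leaf_chart act x).
Proof. exact: (leaf_chart_exists hM hG hact (rs_Delta hs) (rs_DeltaV hs) (rs_VDelta hs)). Qed.

Lemma rs_average : exists s : seq G, [/\ (0 < size s)%N, forall k, k \in s -> K k &
    forall (V : nmodType) (F : G -> V),
      (forall k g, K k -> ineffective act x g -> F (k * g)%g = F k) ->
      forall h, K h -> \sum_(k <- s) F (k * h)%g = \sum_(k <- s) F k /\
                       \sum_(k <- s) F (h * k)%g = \sum_(k <- s) F k].
Proof.
have [L] := rs_leaf.
exact: (stab_average hM hG hact hproper (rs_J hs) (rs_om hs) (rs_Jom hs) (rs_GJ hs) (rs_P hs) L Px).
Qed.

Lemma rs_slice : inhabited (slice act x).
Proof.
have [L] := rs_leaf; have [s [s0 sK sav]] := rs_average.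
exact: (slice_from_average hM hG hact hproper L s0 sK sav).
Qed.

Lemma rs_ineffective_trivial : \forall y \near x, forall k, ineffective act x k -> act k y = y.
Proof. have [L] := rs_leaf; exact: (ineffective_trivial hM hG hact hproper L). Qed.

Lemma rs_local_stabilizer : \forall p \near ((1%g, x) : G * M),
  act p.1 p.2 = p.2 -> act p.1 x = x.
Proof.
have [L] := rs_leaf.
exact: (local_stabilizer hM hG hact hproper (rs_J hs) (rs_om hs) (rs_Jom hs) (rs_GJ hs) (rs_P hs) L Px).
Qed.

Variable S : slice act x.
Notation U := (sdom S).
Notation phi := (sphi S).
Notation psi := (spsi S).
Notation a y := (lsubmx (phi y)).
Notation b y := (rsubmx (phi y)).
Notation rho := (srho S).
Notation sg y := (psi (row_mx 0 (b y))).
Let ch := slice_chart S.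
Let Ux := slice_dom S.
Let phix := slice_center S.

Lemma slice_coord_continuous y : U y -> {for y, continuous (fun y => b y)}.
Proof. by move=> Uy; apply: cont_rsubmx; have [] := chart_phi ch Uy. Qed.

Lemma slice_section_continuous y : U y -> {for y, continuous (fun y => sg y)}.
Proof.
move=> Uy; have c : {for y, continuous (fun y => row_mx (0 : 'rV[R]_(sdim S)) (b y))}.
  by apply: cont_row_mx; [exact: cvg_cst | exact: slice_coord_continuous].
apply: (continuous_comp c).
have r0 : ball 0 (srad S) (row_mx (0 : 'rV[R]_(sdim S)) (b y)).
  apply: ball_row_mx; [exact: slice_rad | exact: ballxx (slice_rad S) |].
  by apply: ball_rsubmx; exact: (chartV ch).
by have [] := chart_psi ch r0.
Qed.

Lemma slice_coord0 : b x = 0. Proof. by rewrite phix; apply/rowP => i; rewrite !mxE. Qed.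

Lemma slice_section0 : sg x = x.
Proof. by rewrite slice_coord0 row_mx0 -phix (chartK ch). Qed.

Lemma slice_sectionP y : U y -> [/\ U (sg y), a (sg y) = 0 & b (sg y) = b y].
Proof.
move=> Uy; have r0 : ball 0 (srad S) (row_mx (0 : 'rV[R]_(sdim S)) (b y)).
  apply: ball_row_mx; [exact: slice_rad | exact: ballxx (slice_rad S) |].
  by apply: ball_rsubmx; exact: (chartV ch).
by split; [exact: (chartU ch) | rewrite (chartVK ch r0) row_mxKl | rewrite (chartVK ch r0) row_mxKr].
Qed.

Lemma slice_ext y z : U y -> U z -> a y = a z -> b y = b z -> y = z.
Proof.
move=> Uy Uz E1 E2; rewrite -(chartK ch Uy) -(chartK ch Uz).
by rewrite -(hsubmxK (phi y)) E1 E2 hsubmxK.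
Qed.

(** Properness writes an element g that relates two points near x as w k with w near 1 and k in K.
    The factor w preserves b, so g changes b by the matrix rho k, and w fixes a point near x only if
    it fixes x. *)
Lemma slice_near : exists V, [/\ nbhs x V, V `<=` U,
  forall y k, V y -> K k -> [/\ U (act k y), a (act k y) = a y *m sal S k
                             & b (act k y) = b y *m rho k],
  forall y k, V y -> ineffective act x k -> act k y = y
  & forall y g, V y -> V (act g y) -> exists w k, [/\ K k, g = (w * k)%g,
      forall z, V z -> b (act g z) = b z *m rho k
      & forall z, V z -> act w z = z -> K w]].
Proof.
have [W1 [V1 [nW1 nV1 inv]]] := (near_pairP _ _ _).1 (slice_inv S).
have [W2 [V2 [nW2 nV2 lst]]] := (near_pairP _ _ _).1 rs_local_stabilizer.
have [V3 nV3 prop] := proper_near hM hG hact hproper x (filterI nW1 nW2).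
have HK : \forall y \near x, forall k, K k -> V1 (act k y) /\ U (act k y).
  apply: (stab_near_covering hproper (P := fun y k => V1 (act k y) /\ U (act k y))) => k Kk.
  apply: (near_comp (act_continuous hact (p := (k, x))) (P := fun z => V1 z /\ U z)).
  by rewrite /= Kk; apply: filterI => //; exact: (chart_nearU ch).
pose V := V2 `&` V3 `&` U `&` [set y | forall k, K k -> V1 (act k y) /\ U (act k y)] `&`
  [set y | forall k, K k -> a (act k y) = a y *m sal S k /\ b (act k y) = b y *m rho k] `&`
  [set y | forall k, ineffective act x k -> act k y = y].
exists V; split.
- have n1 := chart_nearU ch Ux; have n2 := slice_equiv S; have n3 := rs_ineffective_trivial.
  exact: (filterI (filterI (filterI (filterI (filterI nV2 nV3) n1) HK) n2) n3).
- by move=> y [[[[_ ?] _] _] _].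
- move=> y k [[[_ H1] H2] _] Kk; have [_ Uk] := H1 _ Kk; have [? ?] := H2 _ Kk.
  by split.
- by move=> y k [_ H] /H.
- move=> y g [[[[[_ V3y] _] _] _] _] [[[[[_ V3g] _] _] _] _].
  have [w [k [[W1w W2w] Kk gE]]] := prop y g V3y V3g.
  exists w, k; split=> // [z [[[[_ _] H1] H2] _]|z [[[[[V2z _] _] _] _] _] wz].
    have [V1k _] := H1 _ Kk; have [_ <-] := H2 _ Kk.
    by rewrite gE (actM hact); exact: (inv _ _ W1w V1k).
  exact: (lst _ _ W2w V2z wz).
Qed.

Lemma stabilizer_act t z : stabilizer act (act t z) = [set (t * k * t^-1)%g | k in stabilizer act z].
Proof.
apply/seteqP; split=> [g gz|_ [k kz <-]].
  exists (t^-1 * g * t)%g; last by rewrite !mulgA mulgV mul1g mulgK.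
  by rewrite /stabilizer /= !(actM hact) [act g _]gz (actK hact).
by rewrite /stabilizer /= !(actM hact) (actK hact) [act k z]kz.
Qed.

(** It suffices to treat the point s of the transversal on the orbit of y. Its stabilizer lies in K
    and contains the elements acting trivially near x. If b is fixed by K this stabilizer is K;
    conversely a conjugate of K with these properties is K by [conjugate_stab]. *)
Lemma slice_orbit_type : \forall y \near x,
  conj_class K (stabilizer act y) <-> forall k, K k -> b y *m rho k = b y.
Proof.
have [V [nV VU VK VI Vrec]] := slice_near.
have nsg : \forall y \near x, V (sg y).
  by apply: (near_comp (slice_section_continuous Ux)); rewrite slice_section0.
apply: filterS3 nV nsg (slice_turn S) => y Vy Vs yE.
set s := sg y in Vs yE *; set t := sturn S y in yE.
have [Us as0 bs] := slice_sectionP (VU _ Vy).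
rewrite -/s in Us as0 bs.
have fixk k : K k -> b s *m rho k = b s -> act k s = s.
  move=> Kk bk; have [Uk ak bk'] := VK _ _ Vs Kk.
  by apply: slice_ext => //; [rewrite ak as0 mul0mx | rewrite bk' bk].
have stab_sub g : act g s = s -> K g.
  move=> gs; have Vg : V (act g s) by rewrite gs.
  have [w [k [Kk gE brec wfix]]] := Vrec _ _ Vs Vg.
  have ks : act k s = s by apply: fixk => //; rewrite -brec// gs.
  rewrite gE; apply: (stabM hact) => //; apply: (wfix s) => //.
  by rewrite -{1}ks -(actM hact) -gE.
split=> [[g0 gE]|inv]; last first.
  exists t; rewrite {1}yE stabilizer_act; apply/seteqP; split=> _ [k Hk <-]; exists k => //.
    exact: stab_sub.
  by apply: fixk => //; rewrite bs; exact: inv.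
have sE : stabilizer act s = [set ((t^-1 * g0) * k * (t^-1 * g0)^-1)%g | k in K].
  have -> : s = act t^-1%g y by rewrite yE (actK hact).
  rewrite stabilizer_act gE; apply/seteqP; split=> [_ [_ [k Kk <-] <-]|_ [k Kk <-]].
    by exists k => //; rewrite !invgM !invgK !mulgA.
  by exists (g0 * k * g0^-1)%g; [exists k | rewrite !invgM !invgK !mulgA].
set h := (t^-1 * g0)%g in sE.
clearbody h; have [L] := rs_leaf.
have H := conjugate_stab hM hG hact hproper (rs_J hs) (rs_om hs) (rs_Jom hs) (rs_GJ hs) (rs_P hs) L Px (h := h).
move=> k Kk; have Ks : stabilizer act s k.
  rewrite sE; exists (h^-1 * k * h)%g; last by rewrite !mulgA mulgV mul1g mulgK.
  apply: H => // [k' Kk'|g ig].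
    by apply: stab_sub; have : stabilizer act s (h * k' * h^-1)%g by rewrite sE; exists k'.
  have : stabilizer act s g by exact: (VI _ _ Vs ig).
  by rewrite sE => -[k' Kk' <-]; rewrite !mulgA mulVg mul1g mulgVK.
rewrite -bs; have [_ _ <-] := VK _ _ Vs Kk.
by rewrite [act k s]Ks.
Qed.

(** The sum over K of the squares of u rho(k) is invariant under K. One summand k0 already controls
    u, with c the norm bound for the inverse of rho(k0). *)
Let quad_form : exists q : 'rV[R]_(scodim S) -> R, exists2 c, 0 < c &
  [/\ forall u, euclidean_smooth_at u q, q 0 = 0,
      forall u k, K k -> q (u *m rho k) = q u & forall u (e : R), 0 < e -> q u < (e / c) ^+ 2 -> `|u| <= e].
Proof.
have [s [s0 sK sav]] := rs_average.
pose N (w : 'rV[R]_(scodim S)) := \sum_i w 0 i ^+ 2.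
pose q u := \sum_(k <- s) N (u *m rho k).
have N0 w : 0 <= N w by apply: sumr_ge0 => i _; exact: sqr_ge0.
have [k0 k0s] : exists k0, k0 \in s by case: s s0 {sK sav q} => // k0 s' _; exists k0; rewrite mem_head.
have [c c0 Hc] := mulmx_norm_bound (rho k0^-1%g).
exists q, c => //; split.
- move=> u; apply: (es_near (f := fun u : 'rV[R]_(scodim S) => \sum_(z < size s) \sum_i
      (\sum_j u 0 j * rho (tnth (in_tuple s) z) j i) * (\sum_j u 0 j * rho (tnth (in_tuple s) z) j i))).
    apply: nearT => w; rewrite /q (big_tnth _ _ s); apply: eq_bigr => z _.
    by apply: eq_bigr => i _; rewrite mxE expr2.
  apply: es_sum => z; apply: es_sum => i.
  by apply: esM; apply: es_sum => j; apply: esM; [exact: es_coord | exact: es_cst | exact: es_coord | exact: es_cst].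
- rewrite /q big1// => k _; rewrite /N big1// => i _.
  by rewrite mul0mx mxE expr0n.
- move=> u h Kh; pose F k := N (u *m rho k).
  have Fc k g : K k -> ineffective act x g -> F (k * g)%g = F k.
    by move=> Kk ig; rewrite /F srho_class.
  rewrite /q -[RHS](sav _ _ Fc h Kh).1 big_seq [RHS]big_seq; apply: eq_bigr => k /sK Kk.
  by rewrite /F srho_mul// mulmxA.
move=> u e e0 qe; have Kk0 := sK _ k0s.
set w := u *m rho k0; have wn : `|w| < e / c.
  rewrite -(@ltr_pXn2r _ 2)// ?nnegrE//; last by rewrite divr_ge0// ltW.
  apply: le_lt_trans qe; rewrite /q (big_rem k0)//= -/w.
  have : 0 <= \sum_(k <- rem k0 s) N (u *m rho k) by apply: sumr_ge0 => k _; exact: N0.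
  suff : `|w| ^+ 2 <= N w by lra.
  have [->|w0] := eqVneq w 0; first by rewrite normr0 expr0n.
  move: w0; rewrite -normr_eq0 => w0; have [[i j] E] := mx_norm_neq0 w0.
  rewrite [X in X ^+ 2]/Num.Def.normr/= E /= (ord1 i) /N (bigD1 j)//= real_normK ?num_real// lerDl.
  by apply: sumr_ge0 => l _; exact: sqr_ge0.
have uE : u = w *m rho k0^-1%g.
  rewrite /w -mulmxA -srho_mul//; last exact: (stabV hact).
  by rewrite mulVg srho1 mulmx1.
rewrite uE (le_trans (Hc _))// -ler_pdivlMl// mulrC; exact: ltW.
Qed.

(** The function u is cut off by a function of the invariant form q(b). The support then lies in the
    saturation of a compact ball, which is closed by properness, and [glue_invariant] applies. *)
Lemma invariant_extension (U0 : set M) (u : M -> R) : nbhs x U0 ->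
  (forall y, U0 y -> smooth_at y u) ->
  (forall y g, U0 y -> U0 (act g y) -> u (act g y) = u y) ->
  exists2 f, invariant_fun act f & \forall y \near x, f y = u y.
Proof.
move=> nU0 su iu; have [V [nV VU VK VI Vrec]] := slice_near.
have : nbhs x (V `&` U0 `&` [set y | y = act (sturn S y) (sg y)]).
  by apply: filterI; [exact: filterI | exact: slice_turn].
rewrite nbhsE => -[B [oB Bx] Bsub].
have BV y : B y -> V y by move=> /Bsub[[]].
have BU0 y : B y -> U0 y by move=> /Bsub[[]].
have b0 := ballxx (0 : 'rV[R]_(sdim S + scodim S)) (slice_rad S).
have [q [c c0 [sq q0 qrho qlt]]] := quad_form.
have [e e0 He] : exists2 e : R, 0 < e & forall w : 'rV[R]_(sdim S + scodim S), `|w| <= e ->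
    ball 0 (srad S) w /\ B (psi w).
  have : \forall w \near (0 : 'rV[R]_(sdim S + scodim S)), ball 0 (srad S) w /\ B (psi w).
    have [cp _] := chart_psi ch b0.
    apply: filterI; first exact: nbhsx_ballx (slice_rad S).
    by apply: (near_comp cp); rewrite -phix (chartK ch Ux); exact: open_nbhs_nbhs.
  move=> /nbhs_ballP[e' /= e'0 H]; exists (e' / 2); first by rewrite divr_gt0.
  move=> w we; apply: H; rewrite -ball_normE /ball_ /= sub0r normrN (le_lt_trans we)//.
  by rewrite ltr_pdivrMr// ltr_pMr// ltr1n.
pose C0 := psi @` [set w | `|w - 0| <= e].
have cC0 : compact C0.
  by apply: (chart_compact_ball ch) => w; rewrite subr0 => /He[].
pose C := [set y | exists g, C0 (act g y)].
have cC : closed C by exact: (orbit_compact_closed hM hproper).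
have d0 : 0 < (e / c) ^+ 2 by rewrite exprn_gt0// divr_gt0.
(* Where this bump is nonzero one has q(b) < (e / c) ^ 2, hence |b| <= e, and the corresponding
   point of the transversal lies in [C0]. *)
have [beta [sbeta beta1 beta0]] := euclidean_bump (0 : 'rV[R]_1) d0.
pose chi y := beta (\row_(i < 1) q (b y)).
have sqb y : U y -> smooth_at y (fun y => q (b y)).
  move=> Uy; apply: (sm_near hMc (f := fun y => q (\row_j phi y 0 (rshift _ j)))).
    by apply: nearT => z; congr q; apply/rowP => j; rewrite !mxE.
  apply: (sm_comp hMc (u := fun j y => phi y 0 (rshift _ j))) => [j|]; last exact: sq.
  exact: (chart_coord ch).
have schi y : U y -> smooth_at y chi.
  move=> Uy; apply: (sm_comp hMc (u := fun _ y => q (b y))) => [j|]; last exact: sbeta.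
  exact: sqb.
have [|||||f fi [fO fC]] := @glue_invariant _ _ _ act hM hact B C (fun y => chi y * u y)
  oB cC _ _ _ _ _.
- by move=> g y [h Ch]; exists (h * g^-1)%g; rewrite (actM hact) (actK hact).
- by move=> y [g [w /= we Ew]]; exists g; rewrite -Ew; apply: (He w _).2; rewrite -(subr0 w).
- move=> y By; apply: (smM hMc); first by apply: schi; exact: VU (BV _ By).
  exact: su (BU0 _ By).
- move=> y g By Bg; rewrite iu//; try exact: BU0.
  have [w [k [Kk _ bk _]]] := Vrec _ _ (BV _ By) (BV _ Bg).
  congr (_ * _); congr beta; apply/rowP => i; rewrite !mxE bk ?qrho//; exact: BV.
- move=> y By nC; suff -> : chi y = 0 by rewrite mul0r.
  apply: beta0; rewrite subr0 leNgt; apply/negP => lt; apply: nC.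
  exists (sturn S y)^-1%g; have /Bsub[_ /= yE] := By.
  have -> : act (sturn S y)^-1%g y = sg y by rewrite {2}yE (actK hact).
  have be : `|b y| <= e.
    apply: qlt => //; apply: le_lt_trans lt.
    by have := normr_coord_le (\row_(i < 1) q (b y)) 0; rewrite mxE; apply: le_trans; exact: ler_norm.
  exists (row_mx 0 (b y)) => //=; rewrite subr0.
  rewrite [leLHS]/Num.Def.normr/= mx_normrE; apply: bigmax_le => [|[i j] _]; first exact: ltW.
  rewrite (ord1 i) /=; case: (split_ordP j) => l ->; rewrite ?row_mxEl ?row_mxEr.
    by rewrite mxE normr0 ltW.
  by apply: le_trans be; exact: normr_coord_le.
exists f => //.
have nb : \forall y \near x, chi y = 1.
  have cq : {for x, continuous (fun y => \row_(i < 1) q (b y))}.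
    by apply: continuous_row => i; apply: (sm_continuous hMc); exact: sqb.
  apply: (near_comp cq (P := fun z => beta z = 1)).
  have -> : \row_(i < 1) q (b x) = 0 by apply/rowP => i; rewrite !mxE slice_coord0 q0.
  exact: beta1.
have nB : nbhs x B by exact: open_nbhs_nbhs.
by apply: filterS2 nb nB => y c1 By; rewrite fO// c1 mul1r.
Qed.

End fixed_point.
End slice_theory.

(** * Charts of the orbit type pieces *)

(** Rank factorization Q = C B; cancelling the full rank factors in Q Q = Q leaves B C = 1. *)
Lemma idempotent_split {F : fieldType} n (Q : 'M[F]_n) : Q *m Q = Q ->
  exists r (C : 'M[F]_(n, r)) (B : 'M[F]_(r, n)), [/\ C *m B = Q, B *m C = 1%:M & Q *m C = C].
Proof.
move=> QQ; exists (\rank Q), (col_base Q), (row_base Q).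
have E := mulmx_base Q; have Rf := row_base_free Q; have Cf := col_base_full Q.
move: (col_base Q) (row_base Q) E Rf Cf => C B E Rf Cf.
have BC : B *m C = 1%:M.
  apply: (row_free_inj Rf); apply: (@row_full_inj _ _ _ _ C Cf).
  by rewrite /= mul1mx !mulmxA E -mulmxA E.
by split=> //; have := congr1 (mulmx^~ C) E; rewrite /= -mulmxA BC mulmx1 => <-.
Qed.

(** * Equivariant splittings *)

Section equivariant_splitting.
Context {R : realType} {G : groupType} {m d : nat}.
Variables (K N : set G) (s : seq G) (rho : G -> 'M[R]_m) (kappa : G -> 'M[R]_d)
  (T : 'M[R]_(m, d)) (Y0 : 'M[R]_(d, m)).
Hypotheses (K1 : K 1%g) (KM : forall g h, K g -> K h -> K (g * h)%g)
  (KV : forall g, K g -> K g^-1%g) (NK : forall g, N g -> K g) (NV : forall g, N g -> N g^-1%g)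
  (s0 : (0 < size s)%N) (sK : forall k, k \in s -> K k)
  (sav : forall (V : nmodType) (F : G -> V),
      (forall k g, K k -> N g -> F (k * g)%g = F k) ->
      forall h, K h -> \sum_(k <- s) F (k * h)%g = \sum_(k <- s) F k /\
                       \sum_(k <- s) F (h * k)%g = \sum_(k <- s) F k)
  (rhoM : forall g h, K g -> K h -> rho (g * h)%g = rho h *m rho g)
  (rhoN : forall g h, K g -> N h -> rho (g * h)%g = rho g) (rho1 : rho 1%g = 1%:M)
  (rhoT : forall k, K k -> rho k *m T = T *m kappa k) (Y0T : Y0 *m T = 1%:M).

Let kappaE k : K k -> kappa k = Y0 *m (rho k *m T).
Proof. by move=> Kk; rewrite rhoT// mulmxA Y0T mul1mx. Qed.

Let kappaM g h : K g -> K h -> kappa (g * h)%g = kappa h *m kappa g.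
Proof.
move=> Kg Kh; rewrite (kappaE (KM Kg Kh)) rhoM// -mulmxA (rhoT Kg) (mulmxA (rho h)) (rhoT Kh).
by rewrite !mulmxA Y0T mul1mx.
Qed.

Let kappa1 : kappa 1%g = 1%:M. Proof. by rewrite kappaE// rho1 mul1mx Y0T. Qed.

Let rho_triv g : N g -> rho g = 1%:M.
Proof. by move=> ig; rewrite -[g]mul1g rhoN. Qed.

Let kappa_triv g : N g -> kappa g = 1%:M.
Proof. by move=> Ng; rewrite (kappaE (NK Ng)) rho_triv// mul1mx. Qed.

Let c0 : R := (size s)%:R^-1.
Let c0s : c0 * (size s)%:R = 1. Proof. by rewrite mulVf// pnatr_eq0 -lt0n. Qed.
Let avg_cst (V : lmodType R) (v : V) : c0 *: \sum_(k <- s) v = v.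
Proof. by rewrite big_const_seq count_predT iter_addr_0 -scaler_nat scalerA c0s scale1r. Qed.

Let A : 'M[R]_m := c0 *: \sum_(k <- s) rho k.
(** The parameter h lets one family serve both sides of the equivariance of Y: F h k is F 1 k times
    rho h, and F h (k h) is kappa h times F 1 k. *)
Let F (h k : G) : 'M[R]_(d, m) := kappa k *m Y0 *m rho (h * k^-1)%g.
Let Y : 'M[R]_(d, m) := c0 *: \sum_(k <- s) F 1%g k.

Let rhoA h : K h -> rho h *m A = A.
Proof.
move=> Kh; rewrite /A -scalemxAr mulmx_sumr.
have [<- _] := sav rhoN Kh.
congr (_ *: _); rewrite big_seq [RHS]big_seq; apply: eq_bigr => k /sK Kk.
by rewrite rhoM.
Qed.

Let Arho h : K h -> A *m rho h = A.
Proof.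
move=> Kh; rewrite /A -scalemxAl mulmx_suml.
have [_ <-] := sav rhoN Kh.
congr (_ *: _); rewrite big_seq [RHS]big_seq; apply: eq_bigr => k /sK Kk.
by rewrite rhoM.
Qed.

Let fixA q (w : 'M[R]_(q, m)) : (forall k, K k -> w *m rho k = w) -> w *m A = w.
Proof.
move=> wk; rewrite /A -scalemxAr mulmx_sumr -[RHS]avg_cst; congr (_ *: _).
by rewrite big_seq [RHS]big_seq; apply: eq_bigr => k /sK/wk.
Qed.

Let YT : Y *m T = 1%:M.
Proof.
rewrite /Y -scalemxAl mulmx_suml -[RHS]avg_cst; congr (_ *: _).
rewrite big_seq [RHS]big_seq; apply: eq_bigr => k /sK Kk.
have Kk' := KV Kk; rewrite /F mul1g.
by rewrite -[_ *m _ *m T]mulmxA rhoT// mulmxA -(mulmxA _ _ T) Y0T mulmx1 -kappaM// mulVg kappa1.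
Qed.

Let kappaY h : K h -> kappa h *m Y = Y *m rho h.
Proof.
move=> Kh; rewrite /Y -scalemxAr -scalemxAl mulmx_sumr mulmx_suml; congr (_ *: _).
have Fc k g : K k -> N g -> F h (k * g)%g = F h k.
  move=> Kk Ng; have Kg := NK Ng; rewrite /F kappaM// (kappa_triv Ng) mul1mx invgM mulgA.
  by rewrite (rhoM (KM Kh (KV Kg)) (KV Kk)) (rhoN Kh (NV Ng)) -rhoM//; exact: KV.
have [E1 _] := sav Fc Kh; rewrite -[RHS](_ : \sum_(k <- s) F h k = _); last first.
  rewrite big_seq [RHS]big_seq; apply: eq_bigr => k /sK Kk.
  by rewrite /F mul1g rhoM ?mulmxA//; exact: KV.
rewrite -E1 big_seq [RHS]big_seq; apply: eq_bigr => k /sK Kk.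
by rewrite /F invgM mulgA mulgV kappaM// !mulmxA.
Qed.

Let TYA : T *m Y *m A = A *m (T *m Y).
Proof.
have c k : K k -> rho k *m (T *m Y) = T *m Y *m rho k.
  by move=> Kk; rewrite mulmxA rhoT// -(mulmxA _ (kappa k)) kappaY// mulmxA.
rewrite [in LHS]/A [in RHS]/A -scalemxAr -scalemxAl mulmx_sumr mulmx_suml; congr (_ *: _).
by rewrite big_seq [RHS]big_seq; apply: eq_bigr => k /sK Kk; rewrite c.
Qed.

(** A averages rho and so projects rows onto the K-fixed ones. Y averages the left inverse Y0 of T
    over both actions. Then T Y commutes with K and hence with A. *)
Lemma equivariant_splitting : exists (A : 'M[R]_m) (Y : 'M[R]_(d, m)),
  [/\ forall k, K k -> rho k *m A = A /\ A *m rho k = A,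
      forall q (w : 'M[R]_(q, m)), (forall k, K k -> w *m rho k = w) -> w *m A = w,
      Y *m T = 1%:M, forall k, K k -> kappa k *m Y = Y *m rho k & T *m Y *m A = A *m (T *m Y)].
Proof.
exists A, Y; split=> // k Kk; split; [exact: rhoA|exact: Arho].
Qed.

End equivariant_splitting.

(* Coordinates (a, b) as in a leaf chart for which the piece through x is the linear subspace
   b = b pcol prow; there z = b pcol is a coordinate system of the quotient. *)
Record piece_chart {R : realType} {M : smoothSpaceType R} {G : smoothGroupType R}
    (act : G -> M -> M) (P : M -> covec G) (x : M) := PieceChart {
  pdim : nat; pcodim : nat; prank : nat; prad : R; pdom : set M;
  pphi : M -> 'rV[R]_(pdim + pcodim); ppsi : 'rV[R]_(pdim + pcodim) -> M;
  pcol : 'M[R]_(pcodim, prank); prow : 'M[R]_(prank, pcodim);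
  piece_rad : 0 < prad;
  piece_is_chart : is_chart pdom (ball 0 prad) pphi ppsi;
  piece_dom : pdom x;
  piece_center : pphi x = 0;
  piece_split : prow *m pcol = 1%:M;
  piece_level : forall y, pdom y ->
    (level_piece act P (conj_class (stabilizer act x)) y <->
     rsubmx (pphi y) *m pcol *m prow = rsubmx (pphi y));
  piece_vert : forall y v, pdom y -> (vertical act y v <->
    tangent y v /\ forall j, v (fun y => pphi y 0 (rshift pdim j)) = 0);
  piece_stab : forall y g, pdom y -> pdom (act g y) -> exists rho, rho *m pcol = pcol /\
    \forall z \near y, rsubmx (pphi (act g z)) = rsubmx (pphi z) *m rho;
  piece_move : forall y, pdom y -> exists g, y = act g (ppsi (row_mx 0 (rsubmx (pphi y)))) /\
    \forall z \near ppsi (row_mx 0 (rsubmx (pphi y))), rsubmx (pphi (act g z)) = rsubmx (pphi z);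
  piece_same : forall y y', pdom y -> pdom y' -> rsubmx (pphi y) = rsubmx (pphi y') ->
    exists g, y' = act g y;
  piece_tangent : forall v, tangent x v ->
    (forall k, stabilizer act x k -> vertical act x (tmap (act k) x v - v)) ->
    (forall xi, lie_algebra G xi -> v (fun y => P y xi) = 0) ->
    (\row_j v (fun y => pphi y 0 (rshift pdim j))) *m pcol *m prow =
     \row_j v (fun y => pphi y 0 (rshift pdim j)) }.

(** * The momentum map in slice coordinates *)

Section momentum_coordinates.
Context {R : realType} {M : smoothSpaceType R} {G : smoothGroupType R}.
Context {br : (M -> R) -> (M -> R) -> (M -> R)} {J : M -> covec M -> tvec M}
  {om : M -> tvec M -> tvec M -> R} {Delta : M -> set (tvec M)}
  {act : G -> M -> M} {P : M -> covec G}.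
Hypothesis hs : reduction_setting br J om Delta act P.
Let hM := rs_M hs.
Let hG := rs_G hs.
Let hact := rs_act hs.
Let hMc : cinf_space M := manifold_cinf hM.
Let hGc : cinf_space G := lie_group_cinf hG.

Lemma constant_on_chart (X : smoothSpaceType R) n (U : set X) (a : 'rV[R]_n) r phi psi f :
  cinf_space X -> is_chart U (ball a r) phi psi -> (forall y, U y -> smooth_at y f) ->
  (forall y v, U y -> tangent y v -> v f = 0) -> forall y z, U y -> U z -> f y = f z.
Proof.
move=> hX ch sf f0 y z Uy Uz; have by_ := chartV ch Uy; have bz := chartV ch Uz.
have := @lipschitz_of_partials R n (f \o psi) a r 0 (phi y) (phi z) _ _ by_ bz.
rewrite mulr0 mul0r normr_le0 subr_eq0 /= (chartK ch Uy) (chartK ch Uz) => H.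
have ef u : ball a r u -> euclidean_smooth_at u (f \o psi).
  by move=> ur; have [_ s] := chart_psi ch ur; apply: s; apply: sf; exact: (chartU ch).
apply/eqP; apply: H => [u ur|u i ur]; first by apply: es_diff; exact: ef.
have Uu := chartU ch ur.
have := f0 _ _ Uu (chart_vec_tangent ch hX (delta_mx 0 i) Uu).
rewrite (chart_vecE ch) ?(chartVK ch)//; last exact: sf.
rewrite (bigD1 i)//= mxE !eqxx mul1r big1 ?addr0 => [->|k /negPf ki]; first by rewrite normr0.
by rewrite mxE ki andbF mul0r.
Qed.

Section fixed_point.
Variables (x : M) (L : leaf_chart act x).
Hypothesis Px : P x = 0.
Notation l := (lmove L).
Notation phi := (lphi L).
Notation d := (ldim L).
Let ch := leaf_is_chart L.
Let Ux := leaf_dom L.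

Definition leaf_generator (i : 'I_d) : tvec G :=
  tmap l (0 : 'rV[R]_d) (partial_vec 0 (delta_mx 0 i)).

Let sl : smooth_map_at l (0 : 'rV[R]_d) := leaf_move_smooth L (ballxx 0 (leaf_rad L)).

Lemma lie_algebra_leaf_generator i : lie_algebra G (leaf_generator i).
Proof.
rewrite /lie_algebra -(leaf_move0 L); apply: tangent_tmap => //.
exact: derive_tangent.
Qed.

Let leaf_generator_partial i y f : smooth_at y f -> generator act (leaf_generator i) y f =
  partial_vec (0 : 'rV[R]_d) (delta_mx 0 i) (fun c => f (act (l c) y)).
Proof.
move=> sf; have sg : smooth_at (1%g : G) (fun g => f (act g y)).
  by have [_ s] := smooth_act_l hG hact y 1%g; apply: (s f); rewrite (act1 hact).
by rewrite (generatorE hact)// /leaf_generator tmapE; last by rewrite leaf_move0.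
Qed.

Let leaf_generatorE i y f : smooth_at y f -> generator act (leaf_generator i) y f =
  'D_(delta_mx 0 i) (fun c => f (act (l c) y)) 0.
Proof.
move=> sf; have sg : smooth_at (1%g : G) (fun g => f (act g y)).
  by have [_ s] := smooth_act_l hG hact y 1%g; apply: (s f); rewrite (act1 hact).
rewrite leaf_generator_partial// partial_vecE; last first.
  by have [_ s] := sl; apply: (s (fun g => f (act g y))); rewrite leaf_move0.
rewrite (bigD1 i)//= mxE !eqxx mul1r big1 ?addr0// => k /negPf ki.
by rewrite mxE ki andbF mul0r.
Qed.

Lemma leaf_generator_free (c : 'I_d -> R) :
  \sum_i c i *: generator act (leaf_generator i) x = 0 -> forall i, c i = 0.
Proof.
move=> E j; have := congr1 (fun v : tvec M => v (fun y => phi y 0 (lshift _ j))) E.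
have D i : generator act (leaf_generator i) x (fun y => phi y 0 (lshift _ j)) = (i == j)%:R.
  rewrite leaf_generator_partial; last exact: (chart_coord ch).
  have H : \forall c \near (0 : 'rV[R]_d), phi (act (l c) x) 0 (lshift (lcodim L) j) = c 0 j.
    apply: nearS (nbhsx_ballx _ _ (leaf_rad L)) => u ur.
    have r0 := ball_row_mx (leaf_rad L) ur (ballxx (0 : 'rV[R]_(lcodim L)) (leaf_rad L)).
    have := leaf_act L r0; rewrite row_mxKl row_mxKr row_mx0 leaf_psi0 => <-.
    by rewrite (chartVK ch r0) row_mxEl.
  have tv : tangent (0 : 'rV[R]_d) (partial_vec 0 (delta_mx 0 i)) := derive_tangent _ _.
  rewrite (tan_near (cinf_rV _) tv H) partial_vec_coord mxE eqxx /=.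
  by rewrite eq_sym.
rewrite tvec0 tvec_sum (bigD1 j)//= big1 ?addr0; first by rewrite D eqxx mulr1.
by move=> i /negPf ij; rewrite D ij mulr0.
Qed.

Lemma form_sum y n (c : 'I_n -> R) (e : 'I_n -> tvec M) v :
  (forall i, tangent y (e i)) -> tangent y v ->
  om y (\sum_i c i *: e i) v = \sum_i c i * om y (e i) v.
Proof.
have [lin _ _ _] := rs_om hs => te tv.
have om0 : om y 0 v = 0.
  have := lin y 1 0 0 v (tangent0 _) (tangent0 _) tv.
  by rewrite scaler0 addr0 mul1r => /eqP; rewrite -subr_eq0 opprD addrA subrr sub0r oppr_eq0 => /eqP.
elim: n c e te => [|n IH] c e te; first by rewrite !big_ord0.
rewrite !big_ord_recl lin//; first by rewrite IH.
exact: tangent_sum.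
Qed.

(** By [leaf_translate] an element g near 1 acts near x as l(a(g x)), so xi enters only through the
    derivative of a(g x) at g = 1. This is why the coefficients do not depend on y. *)
Lemma generator_comb : exists2 V, nbhs x V & forall xi, lie_algebra G xi ->
  exists c : 'I_d -> R, forall y, V y ->
    generator act xi y = \sum_i c i *: generator act (leaf_generator i) y.
Proof.
have [W [V [nW nV tr]]] := (near_pairP _ _ _).1 (leaf_translate hM hG hact (rs_proper hs)
  (rs_J hs) (rs_om hs) (rs_Jom hs) (rs_GJ hs) (rs_P hs) L Px).
exists V => // xi txi.
pose u (i : 'I_d) g := phi (act g x) 0 (lshift (lcodim L) i).
have su i : smooth_at (1%g : G) (u i).
  have [_ s] := smooth_act_l hG hact x 1%g; apply: (s (fun y => phi y 0 (lshift _ i))).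
  by rewrite (act1 hact); exact: (chart_coord ch).
have uE g : lsubmx (phi (act g x)) = \row_i u i g by apply/rowP => i; rewrite !mxE.
have u1 : \row_i u i 1%g = 0 by rewrite -uE (act1 hact) lsub_center.
exists (fun i => xi (u i)) => y Vy; apply/funext => f; rewrite tvec_sum.
have [sf|nf] := pselect (smooth_at y f); last first.
  rewrite /generator tmap_out ?(act1 hact)// big1// => i _.
  by rewrite tmap_out ?mulr0// (act1 hact).
rewrite (generatorE hact)//.
rewrite (tan_near hGc txi (g := fun g => f (act (l (\row_i u i g)) y))); last first.
  by apply: filterS nW => g Wg; have /= -> := tr _ _ Wg Vy; rewrite uE.
rewrite (tan_chain hGc (F := fun c => f (act (l c) y)) txi su); last first.
  have sa : smooth_map_at (fun c => act (l c) y) (0 : 'rV[R]_d).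
    exact: (smooth_act_comp hact (cinf_rV _) sl (smooth_map_at_cst _ _ (cinf_rV _))).
  by rewrite u1; have [_ s] := sa; apply: (s f); rewrite leaf_move0 (act1 hact).
by apply: eq_bigr => i _; rewrite u1 leaf_generatorE// mulrC.
Qed.

(** The difference vanishes at x, and its differential is 0 because the generators satisfy the same
    relation with constant coefficients. Near x the equation P = 0 thus amounts to d scalar
    equations. *)
Lemma momentum_comb : exists2 V, nbhs x V & forall xi, lie_algebra G xi ->
  exists c : 'I_d -> R, forall y, V y ->
    P y xi = \sum_i c i * P y (leaf_generator i).
Proof.
have [V nV Hg] := generator_comb.
have [r [[chr subr] r0]] := filter_ex (filterI (chart_ball ch Ux nV) (nbhs_right_gt 0)).
have [linl _ _ _] := rs_om hs; have [cP sP eP dP] := rs_P hs.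
set Ur := _ `&` _ in chr subr; have Urx : Ur x by split=> //; exact: ballxx.
exists Ur; first exact: (chart_nearU chr).
move=> xi txi; have [c cE] := Hg _ txi; exists c => y Uy.
have tl := lie_algebra_leaf_generator.
pose f y := P y xi - \sum_i c i * P y (leaf_generator i).
have ss y' : smooth_at y' (fun y => \sum_i c i * P y (leaf_generator i)).
  by apply: (sm_sum hMc) => i; apply: (smM hMc); [exact: (sm_cst hMc) | exact: sP].
have sf y' : smooth_at y' f by apply: (smB hMc); [exact: sP | exact: ss].
have fx : f x = 0.
  by apply/eqP; rewrite /f Px subr_eq0; apply/eqP; rewrite big1// => i _; rewrite mulr0.
suff : f y = f x by rewrite fx => /eqP; rewrite subr_eq0 => /eqP.
apply: (constant_on_chart hMc chr) => // y' v Uy' tv.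
rewrite /f; have sN : smooth_at y' (fun y => - \sum_i c i * P y (leaf_generator i)) by exact: (smN hMc).
rewrite (tanD tv (sP _ txi y') sN) (tanN hMc tv (ss y')).
rewrite (tan_sum hMc tv) => [|i]; last by apply: (smM hMc); [exact: (sm_cst hMc) | exact: sP].
rewrite -(differentialE _ tv) dP// cE; last exact: subr.
rewrite form_sum//; last by move=> i; exact: (tangent_generator hM hG hact).
apply/eqP; rewrite subr_eq0; apply/eqP; apply: eq_bigr => i _.
rewrite (tanZ hMc _ tv); last exact: sP.
by rewrite -dP// differentialE.
Qed.

Variable S : slice act x.
Notation K := (stabilizer act x).
Notation U := (sdom S).
Notation sphi := (sphi S).
Notation spsi := (spsi S).
Notation n := (sdim S).
Notation m := (scodim S).
Notation b y := (rsubmx (sphi y)).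
Notation rho := (srho S).
Let sch := slice_chart S.
Let Sx := slice_dom S.

Let p (y : M) : 'rV[R]_d := \row_i P y (leaf_generator i).
Let db (v : tvec M) : 'rV[R]_m := \row_j v (fun y => sphi y 0 (rshift n j)).
Let dp (v : tvec M) : 'rV[R]_d := \row_i v (fun y => P y (leaf_generator i)).
Let E : 'M[R]_(m, n + m) := row_mx 0 1%:M.
Let sP i y : smooth_at y (fun y => P y (leaf_generator i)).
Proof. by have [_ + _ _] := rs_P hs; apply; exact: lie_algebra_leaf_generator. Qed.

Let db_vec c : db (chart_vec sphi spsi x (c *m E)) = c.
Proof.
apply/rowP => j; rewrite mxE (chart_vec_coord sch)//.
by rewrite mul_mx_row row_mxEr mulmx1.
Qed.

(** The differential of P vanishes on vertical vectors at x, so it factors through db. *)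
Lemma momentum_derivative : exists T : 'M[R]_(m, d), forall v, tangent x v -> dp v = db v *m T.
Proof.
pose e j := chart_vec sphi spsi x (delta_mx 0 j *m E).
exists (\matrix_(j, i) e j (fun y => P y (leaf_generator i))) => v tv; apply/rowP => i; rewrite mxE.
set w := chart_vec sphi spsi x (db v *m E).
have tw : tangent x w by exact: (chart_vec_tangent sch hMc).
have vw : vertical act x (v - w).
  apply/(slice_vert _ Sx); split=> [|j]; first exact: tangentB.
  have /rowP/(_ j) := db_vec (db v); rewrite !mxE -/w => H.
  by rewrite tvecD tvecN H subrr.
have := momentum_vertical hG hact (rs_P hs) (lie_algebra_leaf_generator i) Px vw.
rewrite tvecD tvecN => /eqP; rewrite subr_eq0 => /eqP ->.
have -> : w = \sum_j db v 0 j *: e j.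
  rewrite /w -(chart_vec_sum _ _ hMc sch Sx); congr chart_vec.
  rewrite {1}(row_sum_delta (db v)) mulmx_suml.
  by apply: eq_bigr => j _; rewrite scalemxAl.
by rewrite tvec_sum mxE; apply: eq_bigr => j _; rewrite [X in _ = _ * X]mxE.
Qed.

Section derivative.
Variable T : 'M[R]_(m, d).
Hypothesis dpT : forall v, tangent x v -> dp v = db v *m T.

(** Nondegeneracy of the two-form carries the independence of the generators over to the
    differentials of the momentum functions. *)
Lemma momentum_derivative_full : exists Y : 'M[R]_(d, m), Y *m T = 1%:M.
Proof.
apply/row_fullP; rewrite /row_full -mxrank_tr -/(row_free T^T) -kermx_eq0; apply/eqP/row_matrixP => q; rewrite row0.
set c := row q _; have cT : c *m T^T = 0 by rewrite -row_mul mulmx_ker row0.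
have [lin skew _ nd] := rs_om hs; have [_ _ _ dP] := rs_P hs.
have tg i : tangent x (generator act (leaf_generator i) x).
  by apply: (tangent_generator hM hG hact); exact: lie_algebra_leaf_generator.
apply/rowP => i; rewrite [RHS]mxE; apply: leaf_generator_free i.
apply: (nd x); first exact: tangent_sum.
move=> v tv; rewrite form_sum//.
have -> : \sum_i c 0 i * om x (generator act (leaf_generator i) x) v = (db v *m (c *m T^T)^T) 0 0.
  rewrite trmx_mul trmxK mulmxA -dpT// mxE; apply: eq_bigr => i _.
  rewrite -dP//; last exact: lie_algebra_leaf_generator.
  by rewrite (differentialE _ tv) [RHS]mulrC !mxE.
by rewrite cT trmx0 mulmx0 mxE.
Qed.

Let db_stab k v : K k -> tangent x v -> db (tmap (act k) x v) = db v *m rho k.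
Proof.
move=> Kk tv; apply/rowP => j; rewrite mxE tmap_act//; last exact: (chart_coord sch).
rewrite (tan_near hMc tv (g := fun y => \sum_i rho k i j * sphi y 0 (rshift n i))); last first.
  apply: nearS (slice_equiv S) => y /(_ k Kk)[_ /rowP/(_ j)] /=.
  by rewrite !mxE => ->; apply: eq_bigr => i _; rewrite mxE mulrC.
have sb i : smooth_at x (fun y => sphi y 0 (rshift n i)) by exact: (chart_coord sch).
rewrite (tan_sum hMc tv) => [|i]; last by apply: (smM hMc) => //; exact: (sm_cst hMc).
by rewrite mxE; apply: eq_bigr => i _; rewrite (tanZ hMc _ tv)// mxE mulrC.
Qed.

(** The equivariance of P expresses p(k y) through the elements Ad(k^-1) of the leaf generators, and
    [momentum_comb] rewrites these in terms of p with constant coefficients. *)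
Lemma momentum_derivative_equivariant (Y0 : 'M[R]_(d, m)) : Y0 *m T = 1%:M -> exists kappa : G -> 'M[R]_d,
  exists2 V, nbhs x V & forall k, K k -> rho k *m T = T *m kappa k /\
    forall y, V y -> p (act k y) = p y *m kappa k.
Proof.
move=> Y0T; have [V nV Hc] := momentum_comb.
suff /choice[kappa H] : forall k, exists C : 'M[R]_d, K k -> rho k *m T = T *m C /\
    forall y, V y -> p (act k y) = p y *m C.
  by exists kappa, V.
move=> k; have [Kk|nK] := pselect (K k); last by exists 0.
have [_ _ eP _] := rs_P hs; have [Gm sm si] := hG.
have tl i : lie_algebra G (Ad k^-1%g (leaf_generator i)).
  have sc : smooth_map_at (fun h : G => k^-1 * h * k^-1^-1)%g (1%g : G).
    apply: (smooth_mul_comp hG hGc); last exact: (smooth_map_at_cst _ _ hGc).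
    apply: (smooth_mul_comp hG hGc); first exact: (smooth_map_at_cst _ _ hGc).
    exact: smooth_map_at_id.
  have := tangent_tmap hGc sc (lie_algebra_leaf_generator i).
  by rewrite mulg1 mulgV.
have [c cE] := choice (fun i => Hc _ (tl i)).
pose C := \matrix_(l, i) c i l; have pC z : V z -> p (act k z) = p z *m C.
  move=> Vz; apply/rowP => i; rewrite !mxE eP; last exact: lie_algebra_leaf_generator.
  by rewrite cE//; apply: eq_bigr => j _; rewrite !mxE mulrC.
exists C => _; split=> //.
apply/row_matrixP => j; rewrite !rowE !mulmxA.
set v := chart_vec sphi spsi x (delta_mx 0 j *m E).
have tv : tangent x v by exact: (chart_vec_tangent sch hMc).
rewrite -{1}(db_vec (delta_mx 0 j)) -/v -db_stab// -dpT; last exact: (tangent_stab hM hact).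
rewrite -{1}(db_vec (delta_mx 0 j)) -/v -dpT//.
apply/rowP => i; rewrite mxE tmap_act//.
rewrite (tan_near hMc tv (g := fun y => \sum_l C l i * P y (leaf_generator l))); last first.
  by apply: nearS nV => z /pC/rowP/(_ i); rewrite !mxE /= => ->; apply: eq_bigr => l _; rewrite !mxE mulrC.
rewrite (tan_sum hMc tv) => [|l]; last by apply: (smM hMc) => //; exact: (sm_cst hMc).
by rewrite [RHS]mxE; apply: eq_bigr => l _; rewrite (tanZ hMc _ tv)// [dp v 0 l]mxE mulrC.
Qed.

Section straightening.
Variables (A : 'M[R]_m) (Y : 'M[R]_(d, m)).
Let D : 'M[R]_(m, n + m) := A *m E.
Let sA (t : 'rV[R]_m) : M := affine_param sphi spsi D x t.
(** The nonlinear part of p along the K-fixed part t A of t. Its derivative at 0 vanishes, so that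
    Phi is tangent to the identity; on K-fixed t it gives Phi(t) T = p(sA t), which makes the zero
    level linear there. *)
Let us (t : 'rV[R]_m) : 'rV[R]_d := p (sA t) - t *m (A *m T).
Let Phi (t : 'rV[R]_m) : 'rV[R]_m := t + us t *m Y.
Let dball (t : 'rV[R]_m) := ball 0 (srad S) (sphi x + t *m D).

Let sPA i (t : 'rV[R]_m) : dball t -> smooth_at t (fun t => P (sA t) (leaf_generator i)).
Proof. by move=> /(affine_param_smooth sch)[_ H]; exact: (H _ (sP i _)). Qed.

Let PhiE j : (fun t : 'rV[R]_m => Phi t 0 j) = fun t => t 0 j +
  \sum_l Y l j * (P (sA t) (leaf_generator l) - \sum_q (A *m T) q l * t 0 q).
Proof.
apply/funext => t; rewrite mxE; congr (_ + _); rewrite mxE; apply: eq_bigr => l _.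
rewrite mulrC !mxE; congr (_ * (_ - _)).
by apply: eq_bigr => q _; rewrite [in RHS]mulrC !mxE.
Qed.

Let hV := @cinf_rV R m.

Let lin_smooth l (t : 'rV[R]_m) : smooth_at t (fun t : 'rV[R]_m => \sum_q (A *m T) q l * t 0 q).
Proof.
by apply: (sm_sum hV) => q; apply: (smM hV); [exact: (sm_cst hV) | exact: es_coord].
Qed.

Let us_smooth l (t : 'rV[R]_m) : dball t ->
  smooth_at t (fun t => P (sA t) (leaf_generator l) - \sum_q (A *m T) q l * t 0 q).
Proof. by move=> bt; apply: (smB hV); [exact: sPA | exact: lin_smooth]. Qed.

Let es_Phi j t : dball t -> euclidean_smooth_at t (fun t => Phi t 0 j).
Proof.
move=> bt; rewrite PhiE; apply: esD; first exact: es_coord.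
by apply: es_sum => l; apply: esM; [exact: es_cst | exact: us_smooth].
Qed.

Let dball0 : dball 0.
Proof. by rewrite /dball mul0mx addr0; exact: (chartV sch). Qed.

Let Phi_deriv i j : 'D_(delta_mx 0 i) (fun t => Phi t 0 j) 0 = (i == j)%:R.
Proof.
pose w : tvec 'rV[R]_m := partial_vec (0 : 'rV[R]_m) (delta_mx 0 i).
have tw : tangent (0 : 'rV[R]_m) w := derive_tangent _ _.
have -> : 'D_(delta_mx 0 i) (fun t => Phi t 0 j) 0 = w (fun t => Phi t 0 j).
  rewrite /w partial_vecE; last exact: es_Phi.
  rewrite (bigD1 i)//= mxE !eqxx mul1r big1 ?addr0// => k /negPf ki.
  by rewrite mxE ki andbF mul0r.
have su l := us_smooth l dball0.
have sc (q : 'I_m) : smooth_at (0 : 'rV[R]_m) (fun t : 'rV[R]_m => t 0 q) by exact: es_coord.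
have sY l : smooth_at (0 : 'rV[R]_m) (fun t => Y l j * (P (sA t) (leaf_generator l) - \sum_q (A *m T) q l * t 0 q)).
  by apply: (smM hV) => //; exact: (sm_cst hV).
rewrite PhiE (tanD tw) //; last exact: (sm_sum hV).
rewrite (tan_sum hV tw)// big1 ?addr0 => [|l _].
  by rewrite /w partial_vec_coord mxE eqxx eq_sym.
rewrite (tanZ hV _ tw)//.
have sl0 := lin_smooth l 0; have sp := sPA l dball0.
rewrite (tanD tw sp (smN hV sl0)) (tanN hV tw sl0) (tan_sum hV tw) => [|q]; last first.
  by apply: (smM hV) => //; exact: (sm_cst hV).
have -> : w (fun t => P (sA t) (leaf_generator l)) = (A *m T) i l.
  have -> : w (fun t => P (sA t) (leaf_generator l)) = tmap sA 0 w (fun y => P y (leaf_generator l)).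
    by rewrite tmapE.
  rewrite /sA /w (affine_param_tmap sch)// mulmxA.
  have := dpT (chart_vec_tangent sch hMc (delta_mx 0 i *m A *m E) Sx).
  rewrite db_vec -(mulmxA _ A T) -(rowE i (A *m T)) => /rowP/(_ l).
  by rewrite [dp _ 0 l]mxE => ->; rewrite mxE.
rewrite (bigD1 i)//= (tanZ hV _ tw)// /w partial_vec_coord [delta_mx _ _ _ _]mxE !eqxx mulr1 big1 ?addr0 ?subrr ?mulr0//.
move=> q /negPf qi; rewrite -/w (tanZ hV _ tw)// /w partial_vec_coord [delta_mx _ _ _ _]mxE qi andbF mulr0 //.
Qed.

Hypotheses (rhoA : forall k, K k -> rho k *m A = A /\ A *m rho k = A)
  (fixA : forall q (w : 'M[R]_(q, m)), (forall k, K k -> w *m rho k = w) -> w *m A = w)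
  (YT : Y *m T = 1%:M) (TYA : T *m Y *m A = A *m (T *m Y)).
Variables (kappa : G -> 'M[R]_d) (V2 : set M).
Hypotheses (nV2 : nbhs x V2)
  (kappaP : forall k, K k -> rho k *m T = T *m kappa k /\
     forall y, V2 y -> p (act k y) = p y *m kappa k)
  (kappaY : forall k, K k -> kappa k *m Y = Y *m rho k).
(** The projection onto the rows that are fixed by K and killed by T. *)
Let Q : 'M[R]_m := A *m (1%:M - T *m Y).

Let AA : A *m A = A. Proof. by apply: fixA => k /rhoA[]. Qed.

Let QA : Q *m A = Q.
Proof. by rewrite /Q -mulmxA mulmxBl mul1mx TYA -[X in X - _]mulmx1 -mulmxBr mulmxA AA. Qed.

Let rhoQ k : K k -> rho k *m Q = Q. Proof. by move=> /rhoA[Ek _]; rewrite /Q mulmxA Ek. Qed.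

Let QT : Q *m T = 0.
Proof. by rewrite /Q -mulmxA mulmxBl mul1mx -(mulmxA T) YT mulmx1 subrr mulmx0. Qed.

Let QQ : Q *m Q = Q.
Proof. by rewrite {2}/Q mulmxA QA mulmxBr mulmx1 mulmxA QT mul0mx subr0. Qed.

Let sgE t : sA t = spsi (row_mx 0 (t *m A)).
Proof.
by rewrite /sA /affine_param slice_center add0r /D mulmxA /E mul_mx_row mulmx0 mulmx1.
Qed.

Let level_orbit g y : P y = 0 -> P (act g y) = 0.
Proof.
have [cP _ eP _] := rs_P hs => Py; apply/funext => xi.
have [txi|ntxi] := pselect (lie_algebra G xi); last by have [_ ->] := cP (act g y).
by rewrite eP// Py.
Qed.

Let p_level : \forall y \near x, P y = 0 <-> p y = 0.
Proof.
have [V nV Hc] := momentum_comb; apply: nearS nV => y Vy; split=> [Py|py].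
  by apply/rowP => i; rewrite !mxE Py.
have [cP _ _ _] := rs_P hs; apply/funext => xi.
have [txi|ntxi] := pselect (lie_algebra G xi); last by have [_ ->] := cP y.
have [c cE] := Hc _ txi; rewrite cE// big1// => i _.
by move/rowP/(_ i): py; rewrite !mxE => ->; rewrite mulr0.
Qed.

(** Near x a point lies in the piece iff b is fixed by K and p vanishes at the point of the
    transversal over b. In terms of Phi(b) both conditions together say that Phi(b) is fixed by
    Q. *)
Lemma piece_chart_straight : inhabited (piece_chart act P x).
Proof.
have [V1 [nV1 VU VK _ Vrec]] := slice_near hs Px S.
have sb0 : b x = 0 := slice_coord0 S.
have csg : {for x, continuous (fun y => spsi (row_mx 0 (b y)))} by exact: (slice_section_continuous Sx).
have csA : {for x, continuous (fun y => spsi (row_mx 0 (b y *m A)))}.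
  have cd : {for x, continuous (fun y => b y)} := slice_coord_continuous Sx.
  have cs : {for b x, continuous (fun t : 'rV[R]_m => spsi (row_mx 0 (t *m A)))}.
    rewrite sb0; have [c _] := affine_param_smooth sch dball0.
    by have -> : (fun t : 'rV[R]_m => spsi (row_mx 0 (t *m A))) = sA by apply/funext => t; rewrite sgE.
  exact: (continuous_comp cd cs).
have x0 : spsi (row_mx 0 0) = x by rewrite row_mx0 -(slice_center S) (chartK sch Sx).
have nA (W : M -> Prop) : (\forall y \near x, W y) -> \forall y \near x, W (spsi (row_mx 0 (b y *m A))).
  by move=> nW; apply: (near_comp csA); rewrite sb0 mul0mx x0.
have ns (W : M -> Prop) : (\forall y \near x, W y) -> \forall y \near x, W (spsi (row_mx 0 (b y))).
  by move=> nW; apply: (near_comp csg); rewrite sb0 x0.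
have nball : \forall y \near x, ball 0 (srad S) (row_mx (0 : 'rV[R]_n) (b y *m A)).
  have cd : {for x, continuous (fun y => row_mx (0 : 'rV[R]_n) (b y *m A))}.
    apply: cont_row_mx; first exact: cvg_cst.
    have -> : (fun y => b y *m A) = fun y => \row_i (b y *m A) 0 i by apply/funext => y; apply/rowP => i; rewrite [RHS]mxE.
    apply: continuous_row => i; apply: (sm_continuous hMc).
    apply: (sm_near hMc (f := fun y => \sum_j A j i * sphi y 0 (rshift n j))).
      by apply: nearT => y; rewrite [RHS]mxE; apply: eq_bigr => j _; rewrite mxE mulrC.
    by apply: (sm_sum hMc) => j; apply: (smM hMc); [exact: (sm_cst hMc) | exact: (chart_coord sch)].
  apply: (near_comp cd (P := fun w => ball 0 (srad S) w)).
  by rewrite sb0 mul0mx row_mx0; exact: (nbhsx_ballx _ _ (slice_rad S)).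
have [W3 [V3 [nW3 nV3 inv]]] := (near_pairP _ _ _).1 (slice_inv S).
have nt3 : \forall y \near x, W3 (sturn S y).
  have ct : {for x, continuous (sturn S)} by exact: sturn_continuous.
  by apply: (near_comp ct (P := fun g => W3 g)); rewrite sturn1.
have n3 := ns _ (near_near (P := fun z => V3 z) nV3).
pose good y := [/\ [/\ V1 y, ball 0 (srad S) (row_mx (0 : 'rV[R]_n) (b y *m A)),
    conj_class K (stabilizer act y) <-> (forall k, K k -> b y *m rho k = b y) &
    y = act (sturn S y) (spsi (row_mx 0 (b y)))],
  V1 (sA (b y)), V2 (sA (b y)) /\ (W3 (sturn S y) /\ (\forall z \near spsi (row_mx 0 (b y)), V3 z)) & P (spsi (row_mx 0 (b y))) = 0 <-> p (spsi (row_mx 0 (b y))) = 0].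
have ngood : \forall y \near x, good y.
  have not := slice_orbit_type hs Px S; have nt := slice_turn S.
  have h3 := nA _ nV1; have h4 := nA _ nV2; have h5 := ns _ p_level.
  by near=> y; split; [split|..|split; [|split]|]; rewrite ?sgE; near: y.
have usA k t : K k -> us (t *m rho k) = us t.
  by move=> /rhoA[Ek _]; rewrite /us !sgE -!(mulmxA t) (mulmxA (rho k)) Ek.
(* The point of the transversal with coordinate b A is fixed by K, so equivariance of p makes us (b
   y) invariant under kappa, and Y carries this to invariance under rho. *)
have uYrho k y : good y -> K k -> us (b y) *m Y *m rho k = us (b y) *m Y.
  move=> [[_ bA _ _] V1s [V2s _] _] Kk; have [TkE pk] := kappaP Kk.
  rewrite -mulmxA -kappaY// mulmxA; congr (_ *m Y).
  rewrite /us mulmxBl -pk// -!mulmxA -TkE (mulmxA A) (rhoA Kk).2; congr (p _ - _).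
  have [U1 a1 b1] := VK _ _ V1s Kk; rewrite sgE in V1s U1 a1 b1 *.
  have U2 := chartU sch bA.
  apply: (slice_ext U1 U2); rewrite ?a1 ?b1 (chartVK sch bA) ?row_mxKl ?row_mxKr ?mul0mx//.
  by rewrite -mulmxA (rhoA Kk).2.
have uYA y : good y -> us (b y) *m Y *m A = us (b y) *m Y.
  by move=> gy; apply: fixA => k; exact: uYrho.
pose f i y := split_fun (fun i => sphi y 0 (lshift m i)) (fun j => Phi (b y) 0 j) i.
have fl j : f (lshift m j) = (fun y => sphi y 0 (lshift m j)).
  by apply/funext => y; rewrite /f split_funl.
have fr j : f (rshift n j) = (fun y => Phi (b y) 0 j).
  by apply/funext => y; rewrite /f split_funr.
have brow y : b y = \row_j sphi y 0 (rshift n j) by apply/rowP => j; rewrite !mxE.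
have dballE y : good y -> dball (b y).
  by move=> [[_ + _ _] _ _ _]; rewrite /dball slice_center add0r /D mulmxA /E mul_mx_row mulmx0 mulmx1.
have sfr y j : U y -> good y -> smooth_at y (fun y => Phi (b y) 0 j).
  move=> Uy gy; apply: (sm_near hMc (f := fun y => Phi (\row_j sphi y 0 (rshift n j)) 0 j)).
    by apply: nearT => z; rewrite brow.
  apply: (sm_comp hMc (F := fun t => Phi t 0 j) (u := fun j y => sphi y 0 (rshift n j))) => [q|]; first exact: (chart_coord sch).
  by apply: es_Phi; rewrite -brow; exact: dballE.
have dfr y j v : U y -> good y -> tangent y v -> v (fun y => Phi (b y) 0 j) =
    \sum_i 'D_(delta_mx 0 i) (fun t => Phi t 0 j) (b y) * v (fun y => sphi y 0 (rshift n i)).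
  move=> Uy gy tv.
  rewrite (tan_near hMc tv (g := fun y => Phi (\row_j sphi y 0 (rshift n j)) 0 j)); last first.
    by apply: nearT => z; rewrite brow.
  rewrite (tan_chain hMc (F := fun t => Phi t 0 j) (u := fun j y => sphi y 0 (rshift n j)) tv); first by rewrite brow.
    by move=> q; exact: (chart_coord sch).
  by apply: es_Phi; rewrite -brow; exact: dballE.
have gx : good x := nbhs_singleton ngood.
have dfx j v : tangent x v -> v (fun y => Phi (b y) 0 j) = v (fun y => sphi y 0 (rshift n j)).
  move=> tv; rewrite (dfr _ _ _ Sx gx tv) sb0 (bigD1 j)//= big1 ?addr0 => [|i /negPf ij].
    by rewrite Phi_deriv eqxx mul1r.
  by rewrite Phi_deriv ij mul0r.
have sf i : smooth_at x (f i).
  case: (split_ordP i) => j ->; first by rewrite fl; exact: (chart_coord sch).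
  by rewrite fr; exact: sfr.
have finj v : tangent x v -> (forall i, v (f i) = 0) -> v = 0.
  move=> tv v0; apply: (chart_tan_inj sch hMc Sx tv (tangent0 _)) => i; rewrite tvec0.
  case: (split_ordP i) => j ->; first by have := v0 (lshift m j); rewrite fl.
  by have := v0 (rshift n j); rewrite fr dfx.
have nU : nbhs x U := chart_nearU sch Sx.
have [U1 [W1 [psi1 [ch1 U1x U1sub]]]] := inverse_function_chart hMc sch Sx (filterI nU ngood) sf finj.
pose phi1 y : 'rV[R]_(n + m) := row_mx (lsubmx (sphi y)) (Phi (b y)).
have phi1E : (fun y => \row_i f i y) = phi1.
  apply/funext => y; apply/rowP => i; rewrite mxE; case: (split_ordP i) => j ->.
    by rewrite fl row_mxEl mxE.
  by rewrite fr row_mxEr.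
rewrite phi1E in ch1.
have phi1x : phi1 x = 0.
  rewrite /phi1 sb0 slice_center /Phi /us sgE mul0mx x0 mul0mx subr0.
  have -> : p x = 0 by apply/rowP => i; rewrite !mxE Px.
  by rewrite mul0mx addr0; apply/rowP => i; case: (split_ordP i) => j ->; rewrite ?row_mxEl ?row_mxEr !mxE.
have [r [[chr subr] r0]] := filter_ex (filterI (chart_ball ch1 U1x
   (filterI (chart_nearU ch1 U1x) (ns _ (chart_nearU ch1 U1x)))) (nbhs_right_gt 0)).
have {}r0 : 0 < r by exact: r0.
rewrite phi1x in chr subr.
set dom := _ `&` _ in chr subr.
have domP y : dom y -> [/\ U y, good y, U1 y & U1 (spsi (row_mx 0 (b y)))].
  by move=> dy; have [/= U1y U1s] := subr _ dy; have [Uy gy] := U1sub _ U1y; split.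
have phi1r y : rsubmx (phi1 y) = Phi (b y) by rewrite row_mxKr.
have phi1c j : (fun y => phi1 y 0 (rshift n j)) = fun y => Phi (b y) 0 j.
  by apply/funext => z; rewrite row_mxEr.
(* The rank factorization of Q supplies the quotient coordinates and their embedding. *)
have [rk [cb [rb [Qcr basE Qcol]]]] := idempotent_split QQ.
apply: inhabits; refine (@PieceChart _ _ _ act P x n m rk r dom phi1 psi1
  cb rb r0 chr _ phi1x basE _ _ _ _ _ _).
- by split=> //=; rewrite phi1x; exact: ballxx.
- move=> y /domP[Uy gy _ _]; rewrite phi1r -mulmxA Qcr.
  have [[V1y bA ot yE] _ _ Ps] := gy.
  have PE : P y = 0 <-> P (spsi (row_mx 0 (b y))) = 0.
    split=> [Py|]; last by rewrite [in P y]yE; exact: level_orbit.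
    have -> : spsi (row_mx 0 (b y)) = act (sturn S y)^-1%g y by rewrite [X in act _ X]yE (actK hact).
    exact: level_orbit.
  split=> [[/PE/Ps p0 /ot bk]|bQ].
    have bAE : b y *m A = b y by exact: fixA.
    have -> : Phi (b y) = b y *m Q.
      rewrite /Phi /us sgE bAE p0 sub0r mulmxA bAE /Q mulmxA bAE mulmxBr mulmx1 mulNmx mulmxA.
      by [].
    by rewrite -mulmxA QQ.
  (* The correction us (b y) Y is fixed by A, so invariance of Phi(b) passes to b itself. *)
  have PA : Phi (b y) *m A = Phi (b y) by rewrite -{1}bQ -mulmxA QA.
  have bAE : b y *m A = b y.
    by move: PA; rewrite /Phi mulmxDl uYA// => /addIr.
  split; last by apply/ot => k Kk; rewrite -bAE -mulmxA (rhoA Kk).2.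
  apply/PE/Ps; have : Phi (b y) *m T = 0 by rewrite -bQ -mulmxA QT mulmx0.
  by rewrite /Phi mulmxDl -(mulmxA _ Y) YT mulmx1 /us sgE bAE mulmxA bAE addrC subrK.
- move=> y v /domP[Uy gy U1y _]; split.
    move=> /(slice_vert _ Uy)[tv v0]; split=> // j.
    by rewrite phi1c (dfr _ _ _ Uy gy) // big1// => i _; rewrite v0 mulr0.
  move=> [tv v0]; pose w := chart_vec sphi spsi y (row_mx (\row_i v (fun y => sphi y 0 (lshift m i))) 0).
  have tw : tangent y w by exact: (chart_vec_tangent sch hMc).
  have vw : vertical act y w.
    by apply/(slice_vert _ Uy); split=> // j; rewrite /w (chart_vec_coord sch)// row_mxEr mxE.
  suff -> : v = w by [].
  apply: (chart_tan_inj ch1 hMc U1y tv tw) => i.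
  case: (split_ordP i) => j ->.
    have -> : (fun y => phi1 y 0 (lshift m j)) = fun y => sphi y 0 (lshift m j).
      by apply/funext => z; rewrite row_mxEl mxE.
    by rewrite /w (chart_vec_coord sch)// row_mxEl mxE.
  rewrite v0 phi1c (dfr _ _ _ Uy gy tw) big1// => q _.
  by rewrite /w (chart_vec_coord sch)// row_mxEr mxE mulr0.
- move=> y g dy /domP[_ [[V1g _ _ _] _ _ _] _ _].
  have [Uy [[V1y _ _ _] _ _ _] _ _] := domP _ dy.
  have [w [k [Kk _ bk _]]] := Vrec _ _ V1y V1g.
  exists (rho k); split; first by rewrite -{1}Qcol (mulmxA (rho k) Q) rhoQ// Qcol.
  apply: nearS (chart_nearU chr dy) => z /domP[_ gz _ _]; have [[V1z _ _ _] _ _ _] := gz.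
  by rewrite !phi1r bk// /Phi usA// -{1}(uYrho k)// -mulmxDl.
- move=> y dy; have [Uy [[_ _ _ yE] _ [_ [W3t V3s]] _] _ U1s] := domP _ dy.
  have sgy : psi1 (row_mx 0 (rsubmx (phi1 y))) = spsi (row_mx 0 (b y)).
    rewrite phi1r -[RHS](chartK ch1 U1s); congr psi1.
    by have [_ a1 b1] := slice_sectionP Uy; rewrite /phi1 a1 b1.
  exists (sturn S y); rewrite sgy; split=> //.
  by apply: nearS V3s => z V3z; rewrite !phi1r; have /= -> := inv _ _ W3t V3z.
- move=> y y' /domP[Uy [[_ _ _ yE] _ _ _] _ U1s] /domP[Uy' [[_ _ _ yE'] _ _ _] _ U1s'].
  rewrite !phi1r => PhiE'.
  suff ss : spsi (row_mx 0 (b y)) = spsi (row_mx 0 (b y')).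
    by exists (sturn S y' * (sturn S y)^-1)%g; rewrite {2}yE (actM hact) (actK hact) ss -yE'.
  rewrite -(chartK ch1 U1s) -(chartK ch1 U1s'); congr psi1.
  have [_ a1 b1] := slice_sectionP Uy; have [_ a2 b2] := slice_sectionP Uy'.
  by rewrite /phi1 a1 a2 b1 b2 PhiE'.
- move=> v tv vk vP.
  have -> : \row_j v (fun y => phi1 y 0 (rshift n j)) = db v.
    by apply/rowP => j; rewrite !mxE phi1c dfx.
  have dbk k : K k -> db v *m rho k = db v.
    move=> Kk; rewrite -db_stab//; apply/rowP => j; rewrite !mxE.
    have /(slice_vert _ Sx)[_ /(_ j)] := vk _ Kk.
    by rewrite tvecD tvecN => /eqP; rewrite subr_eq0 => /eqP.
  have dbT : db v *m T = 0.
    by rewrite -dpT//; apply/rowP => i; rewrite !mxE vP//; exact: lie_algebra_leaf_generator.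
  by rewrite -mulmxA Qcr /Q mulmxA fixA// mulmxBr mulmx1 mulmxA dbT mul0mx subr0.
Unshelve. all: by end_near.
Qed.

End straightening.
End derivative.

End fixed_point.

Lemma piece_chart_exists x : P x = 0 -> inhabited (piece_chart act P x).
Proof.
move=> Px; have [L] := rs_leaf hs x; have [S] := rs_slice hs Px.
have [s [s0 sK sav]] := rs_average hs Px.
have [T dpT] := momentum_derivative L Px S; have [Y0 Y0T] := momentum_derivative_full dpT.
have [kappa [V nV kp]] := momentum_derivative_equivariant Px dpT Y0T.
have KM := stabM hact (x := x); have KV := stabV hact (x := x).
have NV := ineffectiveV hM hact (x := x).
have [A [Y [rhoA fixA YT kY TYA]]] := equivariant_splitting (stab1 hact x)
  (fun g h Kg Kh => KM g h Kg Kh) (fun g Kg => KV g Kg) (fun g => @proj1 _ _) (fun g Ng => NV g Ng)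
  s0 sK sav (@srho_mul _ _ _ act x S) (@srho_class _ _ _ act x S) (srho1 S) (fun k Kk => (kp k Kk).1) Y0T.
exact: (piece_chart_straight Px dpT rhoA fixA YT TYA nV kp kY).
Qed.
End momentum_coordinates.

(** * Pieces and their quotients as manifolds *)

Section piece_structure.
Context {R : realType} {M : smoothSpaceType R} {G : smoothGroupType R}.
Context {br : (M -> R) -> (M -> R) -> (M -> R)} {J : M -> covec M -> tvec M}
  {om : M -> tvec M -> tvec M -> R} {Delta : M -> set (tvec M)}
  {act : G -> M -> M} {P : M -> covec G}.
Hypothesis hs : reduction_setting br J om Delta act P.
Variable c : set (set G).
Hypothesis hc : compact_classes G c.
Let hM := rs_M hs.
Let hG := rs_G hs.
Let hact := rs_act hs.
Let hMc : cinf_space M := manifold_cinf hM.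
Let hGc : cinf_space G := lie_group_cinf hG.
Notation N := (level_piece act P c).
Notation iota := (@set_val M N).
Notation pi := (orbit_proj act N).

Lemma conj_classE K L : conj_class K L -> conj_class K = conj_class L :> set (set G).
Proof.
move=> [g ->]; apply/seteqP; split=> [_ [h ->]|_ [h ->]].
  exists (h * g^-1)%g; apply/seteqP; split=> [_ [k Kk <-]|_ [_ [k Kk <-] <-]].
    exists (g * k * g^-1)%g; first by exists k.
    by rewrite invgM invgK !mulgA !mulgVK.
  by exists k => //; rewrite invgM invgK !mulgA !mulgVK.
exists (h * g)%g; apply/seteqP; split=> [_ [_ [k Kk <-] <-]|_ [k Kk <-]].
  by exists k => //; rewrite invgM !mulgA.
by exists (g * k * g^-1)%g; [exists k | rewrite invgM !mulgA].
Qed.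

Lemma compact_class_mem K L : compact_classes G K -> K L -> K = conj_class L.
Proof. by move=> [K0 _ <-]; exact: conj_classE. Qed.

Lemma zero_level_act g y : P y = 0 -> P (act g y) = 0.
Proof.
have [cP _ eP _] := rs_P hs => Py; apply/funext => xi.
have [txi|ntxi] := pselect (lie_algebra G xi); last by have [_ ->] := cP (act g y).
by rewrite eP// Py.
Qed.

Lemma level_piece_act g y : N y -> N (act g y).
Proof.
move=> [Py cy]; split; first exact: zero_level_act.
have cE := compact_class_mem hc cy.
by rewrite /orbit_type /= cE; exists g; rewrite (stabilizer_act hs).
Qed.

Lemma level_pieceE (x : set_type N) : N = level_piece act P (conj_class (stabilizer act (iota x))).
Proof. by have [_ cx] := set_valP x; rewrite {1}(compact_class_mem hc cx). Qed.

Lemma orbit_projP (y y' : set_type N) : pi y = pi y' <-> exists g, iota y' = act g (iota y).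
Proof.
split=> [H|[g E]].
  have E : action_orbit act (iota y) = action_orbit act (iota y') := congr1 (@set_val _ _) H.
  have : action_orbit act (iota y') (iota y') by exists 1%g => //; rewrite (act1 hact).
  by rewrite -E => -[g _ <-]; exists g.
apply: val_inj => /=; apply/seteqP; split=> [_ [h _ <-]|_ [h _ <-]].
  by exists (h * g^-1)%g => //; rewrite E (actM hact) (actK hact).
by exists (h * g)%g => //; rewrite E (actM hact).
Qed.

Definition piece_lift (x0 : set_type N) (y : M) : set_type N := xget x0 [set z | iota z = y].

Lemma piece_liftK x0 y : N y -> iota (piece_lift x0 y) = y.
Proof. by move=> Ny; apply: (@xgetPex _ x0 [set z | iota z = y]); exists (exist _ y (mem_set Ny)). Qed.

Lemma piece_lift_val x0 y : piece_lift x0 (iota y) = y.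
Proof. by apply: val_inj; apply: piece_liftK; exact: (set_valP y). Qed.

Lemma orbit_proj_open (O : set (set_type N)) : open O -> open (pi @` O).
Proof.
move=> /open_subspace[W oW ->]; rewrite /open /= /orbit_open.
apply/open_subspace; exists (\bigcup_g (act g @^-1` W)).
  apply: bigcup_open => g _; apply: open_comp => // y _.
  by have [] := smooth_act_r hM hact g y.
apply/seteqP; split=> [y [y' /= Wy' /esym/orbit_projP[g E]]|y /= [g _ Wg]].
  by exists g => //=; rewrite -E.
have Ng := level_piece_act g (set_valP y).
exists (exist _ (act g (iota y)) (mem_set Ng)) => //.
by apply/esym/orbit_projP; exists g.
Qed.

Let cN : cinf_space (set_type N) := cinf_subspace N hMc.
Let cQ : cinf_space (orbit_space act N) := cinf_orbit_space act N hMc.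

Lemma orbit_space_second_countable : @second_countable (orbit_space act N).
Proof.
have [_ sc _] := hM; have [B cB [oB bB]] := @second_countable_subspace _ _ N sc.
exists [set pi @` W | W in B].
  exact: card_le_trans (card_image_le _ _) cB.
split=> [_ [W BW <-]|q V]; first by apply: orbit_proj_open; exact: oB.
have [x <-] := orbit_proj_surj q.
move=> /near_orbitP[W0 [oW Wx0] WV].
have : nbhs x (pi @^-1` W0) by apply: open_nbhs_nbhs.
move=> /bB[W [BW Wx] WW0].
exists (pi @` W) => [|_ [y /WW0 Wy <-]]; last exact: WV.
by split; [exists W | exists x].
Qed.

(** A compact neighbourhood C of x' that avoids the closed orbit of x exists. Its saturation is
    closed, so the orbits missing C are the required neighbourhood of the orbit of x. *)
Lemma orbit_space_hausdorff : hausdorff_space (orbit_space act N).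
Proof.
rewrite open_hausdorff => p q /eqP pq.
have [x xp] := orbit_proj_surj p; have [x' xq] := orbit_proj_surj q.
have hpr := rs_proper hs.
have clx : closed [set y | exists g, [set iota x] (act g y)].
  by apply: (orbit_compact_closed hM hpr); exact: compact_set1.
have nx' : \forall y \near iota x', ~ exists g, [set iota x] (act g y).
  apply: open_nbhs_nbhs; split; first exact: closed_openC.
  move=> [g /= E]; apply: pq; rewrite -xp -xq; apply/esym/orbit_projP.
  by exists g; rewrite E.
have [C [coC nC Cs]] := compact_nbhd hM nx'.
have clC := orbit_compact_closed hM hpr coC.
pose A := [set y | ~ exists g, C (act g y)].
have oA : open A by apply: closed_openC.
exists (pi @` (iota @^-1` A), pi @` (iota @^-1` (interior C))) => /=.
  split; apply/mem_set; [exists x|exists x'] => //=.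
    move=> [g Cg]; apply: (Cs _ Cg); exists g^-1%g => /=.
    by rewrite (actK hact).
split.
- by apply: orbit_proj_open; apply/open_subspace; exists A.
- by apply: orbit_proj_open; apply/open_subspace; exists (interior C) => //; exact: open_interior.
- apply/eqP/seteqP; split=> // _ [[y Ay <-] [y' Cy' /esym/orbit_projP[g E]]].
  by apply: Ay; exists g; rewrite -E; exact: interior_subset.
Qed.

Section one_chart.
Variables (x : set_type N) (C : piece_chart act P (iota x)).
Notation d := (pdim C).
Notation m := (pcodim C).
Notation q := (prank C).
Notation phi := (pphi C).
Notation psi := (@ppsi _ _ _ _ _ _ C).
Notation U := (pdom C).
Notation r := (prad C).
Notation a y := (lsubmx (phi y)).
Notation b y := (rsubmx (phi y)).
Notation col := (pcol C).
Notation row := (prow C).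
Let ch := piece_is_chart C.
Let Ux := piece_dom C.

Definition piece_z (y : M) : 'rV[R]_q := b y *m col.
Definition piece_emb (w : 'rV[R]_(d + q)) : 'rV[R]_(d + m) := row_mx (lsubmx w) (rsubmx w *m row).
Definition piece_udom : set (set_type N) := iota @^-1` U.
Definition piece_vdom : set 'rV[R]_(d + q) := [set w | ball 0 r (piece_emb w)].
Definition piece_phi (y : set_type N) : 'rV[R]_(d + q) := row_mx (a (iota y)) (piece_z (iota y)).
Definition piece_psi (w : 'rV[R]_(d + q)) : set_type N := piece_lift x (psi (piece_emb w)).

Lemma piece_levelP y : U y -> (N y <-> b y *m col *m row = b y).
Proof. by move=> Uy; have := piece_level Uy; rewrite -(level_pieceE x). Qed.

Lemma piece_embE w : piece_emb w = 0 + w *m block_mx 1%:M 0 0 row.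
Proof.
rewrite add0r -{2}(hsubmxK w) mul_row_block !mulmx1 !mulmx0 addr0 add0r.
by [].
Qed.

Lemma piece_emb_smooth w : smooth_map_at piece_emb w.
Proof.
have -> : piece_emb = fun w => 0 + w *m block_mx 1%:M 0 0 row by apply/funext => u; exact: piece_embE.
exact: affine_smooth.
Qed.

Lemma piece_vdom_open : open piece_vdom.
Proof.
rewrite openE => w Vw; have [cw _] := piece_emb_smooth w.
exact: (near_comp cw (chart_nearV ch Vw)).
Qed.

Lemma piece_psiE w : piece_vdom w -> iota (piece_psi w) = psi (piece_emb w).
Proof.
move=> Vw; apply: piece_liftK; apply/piece_levelP; first exact: (chartU ch).
by rewrite (chartVK ch Vw) row_mxKr -!mulmxA (mulmxA row) piece_split mul1mx.
Qed.

Lemma piece_emb_phi y : piece_udom y -> piece_emb (piece_phi y) = phi (iota y).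
Proof.
move=> Uy; rewrite /piece_emb /piece_phi row_mxKl row_mxKr /piece_z.
by rewrite (piece_levelP Uy).1 ?hsubmxK//; exact: (set_valP y).
Qed.

Lemma piece_z_smooth y i : U y -> smooth_at y (fun y => piece_z y 0 i).
Proof.
move=> Uy; apply: (sm_near hMc (f := fun y => \sum_j col j i * phi y 0 (rshift d j))).
  by apply: nearT => z; rewrite [RHS]mxE; apply: eq_bigr => j _; rewrite mxE mulrC.
by apply: (sm_sum hMc) => j; apply: (smM hMc); [exact: (sm_cst hMc) | exact: (chart_coord ch)].
Qed.

Lemma smooth_restrict (y : set_type N) (f : M -> R) : smooth_at (iota y) f -> smooth_at y (f \o iota).
Proof. by move=> sf; have [_ H] := smooth_map_at_val y; exact: H. Qed.

Lemma piece_chart_level : is_chart piece_udom piece_vdom piece_phi piece_psi.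
Proof.
apply: (is_chartP cN) => [||y Uy|w Vw].
- by apply/open_subspace; exists U => //; case: (chart_open ch).
- exact: piece_vdom_open.
- split.
  + by rewrite /piece_vdom /= piece_emb_phi//; exact: (chartV ch).
  + by rewrite /piece_psi piece_emb_phi// (chartK ch Uy) piece_lift_val.
  + apply/rV_smooth_map => // i; case: (split_ordP i) => j ->.
      apply: (sm_near cN (f := (fun y => phi y 0 (lshift m j)) \o iota)).
        by apply: nearT => z; rewrite /= row_mxEl mxE.
      by apply: smooth_restrict; exact: (chart_coord ch).
    apply: (sm_near cN (f := (fun y => piece_z y 0 j) \o iota)).
      by apply: nearT => z; rewrite /= row_mxEr.
    by apply: smooth_restrict; exact: piece_z_smooth.
- split.
  + by rewrite /piece_udom /= piece_psiE//; exact: (chartU ch).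
  + rewrite /piece_phi /piece_z piece_psiE// (chartVK ch Vw) row_mxKl row_mxKr -mulmxA.
    by rewrite piece_split mulmx1 hsubmxK.
  + apply: smooth_map_at_lift => //; first exact: cinf_rV.
    apply: (smooth_map_at_near (phi := psi \o piece_emb)); first exact: cinf_rV.
      by apply: nearS (open_nbhs_nbhs (conj piece_vdom_open Vw)) => w' Vw' /=; rewrite piece_psiE.
    apply: smooth_map_at_comp; first exact: piece_emb_smooth.
    exact: (chart_psi ch).
Qed.

Definition piece_qdom : set (orbit_space act N) := pi @` piece_udom.
Definition piece_zdom : set 'rV[R]_q := [set z | piece_vdom (row_mx 0 z)].
Definition piece_sec (z : 'rV[R]_q) : set_type N := piece_psi (row_mx 0 z).
Definition piece_qpsi (z : 'rV[R]_q) : orbit_space act N := pi (piece_sec z).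
(** Any representative in the chart domain serves, because z agrees on points of the domain in the
    same orbit. *)
Definition piece_qphi (p : orbit_space act N) : 'rV[R]_q :=
  piece_z (iota (xget x [set y | piece_udom y /\ pi y = p])).

Lemma piece_z_orbit y g : U y -> U (act g y) -> piece_z (act g y) = piece_z y.
Proof.
move=> Uy Ug; have [rho [rc /nbhs_singleton E]] := piece_stab Uy Ug.
by rewrite /piece_z E -mulmxA rc.
Qed.

Lemma piece_qphiE y : piece_udom y -> piece_qphi (pi y) = piece_z (iota y).
Proof.
move=> Uy; rewrite /piece_qphi; set y0 := xget _ _.
have [Uy0 /esym/orbit_projP[g E]] : piece_udom y0 /\ pi y0 = pi y.
  by apply: (@xgetPex _ x [set y' | piece_udom y' /\ pi y' = pi y]); exists y.
by rewrite E; apply: piece_z_orbit => //; rewrite -E.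
Qed.

Lemma piece_sec_udom z : piece_zdom z -> piece_udom (piece_sec z).
Proof. exact: (chartU piece_chart_level). Qed.

Lemma piece_secE z : piece_zdom z -> iota (piece_sec z) = psi (row_mx 0 (z *m row)).
Proof. by move=> Vz; rewrite piece_psiE// /piece_emb row_mxKl row_mxKr. Qed.

Lemma row_mx0_smooth (z : 'rV[R]_q) : smooth_map_at (fun u : 'rV[R]_q => row_mx (0 : 'rV[R]_d) u) z.
Proof.
apply/(rV_smooth_map _ _ (cinf_rV _)) => i; case: (split_ordP i) => j ->.
  apply: (es_near (f := fun=> 0)); last exact: es_cst.
  by apply: nearT => u; rewrite row_mxEl mxE.
apply: (es_near (f := fun u : 'rV[R]_q => u 0 j)); last exact: es_coord.
by apply: nearT => u; rewrite row_mxEr.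
Qed.

Lemma piece_sec_smooth z : piece_zdom z -> smooth_map_at piece_sec z.
Proof.
move=> Vz; apply: (smooth_map_at_comp (psi := piece_psi)); last exact: (chart_psi piece_chart_level).
exact: row_mx0_smooth.
Qed.

Lemma piece_zdomE y : piece_udom y -> piece_zdom (piece_z (iota y)).
Proof.
move=> Uy; have := chartV piece_chart_level Uy; rewrite /piece_vdom /piece_zdom /= /piece_emb.
rewrite /piece_vdom /= /piece_emb !row_mxKl !row_mxKr /piece_phi => H.
apply: ball_row_mx; [exact: piece_rad|exact: ballxx (piece_rad C)|].
by have := ball_rsubmx H; rewrite row_mxKr.
Qed.

Lemma piece_sec_z y : piece_udom y -> pi (piece_sec (piece_z (iota y))) = pi y.
Proof.
move=> Uy; have Vz := piece_zdomE Uy.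
have Us := piece_sec_udom Vz.
apply/orbit_projP; apply: (piece_same Us Uy).
rewrite piece_secE// (chartVK ch) ?row_mxKr; last first.
  by have := Vz; rewrite /piece_zdom /= /piece_vdom /= /piece_emb row_mxKl row_mxKr.
by apply/piece_levelP => //; exact: (set_valP y).
Qed.

Lemma piece_z_sec z : piece_zdom z -> piece_z (iota (piece_sec z)) = z.
Proof.
move=> Vz; have := chartVK piece_chart_level Vz.
by move=> /(congr1 rsubmx); rewrite /piece_phi !row_mxKr.
Qed.

Lemma piece_qchart : is_chart piece_qdom piece_zdom piece_qphi piece_qpsi.
Proof.
have oU : open piece_udom by case: (chart_open piece_chart_level).
have oq : open piece_qdom by exact: orbit_proj_open.
have oz : open piece_zdom.
  rewrite openE => z Vz.
  have cz : {for z, continuous (fun u : 'rV[R]_q => row_mx (0 : 'rV[R]_d) u)}.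
    by have [] := row_mx0_smooth (z : 'rV[R]_q).
  exact: (near_comp cz (open_nbhs_nbhs (conj piece_vdom_open Vz))).
apply: (is_chartP cQ oq oz) => [p [y Uy <-]|z Vz].
- have qE := piece_qphiE Uy; split; [by rewrite qE; exact: (piece_zdomE Uy)| by rewrite qE; exact: (piece_sec_z Uy)|].
  apply: smooth_map_at_descend; last exact: cinf_rV.
  apply: nearS (open_nbhs_nbhs (conj oq _)); last by exists y.
  (* Smoothness on the quotient is tested at every point w over p', also outside the chart domain;
     g^-1 brings w back into it. *)
  move=> p' [y' Uy' <-] w /esym/orbit_projP[g E].
  apply/rV_smooth_map => // i.
  have Ug : U (act g^-1%g (iota w)) by rewrite E (actK hact).
  have nw : \forall w' \near w, U (act g^-1%g (iota w')).
    have [cv _] := smooth_map_at_val w.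
    apply: (near_comp cv (P := fun y => U (act g^-1%g y))).
    have [ca _] := smooth_act_r hM hact g^-1%g (iota w).
    exact: (near_comp ca (chart_nearU ch Ug)).
  apply: (sm_near cN (f := (fun y => piece_z (act g^-1%g y) 0 i) \o iota)).
    apply: nearS nw => w' Uw' /=.
    pose y1 : set_type N := exist _ (act g^-1%g (iota w')) (mem_set (level_piece_act g^-1%g (set_valP w'))).
    have -> : pi w' = pi y1 by apply/orbit_projP; exists g^-1%g.
    by rewrite piece_qphiE.
  apply: smooth_restrict; have [_ sa] := smooth_act_r hM hact g^-1%g (iota w).
  by apply: (sa (fun y => piece_z y 0 i)); exact: piece_z_smooth.
- split; first by exists (piece_sec z); [exact: (piece_sec_udom Vz)|].
    by rewrite /piece_qpsi (piece_qphiE (piece_sec_udom Vz)) (piece_z_sec Vz).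
  apply: (smooth_map_at_comp (psi := pi)); first exact: piece_sec_smooth.
  exact: smooth_map_at_proj.
Qed.

Lemma piece_udomx : piece_udom x. Proof. exact: piece_dom. Qed.

Lemma piece_zx : piece_z (iota x) = 0.
Proof.
rewrite /piece_z piece_center.
by have -> : rsubmx (0 : 'rV[R]_(d + m)) = 0; [apply/rowP => i; rewrite !mxE | rewrite mul0mx].
Qed.

Lemma piece_sec0 : piece_sec 0 = x.
Proof.
have := piece_zdomE piece_udomx; rewrite piece_zx => zd; apply: val_inj.
apply: etrans (piece_secE zd) _.
by rewrite mul0mx row_mx0 -(piece_center C) (chartK ch Ux).
Qed.

End one_chart.
Arguments piece_emb {x} C _.
Arguments piece_vdom {x} C _.
Arguments piece_zdom {x} C _.
Arguments piece_psi {x} C _.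
Arguments piece_sec {x} C _.
Arguments piece_qpsi {x} C _.

Lemma piece_chart_at (x : set_type N) : inhabited (piece_chart act P (iota x)).
Proof. by apply: (piece_chart_exists hs); have [] := set_valP x. Qed.

Lemma level_piece_manifold : is_manifold (set_type N).
Proof.
have [hh sc _] := hM; split; [exact: hausdorff_subspace|exact: second_countable_subspace|].
move=> x; have [C] := piece_chart_at x.
exists (pdim C + prank C)%N, (piece_udom C), (piece_vdom C), (piece_phi C), (piece_psi C).
by split; [exact: piece_chart_level | exact: piece_udomx].
Qed.

Lemma orbit_space_manifold : is_manifold (orbit_space act N).
Proof.
split; [exact: orbit_space_hausdorff|exact: orbit_space_second_countable|].
move=> p; have [x <-] := orbit_proj_surj p; have [C] := piece_chart_at x.
exists (prank C), (piece_qdom C), (piece_zdom C), (piece_qphi C), (piece_qpsi C).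
by split; [exact: piece_qchart | exists x => //; exact: piece_udomx].
Qed.

(** In the charts [piece_sec] is a section of the projection through x, so tangent vectors lift
    along it. *)
Lemma orbit_proj_submersion : is_submersion pi.
Proof.
split; first split.
- by move=> x; have [] := smooth_map_at_proj act x.
- by move=> x f sf; have [_ H] := smooth_map_at_proj act x; exact: H.
move=> x v tv; have [C] := piece_chart_at x.
have qx : piece_qdom C (pi x) by exists x => //; exact: piece_udomx.
have zx : piece_qphi C (pi x) = 0 by rewrite piece_qphiE ?piece_zx//; exact: piece_udomx.
have Vz : piece_zdom C 0 by rewrite -zx; exact: (chartV (piece_qchart C)).
have ss : smooth_map_at (piece_sec C \o piece_qphi C) (pi x).
  apply: smooth_map_at_comp; first exact: (chart_phi (piece_qchart C)).
  by rewrite zx; exact: piece_sec_smooth.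
have sx : (piece_sec C \o piece_qphi C) (pi x) = x by rewrite /= zx piece_sec0.
exists (tmap (piece_sec C \o piece_qphi C) (pi x) v).
  by have := tangent_tmap cN ss tv; rewrite sx.
have := @tmap_comp _ _ _ _ (piece_sec C \o piece_qphi C) pi (pi x) v.
rewrite sx => /(_ (smooth_map_at_proj act x)) <-.
rewrite -[RHS](tmap_id tv); apply: tmap_near => //.
apply: nearS (chart_nearU (piece_qchart C) qx) => p Up.
exact: (chartK (piece_qchart C) Up).
Qed.

End piece_structure.

Arguments piece_emb {R M G act P c x} C _.
Arguments piece_vdom {R M G act P c x} C _.
Arguments piece_zdom {R M G act P c x} C _.
Arguments piece_psi {R M G act P c x} C _.
Arguments piece_sec {R M G act P c x} C _.
Arguments piece_qpsi {R M G act P c x} C _.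

(** * The reduced bracket *)

Section smooth_sections.
Context {R : realType} {X : smoothSpaceType R}.
Hypothesis hX : cinf_space X.

Variables (n : nat) (U : set X) (V : set 'rV[R]_n) (phi : X -> 'rV[R]_n) (psi : 'rV[R]_n -> X).
Hypothesis ch : is_chart U V phi psi.

Lemma smooth_pullback x (F : 'rV[R]_n -> R) : U x -> euclidean_smooth_at (phi x) F ->
  smooth_at x (F \o phi).
Proof. by move=> Ux sF; have [_ H] := chart_phi ch Ux; exact: H. Qed.

Lemma smooth_vf_coords x (Z : X -> tvec X) f : U x -> (\forall y \near x, tangent y (Z y)) ->
  (forall j, smooth_at x (fun y => Z y (fun y => phi y 0 j))) -> smooth_at x f ->
  smooth_at x (fun y => Z y f).
Proof.
move=> Ux tZ sZ sf.
have ef := (chart_sm ch f Ux).1 sf.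
apply: (sm_near hX (f := fun y => \sum_i Z y (fun y => phi y 0 i) * 'D_(delta_mx 0 i) (f \o psi) (phi y))).
  apply: filterS3 tZ (chart_nearU ch Ux) (sm_nearby hX sf) => y ty Uy sy.
  by rewrite -(chart_deriv ch hX Uy ty sy).
apply: (sm_sum hX) => i; apply: (smM hX) => //.
apply: (smooth_pullback (F := fun u => 'D_(delta_mx 0 i) (f \o psi) u)) => //.
exact: es_partial.
Qed.

Lemma smooth_vf_chart_vec c : smooth_vf U (fun y => chart_vec phi psi y c).
Proof.
move=> x Ux; split=> [|f sf]; first exact: (chart_vec_tangent ch hX).
apply: (smooth_vf_coords (Z := fun y => chart_vec phi psi y c)) => //.
  by apply: nearS (chart_nearU ch Ux) => y Uy; exact: (chart_vec_tangent ch hX).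
move=> j; apply: (sm_near hX (f := fun=> c 0 j)); last exact: (sm_cst hX).
by apply: nearS (chart_nearU ch Ux) => y Uy; rewrite (chart_vec_coord ch).
Qed.

Lemma smooth_form_coord al W x c : U x -> W x -> smooth_form W al ->
  smooth_at x (fun y => al y (chart_vec phi psi y c)).
Proof.
move=> Ux Wx sal; have [_ H] := sal x Wx.
apply: (H U); last exact: smooth_vf_chart_vec.
by split=> //; case: (chart_open ch).
Qed.

End smooth_sections.

Lemma smooth_form_differential {R : realType} {X : smoothSpaceType R} (U : set X) f :
  cinf_space X -> (forall x, U x -> smooth_at x f) -> smooth_form U (differential f).
Proof.
move=> hX sf x Ux; split=> [|W Z [oW Wx] sZ]; first exact: cotangent_differential.
have [_ H] := sZ x Wx; apply: (sm_near hX (f := fun y => Z y f)); last exact: H (sf _ Ux).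
apply: nearS (open_nbhs_nbhs (conj oW Wx)) => y Wy.
by have [ty _] := sZ y Wy; rewrite differentialE.
Qed.

Lemma cotangent_lin {R : realType} {X : smoothSpaceType R} (x : X) a (c : R) v w :
  cotangent x a -> tangent x v -> tangent x w -> a (c *: v + w) = c * a v + a w.
Proof. by case=> H _; exact: H. Qed.

Lemma cotangent0 {R : realType} {X : smoothSpaceType R} (x : X) a : cotangent x a -> a 0 = 0.
Proof.
move=> ca; have := cotangent_lin 1 ca (tangent0 x) (tangent0 x).
by rewrite scaler0 addr0 mul1r => /eqP; rewrite -subr_eq0 opprD addrA subrr sub0r oppr_eq0 => /eqP.
Qed.

Lemma cotangent_sum {R : realType} {X : smoothSpaceType R} (x : X) a n (c : 'I_n -> R) e :
  cotangent x a -> (forall i, tangent x (e i)) -> a (\sum_i c i *: e i) = \sum_i c i * a (e i).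
Proof.
move=> ca; elim: n c e => [|n IH] c e te; first by rewrite !big_ord0 (cotangent0 ca).
rewrite !big_ord_recl (cotangent_lin _ ca)//; first by rewrite IH.
exact: tangent_sum.
Qed.

Section bundle_maps.
Context {R : realType} {X : smoothSpaceType R} {JX : X -> covec X -> tvec X}.
Hypotheses (hX : cinf_space X) (hJ : skew_bundle_map JX).

Lemma skew_tangent x a : cotangent x a -> tangent x (JX x a).
Proof. by case: hJ => t _ _ _; exact: t. Qed.

Lemma skew_swap x f g : differential f x (JX x (differential g x)) = - JX x (differential f x) g.
Proof.
have [t _ s _] := hJ; have c := @cotangent_differential _ X x.
by rewrite s// differentialE//; exact: t.
Qed.

Lemma generalized_poisson_of_map :
  generalized_poisson (fun f h x => differential f x (JX x (differential h x))).
Proof.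
have [t lin sk sm] := hJ; have c := @cotangent_differential _ X.
move=> f g h sf sg sh; split.
- move=> x; have sJ : smooth_vf setT (fun x => JX x (differential h x)).
    by apply: sm; [exact: openT | exact: smooth_form_differential].
  have [_ H] := sJ x I; apply: (sm_near hX (f := fun x => JX x (differential h x) f)); last exact: H.
  by apply: nearT => y; rewrite differentialE//; exact: t.
- by apply/funext => x; rewrite sk.
- move=> k; apply/funext => x; have th := t x _ (c x h).
  by rewrite !differentialE// (tan_lin _ th).
- apply/funext => x; have tf := t x _ (c x f).
  rewrite !skew_swap (tanM tf)//.
  by rewrite opprD mulNr mulrN.
Qed.

End bundle_maps.

(** * Existence and values of the reduced bundle map *)

Section reduced_bracket_map.
Context {R : realType} {M : smoothSpaceType R} {G : smoothGroupType R}.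
Context {br : (M -> R) -> (M -> R) -> (M -> R)} {J : M -> covec M -> tvec M}
  {om : M -> tvec M -> tvec M -> R} {Delta : M -> set (tvec M)}
  {act : G -> M -> M} {P : M -> covec G}.
Hypothesis hs : reduction_setting br J om Delta act P.
Variable c : set (set G).
Hypothesis hc : compact_classes G c.
Let hM := rs_M hs.
Let hG := rs_G hs.
Let hact := rs_act hs.
Let hMc : cinf_space M := manifold_cinf hM.
Let hGc : cinf_space G := lie_group_cinf hG.
Let hJ : skew_bundle_map J. Proof. by case: (rs_J hs). Qed.
Notation N := (level_piece act P c).
Notation iota := (@set_val M N).
Notation pi := (orbit_proj act N).
Let cN : cinf_space (set_type N) := cinf_subspace N hMc.
Let cQ : cinf_space (orbit_space act N) := cinf_orbit_space act N hMc.

Definition piece_db x (C : piece_chart act P x) (v : tvec M) : 'rV[R]_(pcodim C) :=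
  \row_j v (fun y => pphi C y 0 (rshift (pdim C) j)).

Definition piece_qz x (C : piece_chart act P (@set_val M N x)) i (q : orbit_space act N) : R :=
  piece_qphi C q 0 i.

Arguments piece_qz {x} C i q.

Section one_chart.
Variables (x : set_type N) (C : piece_chart act P (iota x)).
Notation d := (pdim C).
Notation phi := (pphi C).
Notation U := (pdom C).
Notation b y := (rsubmx (phi y)).
Notation col := (pcol C).
Notation row := (prow C).
Notation db := (piece_db C).
Let ch := piece_is_chart C.
Let chN := piece_chart_level hs hc C.
Let chQ := piece_qchart hs hc C.

Lemma piece_z_deriv y v i : U y -> tangent y v -> v (fun y => piece_z C y 0 i) = (db v *m col) 0 i.
Proof.
move=> Uy tv.
have sb j : smooth_at y (fun y => phi y 0 (rshift d j)) by exact: (chart_coord ch).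
rewrite (tan_near hMc tv (g := fun y => \sum_j col j i * phi y 0 (rshift d j))); last first.
  by apply: nearT => z; rewrite mxE; apply: eq_bigr => j _; rewrite mxE mulrC.
rewrite (tan_sum hMc tv) => [|j]; last by apply: (smM hMc) => //; exact: (sm_cst hMc).
by rewrite mxE; apply: eq_bigr => j _; rewrite (tanZ hMc _ tv)// mxE mulrC.
Qed.

Lemma piece_b_near y : piece_udom C y -> \forall y' \near y, b (iota y') = piece_z C (iota y') *m row.
Proof.
move=> Uy; have := chart_nearU chN Uy; apply: nearS => y' Uy'.
by rewrite /piece_z ((piece_levelP hc Uy').1 (set_valP y')).
Qed.

(** N is given by linear equations on b, so tangency is the same equations on db; the components
    along a are free. *)
Lemma piece_tangentP y v : piece_udom C y -> tangent (iota y) v ->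
  (exists2 w, tangent y w & tmap iota y w = v) <-> db v *m col *m row = db v.
Proof.
move=> Uy tv; have sv := smooth_map_at_val y.
have sz i : smooth_at y (fun y => piece_z C (iota y) 0 i).
  by apply: (smooth_restrict (f := fun y => piece_z C y 0 i)); exact: (piece_z_smooth hs).
have dbw w j : tangent y w -> tmap iota y w (fun y => phi y 0 (rshift d j)) =
    \sum_i w (fun y => piece_z C (iota y) 0 i) * row i j.
  move=> tw; rewrite tmapE; last exact: (chart_coord ch).
  rewrite (tan_near cN tw (g := fun y => \sum_i row i j * piece_z C (iota y) 0 i)); last first.
    apply: nearS (piece_b_near Uy) => y' /rowP/(_ j); rewrite !mxE /= => ->.
    by apply: eq_bigr => i _; rewrite mulrC.
  rewrite (tan_sum cN tw) => [|i]; last by apply: (smM cN) => //; exact: (sm_cst cN).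
  by apply: eq_bigr => i _; rewrite (tanZ cN _ tw)// mulrC.
split=> [[w tw wE]|E].
  apply/rowP => j; rewrite [RHS]mxE -[in RHS]wE dbw// mxE; apply: eq_bigr => i _.
  by rewrite -(piece_z_deriv i Uy tv) -wE tmapE//; exact: (piece_z_smooth hs).
pose w := chart_vec (piece_phi C) (piece_psi C) y
  (row_mx (\row_i v (fun y => phi y 0 (lshift (pcodim C) i))) (db v *m col)).
have tw : tangent y w by exact: (chart_vec_tangent chN cN).
exists w => //; apply: (chart_tan_inj ch hMc Uy _ tv) => [|i].
  exact: (tangent_tmap hMc sv tw).
case: (split_ordP i) => j ->.
  rewrite tmapE; last exact: (chart_coord ch).
  have -> : (fun y => phi y 0 (lshift (pcodim C) j)) \o iota =
      fun y => piece_phi C y 0 (lshift (prank C) j).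
    by apply/funext => z; rewrite /= row_mxEl mxE.
  by rewrite /w (chart_vec_coord chN)// row_mxEl mxE.
have /rowP/(_ j) := E; rewrite [RHS]mxE => <-; rewrite dbw// mxE; apply: eq_bigr => k _.
have -> : (fun y => piece_z C (iota y) 0 k) = fun y => piece_phi C y 0 (rshift d k).
  by apply/funext => z; rewrite row_mxEr.
by rewrite /w (chart_vec_coord chN)// row_mxEr.
Qed.

Lemma piece_qz_near y i : piece_udom C y ->
  \forall y' \near y, piece_qz C i (pi y') = piece_z C (iota y') 0 i.
Proof.
by move=> Uy; apply: nearS (chart_nearU chN Uy) => y' Uy'; rewrite /piece_qz (piece_qphiE hs Uy').
Qed.

Lemma piece_qz_smooth y i : piece_udom C y -> smooth_at (pi y) (piece_qz C i).
Proof. by move=> Uy; apply: (chart_coord chQ); exists y. Qed.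

Lemma piece_pi_z y w i : piece_udom C y -> tangent y w ->
  tmap pi y w (piece_qz C i) = tmap iota y w (fun y => piece_z C y 0 i).
Proof.
move=> Uy tw; rewrite !tmapE; [|exact: (piece_z_smooth hs)|exact: piece_qz_smooth].
by apply: (tan_near cN tw); exact: piece_qz_near.
Qed.

(** Brackets on the quotient are prescribed for restrictions of global invariant functions only;
    this makes the local coordinates accessible to them. *)
Lemma piece_extension i : exists2 f, invariant_fun act f &
  \forall y \near iota x, f y = piece_z C y 0 i.
Proof.
have [Px _] := set_valP x; have [S] := rs_slice hs Px.
apply: (invariant_extension hs Px S (chart_nearU ch (piece_dom C))) => [y Uy|y g Uy Ug].
  exact: (piece_z_smooth hs).
by rewrite (piece_z_orbit Uy Ug).
Qed.

End one_chart.
Arguments piece_extension {x} C i.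
Arguments piece_qz_near {x} C {y} i _.

Lemma tangent_level x v : tangent (iota x) v ->
  (forall k, stabilizer act (iota x) k -> vertical act (iota x) (tmap (act k) (iota x) v - v)) ->
  (forall xi, lie_algebra G xi -> v (fun y => P y xi) = 0) ->
  exists2 w, tangent x w & tmap iota x w = v.
Proof.
move=> tv vk vP; have [C] := piece_chart_at hs x.
by apply/(piece_tangentP (piece_udomx C) tv); exact: piece_tangent.
Qed.

Definition basic_covector (x : set_type N) (al : covec M) : Prop :=
  [/\ cotangent (iota x) al,
      forall k v, stabilizer act (iota x) k -> tangent (iota x) v ->
        al (tmap (act k) (iota x) v) = al v
    & forall v, vertical act (iota x) v -> al v = 0].

(** J al is fixed by K because J and al are invariant. By skewness the differential of P_xi on J al
    is minus al on the generator of xi, which is 0. *)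
Lemma J_tangent_level x al : basic_covector x al ->
  exists2 w, tangent x w & tmap iota x w = J (iota x) al.
Proof.
move=> [cal alk alV]; have tJ := skew_tangent hJ cal; have [_ _ sk _] := hJ.
apply: tangent_level => // [k Kk|xi txi].
  have -> : tmap (act k) (iota x) (J (iota x) al) = J (iota x) al.
    by apply: (stab_J (rs_GJ hs) Kk cal) => v tv; exact: alk.
  by rewrite subrr; exact: (vertical0 act).
have cP := @cotangent_differential _ M (iota x) (fun y => P y xi).
have := sk _ _ _ cP cal; rewrite (differentialE _ tJ) => ->.
rewrite -(generator_J hM hG hact (rs_J hs) (rs_om hs) (rs_Jom hs) (rs_P hs)) //.
by rewrite alV ?oppr0//; apply/(verticalP act); exists xi.
Qed.

Lemma basic_differential x f u : (\forall y \near iota x, f y = u y) -> invariant_fun act f ->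
  basic_covector x (differential u (iota x)).
Proof.
move=> fu [sf fi]; have nx := nbhs_singleton fu.
have su : smooth_at (iota x) u by exact: (sm_near hMc fu (sf _)).
split=> [|k v Kk tv|v vv]; first exact: cotangent_differential.
  have tk := tangent_stab hM hact Kk tv.
  rewrite !differentialE// -(tan_near hMc tk fu) -(tan_near hMc tv fu).
  rewrite tmap_act//; apply: (tan_near hMc tv); apply: nearT => y /=.
  exact: fi.
have tv := vertical_tangent hM hG hact vv.
have [xi txi vE] := (verticalP act _ _).1 vv.
rewrite differentialE// -(tan_near hMc tv fu) vE (generatorE hact)//.
rewrite (tan_near hGc txi (g := fun=> f (iota x))); last by apply: nearT => g; exact: fi.
exact: (tan_cst hGc _ txi).
Qed.

Lemma differential_near (X : smoothSpaceType R) (y : X) f g : cinf_space X ->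
  (\forall z \near y, f z = g z) -> differential f y = differential g y.
Proof.
move=> hX fg; apply/funext => v; have [tv|nt] := pselect (tangent y v).
  by rewrite !differentialE//; exact: (tan_near hX tv).
have [_ H] := @cotangent_differential _ X y f; have [_ H'] := @cotangent_differential _ X y g.
by rewrite H// H'.
Qed.

Lemma J_invariant f h g y : invariant_fun act f -> invariant_fun act h ->
  differential f (act g y) (J (act g y) (differential h (act g y))) =
  differential f y (J y (differential h y)).
Proof.
move=> [sf fi] [sh hi]; have sa := smooth_act_r hM hact g y.
have cd := @cotangent_differential _ M; have tJ := skew_tangent hJ.
rewrite (rs_GJ hs)//.
have ct u : smooth_fun u -> (forall g x, u (act g x) = u x) ->
    cotmap (act g) y (differential u (act g y)) = differential u y.
  move=> su ui; apply/funext => v; have [tv|nt] := pselect (tangent y v).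
    rewrite cotmapE// differentialE; last exact: (tangent_tmap hMc sa tv).
    rewrite tmapE// differentialE//; apply: (tan_near hMc tv).
    by apply: nearT => z; exact: ui.
  have [_ H] := cd y u; rewrite H//.
  by have [_ ->] := cotangent_cotmap hMc hMc sa (cd (act g y) u).
rewrite ct//; have tv := tJ _ _ (cd y h).
rewrite -[in RHS]ct// cotmapE//.
Qed.

Definition piece_rep (q : orbit_space act N) : set_type N := projT1 (cid (orbit_proj_surj q)).
Lemma piece_repK q : pi (piece_rep q) = q. Proof. exact: projT2 (cid (orbit_proj_surj q)). Qed.

Lemma smooth_descend (fh : orbit_space act N -> R) f : smooth_fun f -> fh \o pi = f \o iota -> smooth_fun fh.
Proof.
move=> sf E q; apply: nearT => q' x _; rewrite E.
by apply: smooth_restrict; exact: sf.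
Qed.

Lemma invariant_descend f : (forall g x, f (act g x) = f x) ->
  exists fh : orbit_space act N -> R, fh \o pi = f \o iota.
Proof.
move=> fi; exists (fun q => f (iota (piece_rep q))); apply/funext => x /=.
have /(orbit_projP hs)[g E] := esym (piece_repK (pi x)).
by rewrite E fi.
Qed.

Lemma near_orbit_proj x (Q : orbit_space act N -> Prop) :
  (\forall y \near x, Q (pi y)) -> \forall q \near pi x, Q q.
Proof.
move=> H; have : nbhs x [set y | Q (pi y)] by exact: H.
rewrite nbhsE => -[W [oW Wx] WQ].
have oq : open (pi @` W) by exact: (orbit_proj_open hs hc).
apply: nearS (open_nbhs_nbhs (conj oq _)); last by exists x.
by move=> _ [y Wy <-]; exact: WQ.
Qed.

(** The bracket formula written point by point, so that the values of the reduced map can be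
    constructed and compared at one point, separately from its smoothness. *)
Definition reduced_map_spec (JK : orbit_space act N -> covec (orbit_space act N) -> tvec (orbit_space act N)) :=
  forall x f h (fh hh : orbit_space act N -> R), invariant_fun act f -> invariant_fun act h ->
  fh \o pi = f \o iota -> hh \o pi = h \o iota ->
  differential fh (pi x) (JK (pi x) (differential hh (pi x))) =
  differential f (iota x) (J (iota x) (differential h (iota x))).

Definition pointwise_skew (X : smoothSpaceType R) (x : X) (F : covec X -> tvec X) :=
  [/\ forall a, cotangent x a -> tangent x (F a),
      forall (k : R) a b, cotangent x a -> cotangent x b -> F (k *: a + b) = k *: F a + F b
    & forall a b, cotangent x a -> cotangent x b -> a (F b) = - b (F a)].

Lemma reduced_bracket_spec brK JK : reduced_bracket br brK -> bracket_map brK JK -> reduced_map_spec JK.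
Proof.
move=> [_ rb] [_ bJ] x f h fh hh fi hi fE hE; have [sf _] := fi; have [sh _] := hi.
have sfh := smooth_descend sf fE; have shh := smooth_descend sh hE.
rewrite -bJ//; have := congr1 (@^~ x) (rb f h fh hh fi hi fE hE) => /= ->.
by have [_ ->] := rs_J hs.
Qed.

Section values.
Variable JK : orbit_space act N -> covec (orbit_space act N) -> tvec (orbit_space act N).
Hypotheses (JKspec : reduced_map_spec JK) (JKsk : forall q, pointwise_skew q (JK q)).

Let descend x (C : piece_chart act P (iota x)) i : exists f (fh : orbit_space act N -> R),
  [/\ invariant_fun act f, fh \o pi = f \o iota, \forall y \near iota x, f y = piece_z C y 0 i
    & \forall q \near pi x, fh q = piece_qz C i q].
Proof.
have [f fi fz] := piece_extension C i; have [_ finv] := fi.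
have [fh fhE] := invariant_descend finv; exists f, fh; split=> //.
apply: near_orbit_proj; have [cv _] := smooth_map_at_val x.
apply: filterS2 (near_comp cv fz) (piece_qz_near C i (piece_udomx C)) => y fy qy.
by rewrite qy -fy; have := congr1 (@^~ y) fhE.
Qed.

Lemma reduced_map_coords x (C : piece_chart act P (iota x)) i j :
  JK (pi x) (differential (piece_qz C i) (pi x)) (piece_qz C j) =
  J (iota x) (differential (fun y => piece_z C y 0 i) (iota x)) (fun y => piece_z C y 0 j).
Proof.
have [fi [fhi [ii ei ni qi]]] := @descend x C i; have [fj [fhj [ij ej nj qj]]] := @descend x C j.
have cd := @cotangent_differential _ (orbit_space act N) (pi x).
have cm := @cotangent_differential _ M (iota x).
have [tJK _ _] := JKsk (pi x); have tJ := skew_tangent hJ.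
have := JKspec x ij ii ej ei.
rewrite !(differential_near cQ qi) !(differential_near cQ qj).
rewrite !(differential_near hMc ni) !(differential_near hMc nj).
rewrite differentialE; last exact: tJK.
by rewrite differentialE//; exact: tJ.
Qed.

(** Both sides are evaluated on the coordinates z i. Skewness turns this into pairing a and al with
    the images of dz i, and these are tangent to N, where a and al agree. *)
Lemma reduced_map_basic x al w a : basic_covector x al -> tangent x w ->
  tmap iota x w = J (iota x) al -> cotangent (pi x) a ->
  (forall w', tangent x w' -> al (tmap iota x w') = a (tmap pi x w')) ->
  JK (pi x) a = tmap pi x w.
Proof.
move=> bal tw wE ca alE; have [C] := piece_chart_at hs x; have Ux := piece_udomx C.
have chQ := piece_qchart hs hc C; have Uq : piece_qdom C (pi x) by exists x.
have [tJK _ sJK] := JKsk (pi x); have [_ _ sJ _] := hJ; have tJ := skew_tangent hJ.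
have cd := @cotangent_differential _ (orbit_space act N) (pi x).
have cm := @cotangent_differential _ M (iota x); have [cal _ _] := bal.
have tpw w' : tangent x w' -> tangent (pi x) (tmap pi x w').
  by apply: (tangent_tmap cQ); exact: smooth_map_at_proj.
apply: (chart_tan_inj chQ cQ Uq (tJK _ ca) (tpw _ tw)) => i; rewrite -/(piece_qz C i).
rewrite -[LHS](differentialE _ (tJK _ ca)) sJK//.
rewrite (chart_covec chQ cQ Uq ca (tJK _ (cd _))).
rewrite (piece_pi_z i Ux tw) wE -[RHS](differentialE _ (tJ _ _ cal)) sJ//; congr (- _).
have [f fi fz] := piece_extension C i.
have bz := basic_differential fz fi; have [wi twi wiE] := J_tangent_level bz.
rewrite -wiE alE// (chart_covec chQ cQ Uq ca (tpw _ twi)).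
apply: eq_bigr => k _; congr (_ * _); rewrite -/(piece_qz C k).
by rewrite (piece_pi_z k Ux twi) wiE -reduced_map_coords.
Qed.

(** In a chart the coefficients are the functions B k, brackets of global invariant extensions of
    the coordinates; these are smooth because they come from smooth functions on M. *)
Lemma reduced_map_smooth : skew_bundle_map JK.
Proof.
split=> [q|q|q|U al oU sal q Uq]; [by have [] := JKsk q|by have [_] := JKsk q|by have [_ _] := JKsk q|].
split=> [|f sf]; first by have [t _ _] := JKsk q; apply: t; have [] := sal q Uq.
have [x xq] := orbit_proj_surj q; have [C] := piece_chart_at hs x; have Ux := piece_udomx C.
have chQ := piece_qchart hs hc C; have Uqd : piece_qdom C q by exists x.
have nU : \forall q' \near q, U q' by exact: open_nbhs_nbhs.
apply: (smooth_vf_coords (Z := fun q => JK q (al q)) cQ chQ) => // [|j].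
  by apply: nearS nU => q' Uq'; have [t _ _] := JKsk q'; apply: t; have [] := sal q' Uq'.
rewrite -/(piece_qz C j).
have /choice[fs /choice[fhs H]] := @descend x C.
pose B k q' := differential (fhs k) q' (JK q' (differential (fhs j) q')).
have sB k : smooth_fun (B k).
  have [ik ek _ _] := H k; have [ij ej _ _] := H j; have [sk _] := ik; have [sj _] := ij.
  have [_ brE] := rs_J hs.
  apply: (smooth_descend (f := fun y => differential (fs k) y (J y (differential (fs j) y)))).
    by have [] := generalized_poisson_of_map hMc hJ sk sk sj.
  by apply/funext => y; exact: JKspec.
apply: (sm_near cQ (f := fun q' => - \sum_k B k q' * al q' (chart_vec (piece_qphi C) (piece_qpsi C) q' (delta_mx 0 k)))); last first.
  apply: (smN cQ); apply: (sm_sum cQ) => k; apply: (smM cQ); first exact: sB.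
  exact: (smooth_form_coord cQ chQ _ Uqd Uq sal).
have nq : \forall q' \near q, forall k, \forall q'' \near q', fhs k q'' = piece_qz C k q''.
  by apply: near_forall => k; rewrite -xq; apply: near_near; have [] := H k.
apply: filterS3 nU nq (chart_nearU chQ Uqd) => q' Uq' nq' Uqd'.
have [tJK _ sJK] := JKsk q'; have [ca _] := sal q' Uq'.
have cd := @cotangent_differential _ (orbit_space act N) q'.
rewrite -[RHS](differentialE _ (tJK _ ca)) sJK//; congr (- _).
rewrite (chart_covec chQ cQ Uqd' ca (tJK _ (cd _))); apply: eq_bigr => k _; congr (_ * _).
rewrite -/(piece_qz C k) /B (differential_near cQ (nq' k)) (differential_near cQ (nq' j)).
by rewrite differentialE//; exact: tJK.
Qed.

End values.

(** The value sends dz i to the projection of J dz i, computed at one point x over q. At the other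
    points of the orbit the formula holds because J is invariant. *)
Lemma reduced_map_at q : exists F, pointwise_skew q F /\
  forall x f h (fh hh : orbit_space act N -> R), pi x = q ->
  invariant_fun act f -> invariant_fun act h -> fh \o pi = f \o iota -> hh \o pi = h \o iota ->
  differential fh q (F (differential hh q)) = differential f (iota x) (J (iota x) (differential h (iota x))).
Proof.
have [x xq] := orbit_proj_surj q; have [C] := piece_chart_at hs x; have Ux := piece_udomx C.
have chQ := piece_qchart hs hc C; have Uq : piece_qdom C q by exists x.
pose dz i := differential (fun y => piece_z C y 0 i) (iota x).
pose E i := chart_vec (piece_qphi C) (piece_qpsi C) q (delta_mx 0 i).
have /choice[w wP] : forall i, exists w, tangent x w /\ tmap iota x w = J (iota x) (dz i).
  move=> i; have [f fi fz] := piece_extension C i.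
  by have [w tw wE] := J_tangent_level (basic_differential fz fi); exists w.
have tw i : tangent x (w i) by have [] := wP i.
have wE i : tmap iota x (w i) = J (iota x) (dz i) by have [] := wP i.
have [_ _ sJ _] := hJ; have tJ := skew_tangent hJ.
have cd := @cotangent_differential _ (orbit_space act N) q.
have cm := @cotangent_differential _ M (iota x).
have tpw w' : tangent x w' -> tangent q (tmap pi x w').
  by rewrite -xq; apply: (tangent_tmap cQ); exact: smooth_map_at_proj.
have pz w' k : tangent x w' -> tmap pi x w' (piece_qz C k) = tmap iota x w' (fun y => piece_z C y 0 k).
  exact: (piece_pi_z k Ux).
have cov a v : cotangent q a -> tangent q v -> a v = \sum_k v (piece_qz C k) * a (E k).
  exact: (chart_covec chQ cQ Uq).
exists (fun a => \sum_i a (E i) *: tmap pi x (w i)); split; first split.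
- by move=> a ca; apply: tangent_sum => i; exact: tpw.
- move=> k a b ca cb; rewrite scaler_sumr -big_split; apply: eq_bigr => i _ /=.
  by rewrite scalerA -scalerDl.
- move=> a b ca cb; have tpwi i := tpw _ (tw i).
  rewrite (cotangent_sum _ ca)// (cotangent_sum _ cb)//.
  transitivity (\sum_i \sum_k b (E i) * a (E k) * J (iota x) (dz i) (fun y => piece_z C y 0 k)).
    apply: eq_bigr => i _; rewrite (cov _ _ ca (tpwi i)) mulr_sumr; apply: eq_bigr => k _.
    by rewrite pz// wE [X in _ * X]mulrC mulrA.
  rewrite exchange_big /= -sumrN; apply: eq_bigr => i _.
  rewrite (cov _ _ cb (tpwi i)) mulr_sumr -sumrN; apply: eq_bigr => k _.
  rewrite pz// wE -[J _ _ _ in LHS](differentialE _ (tJ _ _ (cm _))) sJ; [|exact: cm|exact: cm].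
  by rewrite (differentialE _ (tJ _ _ (cm _))) mulrN; congr (- _); ring.
move=> x' f h fh hh x'q fi hi fE hE; have [sf fv] := fi; have [sh hv] := hi.
have sfh := smooth_descend sf fE; have shh := smooth_descend sh hE.
have [g ->] : exists g, iota x' = act g (iota x) by apply/(orbit_projP hs); rewrite xq x'q.
rewrite J_invariant// (cotangent_sum _ (cd fh)); last by move=> i; exact: tpw.
have fx : \forall y \near iota x, f y = f y by exact: nearT.
have [wf twf wfE] := J_tangent_level (basic_differential fx fi).
have dpi (u : M -> R) (uh : orbit_space act N -> R) w' : smooth_fun u -> smooth_fun uh -> uh \o pi = u \o iota ->
    tangent x w' -> tmap pi x w' uh = tmap iota x w' u.
  by move=> su suh uE tw'; rewrite !tmapE// ?uE// xq.
rewrite sJ// (differentialE _ (tJ _ _ (cm _))) -wfE -(dpi _ _ _ sh shh hE twf).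
rewrite -(differentialE _ (tpw _ twf)) (cov _ _ (cd hh) (tpw _ twf)) -sumrN.
apply: eq_bigr => i _; rewrite (differentialE _ (tpw _ (tw i))) (dpi _ _ _ sf sfh fE (tw i)) wE.
rewrite (pz _ _ twf) wfE -(differentialE _ (tJ _ _ (cm _))) sJ// (differentialE _ (tJ _ _ (cm _))).
by ring.
Qed.

Lemma reduced_map_exists : exists JK, skew_bundle_map JK /\ reduced_map_spec JK.
Proof.
have /choice[JK H] := reduced_map_at; exists JK.
have sp : reduced_map_spec JK by move=> x f h fh hh; have [_ H'] := H (pi x); exact: H'.
by split=> //; apply: reduced_map_smooth => // q; have [] := H q.
Qed.

Lemma reduced_bracket_exists : exists brK JK, @reduced_bracket R G M act N br brK /\ bracket_map brK JK.
Proof.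
have [JK [sJK spJK]] := reduced_map_exists.
exists (fun f h q => differential f q (JK q (differential h q))), JK; split; last by split.
split; first exact: generalized_poisson_of_map.
move=> f h fh hh fi hi fE hE; apply/funext => x /=; have [sf _] := fi; have [sh _] := hi.
by rewrite (spJK x f h)//; have [_ ->] := rs_J hs.
Qed.

End reduced_bracket_map.

Arguments piece_qz {R M G act P c x} C i q.
Arguments piece_extension {R M G br J om Delta act P} hs {c x} C i.
Arguments piece_qz_near {R M G br J om Delta act P} hs {c} hc {x} C {y} i _.

(** * The reduced distribution *)

Section smooth_matrices.
Context {R : realType} {X : smoothSpaceType R}.
Hypothesis hX : cinf_space X.

Definition smooth_mx m n (x : X) (A : X -> 'M[R]_(m, n)) : Prop :=
  forall i j, smooth_at x (fun y => A y i j).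

Lemma smooth_mx_cst m n x (A : 'M[R]_(m, n)) : smooth_mx x (fun=> A).
Proof. by move=> i j; exact: (sm_cst hX). Qed.

Lemma smooth_mxM m n p x (A : X -> 'M[R]_(m, n)) (B : X -> 'M[R]_(n, p)) :
  smooth_mx x A -> smooth_mx x B -> smooth_mx x (fun y => A y *m B y).
Proof.
move=> sA sB i j; apply: (sm_near hX (f := fun y => \sum_k A y i k * B y k j)).
  by apply: nearT => y; rewrite mxE.
by apply: (sm_sum hX) => k; exact: (smM hX).
Qed.

Lemma smooth_mxV n x (A : X -> 'M[R]_n) : smooth_mx x A -> A x \in unitmx ->
  (\forall y \near x, A y \in unitmx) /\ smooth_mx x (fun y => invmx (A y)).
Proof. by move=> sA uA; exact: (sm_invmx hX). Qed.

Lemma near_row_free m n x (A : X -> 'M[R]_(m, n)) : smooth_mx x A -> row_free (A x) ->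
  \forall y \near x, row_free (A y).
Proof.
move=> sA /row_freeP[B AB].
have uAB : A x *m B \in unitmx by rewrite AB unitmx1.
have [H _] := smooth_mxV (A := fun y => A y *m B) (smooth_mxM sA (smooth_mx_cst x B)) uAB.
apply: nearS H => y uy; apply/row_freeP; exists (B *m invmx (A y *m B)).
by rewrite mulmxA mulmxV.
Qed.

Lemma smooth_vf_comb h (W : set X) (co : X -> 'I_h -> R) (Z : 'I_h -> X -> tvec X) :
  (forall x l, W x -> smooth_at x (fun y => co y l)) -> (forall l, smooth_vf W (Z l)) ->
  open W -> smooth_vf W (fun x => \sum_l co x l *: Z l x).
Proof.
move=> sc sZ oW x Wx; split=> [|f sf].
  by apply: tangent_sum => l; have [] := sZ l x Wx.
apply: (sm_near hX (f := fun y => \sum_l co y l * Z l y f)).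
  by apply: nearT => y; rewrite tvec_sum.
apply: (sm_sum hX) => l; apply: (smM hX); first exact: sc.
by have [_ H] := sZ l x Wx; exact: H.
Qed.

Lemma smooth_form_comb h (W : set X) (co : X -> 'I_h -> R) (al : 'I_h -> X -> covec X) :
  (forall x l, W x -> smooth_at x (fun y => co y l)) -> (forall l, smooth_form W (al l)) ->
  open W -> smooth_form W (fun x => \sum_l co x l *: al l x).
Proof.
move=> sc sal oW x Wx.
have sumE (y : X) (v : tvec X) : (\sum_l co y l *: al l y) v = \sum_l co y l * al l y v.
  by elim/big_ind2: _ => // a u b w <- <-.
split=> [|W' Z W'x sZ].
  split=> [k v w tv tw|v nv].
    rewrite !sumE mulr_sumr -big_split; apply: eq_bigr => l _ /=.
    by have [ca _] := sal l x Wx; rewrite (cotangent_lin _ ca)// mulrDr mulrCA.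
  by rewrite sumE big1// => l _; have [[_ ->]] := sal l x Wx; rewrite ?mulr0.
apply: (sm_near hX (f := fun y => \sum_l co y l * al l y (Z y))).
  by apply: nearT => y; rewrite sumE.
apply: (sm_sum hX) => l; apply: (smM hX); first exact: sc.
by have [_ H] := sal l x Wx; exact: (H W').
Qed.

End smooth_matrices.

Section idempotent_rank.
Context {F : fieldType}.

Lemma row_free_selection k m (A : 'M[F]_(k, m)) :
  exists h (H : 'M[F]_(h, k)), row_free (H *m A) /\ (\rank A <= h)%N.
Proof.
have /submxP[H HE] : (row_base A <= A)%MS by rewrite eq_row_base.
by exists (\rank A), H; rewrite -HE row_base_free.
Qed.

Lemma right_inverse_solve h k m (A : 'M[F]_(h, m)) (B : 'M[F]_(k, m)) (W : 'M[F]_(m, k)) :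
  (A <= B)%MS -> B *m W \in unitmx -> A *m W *m invmx (B *m W) *m B = A.
Proof.
move=> /submxP[X ->] u; rewrite -(mulmxA X B W) -(mulmxA X) mulmxV// mulmx1.
by [].
Qed.

(** Q maps the row space of B into itself and acts there as an idempotent Y; the product of Y and 1
    - Y is 0, so their ranks add up to at most k. *)
Lemma rank_idempotent_split k n (B : 'M[F]_(k, n)) (Q : 'M[F]_n) : row_free B ->
  Q *m Q = Q -> (B *m Q <= B)%MS -> (\rank (B *m Q) + \rank (B *m (1%:M - Q)) <= k)%N.
Proof.
move=> fB QQ /submxP[Y YE].
have YY : Y *m Y = Y.
  by apply: (row_free_inj fB); rewrite /= -mulmxA -YE mulmxA -YE -mulmxA QQ.
have -> : B *m (1%:M - Q) = (1%:M - Y) *m B by rewrite mulmxBr mulmx1 mulmxBl mul1mx YE.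
rewrite YE !mxrankMfree//; apply: mulmx0_rank_max.
by rewrite mulmxBr mulmx1 YY subrr.
Qed.

End idempotent_rank.

Section subbundles.
Context {R : realType} {X : smoothSpaceType R} {D : X -> set (tvec X)}.
Hypothesis hD : is_subbundle (@smooth_vf R X) D.

Lemma subbundle_frame y : exists U n (e : 'I_n -> X -> tvec X), [/\ open U, U y,
  forall l, smooth_vf U (e l) & forall z, U z -> is_basis (fun l => e l z) (D z)].
Proof. by have [U [n [e [[oU Uy] se be]]]] := hD y; exists U, n, e; split. Qed.

Lemma subbundle_tangent y v : D y v -> tangent y v.
Proof.
have [U [n [e [oU Uy se be]]]] := subbundle_frame y; have [_ ->] := be _ Uy.
by move=> [k _ <-]; apply: tangent_sum => l; have [] := se l y Uy.
Qed.

Lemma subbundle_lin y k v w : D y v -> D y w -> D y (k *: v + w).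
Proof.
have [U [n [e [oU Uy se be]]]] := subbundle_frame y; have [_ ->] := be _ Uy.
move=> [a _ <-] [b _ <-]; exists (fun l => k * a l + b l) => //.
rewrite scaler_sumr -big_split; apply: eq_bigr => l _ /=.
by rewrite scalerA -scalerDl.
Qed.

Lemma subbundle0 y : D y 0.
Proof.
have [U [n [e [oU Uy se be]]]] := subbundle_frame y; have [_ ->] := be _ Uy.
by exists (fun=> 0) => //; rewrite big1// => l _; rewrite scale0r.
Qed.

Lemma subbundleZ y k v : D y v -> D y (k *: v).
Proof. by move=> dv; rewrite -[k *: v]addr0; apply: subbundle_lin => //; exact: subbundle0. Qed.

Lemma subbundle_bigsum (I : eqType) y (s : seq I) (F : I -> tvec X) : (forall k, k \in s -> D y (F k)) ->
  D y (\sum_(k <- s) F k).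
Proof.
move=> H; rewrite big_seq; apply: (big_ind (D y)) => //; first exact: subbundle0.
by move=> v w dv dw; rewrite -[v]scale1r; exact: subbundle_lin.
Qed.

End subbundles.

(** * Local frames of the reduced distribution *)

Section reduced_distributions.
Context {R : realType} {M : smoothSpaceType R} {G : smoothGroupType R}.
Context {br : (M -> R) -> (M -> R) -> (M -> R)} {J : M -> covec M -> tvec M}
  {om : M -> tvec M -> tvec M -> R} {Delta : M -> set (tvec M)}
  {act : G -> M -> M} {P : M -> covec G}.
Hypothesis hs : reduction_setting br J om Delta act P.
Variable c : set (set G).
Hypothesis hc : compact_classes G c.
Let hM := rs_M hs.
Let hG := rs_G hs.
Let hact := rs_act hs.
Let hMc : cinf_space M := manifold_cinf hM.
Let hGc : cinf_space G := lie_group_cinf hG.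
Notation N := (level_piece act P c).
Notation iota := (@set_val M N).
Notation pi := (orbit_proj act N).
Let cN : cinf_space (set_type N) := cinf_subspace N hMc.
Let cQ : cinf_space (orbit_space act N) := cinf_orbit_space act N hMc.

Let Delta_frame y := subbundle_frame (rs_Delta hs) y.
Let Delta_tangent y v := @subbundle_tangent _ _ _ (rs_Delta hs) y v.
Let Delta_lin y k v w := @subbundle_lin _ _ _ (rs_Delta hs) y k v w.
Let Delta0 y := subbundle0 (rs_Delta hs) y.
Let DeltaZ y k v := @subbundleZ _ _ _ (rs_Delta hs) y k v.
Let Delta_bigsum y (s : seq G) F := @subbundle_bigsum _ _ _ (rs_Delta hs) _ y s F.

Lemma tmap_bigsum (X Y : smoothSpaceType R) (f : X -> Y) y (s : seq G) (F : G -> tvec X) :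
  tmap f y (\sum_(k <- s) F k) = \sum_(k <- s) tmap f y (F k).
Proof. by elim: s => [|k s IH]; rewrite ?big_nil ?tmap0// !big_cons tmapD IH. Qed.

Lemma piece_db_lin x (C : piece_chart act P x) k v w :
  piece_db C (k *: v + w) = k *: piece_db C v + piece_db C w.
Proof. by apply/rowP => j; rewrite !mxE. Qed.

Lemma piece_db_bigsum x (C : piece_chart act P x) (s : seq G) (F : G -> tvec M) :
  piece_db C (\sum_(k <- s) F k) = \sum_(k <- s) piece_db C (F k).
Proof.
elim: s => [|k s IH]; first by rewrite !big_nil; apply/rowP => j; rewrite !mxE.
by rewrite !big_cons -IH; apply/rowP => j; rewrite !mxE.
Qed.

Lemma piece_db_sum x (C : piece_chart act P x) n (k : 'I_n -> R) (e : 'I_n -> tvec M) :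
  piece_db C (\sum_l k l *: e l) = (\row_l k l) *m (\matrix_(l, j) piece_db C (e l) 0 j).
Proof.
by apply/rowP => j; rewrite !mxE tvec_sum; apply: eq_bigr => l _; rewrite !mxE.
Qed.

(* The average of v over the stabilizer of y is tangent to N because it is invariant and
   annihilated by the differentials of the momentum functions. *)
Lemma Delta_level_projection (x : set_type N) (C : piece_chart act P (iota x)) y v :
  piece_udom C y -> Delta (iota y) v -> exists v', [/\ Delta (iota y) v',
    exists2 w, tangent y w & tmap iota y w = v',
    piece_db C v' = piece_db C v *m pcol C *m prow C
    & forall al, basic_covector y al -> al v' = al v].
Proof.
move=> Uy dv; have [Py _] := set_valP y; have [s [s0 sK sav]] := rs_average hs Py.
have tv := Delta_tangent dv.
pose F k := tmap (act k) (iota y) v; pose n0 : R := (size s)%:R^-1.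
have n0E : n0 * (size s)%:R = 1 by rewrite mulVf// pnatr_eq0 -lt0n.
have dF k : stabilizer act (iota y) k -> Delta (iota y) (F k).
  by move=> Kk; have := rs_GDelta hs k dv; rewrite [act k _]Kk.
have Fc k g : stabilizer act (iota y) k -> ineffective act (iota y) g -> F (k * g)%g = F k.
  by move=> Kk [Kg ig]; rewrite /F (tmap_actM hM hact) ig// [act g _]Kg.
pose v' := n0 *: \sum_(k <- s) F k.
have dv' : Delta (iota y) v' by apply: DeltaZ; apply: Delta_bigsum => k /sK; exact: dF.
have tv' := Delta_tangent dv'.
have lev : exists2 w, tangent y w & tmap iota y w = v'.
  apply: (tangent_level hs hc) => // [k Kk|xi txi].
    suff -> : tmap (act k) (iota y) v' = v' by rewrite subrr; exact: vertical0.
    rewrite /v' tmapZ tmap_bigsum; congr (_ *: _).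
    rewrite -(sav _ _ Fc _ Kk).2 big_seq [RHS]big_seq; apply: eq_bigr => k0 /sK Kk0.
    by rewrite /F (tmap_actM hM hact) [act k0 _]Kk0.
  have [_ H] := rs_PDelta hs txi (iota y).
  by have := H _ dv'; rewrite differentialE.
exists v'; split=> //; last first.
  move=> al [cal alk _]; rewrite -[v']addr0 (cotangent_lin _ cal) ?(cotangent0 cal) ?addr0; last 2 first.
  - by apply: (subbundle_tangent (rs_Delta hs)); apply: Delta_bigsum => k /sK; exact: dF.
  - exact: tangent0.
  have E1 (s' : seq G) : (forall k, k \in s' -> stabilizer act (iota y) k) ->
      tangent (iota y) (\sum_(k <- s') F k) /\ al (\sum_(k <- s') F k) = (size s')%:R * al v.
    elim: s' => [|k s' IH] H.
      by rewrite !big_nil mul0r (cotangent0 cal); split=> //; exact: tangent0.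
    have [t0 a0] := IH (fun k0 ks => H k0 (mem_behead (s := k :: s') ks)).
    have Kk := H k (mem_head _ _); have tk : tangent (iota y) (F k) := tangent_stab hM hact Kk tv.
    rewrite !big_cons -[F k]scale1r; split; first exact: tangent_lin.
    by rewrite (cotangent_lin _ cal)// a0 mul1r /F alk// /= mulrS mulrDl mul1r.
  by rewrite (E1 s sK).2 mulrA n0E mul1r.
have /(piece_tangentP hs hc Uy tv') <- := lev.
rewrite /v' -[n0 *: _]addr0 piece_db_lin piece_db_bigsum.
have -> : piece_db C 0 = 0 by apply/rowP => j; rewrite !mxE.
rewrite addr0 -!scalemxAl !mulmx_suml.
rewrite -[RHS]scale1r -n0E -scalerA; congr (_ *: _).
transitivity (\sum_(k <- s) piece_db C v *m pcol C *m prow C); last first.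
  by rewrite big_const_seq count_predT iter_addr_0 scaler_nat.
rewrite big_seq [RHS]big_seq; apply: eq_bigr => k /sK Kk; congr (_ *m _).
have Ug : pdom C (act k (iota y)) by rewrite [act k _]Kk.
have [rho [rc nr]] := piece_stab Uy Ug.
have -> : piece_db C (F k) = piece_db C v *m rho; last by rewrite -mulmxA rc.
have sb j : smooth_at (iota y) (fun y => pphi C y 0 (rshift (pdim C) j)).
  exact: (chart_coord (piece_is_chart C)).
apply/rowP => j; rewrite mxE /F tmap_act//.
rewrite (tan_near hMc tv (g := fun y => \sum_i rho i j * pphi C y 0 (rshift (pdim C) i))); last first.
  by apply: nearS nr => z /rowP/(_ j); rewrite !mxE /= => ->; apply: eq_bigr => i _; rewrite mxE mulrC.
rewrite (tan_sum hMc tv) => [|i]; last by apply: (smM hMc) => //; exact: (sm_cst hMc).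
by rewrite mxE; apply: eq_bigr => i _; rewrite (tanZ hMc _ tv)// mxE mulrC.
Qed.

(** The reduced distribution described at a single point, by vectors instead of sections;
    [reduced_distributionE] identifies the two. *)
Definition level_distribution (x : set_type N) : set (tvec (orbit_space act N)) :=
  [set tmap pi x w | w in [set w | tangent x w /\ Delta (iota x) (tmap iota x w)]].

Lemma level_distribution_orbit x x' : pi x = pi x' -> level_distribution x `<=` level_distribution x'.
Proof.
move=> /(orbit_projP hs)[g gE] _ [w [tw dw] <-].
pose ga (y : set_type N) : set_type N := exist _ (act g (iota y)) (mem_set (level_piece_act hs hc g (set_valP y))).
have sga y : smooth_map_at ga y.
  apply: smooth_map_at_lift => //; apply: (smooth_map_at_comp (psi := act g)).
    exact: smooth_map_at_val.
  exact: (smooth_act_r hM hact).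
have gx : ga x = x' by apply: val_inj.
have sp := smooth_map_at_proj act (A := N).
exists (tmap ga x w); first split.
- by have := tangent_tmap cN (sga x) tw; rewrite gx.
- have := tmap_comp w (@smooth_map_at_val _ _ N (ga x)); rewrite gx => <-.
  have -> : iota \o ga = act g \o iota by apply/funext.
  rewrite (tmap_comp w (smooth_act_r hM hact g (iota x))) gE; exact: (rs_GDelta hs).
have := tmap_comp w (sp (ga x)); rewrite gx => <-; congr tmap.
by apply/funext => y; apply/esym/(orbit_projP hs); exists g.
Qed.

Section local_frame.
Variables (x : set_type N) (C : piece_chart act P (iota x)).
Variables (U0 : set M) (k : nat) (E : 'I_k -> M -> tvec M).
Hypotheses (oU0 : open U0) (U0x : U0 (iota x)) (sE : forall l, smooth_vf U0 (E l))
  (bE : forall y, U0 y -> is_basis (fun l => E l y) (Delta y)).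
Notation d := (pdim C).
Notation m := (pcodim C).
Notation q := (prank C).
Notation phi := (pphi C).
Notation psi := (@ppsi _ _ _ _ _ _ C).
Notation U := (pdom C).
Notation r := (prad C).
Notation b y := (rsubmx (phi y)).
Notation col := (pcol C).
Notation prw := (prow C).
Notation db := (piece_db C).
Notation sg y := (psi (row_mx 0 (b y))).
Let ch := piece_is_chart C.
Let chN := piece_chart_level hs hc C.
Let chQ := piece_qchart hs hc C.
Let Q : 'M[R]_m := col *m prw.
Let QQ : Q *m Q = Q. Proof. by rewrite /Q mulmxA -(mulmxA col) piece_split mulmx1. Qed.

Definition frame_mx (y : M) : 'M[R]_(k, m) := \matrix_(l, j) E l y (fun y => phi y 0 (rshift d j)).
Notation B := frame_mx.

Let dom := U `&` U0.
Let dom_open : open dom. Proof. by apply: openI => //; case: (chart_open ch). Qed.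

Lemma frame_dbE y (u : 'rV[R]_k) : db (\sum_l u 0 l *: E l y) = u *m B y.
Proof.
rewrite piece_db_sum; congr (_ *m _); first by apply/rowP => l; rewrite mxE.
by apply/matrixP => l j; rewrite !mxE.
Qed.

Lemma frame_comb y v : dom y -> Delta y v -> exists u : 'rV[R]_k, v = \sum_l u 0 l *: E l y.
Proof.
move=> [_ Uy]; have [_ ->] := bE Uy => -[a _ <-]; exists (\row_l a l).
by apply: eq_bigr => l _; rewrite mxE.
Qed.

Lemma frame_Delta y (u : 'rV[R]_k) : dom y -> Delta y (\sum_l u 0 l *: E l y).
Proof. by move=> [_ Uy]; have [_ ->] := bE Uy; exists (fun l => u 0 l). Qed.

(** The kernel of db consists of the vertical vectors, and Delta contains none of them except 0. *)
Lemma frame_free y : dom y -> row_free (B y).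
Proof.
move=> dy; have [Uy U0y] := dy; rewrite -kermx_eq0; apply/eqP/row_matrixP => i; rewrite row0.
set u := row i _; have uB : u *m B y = 0 by rewrite -row_mul mulmx_ker row0.
have dv := frame_Delta u dy; have tv := Delta_tangent dv.
have vv : vertical act y (\sum_l u 0 l *: E l y).
  apply/(piece_vert _ Uy); split=> // j.
  by have := frame_dbE y u; rewrite uB => /rowP/(_ j); rewrite !mxE.
have : (Delta y `&` vertical act y) (\sum_l u 0 l *: E l y) by [].
rewrite (rs_DeltaV hs) /= => v0; have [fr _] := bE U0y.
by apply/rowP => l; rewrite (fr _ v0) mxE.
Qed.

Lemma frame_smooth y : dom y -> smooth_mx y B.
Proof.
move=> [Uy U0y] l j; apply: (sm_near hMc (f := fun z => E l z (fun y => phi y 0 (rshift d j)))).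
  by apply: nearT => z; rewrite mxE.
by have [_ H] := sE l U0y; apply: H; exact: (chart_coord ch).
Qed.

Lemma section_udom y : U y -> U (sg y).
Proof.
move=> Uy; apply: (chartU ch); apply: ball_row_mx; [exact: piece_rad|exact: ballxx (piece_rad C)|].
exact: (ball_rsubmx (chartV ch Uy)).
Qed.

Lemma section_phi y : U y -> phi (sg y) = row_mx 0 (b y).
Proof.
move=> Uy; apply: (chartVK ch); apply: ball_row_mx; [exact: piece_rad|exact: ballxx (piece_rad C)|].
exact: (ball_rsubmx (chartV ch Uy)).
Qed.

Lemma section_smooth y : U y -> smooth_map_at (fun y => sg y) y.
Proof.
move=> Uy; apply: (smooth_map_at_comp (phi := fun y => row_mx (0 : 'rV[R]_d) (b y)) (psi := psi)).
  apply/(rV_smooth_map _ _ hMc) => i; case: (split_ordP i) => j ->.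
    apply: (sm_near hMc (f := fun=> 0)); last exact: (sm_cst hMc).
    by apply: nearT => z; rewrite row_mxEl mxE.
  apply: (sm_near hMc (f := fun y => phi y 0 (rshift d j))); last exact: (chart_coord ch).
  by apply: nearT => z; rewrite row_mxEr mxE.
apply: (chart_psi ch); apply: ball_row_mx; [exact: piece_rad|exact: ballxx (piece_rad C)|].
exact: (ball_rsubmx (chartV ch Uy)).
Qed.

Lemma section_x : sg (iota x) = iota x.
Proof.
have E1 := chartK ch (piece_dom C); rewrite piece_center in E1; apply: etrans E1; congr psi.
by rewrite piece_center -[RHS]hsubmxK; congr row_mx; apply/rowP => i; rewrite !mxE.
Qed.

Lemma section_vertical y v : U y -> vertical act y v -> tmap (fun y => sg y) y v = 0.
Proof.
move=> Uy /(piece_vert _ Uy)[tv v0]; have Us := section_udom Uy.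
apply: (chart_tan_inj ch hMc Us _ (tangent0 _)) => [|i].
  exact: (tangent_tmap hMc (section_smooth Uy) tv).
rewrite tmapE ?tvec0; last exact: (chart_coord ch).
have nU := chart_nearU ch Uy.
case: (split_ordP i) => j ->.
  rewrite (tan_near hMc tv (g := fun=> 0)) ?(tan_cst hMc _ tv)//.
  by apply: nearS nU => z Uz /=; rewrite section_phi// row_mxEl mxE.
rewrite (tan_near hMc tv (g := fun y => phi y 0 (rshift d j))) ?v0//.
by apply: nearS nU => z Uz /=; rewrite section_phi// row_mxEr mxE.
Qed.

(* Moving y to the section is done by a group element preserving b near the section. *)
Lemma frame_section y : dom y -> dom (sg y) -> (B (sg y) <= B y)%MS.
Proof.
move=> dy ds; have [Uy _] := dy; have [Us _] := ds; have [g [gE ng]] := piece_move Uy.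
apply/row_subP => i; set w := E i (sg y).
have iE : w = \sum_l (delta_mx 0 i : 'rV[R]_k) 0 l *: E l (sg y).
  rewrite (bigD1 i)//= mxE !eqxx scale1r big1 ?addr0// => l /negPf li.
  by rewrite mxE li andbF scale0r.
have dw : Delta (sg y) w by rewrite iE; exact: frame_Delta.
have dgw := rs_GDelta hs g dw; have tw := Delta_tangent dw.
move: dgw; rewrite -gE => dgw; have [u uE] := frame_comb dy dgw.
have : db (tmap (act g) (sg y) w) = db w.
  apply/rowP => j; rewrite !mxE tmapE; last by rewrite -gE; exact: (chart_coord ch).
  by apply: (tan_near hMc tw); apply: nearS ng => z /rowP/(_ j); rewrite !mxE.
rewrite uE frame_dbE {1}iE frame_dbE -rowE => <-; exact: submxMl.
Qed.

Lemma section_level y : piece_udom C y -> sg (iota y) = iota (piece_sec C (piece_qphi C (pi y))).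
Proof.
move=> Uy; rewrite (piece_qphiE hs Uy) (piece_secE hc (piece_zdomE hs hc Uy)); congr (psi (row_mx _ _)).
by rewrite /piece_z ((piece_levelP hc Uy).1 (set_valP y)).
Qed.

(** At points of N averaging over the stabilizer stays inside Delta and acts on db as Q. *)
Lemma frame_projection y : dom (iota y) -> (B (iota y) *m Q <= B (iota y))%MS.
Proof.
move=> dy; have [Uy _] := dy; apply/row_subP => i; rewrite row_mul rowE.
rewrite -frame_dbE; have dv := frame_Delta (delta_mx 0 i) dy.
have [v' [dv' _ v'E _]] := Delta_level_projection (C := C) Uy dv.
by rewrite /Q mulmxA -v'E; have [u ->] := frame_comb dy dv'; rewrite frame_dbE; exact: submxMl.
Qed.

Lemma level_distributionE y u : dom (iota y) ->
  level_distribution y u <-> tangent (pi y) u /\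
    exists e : 'rV[R]_k, \row_i u (piece_qz C i) = e *m B (iota y) *m col.
Proof.
move=> dy; have [Uy _] := dy.
have zE w : tangent y w -> \row_i tmap pi y w (piece_qz C i) = db (tmap iota y w) *m col.
  move=> tw; apply/rowP => i; rewrite mxE (piece_pi_z hs hc i Uy tw).
  apply: (piece_z_deriv hs i Uy).
  exact: (tangent_tmap hMc (smooth_map_at_val y) tw).
have sp := smooth_map_at_proj act (A := N) y.
split=> [[w [tw dw] <-]|[tu [e eE]]].
  split; first exact: (tangent_tmap cQ sp tw).
  by rewrite zE//; have [e ->] := frame_comb dy dw; exists e; rewrite frame_dbE.
have dv := frame_Delta e dy.
have [v' [dv' [w tw wE] v'E _]] := Delta_level_projection (C := C) Uy dv.
exists w; first by split=> //; rewrite wE.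
have Uq : piece_qdom C (pi y) by exists y.
apply: (chart_tan_inj chQ cQ Uq _ tu) => [|i]; first exact: (tangent_tmap cQ sp tw).
rewrite -/(piece_qz C i).
have := zE w tw; rewrite wE v'E -(mulmxA _ prw) piece_split mulmx1 frame_dbE -eE => /rowP/(_ i).
by rewrite !mxE.
Qed.

Lemma smooth_mx_comp (X Y : smoothSpaceType R) n p (f : X -> Y) z (A : Y -> 'M[R]_(n, p)) :
  smooth_map_at f z -> smooth_mx (f z) A -> smooth_mx z (fun t => A (f t)).
Proof. by move=> [_ H] sA i j; exact: H (sA i j). Qed.

Lemma lie_bracketE (Y Z : M -> tvec M) y f : smooth_at y f ->
  lie_bracket Y Z y f = Y y (fun z => Z z f) - Z y (fun z => Y z f).
Proof. by move=> sf; rewrite /lie_bracket /extend0 patchE mem_set. Qed.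

Section sections.
Variables (W : 'M[R]_(m, k)) (h h1 : nat) (H0 : 'M[R]_(h, k)) (H1 : 'M[R]_(h1, k)) (V : set M).
Hypotheses (oV : open V) (hk : (k <= h + h1)%N)
  (VP : forall y, V y -> [/\ dom y, dom (sg y), B y *m W \in unitmx, B (sg y) *m W \in unitmx &
     row_free (H0 *m (B (sg y) *m Q)) /\ row_free (H1 *m (B (sg y) *m (1%:M - Q)))]).

(** At points of N these are the rows H0 B Q, which come from vectors of Delta tangent to N. Off N
    the rows of B Q may leave the row space of B, and the factors with W push them back into it. *)
Let Dz z : 'M[R]_(h, m) := H0 *m (B z *m Q) *m W *m invmx (B z *m W) *m B z.
(** Coefficients for which db of the section at y is the value of Dz at the point of the transversal
    with the same b. Thus db of the section depends on b alone. *)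
Let Cc y : 'M[R]_(h, k) := Dz (sg y) *m W *m invmx (B y *m W).
Let Z (i : 'I_h) y : tvec M := \sum_l Cc y i l *: E l y.
Let Zh (i : 'I_h) p : tvec (orbit_space act N) :=
  \sum_j (Dz (iota (piece_sec C (piece_qphi C p))) *m col) i j *:
    chart_vec (piece_qphi C) (piece_qpsi C) p (delta_mx 0 j).

Let Dz_smooth z : dom z -> B z *m W \in unitmx -> smooth_mx z Dz.
Proof.
move=> dz uz; have sB := frame_smooth dz.
have sW : smooth_mx z (fun _ : M => W) by exact: smooth_mx_cst.
have [_ sV] := smooth_mxV hMc (smooth_mxM hMc sB sW) uz.
apply: (smooth_mxM hMc) => //; apply: (smooth_mxM hMc) => //; apply: (smooth_mxM hMc) => //.
apply: (smooth_mxM hMc); first exact: smooth_mx_cst.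
by apply: (smooth_mxM hMc) => //; exact: smooth_mx_cst.
Qed.

Let Cc_smooth y : V y -> smooth_mx y Cc.
Proof.
move=> /VP[dy ds uy us _]; have [Uy _] := dy.
have sB := frame_smooth dy; have sW : smooth_mx y (fun _ : M => W) by exact: smooth_mx_cst.
have [_ sV] := smooth_mxV hMc (smooth_mxM hMc sB sW) uy.
apply: (smooth_mxM hMc) => //; apply: (smooth_mxM hMc) => //.
by apply: (smooth_mx_comp (section_smooth Uy)); exact: Dz_smooth.
Qed.

Let dbZ i y : V y -> db (Z i y) = row i (Dz (sg y)).
Proof.
move=> Vy; have [dy ds uy us _] := VP Vy.
have -> : Z i y = \sum_l (row i (Cc y)) 0 l *: E l y by apply: eq_bigr => l _; rewrite [in RHS]mxE.
rewrite frame_dbE -row_mul /Cc right_inverse_solve//.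
exact: (submx_trans (submxMl _ _) (frame_section dy ds)).
Qed.

Let Zsec i : vf_section Delta V (Z i).
Proof.
split=> [|y Vy].
  apply: (smooth_vf_comb hMc) => // [y l Vy|l y Vy]; first exact: Cc_smooth.
  by have [[_ U0y] _ _ _ _] := VP Vy; exact: sE.
have [dy _ _ _ _] := VP Vy.
have -> : Z i y = \sum_l (row i (Cc y)) 0 l *: E l y by apply: eq_bigr => l _; rewrite [in RHS]mxE.
exact: frame_Delta.
Qed.

(** Since db Z is constant along the orbits, the bracket is vertical; invariance of Delta puts it in
    Delta as well, so it is 0. *)
Let Zbracket i xi y : lie_algebra G xi -> V y -> lie_bracket (generator act xi) (Z i) y = 0.
Proof.
move=> txi Vy; have [sL dL] := rs_LDelta hs txi oV (Zsec i); have [tL _] := sL y Vy.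
have [[Uy U0y] ds uy us _] := VP Vy.
have nV : \forall z \near y, V z by exact: open_nbhs_nbhs.
have tg := tangent_generator hM hG hact y txi.
have vg z : vertical act z (generator act xi z) by apply/(verticalP act); exists xi.
have tZ : tangent y (Z i y) by exact: Delta_tangent ((Zsec i).2 y Vy).
have vL : vertical act y (lie_bracket (generator act xi) (Z i) y).
  apply/(piece_vert _ Uy); split=> // j.
  rewrite lie_bracketE; last exact: (chart_coord ch).
  rewrite (tan_near hMc tg (g := (fun z => Dz z i j) \o (fun z => sg z))); last first.
    by apply: nearS nV => z Vz; have /rowP/(_ j) := dbZ i Vz; rewrite [LHS]mxE [RHS]mxE.
  have sD : smooth_at (sg y) (fun z => Dz z i j) := Dz_smooth ds us i j.
  rewrite -(tmapE (phi := fun z => sg z) (generator act xi y) sD).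
  rewrite (section_vertical Uy (vg y)) tvec0 sub0r.
  rewrite (tan_near hMc tZ (g := fun=> 0)) ?(tan_cst hMc _ tZ) ?oppr0//.
  by apply: nearS (chart_nearU ch Uy) => z Uz; have [_ ->] := (piece_vert _ Uz).1 (vg z).
have : (Delta y `&` vertical act y) (lie_bracket (generator act xi) (Z i) y) by split; [exact: dL|].
by rewrite (rs_DeltaV hs).
Qed.

Let level_section y : V (iota y) -> exists y0 : set_type N, [/\ sg (iota y) = iota y0,
  y0 = piece_sec C (piece_qphi C (pi y)), dom (iota y0) & piece_udom C y].
Proof.
move=> Vy; have [dy ds _ _ _] := VP Vy; have [Uy _] := dy.
exists (piece_sec C (piece_qphi C (pi y))); have E1 := section_level Uy.
by split=> //; rewrite -E1.
Qed.

Let DzQ y : V (iota y) -> Dz (sg (iota y)) = H0 *m (B (sg (iota y)) *m Q).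
Proof.
move=> Vy; have [dy ds uy us _] := VP Vy; have [y0 [yE _ dy0 _]] := level_section Vy.
rewrite /Dz right_inverse_solve//; apply: submx_trans (submxMl _ _) _.
by rewrite yE; exact: frame_projection.
Qed.

Let Dzprw y : V (iota y) -> Dz (sg (iota y)) *m col *m prw = Dz (sg (iota y)).
Proof. by move=> Vy; rewrite DzQ// -(mulmxA _ col prw) -[col *m prw]/Q -(mulmxA H0) -(mulmxA (B _) Q) QQ. Qed.

Let Zhz i y : V (iota y) ->
  \row_j Zh i (pi y) (piece_qz C j) = row i (Dz (sg (iota y))) *m col.
Proof.
move=> Vy; have [y0 [yE y0E dy0 Uy]] := level_section Vy.
have Uq : piece_qdom C (pi y) by exists y.
rewrite -row_mul yE y0E; apply/rowP => j; rewrite [LHS]mxE [RHS]mxE /Zh tvec_sum (bigD1 j)//= big1 ?addr0.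
  by rewrite (chart_vec_coord chQ)// [delta_mx _ _ _ _]mxE !eqxx mulr1.
by move=> l /negPf lj; rewrite (chart_vec_coord chQ)// [delta_mx _ _ _ _]mxE eq_sym lj andbF mulr0.
Qed.

Let Zh_tangent i y : V (iota y) -> tangent (pi y) (Zh i (pi y)).
Proof.
move=> Vy; have [_ [_ _ _ Uy]] := level_section Vy; have Uq : piece_qdom C (pi y) by exists y.
by apply: tangent_sum => j; exact: (chart_vec_tangent chQ cQ).
Qed.

Let Uh := pi @` [set y | V (iota y)].

Let oUh : open Uh.
Proof. by apply: (orbit_proj_open hs hc); apply/open_subspace; exists V. Qed.

Let Zh_smooth i : smooth_vf Uh (Zh i).
Proof.
apply: (smooth_vf_comb cQ) => // [_ j [y Vy <-]|j _ [y Vy <-]]; last first.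
  have [_ [_ _ _ Uy]] := level_section Vy.
  by apply: (smooth_vf_chart_vec cQ chQ); exists y.
have [y0 [yE y0E dy0 Uy]] := level_section Vy; have [_ _ _ us _] := VP Vy.
have Uq : piece_qdom C (pi y) by exists y.
have ss : smooth_map_at (fun p => iota (piece_sec C (piece_qphi C p))) (pi y).
  apply: (smooth_map_at_comp (phi := fun p => piece_sec C (piece_qphi C p)) (psi := iota)).
    apply: (smooth_map_at_comp (phi := piece_qphi C) (psi := piece_sec C)).
      exact: (chart_phi chQ).
    exact: (piece_sec_smooth hs hc (chartV chQ Uq)).
  exact: smooth_map_at_val.
have s1 : smooth_mx (pi y) (fun p => Dz (iota (piece_sec C (piece_qphi C p)))).
  by apply: (smooth_mx_comp ss); apply: Dz_smooth; rewrite -y0E// -yE.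
by apply: (smooth_mxM cQ s1 (smooth_mx_cst cQ _ col)).
Qed.

Let Zproj i : projects_to V (Z i) (Zh i).
Proof.
move=> y Vy; have [y0 [yE y0E dy0 Uy]] := level_section Vy.
have dZ := (Zsec i).2 _ Vy; have tZ := Delta_tangent dZ.
have [w tw wE] : exists2 w, tangent y w & tmap iota y w = Z i (iota y).
  by apply/(piece_tangentP hs hc Uy tZ); rewrite dbZ// -!row_mul Dzprw.
exists w; split=> //; have Uq : piece_qdom C (pi y) by exists y.
have sp := smooth_map_at_proj act (A := N) y.
apply: (chart_tan_inj chQ cQ Uq (tangent_tmap cQ sp tw) (Zh_tangent i Vy)) => j.
rewrite -/(piece_qz C j) (piece_pi_z hs hc j Uy tw) wE (piece_z_deriv hs j Uy tZ) dbZ//.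
by rewrite -Zhz// mxE.
Qed.

(** At points of N the ranks of B Q and B (1 - Q) add up to at most k <= h + h1. Near x they are at
    least h and h1, so B Q has rank exactly h and the h chosen rows span. *)
Let Zbasis y : V (iota y) -> is_basis (fun i => Zh i (pi y)) (level_distribution y).
Proof.
move=> Vy; have [dy ds uy us [f0 f1]] := VP Vy; have [y0 [yE y0E dy0 Uy]] := level_section Vy.
have Uq : piece_qdom C (pi y) by exists y.
have comb a : \row_j (\sum_i a i *: Zh i (pi y)) (piece_qz C j) =
    (\row_i a i) *m Dz (sg (iota y)) *m col.
  apply/rowP => j; rewrite mxE tvec_sum -mulmxA mxE; apply: eq_bigr => i _; rewrite mxE.
  by have /rowP/(_ j) := Zhz i Vy; rewrite -row_mul !mxE => ->.
have tcomb a : tangent (pi y) (\sum_i a i *: Zh i (pi y)) by apply: tangent_sum => i; exact: Zh_tangent.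
have fB := frame_free dy; have fBs := frame_free ds.
have leB : (B (iota y) <= B (sg (iota y)))%MS.
  have := mxrank_leqif_sup (frame_section dy ds).
  by rewrite (eqP fB) (eqP fBs) => -[_ <-].
have leQ : (B (sg (iota y)) *m Q <= H0 *m (B (sg (iota y)) *m Q))%MS.
  have := mxrank_leqif_sup (submxMl H0 (B (sg (iota y)) *m Q)); rewrite (eqP f0) => -[rk <-].
  rewrite eqn_leq rk /=.
  have pr : (B (sg (iota y)) *m Q <= B (sg (iota y)))%MS by rewrite yE; exact: frame_projection.
  have := rank_idempotent_split fBs QQ pr.
  have := mxrankS (submxMl H1 (B (sg (iota y)) *m (1%:M - Q))); rewrite (eqP f1) => l1 l2.
  rewrite -(leq_add2r (\rank (B (sg (iota y)) *m (1%:M - Q)))); apply: leq_trans l2 _.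
  by apply: leq_trans hk _; rewrite leq_add2l.
split=> [a a0 i|].
  have := comb a; rewrite a0 => /esym.
  have -> : \row_j (0 : tvec (orbit_space act N)) (piece_qz C j) = 0 by apply/rowP => j; rewrite !mxE.
  move=> /(congr1 (mulmx^~ prw)); rewrite /= mul0mx -(mulmxA _ col prw) -(mulmxA _ (Dz _)) (mulmxA (Dz _) col) Dzprw// DzQ//.
  by rewrite -[RHS](mul0mx _ (H0 *m (B (sg (iota y)) *m Q))) => /(row_free_inj f0)/rowP/(_ i); rewrite !mxE.
apply/seteqP; split=> [u /(level_distributionE _ dy)[tu [e eE]]|_ [a _ <-]].
  have /submxP[X XE] := leB; have /submxP[Y YE] := leQ.
  have cc : col *m prw *m col = col by rewrite -mulmxA piece_split mulmx1.
  have E1 : \row_i u (piece_qz C i) = e *m X *m Y *m Dz (sg (iota y)) *m col.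
    rewrite eE XE DzQ// -(mulmxA _ Y) -YE (mulmxA _ _ Q) -(mulmxA _ Q col).
    by rewrite [Q *m col]cc (mulmxA e).
  exists (fun i => (e *m X *m Y) 0 i) => //; apply: (chart_tan_inj chQ cQ Uq (tcomb _) tu) => j.
  rewrite -/(piece_qz C j).
  have := comb (fun i => (e *m X *m Y) 0 i).
  have -> : \row_i (e *m X *m Y) 0 i = e *m X *m Y by apply/rowP => i; rewrite mxE.
  by rewrite -E1 => /rowP/(_ j); rewrite !mxE.
apply/(level_distributionE _ dy); split; first exact: tcomb.
have /submxP[X XE] := frame_section dy ds.
rewrite comb {1}/Dz; exists ((\row_i a i) *m (H0 *m (B (sg (iota y)) *m Q) *m W *m invmx (B (sg (iota y)) *m W)) *m X).
by rewrite -(mulmxA _ X) -XE !mulmxA.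
Qed.

Lemma frame_sections : exists Z Zh, [/\ forall i : 'I_h, vf_section Delta V (Z i),
  forall i xi y, lie_algebra G xi -> V y -> lie_bracket (generator act xi) (Z i) y = 0,
  forall i, smooth_vf Uh (Zh i), forall i, projects_to V (Z i) (Zh i)
  & forall y, V (iota y) -> is_basis (fun i => Zh i (pi y)) (level_distribution y)].
Proof.
exists Z, Zh; split; [exact: Zsec|move=> i xi y; exact: Zbracket|exact: Zh_smooth|exact: Zproj|exact: Zbasis].
Qed.

End sections.

Lemma near_frame_sections : exists V h (Z : 'I_h -> M -> tvec M) (Zh : 'I_h -> orbit_space act N -> tvec (orbit_space act N)),
  [/\ open V /\ V (iota x), forall i, vf_section Delta V (Z i),
  forall i xi y, lie_algebra G xi -> V y -> lie_bracket (generator act xi) (Z i) y = 0,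
  forall i, smooth_vf (pi @` [set y | V (iota y)]) (Zh i) /\ projects_to V (Z i) (Zh i)
  & forall y, V (iota y) -> is_basis (fun i => Zh i (pi y)) (level_distribution y)].
Proof.
have dx : dom (iota x) by split=> //; exact: piece_dom.
have [Ux _] := dx; have ssx := section_smooth Ux; have sx := section_x.
have [W BW] := row_freeP (frame_free dx).
have [h [H0 [fH0 hH0]]] := row_free_selection (B (iota x) *m Q).
have [h1 [H1 [fH1 hH1]]] := row_free_selection (B (iota x) *m (1%:M - Q)).
have sB := frame_smooth dx.
have sc n p (A : 'M[R]_(n, p)) : smooth_mx (iota x) (fun _ : M => A) := smooth_mx_cst hMc _ A.
have sBW := smooth_mxM hMc sB (sc _ _ W).
have uBW : B (iota x) *m W \in unitmx by rewrite BW unitmx1.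
have [nu _] := smooth_mxV hMc sBW uBW.
have f0 := near_row_free hMc (smooth_mxM hMc (sc _ _ H0) (smooth_mxM hMc sB (sc _ _ Q))) fH0.
have f1 := near_row_free hMc (smooth_mxM hMc (sc _ _ H1) (smooth_mxM hMc sB (sc _ _ (1%:M - Q)))) fH1.
have nd : \forall y \near iota x, dom y by exact: open_nbhs_nbhs.
have ns (T : M -> Prop) : (\forall y \near iota x, T y) -> \forall y \near iota x, T (sg y).
  by move=> nT; apply: (near_comp ssx.1); rewrite sx.
have nV : nbhs (iota x) [set y | [/\ dom y, dom (sg y), B y *m W \in unitmx, B (sg y) *m W \in unitmx &
     row_free (H0 *m (B (sg y) *m Q)) /\ row_free (H1 *m (B (sg y) *m (1%:M - Q)))]].
  have n2 := ns _ nd; have n4 := ns _ nu; have n5 := ns _ f0; have n6 := ns _ f1.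
  by near=> y; split; [| | | |split]; near: y.
move: nV; rewrite nbhsE => -[V [oV Vx] Vsub].
have hk : (k <= h + h1)%N.
  have <- : \rank (B (iota x)) = k by apply/eqP; exact: frame_free.
  apply: (@leq_trans (\rank (B (iota x) *m Q) + \rank (B (iota x) *m (1%:M - Q)))%N).
    have {1}-> : B (iota x) = B (iota x) *m Q + B (iota x) *m (1%:M - Q).
      by rewrite -mulmxDr addrC subrK mulmx1.
    exact: mxrank_add.
  exact: leq_add.
have [Z [Zh [H2 H3 H4 H5 H6]]] := frame_sections oV hk Vsub.
by exists V, h, Z, Zh; split=> // i; split.
Unshelve. all: by end_near.
Qed.

End local_frame.

Lemma level_distribution_frame x : exists V h (Z : 'I_h -> M -> tvec M) (Zh : 'I_h -> orbit_space act N -> tvec (orbit_space act N)),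
  [/\ open V /\ V (iota x), forall i, vf_section Delta V (Z i),
  forall i xi y, lie_algebra G xi -> V y -> lie_bracket (generator act xi) (Z i) y = 0,
  forall i, smooth_vf (pi @` [set y | V (iota y)]) (Zh i) /\ projects_to V (Z i) (Zh i)
  & forall y, V (iota y) -> is_basis (fun i => Zh i (pi y)) (level_distribution y)].
Proof.
have [C] := piece_chart_at hs x; have [U0 [k [E [oU U0x sE bE]]]] := Delta_frame (iota x).
exact: (near_frame_sections C oU U0x sE bE).
Qed.

Let oUh V : open V -> open (pi @` [set y | V (iota y)]).
Proof. by move=> oV; apply: (orbit_proj_open hs hc); apply/open_subspace; exists V. Qed.

Lemma level_distribution_lin x k u v : level_distribution x u -> level_distribution x v ->
  level_distribution x (k *: u + v).
Proof.
move=> [w [tw dw] <-] [w' [tw' dw'] <-]; exists (k *: w + w'); last by rewrite tmap_lin.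
by split; [exact: tangent_lin | rewrite tmap_lin; exact: Delta_lin].
Qed.

Lemma reduced_distributionE x : @reduced_distribution R G M act N Delta (pi x) = level_distribution x.
Proof.
apply/seteqP; split=> [v [n [a [e [He ->]]]]|v Dv].
  have He' i : level_distribution x (e i).
    have [U [Z [Uh [Zh [[oU [_ dZ]] _ [_ UhE] [_ pZ] [Uq ->]]]]]] := He i.
    (* The domain of Z may meet the orbit of x only at another point x', from which the vector has
       to be carried over to x. *)
    move: Uq; rewrite UhE => -[x' Ux' xE]; have [w [tw wE pE]] := pZ x' Ux'.
    apply: (level_distribution_orbit xE); rewrite -xE -pE.
    by exists w => //; split=> //; rewrite wE; exact: dZ.
  apply: (big_ind (level_distribution x)) => [|u w Du Dw|i _].
  - by exists 0; [split; [exact: tangent0 | rewrite tmap0; exact: Delta0] | rewrite tmap0].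
  - by rewrite -[u]scale1r; exact: level_distribution_lin.
  - rewrite -[_ *: _]addr0; apply: level_distribution_lin => //.
    by exists 0; [split; [exact: tangent0 | rewrite tmap0; exact: Delta0] | rewrite tmap0].
have [V [h [Z [Zh [[oV Vx] sZ bZ sZh bas]]]]] := level_distribution_frame x.
have [_ DE] := bas x Vx; move: Dv; rewrite DE => -[a _ <-].
exists h, a, (fun i => Zh i (pi x)); split=> // i.
have [sh ph] := sZh i.
exists V, (Z i), (pi @` [set y | V (iota y)]), (Zh i); split=> //.
- by move=> xi txi y Vy; exact: bZ.
- by split; [exact: oUh|].
Qed.

Lemma reduced_distribution_subbundle :
  is_subbundle (@smooth_vf R (orbit_space act N)) (@reduced_distribution R G M act N Delta).
Proof.
move=> q; have [x <-] := orbit_proj_surj q.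
have [V [h [Z [Zh [[oV Vx] _ _ sZh bas]]]]] := level_distribution_frame x.
exists (pi @` [set y | V (iota y)]), h, Zh; split.
- by split; [exact: oUh | exists x].
- by move=> i; have [] := sZh i.
- by move=> _ [y Vy <-]; rewrite reduced_distributionE; exact: bas.
Qed.

End reduced_distributions.

(** * Dirac structures and their sections *)

Section dirac_structures.
Context {R : realType} {X : smoothSpaceType R} {JX : X -> covec X -> tvec X} {D : X -> set (tvec X)}.
Hypotheses (hXm : is_manifold X) (hJ : skew_bundle_map JX) (hD : is_subbundle (@smooth_vf R X) D).
Let hX : cinf_space X := manifold_cinf hXm.

Lemma skew_map0 x : JX x 0 = 0.
Proof.
have [_ lin _ _] := hJ; have c0 : cotangent x (0 : covec X) by split=> [k v w _ _|//]; rewrite mulr0 addr0.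
have := lin x 1 0 0 c0 c0; rewrite scaler0 addr0 scale1r => /eqP.
by rewrite -subr_eq0 opprD addrA subrr sub0r oppr_eq0 => /eqP.
Qed.

Lemma covec_sumE n (c : 'I_n -> R) (e : 'I_n -> covec X) v :
  (\sum_i c i *: e i) v = \sum_i c i * e i v.
Proof. by elim/big_ind2: _ => // a u b w <- <-. Qed.

Lemma cotangent_comb x n (c : 'I_n -> R) (e : 'I_n -> covec X) :
  (forall i, cotangent x (e i)) -> cotangent x (\sum_i c i *: e i).
Proof.
move=> ce; split=> [k v w tv tw|v nv].
  rewrite !covec_sumE mulr_sumr -big_split; apply: eq_bigr => i _ /=.
  by rewrite (cotangent_lin _ (ce i))// mulrDr mulrCA.
by rewrite covec_sumE big1// => i _; have [_ ->] := ce i; rewrite ?mulr0.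
Qed.

Lemma skew_map_sum x n (c : 'I_n -> R) (e : 'I_n -> covec X) :
  (forall i, cotangent x (e i)) -> JX x (\sum_i c i *: e i) = \sum_i c i *: JX x (e i).
Proof.
have [_ lin _ _] := hJ; elim: n c e => [|n IH] c e ce; first by rewrite !big_ord0 skew_map0.
rewrite !big_ord_recl lin//; first by rewrite IH.
exact: cotangent_comb.
Qed.

Section in_chart.
Variables (n : nat) (U : set X) (V : set 'rV[R]_n) (phi : X -> 'rV[R]_n) (psi : 'rV[R]_n -> X).
Hypothesis ch : is_chart U V phi psi.
Variables (U0 : set X) (k : nat) (E : 'I_k -> X -> tvec X).
Hypotheses (oU0 : open U0) (sE : forall l, smooth_vf U0 (E l))
  (bE : forall y, U0 y -> is_basis (fun l => E l y) (D y)).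
Let dom := U `&` U0.

Let crd (v : tvec X) : 'rV[R]_n := \row_j v (fun y => phi y 0 j).
Let B y : 'M[R]_(k, n) := \matrix_(l, j) E l y (fun y => phi y 0 j).
Let cov y (t : 'rV[R]_n) : covec X := \sum_j t 0 j *: differential (fun y => phi y 0 j) y.

Let cov_cotangent y t : cotangent y (cov y t).
Proof. by apply: cotangent_comb => j; exact: cotangent_differential. Qed.

Let covE y t v : tangent y v -> cov y t v = (crd v *m t^T) 0 0.
Proof.
move=> tv; rewrite /cov covec_sumE mxE; apply: eq_bigr => j _.
by rewrite differentialE// !mxE mulrC.
Qed.

Let cov_surj y a : U y -> cotangent y a -> exists t, a = cov y t.
Proof.
move=> Uy ca; exists (\row_j a (chart_vec phi psi y (delta_mx 0 j))).
apply: (chart_covec_eq ch hX Uy ca) => // i.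
rewrite covE; last exact: (chart_vec_tangent ch hX).
rewrite mxE (bigD1 i)//= big1 ?addr0 => [|j /negPf ji].
  by rewrite mxE (chart_vec_coord ch)// mxE !eqxx mul1r !mxE.
by rewrite mxE (chart_vec_coord ch)// mxE ji andbF mul0r.
Qed.

Let crd_inj y v w : U y -> tangent y v -> tangent y w -> crd v = crd w -> v = w.
Proof.
move=> Uy tv tw E1; apply: (chart_tan_inj ch hX Uy tv tw) => i.
by have /rowP/(_ i) := E1; rewrite !mxE.
Qed.

Let crd_comb y (u : 'I_k -> R) : crd (\sum_l u l *: E l y) = (\row_l u l) *m B y.
Proof. by apply/rowP => j; rewrite !mxE tvec_sum; apply: eq_bigr => l _; rewrite !mxE. Qed.

Let E_tangent y l : dom y -> tangent y (E l y).
Proof. by move=> [_ Uy]; have [] := sE l Uy. Qed.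

Let E_D y l : dom y -> D y (E l y).
Proof. by move=> [_ Uy]; exact: basis_mem (bE Uy). Qed.

Let B_free y : dom y -> row_free (B y).
Proof.
move=> dy; have [Uy U0y] := dy; rewrite -kermx_eq0; apply/eqP/row_matrixP => i; rewrite row0.
set u := row i _; have uB : u *m B y = 0 by rewrite -row_mul mulmx_ker row0.
have [fr _] := bE U0y; apply/rowP => l; rewrite [RHS]mxE; apply: (fr (fun l => u 0 l)).
apply: (crd_inj Uy _ (tangent0 _)); first by apply: tangent_sum => l'; exact: E_tangent.
have := crd_comb y (fun l => u 0 l).
have -> : \row_l u 0 l = u by apply/rowP => l'; rewrite mxE.
by rewrite uB => ->; apply/rowP => j; rewrite !mxE.
Qed.

Let annE y t : dom y -> annihilator D y (cov y t) <-> t *m (B y)^T = 0.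
Proof.
move=> dy; have [Uy U0y] := dy; split=> [[_ H]|tB].
  apply/rowP => l; have := H _ (E_D l dy); rewrite covE; last exact: E_tangent.
  by rewrite !mxE => E0; rewrite -[RHS]E0; apply: eq_bigr => j _; rewrite !mxE mulrC.
split=> // v Dv; have [_ DE] := bE U0y; move: Dv; rewrite DE => -[u _ <-].
rewrite covE; last by apply: tangent_sum => l; exact: E_tangent.
by rewrite crd_comb -mulmxA -[B y]trmxK -trmx_mul tB trmx0 mulmx0 mxE.
Qed.

Let biannihilator y w : dom y -> tangent y w -> (forall b, annihilator D y b -> b w = 0) -> D y w.
Proof.
move=> dy tw H; have [Uy U0y] := dy.
have /submxP[u uE] : (crd w <= B y)%MS.
  rewrite submxE; apply/eqP/rowP => i; rewrite [RHS]mxE.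
  have /H : annihilator D y (cov y (col i (cokermx (B y)))^T).
    apply/(annE _ dy); rewrite -trmx_mul; apply/eqP; rewrite trmx_eq0; apply/eqP.
    by rewrite colE mulmxA mulmx_coker mul0mx.
  by rewrite covE// trmxK colE mulmxA -colE mxE.
have [_ ->] := bE U0y; exists (fun l => u 0 l) => //.
apply: (crd_inj Uy _ tw); first by apply: tangent_sum => l; exact: E_tangent.
by rewrite crd_comb uE; congr (_ *m _); apply/rowP => l; rewrite mxE.
Qed.

(** Isotropy is the skewness of the bundle map. For maximality, orthogonality to the pairs (d, 0)
    puts the covector in the annihilator, and orthogonality to the pairs (J b, b) puts v - J a in
    the biannihilator of D, which is D. *)
Lemma dirac_of_orthogonal y p : dom y -> dirac_of JX D y p <->
  [/\ tangent y p.1, cotangent y p.2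
    & forall q, dirac_of JX D y q -> p.2 q.1 + q.2 p.1 = 0].
Proof.
have [tJ lin sk _] := hJ; move=> dy; split=> [[tv ca dv aa]|[tv ca H]].
  split=> // -[w b] [/= tw cb dw ab].
  have -> : w = JX y b + (w - JX y b) by rewrite addrC subrK.
  have -> : p.1 = JX y p.2 + (p.1 - JX y p.2) by rewrite addrC subrK.
  rewrite -[JX y b]scale1r -[JX y p.2]scale1r.
  rewrite (cotangent_lin _ ca (tJ _ _ cb)); last by rewrite scale1r; exact: tangentB (tJ _ _ cb).
  rewrite (cotangent_lin _ cb (tJ _ _ ca)); last by rewrite scale1r; exact: tangentB (tJ _ _ ca).
  have [_ /(_ _ dw) /= E1] := aa; have [_ /(_ _ dv) /= E2] := ab.
  by rewrite !scale1r E1 E2 !addr0 !mul1r (sk _ _ _ ca cb) addNr.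
have aa : annihilator D y p.2.
  split=> // d Dd; have td := subbundle_tangent hD Dd.
  have c0 : cotangent y (0 : covec X) by split=> [k' v w _ _|//]; rewrite mulr0 addr0.
  have := H (d, 0); rewrite /= addr0; by apply; split=> //=; rewrite skew_map0 subr0.
split=> //; apply: biannihilator => // [|b [cb ab]]; first exact: tangentB (tJ _ _ ca).
have -> : p.1 - JX y p.2 = (-1) *: JX y p.2 + p.1 by rewrite scaleN1r addrC.
rewrite (cotangent_lin _ cb (tJ _ _ ca) tv) mulN1r -sk//.
have := H (JX y b, b) => /=; apply; split=> //=; first exact: tJ.
by rewrite subrr; exact: subbundle0.
Qed.

Section coframe.
Variables (W : 'M[R]_(n, k)) (q : nat) (K0 : 'M[R]_(q, n)) (V0 : set X).
Hypotheses (oV0 : open V0) (dV0 : V0 `<=` dom) (uV0 : forall y, V0 y -> B y *m W \in unitmx)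
  (hq : (n <= k + q)%N).
(** The factor 1 - W (B W)^-1 B is killed by B from the left, so its transpose moves the constant
    covectors K0 into the annihilator at every y. *)
Let Th y : 'M[R]_(q, n) := K0 *m (1%:M - W *m invmx (B y *m W) *m B y)^T.
Hypothesis fTh : forall y, V0 y -> row_free (Th y).
Let th i y : covec X := cov y (row i (Th y)).

Let ThB y : V0 y -> Th y *m (B y)^T = 0.
Proof.
move=> Vy; rewrite /Th -mulmxA -trmx_mul mulmxBr mulmx1 !mulmxA mulmxV ?uV0// mul1mx subrr.
by rewrite trmx0 mulmx0.
Qed.

Let B_smooth y : dom y -> smooth_mx y B.
Proof.
move=> [Uy U0y] l j; apply: (sm_near hX (f := fun z => E l z (fun y => phi y 0 j))).
  by apply: nearT => z; rewrite mxE.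
by have [_ H] := sE l U0y; apply: H; exact: (chart_coord ch).
Qed.

Let Th_smooth y : V0 y -> smooth_mx y Th.
Proof.
move=> Vy; have sB := B_smooth (dV0 Vy).
have sW : smooth_mx y (fun _ : X => W) by exact: smooth_mx_cst.
have [_ sV] := smooth_mxV hX (smooth_mxM hX sB sW) (uV0 Vy).
apply: (smooth_mxM hX); first exact: smooth_mx_cst.
move=> i j.
have sP := smooth_mxM hX (smooth_mxM hX sW sV) sB.
apply: (sm_near hX (f := fun z => (1%:M : 'M[R]_n) j i - (W *m invmx (B z *m W) *m B z) j i)).
  by apply: nearT => z; rewrite !mxE.
by apply: (smB hX); [exact: (sm_cst hX) | exact: sP].
Qed.

Let th_smooth i : smooth_form V0 (th i).
Proof.
apply: (smooth_form_comb hX (al := fun j => differential (fun y => phi y 0 j))) => // [y j Vy|j].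
  apply: (sm_near hX (f := fun y => Th y i j)); last exact: Th_smooth.
  by apply: nearT => z; rewrite [RHS]mxE.
by apply: smooth_form_differential => // y /dV0[Uy _]; exact: (chart_coord ch).
Qed.

Let th_cotangent i y : cotangent y (th i y). Proof. exact: cov_cotangent. Qed.

Let th_comb y (a : 'I_q -> R) : \sum_i a i *: th i y = cov y ((\row_i a i) *m Th y).
Proof.
apply/funext => v; rewrite /th /cov !covec_sumE.
under eq_bigr do rewrite covec_sumE mulr_sumr.
rewrite exchange_big /=; apply: eq_bigr => j _.
rewrite [X in X * _]mxE mulr_suml; apply: eq_bigr => i _.
by rewrite mulrA; congr (_ * _ * _); [rewrite mxE | rewrite mxE].
Qed.

Let ann_basis y a : V0 y -> annihilator D y a -> exists t : 'I_q -> R, a = \sum_i t i *: th i y.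
Proof.
move=> Vy aa; have [ca _] := aa; have dy := dV0 Vy; have [Uy _] := dy.
have [t tE] := cov_surj Uy ca; move: aa; rewrite tE => /(annE _ dy) tB.
have /submxP[s sE'] : (t <= Th y)%MS.
  have tk : (t <= kermx (B y)^T)%MS by apply/sub_kermxP.
  apply: submx_trans tk _.
  have le : (Th y <= kermx (B y)^T)%MS by apply/sub_kermxP; exact: ThB.
  have [rk <-] := mxrank_leqif_sup le; rewrite eqn_leq rk (eqP (fTh Vy)) mxrank_ker mxrank_tr.
  by rewrite (eqP (B_free dy)) leq_subLR.
exists (fun i => s 0 i); rewrite th_comb sE'; congr cov; congr (_ *m _).
by apply/rowP => i; rewrite mxE.
Qed.

Let fr (i : 'I_(k + q)) y : tvec X * covec X :=
  split_fun (fun l => (E l y, 0)) (fun i => (JX y (th i y), th i y)) i.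

Let fr_sum y (a : 'I_(k + q) -> R) : \sum_i a i *: fr i y =
  (\sum_l a (lshift q l) *: E l y + JX y (\sum_i a (rshift k i) *: th i y),
   \sum_i a (rshift k i) *: th i y).
Proof.
have sumP I (r : seq I) (F : I -> tvec X * covec X) : \sum_(i <- r) F i = (\sum_(i <- r) (F i).1, \sum_(i <- r) (F i).2).
  elim: r => [|i r IH]; first by rewrite !big_nil.
  by rewrite !big_cons IH.
rewrite sumP; congr pair; rewrite big_split_ord /=.
  rewrite skew_map_sum; last by move=> i; exact: th_cotangent.
  by congr (_ + _); apply: eq_bigr => i _; rewrite /fr ?split_funl ?split_funr.
rewrite big1 ?add0r => [|l _]; last by rewrite /fr split_funl /= scaler0.
by apply: eq_bigr => i _; rewrite /fr split_funr.
Qed.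

Lemma dirac_of_frame : exists e : 'I_(k + q) -> X -> tvec X * covec X,
  (forall i, smooth_pair V0 (e i)) /\ forall y, V0 y -> is_basis (fun i => e i y) (dirac_of JX D y).
Proof.
have [tJ lin sk sm] := hJ.
exists fr; split=> [i|y Vy].
  case: (split_ordP i) => j ->; rewrite /smooth_pair.
    have -> : fr (lshift q j) = fun y => (E j y, 0) by apply/funext => y; rewrite /fr split_funl.
    split=> y Vy /=; first by have [_ U0y] := dV0 Vy; exact: sE.
    split; first by split=> [k' v w _ _|//]; rewrite mulr0 addr0.
    by move=> W' Z _ _; exact: (sm_cst hX).
  have -> : fr (rshift k j) = fun y => (JX y (th j y), th j y) by apply/funext => y; rewrite /fr split_funr.
  by split; [exact: sm oV0 (th_smooth j) | exact: th_smooth].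
have dy := dV0 Vy; have [Uy U0y] := dy; have [free span] := bE U0y.
split=> [a|].
  rewrite fr_sum => -[]; set t := \sum_i _ => Ev Et; move: Ev; rewrite Et skew_map0 addr0 => Ev.
  have al := free _ Ev.
  have ar i : a (rshift k i) = 0.
    have : (\row_i a (rshift k i)) *m Th y = 0.
      have cvE u : cov y u = 0 -> u = 0.
        move=> u0; apply/rowP => j; have := covE u (chart_vec_tangent ch hX (delta_mx 0 j) Uy).
        rewrite u0 => /esym; rewrite mxE (bigD1 j)//= big1 ?addr0 => [|l /negPf lj].
          by rewrite [crd _ _ _]mxE (chart_vec_coord ch)// mxE !eqxx mul1r !mxE.
        by rewrite [crd _ _ _]mxE (chart_vec_coord ch)// mxE lj andbF mul0r.
      by apply: cvE; rewrite -th_comb.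
    by rewrite -[RHS](mul0mx _ (Th y)) => /(row_free_inj (fTh Vy))/rowP/(_ i); rewrite !mxE.
  by move=> i; case: (split_ordP i) => j ->.
apply/seteqP; split=> [[v b] [/= tv cb dv ab]|_ [a _ <-]].
  have [s sE'] := ann_basis Vy ab; move: dv; rewrite span => -[u _ uE].
  exists (split_fun u s) => //; rewrite fr_sum.
  have -> : \sum_i split_fun u s (rshift k i) *: th i y = b.
    by rewrite sE'; apply: eq_bigr => i _; rewrite split_funr.
  congr pair; under eq_bigr do rewrite split_funl.
  by rewrite uE subrK.
rewrite fr_sum; set b := \sum_i a (rshift k i) *: _.
have cb : cotangent y b by apply: cotangent_comb.
have Dl : D y (\sum_l a (lshift q l) *: E l y) by rewrite span; exists (fun l => a (lshift q l)).
split=> //=.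
- by apply: tangentD; [exact: (subbundle_tangent hD Dl) | exact: tJ].
- by rewrite addrK.
- by rewrite /b th_comb; apply/(annE _ dy); rewrite -mulmxA ThB// mulmx0.
Qed.

End coframe.

Lemma dirac_of_near_frame x : U x -> U0 x -> exists V0 q (e : 'I_q -> X -> tvec X * covec X),
  [/\ open_nbhs x V0, forall i, smooth_pair V0 (e i) & forall y, V0 y -> is_basis (fun i => e i y) (dirac_of JX D y)].
Proof.
move=> Ux U0x; have dx : dom x by [].
have [W BW] := row_freeP (B_free dx).
pose K0 := row_base (kermx (B x)^T).
have K0B : K0 *m (B x)^T = 0 by apply/sub_kermxP; rewrite eq_row_base.
have hq : (n <= k + \rank (kermx (B x)^T))%N.
  by rewrite mxrank_ker mxrank_tr (eqP (B_free dx)) -leq_subLR.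
pose Th y : 'M[R]_(_, n) := K0 *m (1%:M - W *m invmx (B y *m W) *m B y)^T.
have sB : smooth_mx x B.
  move=> l j; apply: (sm_near hX (f := fun z => E l z (fun y => phi y 0 j))).
    by apply: nearT => z; rewrite mxE.
  by have [_ H] := sE l U0x; apply: H; exact: (chart_coord ch).
have sW : smooth_mx x (fun _ : X => W) by exact: smooth_mx_cst.
have uBW : B x *m W \in unitmx by rewrite BW unitmx1.
have [nu sV] := smooth_mxV hX (smooth_mxM hX sB sW) uBW.
have sTh : smooth_mx x Th.
  apply: (smooth_mxM hX); first exact: smooth_mx_cst.
  move=> i j; have sP := smooth_mxM hX (smooth_mxM hX sW sV) sB.
  apply: (sm_near hX (f := fun z => (1%:M : 'M[R]_n) j i - (W *m invmx (B z *m W) *m B z) j i)).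
    by apply: nearT => z; rewrite !mxE.
  by apply: (smB hX); [exact: (sm_cst hX) | exact: sP].
have fTh : row_free (Th x).
  rewrite /Th BW invmx1 mulmx1 linearB /= trmx1 mulmxBr mulmx1 trmx_mul mulmxA K0B mul0mx subr0.
  exact: row_base_free.
have nf := near_row_free hX sTh fTh.
have od : open dom by apply: openI => //; case: (chart_open ch).
have nd : \forall y \near x, dom y by exact: open_nbhs_nbhs.
have : nbhs x [set y | [/\ dom y, B y *m W \in unitmx & row_free (Th y)]].
  by near=> y; split; near: y.
rewrite nbhsE => -[V0 [oV Vx] Vsub].
have [|||e [se be]] := @dirac_of_frame W _ K0 V0 oV _ _ hq _.
- by move=> y /Vsub[].
- by move=> y /Vsub[].
- by move=> y /Vsub[].
by exists V0, (k + \rank (kermx (B x)^T))%N, e; split.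
Unshelve. all: by end_near.
Qed.

End in_chart.

Lemma is_dirac_of : is_dirac (dirac_of JX D).
Proof.
have [_ _ chX] := hXm; split=> [x|x p].
  have [n [U [V [phi [psi [ch Ux]]]]]] := chX x.
  have [U0 [k [E [oU0 U0x sE bE]]]] := subbundle_frame hD x.
  have [V0 [q [e [oV se be]]]] := dirac_of_near_frame ch oU0 sE bE Ux U0x.
  by exists V0, q, e.
have [n [U [V [phi [psi [ch Ux]]]]]] := chX x.
have [U0 [k [E [oU0 U0x sE bE]]]] := subbundle_frame hD x.
by apply: (dirac_of_orthogonal ch sE bE); split.
Qed.

End dirac_structures.

(** * Patching local sections of an affine bundle *)

Section patching.
Context {R : realType} {X : smoothSpaceType R}.
Hypothesis hXm : is_manifold X.
Let hX : cinf_space X := manifold_cinf hXm.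

(** The support lies in a compact subset of V. The last alternative is what allows the bump to
    multiply sections that are defined on V only. *)
Lemma manifold_bump x (V : set X) : nbhs x V -> exists (phi : X -> R) O, [/\ smooth_fun phi, open_nbhs x O,
  O `<=` V, forall y, O y -> phi y = 1 & forall y, V y \/ \forall z \near y, phi z = 0].
Proof.
move=> nV; have [hh _ chX] := hXm; have [n [U [V0 [phi [psi [ch Ux]]]]]] := chX x.
have [r [[chr subr] r0]] := filter_ex (filterI (chart_ball ch Ux nV) (nbhs_right_gt 0)).
set a := phi x in chr subr; pose e := r / 2; have e0 : 0 < e by rewrite divr_gt0.
have Ba u : `|u - a| <= e -> ball a r u.
  by move=> ue; rewrite -ball_normE /ball_ /= distrC (le_lt_trans ue)// ltr_pdivrMr// ltr_pMr// ltr1n.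
have [beta [sbeta beta1 beta0]] := euclidean_bump a e0.
pose K := psi @` [set u | `|u - a| <= e].
have cK : closed K.
  by apply: compact_closed => //; exact: (chart_compact_ball chr).
have KU y : K y -> U y /\ V y.
  move=> [u /= /Ba ur <-]; have Ur := chartU chr ur.
  by split; [case: Ur | exact: subr].
pose f y := if pselect (U y) then beta (phi y) else 0.
have fU y : U y -> f y = beta (phi y) by rewrite /f; case: pselect.
have fK y : ~ K y -> f y = 0.
  rewrite /f; case: pselect => // Uy nK; apply: beta0; rewrite leNgt; apply/negP => lt.
  by apply: nK; exists (phi y); [exact: ltW | exact: (chartK ch Uy)].
have nK y : ~ K y -> \forall z \near y, f z = 0.
  move=> nKy; apply: nearS (open_nbhs_nbhs (conj (closed_openC cK) nKy)) => z; exact: fK.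
have n1 : nbhs x [set y | f y = 1 /\ V y].
  have [cphi _] := chart_phi ch Ux.
  have n2 := near_comp cphi (P := fun u => beta u = 1) beta1.
  by apply: filterS3 (chart_nearU ch Ux) n2 nV => y Uy b1 Vy; rewrite /= fU.
move: n1; rewrite nbhsE => -[T [oT Tx] Tsub]; exists f, T; split=> // [y|y /Tsub[]//|y /Tsub[]//|y].
- have [Ky|nKy] := pselect (K y); last first.
    by apply: (sm_near hX (f := fun=> 0)); [apply: nearS (nK _ nKy) => z -> | exact: (sm_cst hX)].
  have [Uy _] := KU y Ky; apply: (sm_near hX (f := beta \o phi)).
    by apply: nearS (chart_nearU ch Uy) => z Uz; rewrite fU.
  exact: (smooth_pullback ch).
- by have [/KU[_ Vy]|nKy] := pselect (K y); [left | right; exact: nK].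
Qed.

Lemma smooth_vf_affine y (phi : X -> R) (Z Z' : X -> tvec X) : smooth_at y phi ->
  smooth_vf [set y] Z -> smooth_vf [set y] Z' ->
  smooth_vf [set y] (fun z => phi z *: Z z + (1 - phi z) *: Z' z).
Proof.
move=> sp sZ sZ' _ ->; have [t s] := sZ y erefl; have [t' s'] := sZ' y erefl.
split=> [|f sf]; first by apply: tangentD; exact: tangentZ.
apply: (smD hX); apply: (smM hX) => //; [exact: s | by apply: (smB hX) => //; exact: (sm_cst hX) | exact: s'].
Qed.

Lemma cotangent_affine y (k k' : R) (a a' : covec X) : cotangent y a -> cotangent y a' ->
  cotangent y (k *: a + k' *: a').
Proof.
move=> [la za] [la' za']; split=> [c v w tv tw|v nv]; rewrite !fctE.
  by rewrite la// la'// /GRing.scale /=; ring.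
by rewrite za// za'// /GRing.scale /= !mulr0 addr0.
Qed.

Lemma smooth_form_affine y (phi : X -> R) (al al' : X -> covec X) : smooth_at y phi ->
  smooth_form [set y] al -> smooth_form [set y] al' ->
  smooth_form [set y] (fun z => phi z *: al z + (1 - phi z) *: al' z).
Proof.
move=> sp sa sa' _ ->; have [t s] := sa y erefl; have [t' s'] := sa' y erefl.
split=> [|W Z nW sZ]; first exact: cotangent_affine.
apply: (smD hX (f := fun z => phi z * al z (Z z)) (g := fun z => (1 - phi z) * al' z (Z z))); apply: (smM hX) => //.
- exact: (s W).
- by apply: (smB hX) => //; exact: (sm_cst hX).
- exact: (s' W).
Qed.

Lemma smooth_pair_near y (s s' : X -> tvec X * covec X) : (\forall z \near y, s z = s' z) ->
  smooth_pair [set y] s -> smooth_pair [set y] s'.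
Proof.
move=> E [sZ sa]; have E0 := nbhs_singleton E; split=> _ ->.
  have [t st] := sZ y erefl; split=> [|f sf]; first by rewrite -E0.
  by apply: (sm_near hX _ (st f sf)); apply: nearS E => z ->.
have [t st] := sa y erefl; split=> [|W Z nW sW]; first by rewrite -E0.
by apply: (sm_near hX _ (st W Z nW sW)); apply: nearS E => z ->.
Qed.

Variables (A : X -> set (tvec X * covec X)) (S : set X).
Hypothesis Aaff : forall y (k : R) p p', A y p -> A y p' -> A y (k *: p + (1 - k) *: p').
Hypothesis Aloc : forall x, S x -> exists V s, [/\ open_nbhs x V, smooth_pair V s & forall y, V y -> A y (s y)].

Record patch_datum := PatchDatum {
  pt_V : set X; pt_O : set X; pt_phi : X -> R; pt_s : X -> tvec X * covec X;
  pt_open : open pt_O; pt_sub : pt_O `<=` pt_V;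
  pt_smooth : smooth_fun pt_phi;
  pt_one : forall y, pt_O y -> pt_phi y = 1;
  pt_zero : forall y, pt_V y \/ \forall z \near y, pt_phi z = 0;
  pt_pair : smooth_pair pt_V pt_s;
  pt_A : forall y, pt_V y -> A y (pt_s y) }.

(** A filler for the indices to which no local section belongs. *)
Let null_datum : patch_datum.
Proof.
apply: (@PatchDatum set0 set0 (fun=> 0) (fun=> 0)) => //.
- exact: open0.
- by move=> y; exact: (sm_cst hX).
- by move=> y; right; exact: nearT.
Qed.

(** The injection f numbers a countable base. For each basic set that fits into some patch one such
    patch is chosen, and these patches cover S. *)
Lemma countable_patch_data : exists d : nat -> patch_datum, forall x, S x -> exists n, pt_O (d n) x.
Proof.
have [_ [B /countable_injP[f finj] [oB bB]] _] := hXm.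
pose good n (d : patch_datum) := forall b d', B b -> f b = n -> b `<=` pt_O d' -> b `<=` pt_O d.
have /choice[d dP] : forall n, exists d, good n d.
  move=> n; have [[b [Bb fb [d bd]]]|H] := pselect (exists b, [/\ B b, f b = n & exists d, b `<=` pt_O d]).
    by exists d => b' d' Bb' fb' _; rewrite (finj b' b) ?inE// fb' fb.
  by exists null_datum => b d' Bb fb bd; case: H; exists b; split=> //; exists d'.
exists d => x Sx; have [V [s [[oV Vx] sV AV]]] := Aloc Sx.
have [phi [T [sphi nT TV T1 V0]]] := manifold_bump (open_nbhs_nbhs (conj oV Vx)).
have oT := nT.1; have Tx := nT.2; pose d0 := PatchDatum oT TV sphi T1 V0 sV AV.
have [b [Bb bx] bT] := bB x _ (open_nbhs_nbhs (conj oT Tx)).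
exists (f b); apply: (dP _ b d0) => //.
Qed.

(* The sections s_n are glued into s = phi_0 s_0 + (1 - phi_0) (phi_1 s_1 + (1 - phi_1) (..)), which
   stops at the first index where phi_n = 1. *)
Lemma patch_sections : exists U s, [/\ open U, S `<=` U, smooth_pair U s & forall y, U y -> A y (s y)].
Proof.
have [d dS] := countable_patch_data.
pose phi n := pt_phi (d n).
pose T := fix T k i (y : X) : tvec X * covec X :=
  if k is k'.+1 then phi i y *: pt_s (d i) y + (1 - phi i y) *: T k' i.+1 y else pt_s (d i) y.
have TP k i y : pt_O (d (i + k)%N) y -> smooth_pair [set y] (T k i) /\ A y (T k i y).
  elim: k i => [|k IH] i.
    rewrite addn0 => /pt_sub Vy; split; last exact: pt_A.
    by have [s1 s2] := pt_pair (d i); split=> _ ->; [exact: s1 | exact: s2].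
  rewrite addnS -addSn => /IH[[sZ sa] AT].
  have [Vy|z0] := pt_zero (d i) y.
    split; last by apply: Aaff => //; exact: pt_A.
    have [s1 s2] := pt_pair (d i).
    split; [apply: (smooth_vf_affine (pt_smooth (d i) y) _ sZ) => _ -> | apply: (smooth_form_affine (pt_smooth (d i) y) _ sa) => _ ->].
      exact: s1.
    exact: s2.
  have E : \forall z \near y, T k i.+1 z = T k.+1 i z.
    by apply: nearS z0 => z z0 /=; rewrite /phi z0 scale0r add0r subr0 scale1r.
  split; first exact: (smooth_pair_near E).
  by rewrite -(nbhs_singleton E).
have Tstop k l i y : phi (i + k)%N y = 1 -> T (k + l)%N i y = T k i y.
  elim: k i => [|k IH] i.
    by rewrite addn0 add0n => E; case: l => // l /=; rewrite E subrr scale0r addr0 scale1r.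
  by rewrite addnS -addSn => /IH /= ->.
pose U := \bigcup_n pt_O (d n).
(* Any index n with y in the n-th open set would do: all of them give the same value, so m need not
   be locally constant. *)
pose m y := xget 0%N [set n | pt_O (d n) y].
have mP n y : pt_O (d n) y -> pt_O (d (m y)) y.
  by move=> Oy; apply: (@xgetPex _ 0%N [set n | pt_O (d n) y]); exists n.
have sE n y : pt_O (d n) y -> T (m y) 0%N y = T n 0%N y.
  move=> Oy; have Omy := mP _ _ Oy.
  have [le|/ltnW le] := leqP n (m y).
    by rewrite -(subnKC le) Tstop// add0n; exact: pt_one.
  by rewrite -[in RHS](subnKC le) Tstop// add0n; exact: pt_one.
exists U, (fun y => T (m y) 0%N y); split.
- by apply: bigcup_open => n _; exact: pt_open.
- by move=> x /dS[n On]; exists n.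
- have H y : U y -> smooth_pair [set y] (fun y => T (m y) 0%N y).
    move=> [n _ On]; have [sT _] : smooth_pair [set y] (T n 0%N) /\ A y (T n 0%N y) by exact: TP.
    apply: smooth_pair_near sT.
    by apply: nearS (open_nbhs_nbhs (conj (@pt_open (d n)) On)) => z /sE.
  by split=> y /H[s1 s2]; [exact: s1 | exact: s2].
- by move=> y [n _ On]; rewrite (sE n)//; have [] := TP n 0%N y On.
Qed.

End patching.

Section frame_coefficients.
Context {R : realType} {X : smoothSpaceType R}.
Hypothesis hX : cinf_space X.
Variables (n : nat) (U : set X) (V : set 'rV[R]_n) (phi : X -> 'rV[R]_n) (psi : 'rV[R]_n -> X).
Hypothesis ch : is_chart U V phi psi.
Variables (W : set X) (h : nat) (e : 'I_h -> X -> tvec X) (D : X -> set (tvec X)) (v : X -> tvec X).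
Hypotheses (oW : open W) (se : forall i, smooth_vf W (e i))
  (be : forall y, W y -> is_basis (fun i => e i y) (D y))
  (sv : smooth_vf W v) (Dv : forall y, W y -> D y (v y)).

Lemma frame_coefficients x : U x -> W x -> exists co : X -> 'I_h -> R,
  \forall y \near x, (forall i, smooth_at y (co^~ i)) /\ v y = \sum_i co y i *: e i y.
Proof.
move=> Ux Wx.
pose crd (w : tvec X) : 'rV[R]_n := \row_j w (fun y => phi y 0 j).
pose B y : 'M[R]_(h, n) := \matrix_(l, j) e l y (fun y => phi y 0 j).
have crd_comb y (u : 'rV[R]_h) : crd (\sum_l u 0 l *: e l y) = u *m B y.
  by apply/rowP => j; rewrite !mxE tvec_sum; apply: eq_bigr => l _; rewrite !mxE.
have et y l : W y -> tangent y (e l y) by move=> Wy; have [] := se l Wy.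
have sB y : U y -> W y -> smooth_mx y B.
  move=> Uy Wy l j; apply: (sm_near hX (f := fun z => e l z (fun y => phi y 0 j))).
    by apply: nearT => z; rewrite mxE.
  by have [_ H] := se l Wy; apply: H; exact: (chart_coord ch).
have fB : row_free (B x).
  rewrite -kermx_eq0; apply/eqP/row_matrixP => i; rewrite row0.
  set u := row i _; have uB : u *m B x = 0 by rewrite -row_mul mulmx_ker row0.
  have [fr _] := be Wx; apply/rowP => l; rewrite [RHS]mxE; apply: (fr (fun l => u 0 l)).
  apply: (chart_tan_inj ch hX Ux _ (tangent0 _)); first by apply: tangent_sum => l'; exact: et.
  move=> j; have /rowP/(_ j) := crd_comb x u; rewrite uB !mxE => ->.
  by [].
have [Q BQ] := row_freeP fB.
have sc (y : X) : smooth_mx y (fun _ : X => Q) := smooth_mx_cst hX _ Q.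
have uBQ : B x *m Q \in unitmx by rewrite BQ unitmx1.
have [nu _] := smooth_mxV hX (smooth_mxM hX (sB x Ux Wx) (sc x)) uBQ.
pose co y := crd (v y) *m Q *m invmx (B y *m Q).
exists (fun y i => co y 0 i).
have nW : \forall y \near x, W y by exact: open_nbhs_nbhs.
apply: filterS3 (chart_nearU ch Ux) nW nu => y Uy Wy uy.
split=> [i|].
  have [_ sV] := smooth_mxV hX (smooth_mxM hX (sB y Uy Wy) (sc y)) uy.
  have scr : smooth_mx y (fun y => crd (v y)).
    move=> k j; apply: (sm_near hX (f := fun z => v z (fun y => phi y 0 j))).
      by apply: nearT => z; rewrite mxE.
    by have [_ H] := sv Wy; apply: H; exact: (chart_coord ch).
  exact: (smooth_mxM hX (smooth_mxM hX scr (sc y)) sV).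
have [_ DE] := be Wy; have := Dv Wy; rewrite DE => -[u _ uE].
have -> : co y = \row_i u i.
  rewrite /co -uE; have := crd_comb y (\row_i u i).
  under [X in crd X]eq_bigr do rewrite mxE.
  by move=> ->; rewrite -(mulmxA _ (B y) Q) mulmxK.
by rewrite -uE; apply: eq_bigr => i _; rewrite mxE.
Qed.

End frame_coefficients.

(** * Reduction of the Dirac structure to a piece *)

Section dirac_reduction.
Context {R : realType} {M : smoothSpaceType R} {G : smoothGroupType R}.
Context {br : (M -> R) -> (M -> R) -> (M -> R)} {J : M -> covec M -> tvec M}
  {om : M -> tvec M -> tvec M -> R} {Delta : M -> set (tvec M)}
  {act : G -> M -> M} {P : M -> covec G}.
Hypothesis hs : reduction_setting br J om Delta act P.
Variable c : set (set G).
Hypothesis hc : compact_classes G c.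
Let hM := rs_M hs.
Let hact := rs_act hs.
Let hMc : cinf_space M := manifold_cinf hM.
Let hJ : skew_bundle_map J. Proof. by case: (rs_J hs). Qed.
Notation N := (level_piece act P c).
Notation iota := (@set_val M N).
Notation pi := (orbit_proj act N).
Let cN : cinf_space (set_type N) := cinf_subspace N hMc.
Let cQ : cinf_space (orbit_space act N) := cinf_orbit_space act N hMc.

Lemma basic_annihilator (x : set_type N) al : basic_covector x al ->
  (forall w, tangent x w -> Delta (iota x) (tmap iota x w) -> al (tmap iota x w) = 0) ->
  annihilator Delta (iota x) al.
Proof.
move=> bal H; split=> [|v dv]; first by case: bal.
have [C] := piece_chart_at hs x.
have [v' [dv' [w tw wE] _ alE]] := Delta_level_projection hs hc (piece_udomx C) dv.
by rewrite -alE// -wE; apply: H => //; rewrite wE.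
Qed.

Lemma basic_covector_comb (x : set_type N) n (k : 'I_n -> R) al :
  (forall i, basic_covector x (al i)) -> basic_covector x (\sum_i k i *: al i).
Proof.
move=> bal; split=> [|g v Kg tv|v vv].
- by apply: cotangent_comb => i; have [] := bal i.
- by rewrite !covec_sumE; apply: eq_bigr => i _; have [_ H _] := bal i; congr (_ * _); exact: H.
- by rewrite covec_sumE big1// => i _; have [_ _ ->] := bal i; rewrite ?mulr0.
Qed.

Section level_lift.
Variables (x : set_type N) (C : piece_chart act P (iota x)).
Let ch := piece_is_chart C.
Let chQ := piece_qchart hs hc C.
Notation cvec := (chart_vec (piece_qphi C) (piece_qpsi C)).

Lemma piece_z_basic (y : set_type N) i : piece_udom C y ->
  basic_covector y (differential (fun y => piece_z C y 0 i) (iota y)).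
Proof.
move=> Uy; have [Py _] := set_valP y; have [S] := rs_slice hs Py.
have [||f fi fz] := invariant_extension hs Py S (u := fun y => piece_z C y 0 i) (chart_nearU ch Uy).
- by move=> z Uz; exact: (piece_z_smooth hs).
- by move=> z g Uz Ug; rewrite (piece_z_orbit Uz Ug).
exact: (basic_differential hs fz fi).
Qed.

(** An extension of the projection to a neighbourhood of x in M, available because z is defined off
    N. *)
Definition piece_base (y : M) : orbit_space act N := piece_qpsi C (piece_z C y).

Lemma piece_base_val y : piece_udom C y -> piece_base (iota y) = pi y.
Proof. exact: (piece_sec_z hs hc). Qed.

Lemma piece_base_smooth y : pdom C y -> piece_zdom C (piece_z C y) ->
  smooth_map_at piece_base y /\ piece_qdom C (piece_base y).
Proof.
move=> Uy zy; split; last exact: (chartU chQ zy).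
apply: (smooth_map_at_comp (psi := piece_qpsi C)); last exact: (chart_psi chQ).
by apply/rV_smooth_map => // i; exact: (piece_z_smooth hs).
Qed.

Lemma near_piece_base Uh : open Uh -> Uh (pi x) -> \forall y \near iota x,
  [/\ pdom C y, smooth_map_at piece_base y, piece_qdom C (piece_base y) & Uh (piece_base y)].
Proof.
move=> oU Ux; have Ux0 := piece_udomx C; have zx := piece_zdomE hs hc Ux0.
have [[cb _] _] := piece_base_smooth Ux0 zx.
have cz : {for iota x, continuous (piece_z C)}.
  have [] : smooth_map_at (piece_z C) (iota x) by apply/rV_smooth_map => // i; exact: (piece_z_smooth hs).
  by [].
have n1 : \forall y \near iota x, piece_zdom C (piece_z C y).
  by apply: (near_comp cz); apply: open_nbhs_nbhs; split=> //; case: (chart_open chQ).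
have n2 : \forall y \near iota x, Uh (piece_base y).
  by apply: (near_comp cb); rewrite piece_base_val//; exact: open_nbhs_nbhs.
apply: filterS3 (chart_nearU ch Ux0) n1 n2 => y Uy zy Uhy.
by have [] := piece_base_smooth Uy zy.
Qed.

(** The components of ah are read at [piece_base] and used with the differentials of z. At points of
    N the result is basic and has the same pullback as ah. *)
Definition level_lift (ah : orbit_space act N -> covec (orbit_space act N)) (y : M) : covec M :=
  \sum_i ah (piece_base y) (cvec (piece_base y) (delta_mx 0 i)) *: differential (fun y => piece_z C y 0 i) y.

Lemma level_lift_basic ah y : piece_udom C y -> basic_covector y (level_lift ah (iota y)).
Proof. by move=> Uy; apply: basic_covector_comb => i; exact: piece_z_basic. Qed.

Lemma level_lift_pullback ah y w : piece_udom C y -> cotangent (pi y) (ah (pi y)) -> tangent y w ->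
  level_lift ah (iota y) (tmap iota y w) = ah (pi y) (tmap pi y w).
Proof.
move=> Uy ca tw; rewrite /level_lift piece_base_val// covec_sumE.
have Uq : piece_qdom C (pi y) by exists y.
have tp := tangent_tmap cQ (smooth_map_at_proj act y) tw.
have ti := tangent_tmap hMc (smooth_map_at_val y) tw.
rewrite (chart_covec chQ cQ Uq ca tp); apply: eq_bigr => i _.
by rewrite differentialE// -/(piece_qz C i) (piece_pi_z hs hc i Uy tw) mulrC.
Qed.

Lemma level_lift_smooth ah Uh V : smooth_form Uh ah -> open V ->
  (forall y, V y -> [/\ pdom C y, smooth_map_at piece_base y, piece_qdom C (piece_base y) & Uh (piece_base y)]) ->
  smooth_form V (level_lift ah).
Proof.
move=> sa oV H; apply: (smooth_form_comb hMc (co := fun y i => _)) => // [y i Vy|i].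
  have [_ [_ sb] Uq Uhy] := H y Vy.
  exact: (sb _ (smooth_form_coord cQ chQ (delta_mx 0 i) Uq Uhy sa)).
by apply: smooth_form_differential => // y /H[Uy _ _ _]; exact: (piece_z_smooth hs).
Qed.

End level_lift.

Lemma basic_lift (x : set_type N) b : cotangent (pi x) b -> exists2 al, basic_covector x al &
  forall w, tangent x w -> al (tmap iota x w) = b (tmap pi x w).
Proof.
move=> cb; have [C] := piece_chart_at hs x; exists (level_lift C (fun=> b) (iota x)).
  by apply: level_lift_basic; exact: piece_udomx.
by move=> w tw; apply: level_lift_pullback => //; exact: piece_udomx.
Qed.

Variable JK : orbit_space act N -> covec (orbit_space act N) -> tvec (orbit_space act N).
Hypotheses (hJK : skew_bundle_map JK) (JKspec : @reduced_map_spec R M G J act P c JK).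
Notation Dh := (@reduced_distribution R G M act N Delta).

Let JKsk q : pointwise_skew q (JK q).
Proof. by have [t l s _] := hJK; split; [exact: t | exact: l | exact: s]. Qed.

Let JK_basic x al w a := @reduced_map_basic _ _ _ _ _ _ _ _ _ hs _ hc _ JKspec JKsk x al w a.

Lemma reduced_is_dirac : is_dirac (dirac_of JK Dh).
Proof.
exact: (is_dirac_of (orbit_space_manifold hs hc) hJK (reduced_distribution_subbundle hs hc)).
Qed.

Lemma annihilator_lift x al b : basic_covector x al -> annihilator Dh (pi x) b ->
  (forall w, tangent x w -> al (tmap iota x w) = b (tmap pi x w)) -> annihilator Delta (iota x) al.
Proof.
move=> bal [_ ab] alE; apply: (basic_annihilator bal) => w tw dw.
by rewrite alE//; apply: ab; rewrite (reduced_distributionE hs hc); exists w.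
Qed.

(* A pair of the restriction of D is orthogonal to lifts of the pairs of the reduced structure,
   hence projects into it, by maximality of the latter. *)
Lemma reduced_section_pair Uh Zh ah : smooth_vf Uh Zh -> smooth_form Uh ah ->
  reduced_section (dirac_of J Delta) Uh Zh ah -> pair_section (dirac_of JK Dh) Uh Zh ah.
Proof.
move=> sZ sa [U [Z [al [[oU UE] [_ DZ] pZ alE]]]]; split; first by split.
have [_ dmax] := reduced_is_dirac; have [_ Dorth] := is_dirac_of hM hJ (rs_Delta hs).
move=> q Uq; have [x xq] := orbit_proj_surj q; move: Uq; rewrite -xq => Uq.
have Ux := (UE x).2 Uq.
have [tZ _] := sZ _ Uq; have [ca _] := sa _ Uq.
apply/dmax; split=> // -[v b] [/= tv cb dv ab].
have [be bbe beE] := basic_lift cb; have abe := annihilator_lift bbe ab beE.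
have [wJ twJ wJE] := J_tangent_level hs hc bbe.
have JKE := JK_basic bbe twJ wJE cb beE.
move: dv; rewrite (reduced_distributionE hs hc) => -[w0 [tw0 dw0] w0E].
have tw : tangent x (w0 + wJ) by exact: tangentD.
have piE : tmap pi x (w0 + wJ) = v by rewrite tmapD w0E JKE subrK.
have [_ _ orth] := (Dorth (iota x) _).1 (DZ _ Ux).
have /orth /= : dirac_of J Delta (iota x) (tmap iota x (w0 + wJ), be).
  split=> //=; first exact: (tangent_tmap hMc (smooth_map_at_val x) tw).
    by case: bbe.
  by rewrite tmapD wJE addrK.
have [w [tw' wE pE]] := pZ x Ux.
rewrite -wE beE// pE.
have := congr1 (fun f => f (w0 + wJ)) (alE x Ux); rewrite !cotmapE// piE => ->.
by [].
Qed.

Section lifting.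
Variables (Uh : set (orbit_space act N)) (Zh : orbit_space act N -> tvec (orbit_space act N))
  (ah : orbit_space act N -> covec (orbit_space act N)).
Hypotheses (oU : open Uh) (sZ : smooth_vf Uh Zh) (sa : smooth_form Uh ah)
  (DZ : forall q, Uh q -> dirac_of JK Dh q (Zh q, ah q)).

(** Off N only membership in the Dirac structure is asked. On N the clause on Uh makes the domain of
    a patched section meet N exactly in the preimage of Uh. *)
Definition lifted_pair (y : M) : set (tvec M * covec M) := [set p | dirac_of J Delta y p /\
  forall x : set_type N, iota x = y ->
  [/\ Uh (pi x), exists w, [/\ tangent x w, tmap iota x w = p.1 & tmap pi x w = Zh (pi x)]
    & forall w, tangent x w -> p.2 (tmap iota x w) = ah (pi x) (tmap pi x w)]].

Lemma lifted_pair_affine y (k : R) p p' : lifted_pair y p -> lifted_pair y p' ->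
  lifted_pair y (k *: p + (1 - k) *: p').
Proof.
move=> [[t1 c1 d1 [_ a1]] H1] [[t2 c2 d2 [_ a2]] H2].
have Ev (T : lmodType R) (v : T) : k *: v + (1 - k) *: v = v by rewrite -scalerDl addrC subrK scale1r.
split; first split => /=.
- by apply: tangentD; exact: tangentZ.
- exact: cotangent_affine.
- have [_ lin _ _] := hJ.
  have c0 : cotangent y (0 : covec M) by split=> [r v w _ _|//]; rewrite mulr0 addr0.
  have JZ r a : cotangent y a -> J y (r *: a) = r *: J y a.
    by move=> ca; rewrite -[r *: a]addr0 lin// (skew_map0 hJ) addr0.
  have c2' : cotangent y ((1 - k) *: p'.2).
    by have := cotangent_affine 0 (1 - k) c0 c2; rewrite scale0r add0r.
  rewrite lin// JZ// opprD addrACA -!scalerBr.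
  apply: (subbundle_lin (rs_Delta hs)) => //.
  exact: (subbundleZ (rs_Delta hs)).
- split=> [|v dv]; first exact: cotangent_affine.
  by rewrite !fctE a1// a2// /GRing.scale /= !mulr0 addr0.
move=> x xy; have [Ux [w [tw wE pE]] aE] := H1 x xy; have [_ [w' [tw' wE' pE']] aE'] := H2 x xy.
split=> // [|u tu].
  exists (k *: w + (1 - k) *: w'); split; first by apply: tangentD; exact: tangentZ.
    by rewrite tmapD !tmapZ wE wE'.
  by rewrite tmapD !tmapZ pE pE' Ev.
by rewrite /= !fctE aE// aE'//; exact: (Ev R^o).
Qed.

Lemma lifted_pair_local (x : set_type N) : Uh (pi x) -> exists V s,
  [/\ open_nbhs (iota x) V, smooth_pair V s & forall y, V y -> lifted_pair y (s y)].
Proof.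
move=> Ux; have [C] := piece_chart_at hs x; have ch := piece_is_chart C; have Ux0 := piece_udomx C.
have chQ := piece_qchart hs hc C; have Uq : piece_qdom C (pi x) by exists x.
have [U0 [k [E [oU0 U0x sE bE]]]] := subbundle_frame (rs_Delta hs) (iota x).
have [V0 [h [Zf [Zfh [[oV0 V0x] sZf _ sZfh bas]]]]] := level_distribution_frame hs hc x.
pose W := Uh `&` pi @` [set y | V0 (iota y)].
have oW : open W.
  by apply: openI => //; apply: (orbit_proj_open hs hc); apply/open_subspace; exists V0.
have Wx : W (pi x) by split=> //; exists x.
(* Zh - JK ah is a section of the reduced distribution, so it has smooth coefficients in the
   projected frame; pulled back by [piece_base] they will multiply the invariant frame on M. *)
have [co nco] : exists co : orbit_space act N -> 'I_h -> R, \forall q \near pi x,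
    (forall i, smooth_at q (co^~ i)) /\ Zh q - JK q (ah q) = \sum_i co q i *: Zfh i q.
  apply: (frame_coefficients cQ chQ oW (D := Dh)) => // [i q [_ Vq]|q [_ [y Vy <-]]|q [Uhq _]|q [Uhq _]].
  - by have [H _] := sZfh i; exact: H.
  - by rewrite (reduced_distributionE hs hc); exact: bas.
  - have [tZ Hs] := sZ Uhq; have [_ _ _ sJ] := hJK; have [tJ HJ] := sJ _ _ oU sa q Uhq.
    split=> [|f sf]; first exact: tangentB.
    apply: (sm_near cQ (f := fun y => Zh y f - JK y (ah y) f)); first exact: nearT.
    by apply: (smB cQ); [exact: Hs | exact: HJ].
  - by have [] := DZ Uhq.
have /near_orbitP[W1 [oW1 W1x] W1sub] := nco.
pose B := frame_mx C E.
have dx : (pdom C `&` U0) (iota x) by [].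
have [Q BQ] := row_freeP (frame_free hs bE dx).
have sc (y : M) : smooth_mx y (fun _ : M => Q) := smooth_mx_cst hMc _ Q.
have uBQ : B (iota x) *m Q \in unitmx by rewrite /B BQ unitmx1.
have [nu _] := smooth_mxV hMc (smooth_mxM hMc (frame_smooth hs sE dx) (sc _)) uBQ.
have nb := near_piece_base C (openI oU oW1) (conj Ux W1x).
have nV : nbhs (iota x) [set y | [/\ V0 y, U0 y, B y *m Q \in unitmx &
    [/\ pdom C y, smooth_map_at (piece_base C) y, piece_qdom C (piece_base C y) & (Uh `&` W1) (piece_base C y)]]].
  have n0 : \forall y \near iota x, V0 y by exact: open_nbhs_nbhs.
  have n1 : \forall y \near iota x, U0 y by exact: open_nbhs_nbhs.
  by near=> y; split; near: y.
move: nV; rewrite nbhsE => -[V [oV Vx] Vsub].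
pose base := piece_base C; pose al0 := level_lift C ah.
have sal0 : smooth_form V al0.
  apply: (level_lift_smooth sa oV) => y /Vsub[_ _ _ [Uy sb Uqy [Uhy _]]].
  by split.
pose b j (y : M) := pphi C y 0 (rshift (pdim C) j).
(* The coefficients solve kap B^T = - (al0 (E l))_l by means of Q, so that the corrected form
   vanishes on the frame of Delta. *)
pose kap y j := - ((\row_l al0 y (E l y)) *m invmx (B y *m Q)^T *m Q^T) 0 j.
pose al y := al0 y + \sum_j kap y j *: differential (b j) y.
pose X y := \sum_i co (base y) i *: Zf i y.
have sal : smooth_form V al.
  have s1 : smooth_form V (fun y => \sum_j kap y j *: differential (b j) y).
    apply: (smooth_form_comb hMc) => // [y j Vy|j]; last first.
      by apply: smooth_form_differential => // y /Vsub[_ _ _ [Uy _ _ _]]; exact: (chart_coord ch).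
    have [_ U0y uy [Uy _ _ _]] := Vsub y Vy; apply: (smN hMc).
    have [_ sV] := smooth_mxV hMc (smooth_mxM hMc (frame_smooth hs sE (conj Uy U0y)) (sc y)) uy.
    have sr : smooth_mx y (fun y => \row_l al0 y (E l y)).
      move=> l l'; apply: (sm_near hMc (f := fun y => al0 y (E l' y))).
        by apply: nearT => z; rewrite mxE.
      by have [_ H] := sal0 y Vy; apply: H (sE l').
    have sVt : smooth_mx y (fun y => invmx (B y *m Q)^T).
      move=> l l'; apply: (sm_near hMc _ (sV l' l)); apply: nearT => z.
      by rewrite -trmx_inv mxE.
    exact: (smooth_mxM hMc (smooth_mxM hMc sr sVt) (smooth_mx_cst hMc _ Q^T)).
  move=> y Vy; have [c1 H1] := sal0 y Vy; have [c2 H2] := s1 y Vy.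
  split=> [|W' Z' nW sW].
    by have := cotangent_affine 1 1 c1 c2; rewrite !scale1r.
  apply: (smD hMc (f := fun y => al0 y (Z' y))); first exact: (H1 W').
  exact: (H2 W').
have alE y l : V y -> al y (E l y) = 0.
  move=> Vy; have [_ U0y uy [Uy _ _ _]] := Vsub y Vy.
  have tE l' : tangent y (E l' y) by have [] := sE l' _ U0y.
  rewrite /al fctE covec_sumE.
  have -> : \sum_j kap y j * differential (b j) y (E l y) =
      - ((\row_l al0 y (E l y)) *m invmx (B y *m Q)^T *m (B y *m Q)^T) 0 l.
    rewrite {2}(trmx_mul (B y) Q) mulmxA [in RHS]mxE -sumrN; apply: eq_bigr => j _.
    by rewrite differentialE// /kap mulNr; congr (- (_ * _)); rewrite 2!mxE.
  by rewrite mulmxKV ?unitmx_tr// mxE subrr.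
have ann y : V y -> annihilator Delta y (al y).
  move=> Vy; have [_ U0y _ _] := Vsub y Vy; have [ca _] := sal y Vy; split=> // v dv.
  have [_ DE] := bE y U0y; move: dv; rewrite DE => -[u _ <-].
  rewrite (cotangent_sum _ ca) => [|l]; last by have [] := sE l _ U0y.
  by rewrite big1// => l _; rewrite alE// mulr0.
have sX : smooth_vf V X.
  apply: (smooth_vf_comb hMc) => // [y i Vy|i y Vy].
    have [_ _ _ [_ [_ sb] _ [_ W1y]]] := Vsub y Vy; have [H _] := W1sub _ W1y.
    exact: sb (H i).
  by have [V0y _ _ _] := Vsub y Vy; have [H _] := sZf i; exact: H.
have dX y : V y -> Delta y (X y).
  move=> Vy; have [V0y _ _ _] := Vsub y Vy.
  apply: (big_ind (Delta y)) => [|u w du dw|i _]; first exact: (subbundle0 (rs_Delta hs)).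
    by rewrite -[u]scale1r; exact: (subbundle_lin (rs_Delta hs)).
  by apply: (subbundleZ (rs_Delta hs)); have [_ H] := sZf i; exact: H.
have [_ _ _ sJ] := hJ; have sJal := sJ _ _ oV sal.
exists V, (fun y => (J y (al y) + X y, al y)); split=> // [|y Vy].
  split=> //= y Vy; have [t1 H1] := sJal y Vy; have [t2 H2] := sX y Vy.
  split=> [|f sf]; first exact: tangentD.
  by apply: (smD hMc); [exact: H1 | exact: H2].
have [t1 _] := sJal y Vy; have [t2 _] := sX y Vy; have [ca _] := sal y Vy.
split; first split=> //=.
- exact: tangentD.
- by rewrite addrAC subrr add0r; exact: dX.
- exact: ann.
move=> z zy; move: Vy t1 t2 ca; rewrite -zy => Vy t1 t2 ca.
have [V0z _ _ [Uz _ _ [Uhz W1z]]] := Vsub _ Vy.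
have bz := piece_base_val (C := C) (y := z) Uz; rewrite bz in Uhz W1z.
have [caz _] := sa Uhz; have [_ _ _ aaz] := DZ Uhz.
have bal0 := level_lift_basic (C := C) ah (y := z) Uz.
have alp w := @level_lift_pullback _ C ah z w Uz caz.
have ann0 := annihilator_lift bal0 aaz alp.
(* On N the lift already annihilates Delta, so the correction vanishes there and the pullback is
   unchanged. *)
have al0E : al (iota z) = al0 (iota z).
  rewrite /al big1 ?addr0// => j _; suff -> : kap (iota z) j = 0 by rewrite scale0r.
  rewrite /kap; have -> : \row_l al0 (iota z) (E l (iota z)) = 0.
    apply/rowP => l; rewrite !mxE; have [_ H] := ann0; apply: H.
    by have [_ U0z _ _] := Vsub _ Vy; exact: (basis_mem l (bE _ U0z)).
  by rewrite !mul0mx mxE oppr0.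
have [wJ twJ wJE] := J_tangent_level hs hc bal0.
have JKE := JK_basic bal0 twJ wJE caz alp.
have /choice[w wP] : forall i, exists w, [/\ tangent z w, tmap iota z w = Zf i (iota z) & tmap pi z w = Zfh i (pi z)].
  by move=> i; have [_ H] := sZfh i; exact: H.
split=> // [|u tu /=]; last by rewrite al0E; exact: alp.
exists (wJ + \sum_i co (pi z) i *: w i); split.
- by apply: tangentD => //; apply: tangent_sum => i; have [] := wP i.
- rewrite tmapD tmap_sum wJE al0E /=; congr (_ + _); rewrite /X /base bz.
  by apply: eq_bigr => i _; have [_ ->] := wP i.
rewrite tmapD tmap_sum -JKE; have [_ E1] := W1sub _ W1z.
rewrite -[RHS](subrK (JK (pi z) (ah (pi z)))) E1 addrC; congr (_ + _).
by apply: eq_bigr => i _; have [_ _ ->] := wP i.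
Unshelve. all: by end_near.
Qed.

End lifting.

Theorem reduces_dirac_reduced : @reduces_dirac R G M act N (dirac_of J Delta) (dirac_of JK Dh).
Proof.
split; first exact: reduced_is_dirac.
move=> Uh Zh ah oU sZ sa; split=> [[_ DZ]|]; last exact: reduced_section_pair.
(* The lifts are patched over the preimage of Uh, seen in M; the match transports a local lift along
   the equality of [iota x] with the given point. *)
have [U [s [oUs SU sp As]]] := patch_sections hM (@lifted_pair_affine Uh Zh ah)
  (S := [set iota x | x in [set x | Uh (pi x)]])
  (fun y => fun '(ex_intro2 x Ux xy) => ecast y (exists V s, [/\ open_nbhs y V, smooth_pair V s & forall z, V z -> lifted_pair Uh Zh ah z (s z)]) xy
     (lifted_pair_local oU sZ sa DZ Ux)).
exists U, (fun y => (s y).1), (fun y => (s y).2); split.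
- split=> // x; split=> [Ux|Ux]; last by apply: SU; exists x.
  by have [_ /(_ x erefl)[]] := As _ Ux.
- split; first exact: sp.
  by move=> y /As[dy _]; move: dy; case: (s y).
- by move=> x /As[_ /(_ x erefl)[_ [w [tw wE pE]] _]]; exists w.
- move=> x /As[[_ ca _ _] /(_ x erefl)[Ux _ aE]]; apply/funext => v.
  have [tv|nt] := pselect (tangent x v); first by rewrite !cotmapE// aE.
  by rewrite /cotmap /extend0 !patchC// inE.
Qed.

End dirac_reduction.

(** * The decomposition into orbit types *)

Section orbit_type_decomposition.
Context {R : realType} {M : smoothSpaceType R} {G : smoothGroupType R}.
Context {br : (M -> R) -> (M -> R) -> (M -> R)} {J : M -> covec M -> tvec M}
  {om : M -> tvec M -> tvec M -> R} {Delta : M -> set (tvec M)}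
  {act : G -> M -> M} {P : M -> covec G}.
Hypothesis hs : reduction_setting br J om Delta act P.
Let hact := rs_act hs.

Lemma stabilizer_class x : compact_classes G (conj_class (stabilizer act x)).
Proof.
exists (stabilizer act x) => //; split.
- exact: (stab1 hact).
- by move=> g h; exact: (stabM hact).
- by move=> g; exact: (stabV hact).
- exact: (stab_compact (rs_proper hs)).
Qed.

Lemma conj_class_refl (K : set G) : conj_class K K.
Proof.
exists 1%g; apply/seteqP; split=> [k Kk|_ [k Kk <-]]; last by rewrite invg1 mul1g mulg1.
by exists k => //; rewrite invg1 mul1g mulg1.
Qed.

Lemma orbit_decomposition : action_orbit act @` zero_level P =
  \bigcup_(c in compact_classes G) (action_orbit act @` level_piece act P c).
Proof.
apply/seteqP; split=> [_ [x Px <-]|_ [c _ [x [Px _] <-]]]; last by exists x.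
exists (conj_class (stabilizer act x)); first exact: stabilizer_class.
by exists x => //; split=> //; exact: conj_class_refl.
Qed.

Lemma orbit_decomposition_trivI :
  trivIset (compact_classes G) (fun c => action_orbit act @` level_piece act P c).
Proof.
move=> c c' hc hc' [_ [[x [_ cx] <-] [y [Py cy] E]]].
have : action_orbit act x x by exists 1%g => //; exact: (act1 hact).
rewrite -E => -[g _ gE]; have [_ cgy] := level_piece_act hs hc' g (conj Py cy).
by move: cgy; rewrite gE => /(compact_class_mem hc') ->; rewrite -(compact_class_mem hc cx).
Qed.

End orbit_type_decomposition.

Theorem proposition27 (R : realType)
  (M : smoothSpaceType R) (G : smoothGroupType R)
  (br : (M -> R) -> (M -> R) -> (M -> R))
  (J : M -> covec M -> tvec M)
  (om : M -> tvec M -> tvec M -> R)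
  (Delta : M -> set (tvec M))
  (H : M -> R)
  (act : G -> M -> M)
  (P : M -> covec G)
  (hM : is_manifold M)
  (hbr : generalized_poisson br)
  (hJ : bracket_map br J)
  (hom : nondegenerate_two_form om)
  (hJom : inverse_of_form J om)
  (hDelta : is_subbundle (@smooth_vf R M) Delta)
  (hH : smooth_fun H)
  (hG : is_lie_group G)
  (hact : smooth_action act)
  (hproper : proper_action act)
  (hHinv : forall g x, H (act g x) = H x)
  (hLJ : forall xi, lie_algebra G xi -> lie_map_zero (generator act xi) J)
  (hLDelta : forall xi, lie_algebra G xi -> forall U Z, open U ->
     vf_section Delta U Z ->
     vf_section Delta U (lie_bracket (generator act xi) Z))
  (hGJ : action_preserves_map act J)
  (hGDelta : action_preserves_distribution act Delta)
  (hP : is_momentum_map act om P)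
  (hPDelta : forall xi, lie_algebra G xi -> forall x,
     annihilator Delta x (differential (fun y => P y xi) x))
  (hDeltaV : forall x, Delta x `&` vertical act x = [set 0])
  (hVDelta : is_subbundle (@smooth_vf R M)
     (fun x => set_add (vertical act x) (Delta x)))
  (hreg : forall c, compact_classes G c ->
     regular_conditions act (level_piece act P c) (dirac_of J Delta)) :
  [/\ action_orbit act @` zero_level P =
        \bigcup_(c in compact_classes G) (action_orbit act @` level_piece act P c),
      trivIset (compact_classes G) (fun c => action_orbit act @` level_piece act P c)
    & forall c, compact_classes G c ->
        [/\ is_manifold (set_type (level_piece act P c)),
            is_manifold (orbit_space act (level_piece act P c))
          & is_submersion (orbit_proj act (level_piece act P c))]]
  /\
  forall c, compact_classes G c ->
    (exists brK (JK : orbit_space act (level_piece act P c) ->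
                      covec (orbit_space act (level_piece act P c)) ->
                      tvec (orbit_space act (level_piece act P c))),
       reduced_bracket br brK /\ bracket_map brK JK) /\
    (exists HK : orbit_space act (level_piece act P c) -> R,
       HK \o orbit_proj act (level_piece act P c) = H \o set_val) /\
    forall brK (JK : orbit_space act (level_piece act P c) ->
                     covec (orbit_space act (level_piece act P c)) ->
                     tvec (orbit_space act (level_piece act P c)))
           (HK : orbit_space act (level_piece act P c) -> R),
      reduced_bracket br brK -> bracket_map brK JK ->
      HK \o orbit_proj act (level_piece act P c) = H \o set_val ->
      reduces_dirac (dirac_of J Delta)
        (dirac_of JK (reduced_distribution Delta)) /\
      reduces_hamiltonian H HK.
Proof.
have hs : reduction_setting br J om Delta act P by [].
split=> [|c hc].
  split=> [||c hc]; [exact: (orbit_decomposition hs) | exact: (orbit_decomposition_trivI hs) | split].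
  - exact: (level_piece_manifold hs hc).
  - exact: (orbit_space_manifold hs hc).
  - exact: (orbit_proj_submersion hs hc).
split; first exact: (reduced_bracket_exists hs hc).
split; first exact: (invariant_descend hs c hHinv).
move=> brK JK HK rb bJ HKE; split.
  exact: (reduces_dirac_reduced hs hc bJ.1 (reduced_bracket_spec hs rb bJ)).
by split=> //; exact: (smooth_descend hH HKE).
Qed.
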